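(* Let $n\ge 1$ and let $p(\cdot)\in\mathcal{P}(\mathbb{R}^n)$. Let $\sigma$ be a compactly supported Borel measure on $\mathbb{R}^n$, let $m=\widehat{\sigma}$ be its Fourier transform, and let $0\le\beta\le n$ and $\alpha>1/2$ be real numbers such that: 1) $\sigma$ is locally uniformly $\beta$-dimensional; 2) there is a constant $C$ such that $\left\{\int_{1}^{2}|m(t\xi)|^{2}\,dt\right\}^{1/2}\leq C(1+|\xi|)^{-\alpha}$ for all $\xi\in\mathbb{R}^n$; 3) there is a constant $C$ such that $\left\{\int_{1}^{2}|\nabla m(t\xi)|^{2}\,dt\right\}^{1/2}\leq C(1+|\xi|)^{-\alpha}$ for all $\xi\in\mathbb{R}^n$. Suppose that for some $\theta$ with $$0<\theta<\frac{2\alpha-1}{2\alpha-1+2n-2\beta}$$ one has $$\frac{2\theta p(\cdot)}{2-(1-\theta)p(\cdot)}\in\mathcal{B}(\mathbb{R}^n).$$ Then the maximal operator $\mathcal{M}_m$ maps $L^{p(\cdot)}(\mathbb{R}^n)$ to itself, i.e. there is a constant $C'$ such that $\|\mathcal{M}_m f\|_{p(\cdot)}\le C'\|f\|_{p(\cdot)}$ for all Schwartz functions $f$ on $\mathbb{R}^n$.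
   Context: Maximal multiplier operator: Borel measures are nonnegative and finite. For $m=\widehat\sigma$ with $\sigma$ a compactly supported Borel measure, and for $t>0$, define $M_t$ by $(M_tf)^{\wedge}(\xi)=\widehat f(\xi)m(t\xi)$; equivalently $M_tf(x)=\int f(x-ty)\,d\sigma(y)$. The maximal operator is $\mathcal{M}_mf(x)=\sup_{t>0}|M_tf(x)|$, defined a priori for Schwartz functions $f$. Here $\nabla m(t\xi)$ denotes the gradient of $m$ evaluated at the point $t\xi$. Locally uniformly $\beta$-dimensional: there is a constant $C_\beta$ such that $\sigma(B(x,R))\le C_\beta R^\beta$ for every $x\in\mathbb{R}^n$ and $0<R\le 1$, where $B(x,R)$ is the ball of radius $R$ centered at $x$. Variable Lebesgue spaces: $\mathcal{P}(\mathbb{R}^n)$ is the set of all measurable functions $p:\mathbb{R}^n\to[1,\infty]$. For $p\in\mathcal{P}(\mathbb{R}^n)$, $L^{p(\cdot)}(\mathbb{R}^n)$ is the set of measurable $f$ with $\int_{\mathbb{R}^n}(|f(x)|/\lambda)^{p(x)}dx<\infty$ for some $\lambda>0$, with norm $\|f\|_{p(\cdot)}=\inf\{\lambda>0:\int_{\mathbb{R}^n}(|f(x)|/\lambda)^{p(x)}dx\le 1\}$. (Where $p(x)=\infty$ the usual convention $s^\infty=0$ for $0\le s\le 1$ and $s^\infty=\infty$ for $s>1$ is used.) The class $\mathcal{B}(\mathbb{R}^n)$: the set of all $q\in\mathcal{P}(\mathbb{R}^n)$ for which the Hardy–Littlewood maximal operator $Mf(x)=\sup_{r>0}\frac{1}{|B(x,r)|}\int_{B(x,r)}|f(y)|dy$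 is bounded on $L^{q(\cdot)}(\mathbb{R}^n)$. In particular, $\frac{2\theta p(\cdot)}{2-(1-\theta)p(\cdot)}\in\mathcal{B}(\mathbb{R}^n)$ includes the requirement that this function takes values in $[1,\infty]$ (with value $\infty$ where the denominator is $0$). *)

(* Defs.v *)
From HB Require Import structures.
From mathcomp Require Import all_boot all_order all_algebra.
From mathcomp Require Import all_classical all_reals all_analysis.
From mathcomp Require Import complex.
From mathcomp Require Import measurable_realfun.

Set Implicit Arguments.
Unset Strict Implicit.
Unset Printing Implicit Defensive.

Import Order.TTheory GRing.Theory Num.Theory.
Import numFieldNormedType.Exports.
Import ComplexField.Normc.

Local Open Scope classical_set_scope.
Local Open Scope ring_scope.
Local Open Scope complex_scope.

Definition rV_display : measure_display.
Proof. exact: default_measure_display. Qed.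

Section borel_rV.
Context {R : realType} {n : nat}.

Definition rV_borel : set (set 'rV[R]_n) := <<s [set A | open A] >>.

Let rV_borel0 : rV_borel set0.
Proof. exact: sigma_algebra0. Qed.

Let rV_borelC A : rV_borel A -> rV_borel (~` A).
Proof. exact: sigma_algebraC. Qed.

Let rV_borel_bigcup (F : (set 'rV[R]_n)^nat) :
  (forall i, rV_borel (F i)) -> rV_borel (\bigcup_i (F i)).
Proof. exact: sigma_algebra_bigcup. Qed.

HB.instance Definition _ := @isMeasurable.Build rV_display 'rV[R]_n
  rV_borel rV_borel0 rV_borelC rV_borel_bigcup.

Lemma rV_open_measurable (A : set 'rV[R]_n) : open A -> measurable A.
Proof. by move=> oA; exact: sub_sigma_algebra. Qed.

End borel_rV.

Section lebesgue_rV.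
Context {R : realType}.

Lemma measurable_coord_rV n (i : 'I_n) :
  measurable_fun [set: 'rV[R]_n] (fun v => v ord0 i : R).
Proof.
apply: (measurability _ (RGenOpens.measurableE R)) => //.
move=> _ [_ [a [b ->] <-]]; rewrite setTI.
apply: rV_open_measurable; apply: open_comp; last exact: interval_open.
by move=> v _; exact: coord_continuous.
Qed.

Lemma measurable_fun_rV d (T : measurableType d) n (f : T -> 'rV[R]_n) :
  (forall i, measurable_fun [set: T] (fun x => f x ord0 i : R)) ->
  measurable_fun [set: T] f.
Proof.
move=> mf.
have mB (c : 'rV[R]_n) (e : R) : 0 < e ->
    measurable (f @^-1` [set v | forall i, `|c ord0 i - v ord0 i| < e]).
  move=> e0.
  have -> : f @^-1` [set v | forall i, `|c ord0 i - v ord0 i| < e] =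
      \bigcap_(i : 'I_n)
        (setT `&` (fun x => f x ord0 i : R) @^-1` ball (c ord0 i) e).
    by apply/seteqP; split=> [x xB i _|x xB i]; [split=> //; exact: xB|
       have [] := xB i I].
  apply: fin_bigcap_measurable => //.
  by move=> i _; apply: mf => //; exact: measurable_ball.
apply: (measurability [set A : set 'rV[R]_n | open A]) => // _ [U oU <-].
rewrite setTI.
pose B (q : 'rV[rat]_n * nat) : set 'rV[R]_n :=
  [set v | forall i, `|ratr (q.1 ord0 i) - v ord0 i| < q.2.+1%:R^-1].
have -> : U = \bigcup_(q : 'rV[rat]_n * nat) (if `[< B q `<=` U >] then B q else set0).
  apply/seteqP; split=> [v Uv|v [q _]]; last by case: asboolP => // + Bv; apply.
  have /nbhs_ballP[e /= e0 eU] : nbhs v U by exact: open_nbhs_nbhs.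
  have [k ke] : exists k : nat, k.+1%:R^-1 < e / 2.
    have e20 : 0 < e / 2 by rewrite divr_gt0.
    have [k _ /(_ k (leqnn k)) ke] := near_infty_natSinv_lt (PosNum e20).
    by exists k.
  have k0 : 0 < k.+1%:R^-1 :> R by rewrite invr_gt0.
  have hq i : exists q : rat, `|ratr q - v ord0 i| < k.+1%:R^-1.
    have /rat_in_itvoo[q] : v ord0 i < v ord0 i + k.+1%:R^-1 by rewrite ltrDl.
    rewrite in_itv/= => /andP[vq qv]; exists q.
    by rewrite ger0_norm ?subr_ge0 ?(ltW vq)// ltrBlDl.
  have [q hq'] := choice hq.
  exists (\row_i q i, k) => //.
  have Bq : B (\row_i q i, k) v by move=> i /=; rewrite mxE.
  case: asboolP => // -[] w Bw; apply: eU; split=> // i j.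
  rewrite ord1 /ball/= (le_lt_trans (ler_distD (ratr (q j)) _ _))//.
  rewrite (splitr e) ltrD// (lt_trans _ ke)//; first by rewrite distrC.
  by have /= := Bw j; rewrite mxE.
rewrite preimage_bigcup; apply: countable_bigcupT_measurable => //.
move=> q; case: asboolP => _; last by rewrite preimage_set0.
pose c : 'rV[R]_n := \row_i ratr (q.1 ord0 i).
have -> : B q = [set v | forall i, `|c ord0 i - v ord0 i| < q.2.+1%:R^-1].
  by apply/seteqP; split=> v vB i; have := vB i; rewrite mxE.
by apply: mB; rewrite invr_gt0.
Qed.

Definition rV_cons n (z : measurableTypeR R * 'rV[R]_n) : 'rV[R]_n.+1 :=
  \row_i if unlift ord0 i is Some j then z.2 ord0 j else z.1.

Lemma measurable_rV_cons n :
  measurable_fun [set: measurableTypeR R * 'rV[R]_n] (@rV_cons n).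
Proof.
apply: measurable_fun_rV => i.
case: (unliftP ord0 i) => [j ij|i0].
  rewrite (_ : (fun _ => _) = (fun v : 'rV[R]_n => v ord0 j : R) \o snd).
    by apply: measurableT_comp; [exact: measurable_coord_rV|].
  by apply/funext => z /=; rewrite mxE ij liftK.
rewrite (_ : (fun _ => _) = fst).
  exact: measurable_fst.
by apply/funext => z /=; rewrite mxE i0 unlift_none.
Qed.

Definition rV_uncons n (v : 'rV[R]_n.+1) : measurableTypeR R * 'rV[R]_n :=
  (v ord0 ord0, \row_j v ord0 (lift ord0 j)).

Lemma rV_consK n : cancel (@rV_cons n) (@rV_uncons n).
Proof.
case=> a u; congr pair; rewrite /= ?mxE ?unlift_none//.
by apply/rowP => j; rewrite !mxE liftK.
Qed.

Lemma measurable_rV_uncons n : measurable_fun [set: 'rV[R]_n.+1] (@rV_uncons n).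
Proof.
apply: measurable_fun_pair => /=; first exact: measurable_coord_rV.
apply: measurable_fun_rV => j.
apply: (eq_measurable_fun (fun v : 'rV[R]_n.+1 => v ord0 (lift ord0 j) : R)).
  by move=> v _; rewrite mxE.
exact: measurable_coord_rV.
Qed.

Section step.
Variables (n : nat) (mu : {sigma_finite_measure set 'rV[R]_n -> \bar R}).

Definition lebesgue_rV_step : set 'rV[R]_n.+1 -> \bar R :=
  pushforward (lebesgue_measure \x mu)%E (@rV_cons n).

Let step0 : lebesgue_rV_step set0 = 0%E.
Proof. by rewrite /lebesgue_rV_step /pushforward preimage_set0 measure0. Qed.

Let step_ge0 A : (0 <= lebesgue_rV_step A)%E.
Proof. by rewrite /lebesgue_rV_step /pushforward measure_ge0. Qed.

Let step_sigma_additive : semi_sigma_additive lebesgue_rV_step.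
Proof.
move=> F mF tF mUF; rewrite /lebesgue_rV_step /pushforward preimage_bigcup.
have mc (A : set 'rV[R]_n.+1) : measurable A -> measurable (@rV_cons n @^-1` A).
  by move=> mA; rewrite -[X in measurable X]setTI; exact: measurable_rV_cons.
apply: measure_semi_sigma_additive.
- by move=> k; exact: mc.
- apply/trivIsetP => i j _ _ ij; rewrite -preimage_setI.
  by move/trivIsetP : tF => /(_ _ _ _ _ ij) ->//; rewrite preimage_set0.
- by rewrite -preimage_bigcup; exact: mc.
Qed.

HB.instance Definition _ := isMeasure.Build _ _ _ lebesgue_rV_step
  step0 step_ge0 step_sigma_additive.

Let step_sigma_finite : sigma_finite setT lebesgue_rV_step.
Proof.
have /sigma_finiteP[F [FT ndF Foo]] := sigma_finiteT (@lebesgue_measure R).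
have /sigma_finiteP[G [GT ndG Goo]] := sigma_finiteT mu.
exists (fun k => @rV_uncons n @^-1` (F k `*` G k)).
  rewrite -preimage_bigcup (_ : \bigcup_k _ = setT) ?preimage_setT//.
  apply/seteqP; split=> // -[x u] _.
  have [k _ Fx] : (\bigcup_k F k) x by rewrite -FT.
  have [l _ Gu] : (\bigcup_k G k) u by rewrite -GT.
  exists (maxn k l) => //; split => /=.
    by move: Fx; exact/subsetPset/ndF/leq_maxl.
  by move: Gu; exact/subsetPset/ndG/leq_maxr.
move=> k; have [mF Fk] := Foo k; have [mG Gk] := Goo k; split.
  rewrite -[X in measurable X]setTI; apply: measurable_rV_uncons => //.
  exact: measurableX.
rewrite /lebesgue_rV_step /pushforward -comp_preimage.
rewrite (_ : _ \o _ = id); last by apply/funext => z; exact: rV_consK.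
by rewrite preimage_id product_measure1E// lte_mul_pinfty// ge0_fin_numE.
Qed.

HB.instance Definition _ := Measure_isSigmaFinite.Build _ _ _ lebesgue_rV_step
  step_sigma_finite.

End step.

(* n-fold product of the one-dimensional Lebesgue measure, transported to
   'rV[R]_n through rV_cons. *)
Fixpoint lebesgue_rV n : {sigma_finite_measure set 'rV[R]_n -> \bar R} :=
  if n is n'.+1 then lebesgue_rV_step (lebesgue_rV n') else \d_ (0 : 'rV[R]_0).

Lemma lebesgue_rV_box n (a b : 'I_n -> R) : (forall i, a i <= b i) ->
  lebesgue_rV n [set v : 'rV[R]_n | forall i, v ord0 i \in `[a i, b i]] =
  (\prod_(i < n) (b i - a i))%:E.
Proof.
elim: n a b => [|n IH] a b ab.
  rewrite big_ord0 /= diracE mem_set//; by case.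
rewrite big_ord_recl EFinM -IH// /= /lebesgue_rV_step /pushforward.
have -> : @rV_cons n @^-1` [set v : 'rV[R]_n.+1 | forall i, v ord0 i \in `[a i, b i]] =
  `[a ord0, b ord0]%classic `*`
  [set v : 'rV[R]_n | forall i, v ord0 i \in `[a (lift ord0 i), b (lift ord0 i)]].
  apply/seteqP; split=> [[x u] /= xu|[x u] /= [xab uab] i].
    split=> [|i]; first by have := xu ord0; rewrite mxE unlift_none.
    by have := xu (lift ord0 i); rewrite mxE liftK.
  by rewrite mxE; case: unliftP => [j|] ->.
rewrite product_measure1E//.
- rewrite [X in (X * _)%E]lebesgue_measure_itv/= lte_fin.
  by case: ltgtP (ab ord0) => //= ->; rewrite subrr.
- have -> : [set v : 'rV[R]_n | forall i, v ord0 i \in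
       `[a (lift ord0 i), b (lift ord0 i)]] = \bigcap_(i : 'I_n)
     (setT `&` (fun v => v ord0 i : R) @^-1`
        `[a (lift ord0 i), b (lift ord0 i)]%classic).
    by apply/seteqP; split=> [v vB i _|v vB i]; [split=> //; exact: vB|
       have [] := vB i I].
  apply: fin_bigcap_measurable => // i _.
  by have := @measurable_coord_rV n i measurableT _ (measurable_itv `[a (lift ord0 i), b (lift ord0 i)]).
Qed.

End lebesgue_rV.

Section euclidean.
Context {R : realType} {n : nat}.
Implicit Types (x y : 'rV[R]_n) (z : 'rV[R[i]]_n).

Definition dotr x y : R := \sum_i x ord0 i * y ord0 i.

(* The library norm and balls of 'rV[R]_n are those of the sup norm. *)
Definition enorm x : R := Num.sqrt (\sum_i x ord0 i ^+ 2).

Definition eball x (r : R) : set 'rV[R]_n := [set y | enorm (y - x) < r].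

Definition cenorm z : R := Num.sqrt (\sum_i normc (z ord0 i) ^+ 2).

End euclidean.

Section complex_valued.
Context {R : realType} {n : nat}.
Implicit Types (f : 'rV[R]_n -> R[i]) (x : 'rV[R]_n).

Definition cintegral d (T : measurableType d) (mu : {measure set T -> \bar R})
    (g : T -> R[i]) : R[i] :=
  (\int[mu]_y complex.Re (g y)) +i* (\int[mu]_y complex.Im (g y)).

Definition cdifferentiable f x : Prop :=
  differentiable (fun y => complex.Re (f y)) x /\
  differentiable (fun y => complex.Im (f y)) x.

Definition cpartial (i : 'I_n) f : 'rV[R]_n -> R[i] := fun x =>
  ('D_(delta_mx ord0 i) (fun y => complex.Re (f y)) x) +i*
  ('D_(delta_mx ord0 i) (fun y => complex.Im (f y)) x).

(* [cpartials [:: i1; ...; ik] f] is d_i1 (... (d_ik f)). *)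
Definition cpartials (s : seq 'I_n) f : 'rV[R]_n -> R[i] := foldr cpartial f s.

Definition cgradient f x : 'rV[R[i]]_n := \row_i cpartial i f x.

(* Smoothness is expressed by the differentiability of all iterated partial
   derivatives. *)
Definition schwartz f : Prop := forall s : seq 'I_n,
  (forall x, cdifferentiable (cpartials s f) x) /\
  forall k : nat, exists C : R, forall x,
    enorm x ^+ k * normc (cpartials s f x) <= C.

End complex_valued.

Section maximal_multiplier.
Context {R : realType} {n : nat}.
Variable sigma : {finite_measure set 'rV[R]_n -> \bar R}.

Definition compactly_supported : Prop :=
  exists2 K : set 'rV[R]_n, compact K & sigma (~` K) = 0%E.

Definition locally_uniformly_dimensional (beta : R) : Prop :=
  exists C : R, forall (x : 'rV[R]_n) (r : R), 0 < r -> r <= 1 ->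
    (sigma (eball x r) <= (C * r `^ beta)%:E)%E.

(* exp (- 2 pi i <x, xi>) integrated against sigma. *)
Definition fourier (xi : 'rV[R]_n) : R[i] :=
  cintegral sigma (fun x =>
    cos (2 * pi * dotr x xi) -i* sin (2 * pi * dotr x xi)).

(* The operator with Fourier multiplier xi |-> fourier (t *: xi). *)
Definition multiplier_op (t : R) (f : 'rV[R]_n -> R[i]) (x : 'rV[R]_n) : R[i] :=
  cintegral sigma (fun y => f (x - t *: y)).

Definition maximal_op (f : 'rV[R]_n -> R[i]) (x : 'rV[R]_n) : \bar R :=
  ereal_sup [set (normc (multiplier_op t f x))%:E | t in [set t : R | 0 < t]].

End maximal_multiplier.

Section variable_lebesgue.
Context {R : realType} {n : nat}.
Implicit Types (p q : 'rV[R]_n -> \bar R) (f : 'rV[R]_n -> R[i]).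

(* Measurability with respect to the completion of the Borel sigma-algebra
   under Lebesgue measure. *)
Definition lebesgue_measurable d (T : measurableType d)
    (g : 'rV[R]_n -> T) : Prop :=
  forall Y, measurable Y -> completed_algebra_gen (lebesgue_rV n) (g @^-1` Y).

(* The value +oo is allowed; it encodes exponents p(x) = infinity. *)
Definition exponent p : Prop :=
  lebesgue_measurable p /\ forall x, (1 <= p x)%E.

(* s^e with the convention s^oo = 0 if s <= 1 and s^oo = oo otherwise. *)
Definition vpower (s e : \bar R) : \bar R :=
  match e with
  | r%:E => (s `^ r)%E
  | +oo%E => if (s <= 1)%E then 0%E else +oo%E
  | -oo%E => 0%E (* never used: exponents are at least 1 *)
  end.

Definition modular p (g : 'rV[R]_n -> \bar R) : \bar R :=
  (\int[lebesgue_rV n]_x vpower `|g x| (p x))%E.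

Definition vnorm p (g : 'rV[R]_n -> \bar R) : \bar R :=
  ereal_inf [set l%:E | l in
    [set l : R | 0 < l /\ (modular p (fun x => g x / l%:E) <= 1)%E]].

Definition cmodulus f : 'rV[R]_n -> \bar R := fun x => (normc (f x))%:E.

Definition vLspace p f : Prop :=
  [/\ lebesgue_measurable (fun x => complex.Re (f x)),
      lebesgue_measurable (fun x => complex.Im (f x)) &
      exists2 l : R, 0 < l &
        (modular p (fun x => cmodulus f x / l%:E) < +oo)%E].

Definition hardy_littlewood f (x : 'rV[R]_n) : \bar R :=
  ereal_sup [set ((lebesgue_rV n (eball x r))^-1 *
    \int[lebesgue_rV n]_(y in eball x r) cmodulus f y)%E
      | r in [set r : R | 0 < r]].

Definition HL_bounded_exponent q : Prop :=
  exponent q /\ exists C : R, forall f, vLspace q f ->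
    (vnorm q (hardy_littlewood f) <= C%:E * vnorm q (cmodulus f))%E.

End variable_lebesgue.

(* Main.v *)
(* The operator M_t is smoothed at the scales 2^-j t by the multipliers
   1 - (1 - e)^(K+1), with e a Gaussian; the differences D_j of consecutive
   smoothings satisfy an L^2 bound 2^(-j (alpha - 1/2)) for the supremum over t
   (a Sobolev inequality in t and Bessel's inequality, summed over dyadic t; the
   lowest frequencies are handled by TT-star) and a pointwise bound by
   2^(j (n - beta)) times the Hardy-Littlewood maximal function (sigma is
   beta-dimensional).  Writing |f| = f0^(1-theta) f1^theta with
   f0 = |f|^(p/2) and f1 = |f|^(p/q), q the exponent of the hypothesis, and
   cutting f along the dyadic level sets of f1 / f0, the two bounds give
   |M_t f| <= C U^((1-theta)/2) (M f1)^theta with U independent of t and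
   integrable, so |M_t f|^p is at most a constant times U + (M f1)^q. *)

Require Import Defs.
From HB Require Import structures.
From mathcomp Require Import all_boot all_order all_algebra.
From mathcomp Require Import all_classical all_reals all_analysis.
From mathcomp Require Import complex.
From mathcomp Require Import measurable_realfun.
From mathcomp Require Import ring lra zify.

Import Order.TTheory GRing.Theory Num.Theory.
Import numFieldNormedType.Exports.
Import ComplexField.Normc.

Local Open Scope classical_set_scope.
Local Open Scope ring_scope.

Set Implicit Arguments.
Unset Strict Implicit.
Unset Printing Implicit Defensive.

(** The exponent [q] solves 1/p = (1-theta)/2 + theta/q at each point, and the bound on [theta] says
    exactly that (alpha - 1/2)(1-theta) exceeds (n-beta) theta, so that the interpolated pieces sum
    geometrically in j. Since p varies with the point, the interpolation is carried out by hand at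
    each x: where f1 / f0 is about 2^k, |f| is about 2^(k theta) f0 and also 2^(-k (1-theta)) f1;
    each piece thus has two competing bounds, and the smaller one decays geometrically away from the
    k where they cross. All L^2 bounds are packed into one integrable function by a weighted sum of
    squares, which costs an arbitrarily small part of the exponent alpha - 1/2. Gaussians keep every
    kernel and every multiplier explicit; the power K+1 >= alpha makes D_j flat at frequency zero,
    where the decay of m gives nothing. A single integer N truncates the range of t, the pieces and
    the levels, and Fatou's lemma removes it. The maximal operator is never shown to be measurable,
    so its modular is estimated as a lower integral. *)

Section lower_integral.
Local Open Scope ereal_scope.
Context d (T : measurableType d) (R : realType) (mu : {measure set T -> \bar R}).
Implicit Types f g u v : T -> \bar R.
Import HBNNSimple.

(** The integral of a nonnegative function is a supremum over the simple functions below it. This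
    reduction is what allows maximal functions and powers with merely Lebesgue measurable exponents
    to be integrated. *)
Lemma nonneg_integral_le f (c : \bar R) : (forall x, 0 <= f x) ->
  (forall h : {nnsfun T >-> R}, (forall x, (h x)%:E <= f x) ->
    \int[mu]_x (h x)%:E <= c) -> \int[mu]_x f x <= c.
Proof.
move=> f0 hc; rewrite ge0_integralTE//; apply: ge_ereal_sup => _ [h hf <-].
by rewrite -integralT_nnsfun; exact: hc.
Qed.

Lemma le_nonneg_integral f (h : T -> \bar R) : measurable_fun setT h ->
  (forall x, 0 <= h x <= f x) -> \int[mu]_x h x <= \int[mu]_x f x.
Proof.
move=> mh hf; have h0 x : 0 <= h x by have /andP[] := hf x.
have f0 x : 0 <= f x by have /andP[/le_trans H /H] := hf x.
apply: nonneg_integral_le => // g gh; rewrite integralT_nnsfun.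
rewrite (ge0_integralTE _ f0); apply: ereal_sup_ubound; exists g => // x.
by apply: le_trans (gh x) _; have /andP[] := hf x.
Qed.

(* No measurability is assumed: the library integral of a nonnegative function
   is its lower integral. *)
Lemma ge0_le_integral_off (N : set T) f g : measurable N -> mu N = 0 ->
  (forall x, 0 <= f x) -> (forall x, 0 <= g x) ->
  (forall x, ~ N x -> f x <= g x) -> \int[mu]_x f x <= \int[mu]_x g x.
Proof.
move=> mN N0 f0 g0 fg; apply: nonneg_integral_le => // h hf.
have mh : measurable_fun setT (fun x => (h x)%:E) by exact/measurable_EFinP.
pose h' := fun x => (h x)%:E * (\1_(~` N) x)%:E.
have mh' : measurable_fun setT h'.
  apply: emeasurable_funM => //; apply/measurable_EFinP.
  by apply: measurable_indic; exact: measurableC.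
rewrite (@ge0_ae_eq_integral _ _ _ mu setT (fun x => (h x)%:E) h')//.
- apply: le_nonneg_integral => // x; rewrite /h' indicE in_setC.
  have [xN|xN] := boolP (x \in N); first by rewrite mule0 lexx g0.
  rewrite mule1 lee_fin fun_ge0/= (le_trans (hf x))// fg//.
  by move: xN; rewrite notin_setE.
- by move=> x _; rewrite lee_fin fun_ge0.
- by move=> x _; rewrite /h' mule_ge0// lee_fin ?fun_ge0.
- exists N; split=> // x /=; apply: contra_notP => xN _.
  by rewrite /h' indicE (mem_set (xN : (~` N) x)) mule1.
Qed.

Lemma ge0_le_integralT f g : (forall x, 0 <= f x <= g x) ->
  \int[mu]_x f x <= \int[mu]_x g x.
Proof.
move=> fg; apply: (@ge0_le_integral_off set0) => // x.
- by have /andP[] := fg x.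
- by have /andP[/le_trans H /H] := fg x.
- by have /andP[] := fg x.
Qed.

(** A lower integral is in general only superadditive. Measurability of one summand gives this
    converse: a simple [h] below [u + v] splits into the minimum of [h] and [u], and a measurable
    remainder below [v]. *)
Lemma ge0_le_integralD u v : measurable_fun setT u ->
  (forall x, 0 <= u x) -> (forall x, 0 <= v x) ->
  \int[mu]_x (u x + v x) <= \int[mu]_x u x + \int[mu]_x v x.
Proof.
move=> mu_ u0 v0; apply: nonneg_integral_le => [x|h huv]; first exact: adde_ge0.
have mh : measurable_fun setT (fun x => (h x)%:E) by exact/measurable_EFinP.
pose a x := mine (h x)%:E (u x).
have a0 x : 0 <= a x by rewrite /a le_min u0 lee_fin fun_ge0.
have ah x : a x <= (h x)%:E by rewrite /a ge_min lexx.
have afin x : a x \is a fin_num by rewrite ge0_fin_numE// (le_lt_trans (ah x))// ltry.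
have ma : measurable_fun setT a by exact: measurable_mine.
have mb : measurable_fun setT (fun x => (h x)%:E - a x).
  by apply: emeasurable_funB.
rewrite (_ : \int[mu]_x (h x)%:E = \int[mu]_x (a x + ((h x)%:E - a x))); last first.
  by apply: eq_integral => x _; rewrite addeC subeK.
rewrite ge0_integralD//; last by move=> x _; rewrite sube_ge0// ?ah// afin.
apply: leeD; apply: ge0_le_integralT => x.
  by rewrite a0 /a ge_min lexx orbT.
rewrite sube_ge0 ?afin// ah/= leeBlDr// /a.
have [_|uh] := leP (h x)%:E (u x).
  by rewrite leeDr.
by rewrite addeC.
Qed.

End lower_integral.

(** * Integrability and Fubini for real-valued functions *)

Section real_integrable.
Context d (T : measurableType d) (R : realType) (mu : {measure set T -> \bar R}).
Implicit Types f g : T -> R.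

Lemma le_integrableR f g : measurable_fun setT f -> (forall x, `|f x| <= g x) ->
  mu.-integrable setT (EFin \o g) -> mu.-integrable setT (EFin \o f).
Proof.
move=> mf fg; apply: le_integrable => //; first exact/measurable_EFinP.
by move=> x _ /=; rewrite lee_fin (le_trans (fg x))// ler_norm.
Qed.

Lemma integrableRZ (k : R) f : mu.-integrable setT (EFin \o f) ->
  mu.-integrable setT (EFin \o (fun x => k * f x)).
Proof. by move=> /(integrableZl measurableT k). Qed.

Lemma integrableRD f g : mu.-integrable setT (EFin \o f) ->
  mu.-integrable setT (EFin \o g) ->
  mu.-integrable setT (EFin \o (fun x => f x + g x)).
Proof. by move=> mf mg; have := integrableD measurableT mf mg. Qed.

Lemma integrableRB f g : mu.-integrable setT (EFin \o f) ->
  mu.-integrable setT (EFin \o g) ->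
  mu.-integrable setT (EFin \o (fun x => f x - g x)).
Proof. by move=> mf mg; have := integrableB measurableT mf mg. Qed.

Lemma integrableR_sum (I : Type) (s : seq I) (f : I -> T -> R) :
  (forall i, mu.-integrable setT (EFin \o f i)) ->
  mu.-integrable setT (EFin \o (fun x => \sum_(i <- s) f i x)).
Proof.
move=> intf; elim: s => [|i s IH].
  rewrite (_ : _ \o _ = cst 0%E); first exact: integrable0.
  by apply/funext => x /=; rewrite big_nil.
rewrite (_ : _ \o _ = EFin \o (fun x => f i x + \sum_(i <- s) f i x)).
  exact: integrableRD.
by apply/funext => x /=; rewrite big_cons.
Qed.

Lemma Rintegral_sum (I : Type) (s : seq I) (f : I -> T -> R) :
  (forall i, mu.-integrable setT (EFin \o f i)) ->
  \int[mu]_x (\sum_(i <- s) f i x) = \sum_(i <- s) \int[mu]_x f i x.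
Proof.
move=> intf; elim: s => [|i s IH].
  rewrite big_nil (@eq_Rintegral _ _ _ mu setT (fun=> 0)); last by move=> x _; rewrite big_nil.
  by rewrite /Rintegral integral0.
rewrite big_cons -IH -RintegralD//; last exact: integrableR_sum.
by apply: eq_Rintegral => x _; rewrite big_cons.
Qed.

Lemma EFin_Rintegral f : mu.-integrable setT (EFin \o f) ->
  ((\int[mu]_x f x)%:E = \int[mu]_x (f x)%:E)%E.
Proof. by move=> intf; rewrite /Rintegral fineK// integrable_fin_num. Qed.

End real_integrable.

Section Rfubini.
Context d1 d2 (T1 : measurableType d1) (T2 : measurableType d2) (R : realType).
Variables (m1 : {sigma_finite_measure set T1 -> \bar R}).
Variables (m2 : {sigma_finite_measure set T2 -> \bar R}).

Lemma measurable_Rintegral (k : T1 -> T2 -> R) :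
  measurable_fun setT (fun z : T1 * T2 => k z.1 z.2) ->
  measurable_fun setT (fun x => \int[m2]_y k x y).
Proof.
move=> mk.
have mkE : measurable_fun setT (fun z : T1 * T2 => (k z.1 z.2)%:E).
  exact/measurable_EFinP.
have mp := @measurable_fun_fubini_tonelli_F _ _ _ _ _ m2 _
  (measurable_funepos mkE) (funepos_ge0 _).
have mn := @measurable_fun_fubini_tonelli_F _ _ _ _ _ m2 _
  (measurable_funeneg mkE) (funeneg_ge0 _).
have mI : measurable_fun setT (fun x => \int[m2]_y (k x y)%:E)%E.
  apply: eq_measurable_fun (emeasurable_funB mp mn) => x _ /=.
  by rewrite [RHS]integralE; congr (_ - _)%E; apply: eq_integral => y _; rewrite ?funeposE ?funenegE.
exact: (measurableT_comp (fine_measurable measurableT) mI).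
Qed.

Variables (f : T1 -> R) (g : T2 -> R) (k : T1 -> T2 -> R).
Hypothesis intf : m1.-integrable setT (EFin \o f).
Hypothesis intg : m2.-integrable setT (EFin \o g).
Hypothesis mk : measurable_fun setT (fun z : T1 * T2 => k z.1 z.2).
Hypothesis kfg : forall x y, `|k x y| <= f x * g y.

Lemma measurable_dominated1 x : measurable_fun setT (k x).
Proof. exact: (measurableT_comp mk (measurable_pair1 x)). Qed.

Lemma measurable_dominated2 y : measurable_fun setT (k^~ y).
Proof. exact: (measurableT_comp mk (measurable_pair2 y)). Qed.

Lemma integrable_dominated1 x : m2.-integrable setT (EFin \o k x).
Proof.
apply: (le_integrableR (measurable_dominated1 x) (kfg x)).
by have := integrableZl measurableT (f x) intg.
Qed.

Lemma integrable_dominated2 y : m1.-integrable setT (EFin \o k^~ y).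
Proof.
apply: (le_integrableR (measurable_dominated2 y) (kfg^~ y)).
by have := integrableZr measurableT (g y) intf.
Qed.

Lemma Rintegral_dominated_le1 x : `|\int[m2]_y k x y| <= f x * \int[m2]_y g y.
Proof.
rewrite -RintegralZl//.
apply: le_trans (le_normr_Rintegral measurableT (integrable_dominated1 x)) _.
apply: le_Rintegral => //; first exact: integrable_norm (integrable_dominated1 x).
by have := integrableZl measurableT (f x) intg.
Qed.

Lemma integrable_Rintegral1 :
  m1.-integrable setT (EFin \o (fun x => \int[m2]_y k x y)).
Proof.
apply: (le_integrableR (measurable_Rintegral mk) Rintegral_dominated_le1).
by have := integrableZr measurableT (\int[m2]_y g y) intf.
Qed.

Lemma integrable_dominated : (m1 \x m2)%E.-integrable setT
  (fun z : T1 * T2 => (k z.1 z.2)%:E).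
Proof.
apply/integrable12ltyP; first exact/measurable_EFinP.
have K x : (\int[m2]_y `|(k x y)%:E| = (\int[m2]_y `|k x y|)%:E)%E.
  by rewrite /Rintegral fineK// integrable_fin_num// integrable_norm// integrable_dominated1.
under eq_integral do rewrite /= K.
apply: (@le_lt_trans _ _ (\int[m1]_x (f x * \int[m2]_y g y)%:E)%E).
  apply: ge0_le_integralT => x; rewrite !lee_fin Rintegral_ge0//=.
  rewrite -RintegralZl//; apply: le_Rintegral => //.
    exact: integrable_norm (integrable_dominated1 x).
  by have := integrableZl measurableT (f x) intg.
by apply: integrable_lty => //; have := integrableZr measurableT (\int[m2]_y g y) intf.
Qed.

(** The product bound [kfg] makes every section integrable, not just almost every one, so both
    iterated integrals are genuine real integrals with no exceptional set. *)
Lemma Rintegral_swap :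
  \int[m1]_x \int[m2]_y k x y = \int[m2]_y \int[m1]_x k x y.
Proof.
have := Fubini integrable_dominated => /=.
have E1 x : (\int[m2]_y (k x y)%:E = (\int[m2]_y k x y)%:E)%E.
  by rewrite /Rintegral fineK// integrable_fin_num// integrable_dominated1.
have E2 y : (\int[m1]_x (k x y)%:E = (\int[m1]_x k x y)%:E)%E.
  by rewrite /Rintegral fineK// integrable_fin_num// integrable_dominated2.
under eq_integral do rewrite E1.
under [in X in _ = X -> _]eq_integral do rewrite E2.
by rewrite /Rintegral => ->.
Qed.

End Rfubini.

(** * Calculus on the line and differentiation under the integral *)

Section calculus.
Context {R : realType}.
Notation leb := (@lebesgue_measure R).

Lemma is_derive_continuous (F f : R -> R) :
  (forall x, is_derive x (1:R) F (f x)) -> continuous F.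
Proof.
move=> dF x; apply: differentiable_continuous; apply/derivable1_diffP.
by have [] := dF x.
Qed.

Lemma FTC2_is_derive (F f : R -> R) (a b : R) : a <= b ->
  (forall x, is_derive x (1:R) F (f x)) -> continuous f ->
  \int[leb]_(x in `[a, b]) f x = F b - F a.
Proof.
rewrite le_eqVlt => /predU1P[<-|ab] dF cf.
  by rewrite set_itv1 Rintegral_set1 subrr.
have cF := is_derive_continuous dF.
rewrite /Rintegral (@continuous_FTC2 _ f F)//.
- exact: continuous_subspaceT.
- split.
  + by move=> x _; have [] := dF x.
  + by apply: cvg_at_right_filter; exact: cF.
  + by apply: cvg_at_left_filter; exact: cF.
- by move=> x _; rewrite derive1E; have [_ ->] := dF x.
Qed.

Lemma cvg_integral_symitv (f : R -> R) : leb.-integrable setT (EFin \o f) ->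
  \int[leb]_(x in `[- n%:R, n%:R]) f x @[n --> \oo] --> \int[leb]_x f x.
Proof.
move=> intf; have mf := measurable_int _ intf.
apply: fine_cvg; rewrite [X in _ --> X]fineK; last exact: integrable_fin_num.
rewrite (_ : (fun _ => _) = (fun n : nat =>
    \int[leb]_x ((EFin \o f) \_ `[(- n%:R)%R : R, n%:R%R]) x)%E); last first.
  by apply/funext => n; rewrite -integral_mkcond.
have [] := @dominated_convergence _ _ R leb setT measurableT
  (fun n : nat => (EFin \o f) \_ `[- n%:R : R, n%:R]) (EFin \o f) (abse \o (EFin \o f)).
- move=> n; apply/measurable_restrict => //.
  exact: measurable_funTS.
- by [].
- apply: aeW => x _; apply: cvg_near_cst.
  exists (Num.truncn `|x|).+1 => // n /= xn.
  rewrite patchE ifT// inE/= in_itv/= -ler_norml.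
  apply: ltW; apply: lt_le_trans (truncnS_gt _) _; by rewrite ler_nat.
- exact: integrable_abse.
- apply: aeW => x n _ /=; rewrite patchE; case: ifPn => // _.
  by rewrite abse0.
- by [].
Qed.

(** Integration by parts on the line is this lemma applied to a product. Limits along the integers
    suffice, because the integral is the limit over the intervals [[-n, n]]. *)
Lemma integral_derive0 (F f : R -> R) :
  (forall x, is_derive x (1:R) F (f x)) -> continuous f ->
  leb.-integrable setT (EFin \o f) ->
  F n%:R @[n --> \oo] --> (0:R) -> F (- n%:R) @[n --> \oo] --> (0:R) ->
  \int[leb]_x f x = 0.
Proof.
move=> dF cf intf Fp Fn.
have := cvg_integral_symitv intf.
rewrite (_ : (fun _ => _) = (fun n : nat => F n%:R - F (- n%:R))); last first.
  by apply/funext => n; rewrite (FTC2_is_derive _ dF)// ge0_cp.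
move=> /cvg_lim <-//.
by apply/cvg_lim => //; rewrite -[X in _ --> X](subrr (0:R)); exact: cvgB.
Qed.

Lemma derivable_zero_cst (F : R -> R) (x y : R) :
  (forall x, is_derive x (1:R) F 0) -> F x = F y.
Proof.
by move=> dF; exact: is_derive_0_is_cst.
Qed.

End calculus.

Section derive_under_integral.
Context d (T : measurableType d) (R : realType) (mu : {measure set T -> \bar R}).
Variables (c a b : T -> R).
Hypotheses (mc : measurable_fun setT c) (ma : measurable_fun setT a)
  (mb : measurable_fun setT b).
Hypothesis intc : mu.-integrable setT (EFin \o c).
Hypothesis intcb : mu.-integrable setT (EFin \o (fun y => c y * b y)).

Lemma measurable_cos_lin x : measurable_fun setT (fun y => cos (a y + x * b y)).
Proof.
apply: measurableT_comp; first by apply: continuous_measurable_fun; exact: continuous_cos.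
by apply: measurable_funD => //; apply: measurable_funM.
Qed.

Lemma measurable_sin_lin x : measurable_fun setT (fun y => sin (a y + x * b y)).
Proof.
apply: measurableT_comp; first by apply: continuous_measurable_fun; exact: continuous_sin.
by apply: measurable_funD => //; apply: measurable_funM.
Qed.

Lemma is_derive_cos_lin (u v : R) x :
  is_derive x (1:R) (fun x => cos (u + x * v)) (- v * sin (u + x * v)).
Proof.
have := @is_derive1_comp _ cos (fun x => u + x * v) x _ v (is_derive_cos _) _.
rewrite mulNr mulrC mulNr mulrC; apply.
apply: is_derive_eq; rewrite add0r.
by rewrite scaler0 add0r /GRing.scale/= mul1r mulr1.
Qed.

Lemma is_derive_sin_lin (u v : R) x :
  is_derive x (1:R) (fun x => sin (u + x * v)) (v * cos (u + x * v)).
Proof.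
have := @is_derive1_comp _ sin (fun x => u + x * v) x _ v (is_derive_sin _) _.
rewrite mulrC; apply.
apply: is_derive_eq; rewrite add0r.
by rewrite scaler0 add0r /GRing.scale/= mul1r mulr1.
Qed.

(** The free phase [a] makes one lemma serve cosine and sine integrals, the latter through a shift
    by pi/2. The derivative is dominated by [|c y * b y|], which does not depend on [x]. *)
Lemma is_derive_integral_cos x :
  is_derive x (1:R) (fun x => \int[mu]_y (c y * cos (a y + x * b y)))
    (- \int[mu]_y (c y * b y * sin (a y + x * b y))).
Proof.
pose f x y := c y * cos (a y + x * b y).
have df x' y : is_derive x' (1:R) (f^~ y) (c y * (- b y * sin (a y + x' * b y))).
  have := is_derive_cos_lin (a y) (b y) x' => H.
  rewrite /f; apply: is_derive_eq.
  by [] .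
have intf x' : mu.-integrable setT (EFin \o f x').
  apply: (@le_integrableR _ _ _ _ _ (fun y => `|c y|)).
  - by apply: measurable_funM => //; exact: measurable_cos_lin.
  - by move=> y; rewrite normrM ler_piMr// cos_max.
  - by have := integrable_norm intc.
have Ix : `]x - 1, x + 1[%classic x by rewrite /= in_itv/=; lra.
have p1 x' y : partial1of2 f x' y = - (c y * b y * sin (a y + x' * b y)).
  by rewrite partial1of2E; have [_ ->] := df x' y; rewrite mulNr mulrN mulrA.
have intG : mu.-integrable setT (EFin \o (fun y => `|c y * b y|)).
  by have := integrable_norm intcb.
have G0 y : 0 <= `|c y * b y| by [].
have H1 x' y : `]x - 1, x + 1[%classic x' -> [set: T] y -> derivable (f^~ y) x' 1.
  by move=> _ _; have [] := df x' y.
have H2 x' y : `]x - 1, x + 1[%classic x' -> [set: T] y ->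
    `|partial1of2 f x' y| <= `|c y * b y|.
  by move=> _ _; rewrite p1 normrN normrM ler_piMr// sin_max.
have H0 x' : `]x - 1, x + 1[%classic x' -> mu.-integrable setT (EFin \o f x').
  by move=> _; exact: intf.
split.
  exact: (@derivable_under_integral _ _ _ mu f setT measurableT x (x - 1) (x + 1)
    Ix H0 H1 _ G0 intG H2).
rewrite -derive1E.
rewrite (@differentiation_under_integral _ _ _ mu f setT measurableT x (x - 1) (x + 1)
    Ix H0 H1 _ G0 intG H2).
rewrite -mulN1r -RintegralZl//.
  by apply: eq_Rintegral => y _; rewrite p1 mulN1r.
apply: (@le_integrableR _ _ _ _ _ (fun y => `|c y * b y|)) => //.
- by apply: measurable_funM; [exact: measurable_funM|exact: measurable_sin_lin].
- by move=> y; rewrite normrM ler_piMr// sin_max.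
Qed.

End derive_under_integral.

(** * The one-dimensional Gaussian and its Fourier transform *)

Section gaussian1.
Context {R : realType}.
Notation leb := (@lebesgue_measure R).
Implicit Types s a x : R.

Definition gauss1 s a : R := expR (- (pi * (s * a) ^+ 2)).

Lemma gauss1_gt0 s a : 0 < gauss1 s a. Proof. exact: expR_gt0. Qed.

Lemma gauss1_ge0 s a : 0 <= gauss1 s a. Proof. exact: expR_ge0. Qed.

Lemma is_derive_gauss1 s a :
  is_derive a (1:R) (gauss1 s) (- (2 * pi * s ^+ 2 * a) * gauss1 s a).
Proof.
have H : is_derive a (1:R) (fun a => - (pi * (s * a) ^+ 2)) (- (2 * pi * s ^+ 2 * a)).
  apply: is_derive_eq; rewrite /GRing.scale/= ?expr2; ring.
have := @is_derive1_comp _ expR (fun a => - (pi * (s * a) ^+ 2)) a _ _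
  (is_derive_expR _) H.
by rewrite mulrC.
Qed.

Lemma continuous_gauss1 s : continuous (gauss1 s).
Proof. exact: is_derive_continuous (is_derive_gauss1 s). Qed.

Lemma measurable_gauss1 s : measurable_fun setT (gauss1 s).
Proof. by apply: continuous_measurable_fun; exact: continuous_gauss1. Qed.

(** Imports the Gaussian integral from the normal density. *)
Lemma gauss1_normal_pdf s m a : 0 < s ->
  s * gauss1 s (a - m) = normal_pdf m (s * Num.sqrt (pi *+ 2))^-1 a.
Proof.
move=> s0; have p0 : 0 < pi :> R by exact: pi_gt0.
have q0 : 0 < Num.sqrt (pi *+ 2) :> R by rewrite sqrtr_gt0 pmulrn_lgt0.
have e : (s * Num.sqrt (pi *+ 2))^-1 ^+ 2 = (s ^+ 2 * (pi *+ 2))^-1.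
  by rewrite exprVn exprMn sqr_sqrtr// pmulrn_lge0// ltW.
rewrite normal_pdfE; last by rewrite invr_neq0// mulf_neq0// gt_eqF.
congr (_ * _).
  rewrite /normal_peak e.
  have -> : (s ^+ 2 * (pi *+ 2))^-1 * pi *+ 2 = (s^-1) ^+ 2.
    have := lt0r_neq0 p0; have := lt0r_neq0 s0 => s1 p1.
    by move: s1 p1; clear; move: (pi) => P s1 p1; field; rewrite p1 s1.
  by rewrite sqrtr_sqr ger0_norm ?invr_ge0 ?ltW// invrK.
rewrite /gauss1 /normal_fun e; congr expR.
rewrite exprMn; have := lt0r_neq0 p0; have := lt0r_neq0 s0.
by clear; move: (pi) => P s1 p1; field; rewrite p1 s1.
Qed.

Lemma integrable_gauss1 s m : 0 < s ->
  leb.-integrable setT (EFin \o (fun a => s * gauss1 s (a - m))).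
Proof.
move=> s0; rewrite (_ : _ \o _ = EFin \o normal_pdf m (s * Num.sqrt (pi *+ 2))^-1).
  exact: integrable_normal_pdf.
by apply/funext => a /=; rewrite gauss1_normal_pdf.
Qed.

Lemma integral_gauss1 s m : 0 < s -> (\int[leb]_a (s * gauss1 s (a - m))%:E = 1)%E.
Proof.
move=> s0; rewrite -(@integral_normal_pdf R m (s * Num.sqrt (pi *+ 2))^-1).
by apply: eq_integral => a _; rewrite gauss1_normal_pdf.
Qed.

Lemma integrable_gauss10 s : 0 < s -> leb.-integrable setT (EFin \o gauss1 s).
Proof.
move=> s0; have := integrableZl measurableT s^-1 (integrable_gauss1 0 s0).
apply: eq_integrable => // a _ /=.
by rewrite subr0 -EFinM mulrA mulVf ?mul1r// gt_eqF.
Qed.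

Lemma Rintegral_gauss10 s : 0 < s -> \int[leb]_a gauss1 s a = s^-1.
Proof.
move=> s0; have i1 := integrable_gauss10 s0.
have := integral_gauss1 0 s0; under eq_integral do rewrite subr0 EFinM.
rewrite integralZl// => /(congr1 fine).
rewrite fineM ?integrable_fin_num//= => e.
by rewrite /Rintegral -[LHS](mulKf (lt0r_neq0 s0)) e mulr1.
Qed.

(** Half of the exponent absorbs the linear factor; the other half is the Gaussian of scale
    [s / sqrt 2]. *)
Lemma norm_gauss1_le s a : 0 < s ->
  `|a| * gauss1 s a <= s^-1 * gauss1 (s / Num.sqrt 2) a.
Proof.
move=> s0; set b := pi * (s * a) ^+ 2 / 2.
have -> : gauss1 s a = gauss1 (s / Num.sqrt 2) a * expR (- b).
  rewrite /gauss1 -expRD; congr expR; rewrite /b !exprMn exprVn sqr_sqrtr//.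
  by field.
rewrite mulrCA mulrC ler_wpM2r ?gauss1_ge0//.
rewrite expRN ler_pdivrMr ?expR_gt0// mulrC ler_pdivlMr//.
apply: le_trans (expR_ge1Dx b).
have h : `|s * a| <= 1 + (s * a) ^+ 2.
  rewrite -(real_normK (num_real (s * a))).
  by have := normr_ge0 (s * a); nra.
have p2 : (2 : R) <= pi by exact: pi_ge2.
have := sqr_ge0 (s * a).
have -> : `|a| * s = `|s * a| by rewrite normrM (gtr0_norm s0) mulrC.
rewrite /b => sq; apply: (le_trans h); rewrite lerD2l; nra.
Qed.

Lemma integrable_gauss1_mul s : 0 < s ->
  leb.-integrable setT (EFin \o (fun a => gauss1 s a * (2 * pi * a))).
Proof.
move=> s0; have s20 : 0 < s / Num.sqrt 2 by rewrite divr_gt0// sqrtr_gt0.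
have p0 : 0 < pi :> R by exact: pi_gt0.
have mg := measurable_gauss1 s.
apply: (@le_integrableR _ _ _ leb _ (fun a : R => 2 * pi * s^-1 * gauss1 (s / Num.sqrt 2) a)).
- by apply: measurable_funM => //; exact: measurable_funM.
- have p20 : 0 <= 2 * pi :> R by rewrite mulr_ge0 ?ltW.
  move=> a; rewrite normrM (ger0_norm (gauss1_ge0 s a)) normrM (ger0_norm p20).
  have h := norm_gauss1_le a s0.
  have -> : gauss1 s a * (2 * pi * `|a|) = 2 * pi * (`|a| * gauss1 s a) by ring.
  by rewrite -[X in _ <= X]mulrA ler_wpM2l.
- by have := integrableZl measurableT (2 * pi * s^-1) (integrable_gauss10 s20).
Qed.

Lemma cvg_gauss1_0 s : 0 < s -> gauss1 s n%:R @[n --> \oo] --> (0 : R).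
Proof.
move=> s0; apply/cvgrPdist_le => e e0.
exists (Num.truncn ((s ^+ 2 * e)^-1)).+1 => // n /= ne.
have n0 : (0 < n)%N by exact: leq_trans ne.
have nn : (s ^+ 2 * e)^-1 <= n%:R.
  by apply: ltW; apply: lt_le_trans (truncnS_gt _) _; rewrite ler_nat.
rewrite sub0r normrN gtr0_norm ?gauss1_gt0// /gauss1 expRN -[leRHS]invrK.
rewrite lef_pV2 ?posrE ?expR_gt0 ?invr_gt0//.
apply: le_trans (expR_ge1Dx _).
have p2 : (2 : R) <= pi by exact: pi_ge2.
have n1 : 1 <= n%:R :> R by rewrite ler1n.
have se : 0 < s ^+ 2 by rewrite exprn_gt0.
have : e^-1 <= s ^+ 2 * n%:R.
  move: nn; rewrite invfM => nn.
  by rewrite -(ler_pM2l (x := (s ^+ 2)^-1)) ?invr_gt0// mulKf ?gt_eqF.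
rewrite exprMn; move=> h; apply: (le_trans h).
have : s ^+ 2 * n%:R <= s ^+ 2 * n%:R ^+ 2.
  by rewrite ler_pM2l// expr2; nra.
by have := sqr_ge0 (n%:R : R); nra.
Qed.

Let J s phi x := \int[leb]_a (gauss1 s a * cos (phi + x * (2 * pi * a))).

(** Differentiating under the integral brings out the factor [2 * pi * a], and [a * gauss1 s a] is
    up to a constant the derivative of [gauss1 s]; integration by parts then returns [J] itself. *)
Let dJ s phi x : 0 < s ->
  is_derive x (1:R) (J s phi) (- (2 * pi * x / s ^+ 2) * J s phi x).
Proof.
move=> s0; have p0 : 0 < pi :> R by exact: pi_gt0.
have mg := measurable_gauss1 s.
have ig := integrable_gauss10 s0; have ig2 := integrable_gauss1_mul s0.
have mb : measurable_fun setT (fun a : R => 2 * pi * a) by exact: measurable_funM.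
have := @is_derive_integral_cos _ (measurableTypeR R) R leb (gauss1 s) (cst phi) (fun a => 2 * pi * a)
  mg (measurable_cst phi) mb ig ig2 x.
rewrite -/(J s phi) => H; apply: is_derive_eq.
set I1 := Rintegral _ _ _.
(* The boundary term of the integration by parts: its derivative [f] has integral zero, and the two
   terms of [f] integrate to multiples of [I1] and of [J]. *)
pose F a := gauss1 s a * sin (phi + x * (2 * pi * a)).
pose f a := (- (2 * pi * s ^+ 2 * a) * gauss1 s a) * sin (phi + x * (2 * pi * a))
  + gauss1 s a * (2 * pi * x * cos (phi + x * (2 * pi * a))).
have dsin a : is_derive a (1:R) (fun a => sin (phi + x * (2 * pi * a)))
    (2 * pi * x * cos (phi + x * (2 * pi * a))).
  have := is_derive_sin_lin phi (2 * pi * x) a.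
  rewrite (_ : (fun x0 : R => _) = (fun a => sin (phi + x * (2 * pi * a)))).
    by rewrite (_ : a * (2 * pi * x) = x * (2 * pi * a))//; ring.
  by apply/funext => b; congr (sin (_ + _)); ring.
have dcos a : is_derive a (1:R) (fun a => cos (phi + x * (2 * pi * a)))
    (- (2 * pi * x) * sin (phi + x * (2 * pi * a))).
  have := is_derive_cos_lin phi (2 * pi * x) a.
  rewrite (_ : (fun x0 : R => _) = (fun a => cos (phi + x * (2 * pi * a)))).
    by rewrite (_ : a * (2 * pi * x) = x * (2 * pi * a))//; ring.
  by apply/funext => b; congr (cos (_ + _)); ring.
have dF a : is_derive a (1:R) F (f a).
  have H1 := is_derive_gauss1 s a; have H2 := dsin a.
  by rewrite /F; apply: is_derive_eq; rewrite /f /GRing.scale/=; ring.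
have cf : continuous f.
  move=> a; apply: cvgD; apply: cvgM.
  - apply: cvgM; last exact: continuous_gauss1.
    by apply: cvgN; apply: cvgM; [exact: cvg_cst|exact: cvg_id].
  - exact: (is_derive_continuous dsin).
  - exact: continuous_gauss1.
  - by apply: cvgM; [exact: cvg_cst|exact: (is_derive_continuous dcos)].
have i1 : leb.-integrable setT (EFin \o (fun a => gauss1 s a * (2 * pi * a) *
    sin (phi + x * (2 * pi * a)))).
  apply: (@le_integrableR _ _ _ leb _ (fun y : R => `|gauss1 s y * (2 * pi * y)|)).
  - apply: measurable_funM; first exact: measurable_funM.
    exact: measurable_sin_lin.
  - by move=> y; rewrite normrM ler_piMr// sin_max.
  - by have := integrable_norm ig2.
have i2 : leb.-integrable setT (EFin \o (fun a => gauss1 s a *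
    cos (phi + x * (2 * pi * a)))).
  apply: (@le_integrableR _ _ _ leb _ (gauss1 s)) => //.
  - by apply: measurable_funM => //; exact: measurable_cos_lin.
  - by move=> y; rewrite normrM ger0_norm ?gauss1_ge0// ler_piMr ?gauss1_ge0// cos_max.
have i1' := integrableRZ (- s ^+ 2) i1.
have i2' := integrableRZ (2 * pi * x) i2.
have fE : f = (fun a => - s ^+ 2 * (gauss1 s a * (2 * pi * a) * sin (phi + x * (2 * pi * a)))
    + 2 * pi * x * (gauss1 s a * cos (phi + x * (2 * pi * a)))).
  by apply/funext => a; rewrite /f; ring.
have intf : leb.-integrable setT (EFin \o f) by rewrite fE; exact: integrableRD.
have Fle a : `|F a| <= gauss1 s a.
  by rewrite /F normrM ger0_norm ?gauss1_ge0// ler_piMr ?gauss1_ge0// sin_max.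
have Fp : F n%:R @[n --> \oo] --> (0:R).
  apply: norm_cvg0; apply: (squeeze_cvgr _ (cvg_cst (0:R)) (cvg_gauss1_0 s0)).
  by apply: nearW => n /=; rewrite normr_ge0 Fle.
have Fn : F (- n%:R) @[n --> \oo] --> (0:R).
  apply: norm_cvg0; apply: (squeeze_cvgr _ (cvg_cst (0:R)) (cvg_gauss1_0 s0)).
  apply: nearW => n /=; rewrite normr_ge0/=.
  by have := Fle (- n%:R); rewrite /gauss1 mulrN sqrrN.
have := integral_derive0 dF cf intf Fp Fn.
rewrite fE RintegralD// !RintegralZl// -/(J s phi x) -/I1 => e.
have : s ^+ 2 * I1 = 2 * pi * x * J s phi x by lra.
move=> e'; rewrite mulNr; congr (- _).
have s2 : s ^+ 2 != 0 by rewrite expf_neq0// gt_eqF.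
by rewrite -[LHS](mulKf s2) e'; field; rewrite gt_eqF.
Qed.

(** The phase [phi] is carried along because in dimension n the transform is computed one coordinate
    at a time, the other coordinates entering as a phase. *)
Lemma fourier_gauss1 s phi x : 0 < s ->
  \int[leb]_a (gauss1 s a * cos (phi + x * (2 * pi * a))) =
  cos phi * (s^-1 * gauss1 s^-1 x).
Proof.
move=> s0; rewrite -/(J s phi x).
(* Integrating factor of the equation [dJ]: the product [E * J] is constant, and at 0 it is a
   Gaussian integral. *)
pose E y := expR (pi * (s^-1 * y) ^+ 2).
have dE y : is_derive y (1:R) E (2 * pi / s ^+ 2 * y * E y).
  have H : is_derive y (1:R) (fun a => pi * (s^-1 * a) ^+ 2) (2 * pi / s ^+ 2 * y).
    by apply: is_derive_eq; rewrite /GRing.scale/= ?expr2; field; rewrite gt_eqF.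
  have := @is_derive1_comp _ expR (fun a => pi * (s^-1 * a) ^+ 2) y _ _
    (is_derive_expR _) H.
  by rewrite mulrC.
have d0 y : is_derive y (1:R) (fun y => E y * J s phi y) 0.
  have H1 := dE y; have H2 := dJ phi y s0.
  by apply: is_derive_eq; rewrite /GRing.scale/=; field; rewrite gt_eqF.
have := derivable_zero_cst x 0 d0.
rewrite {2}/E mulr0 expr0n mulr0 expR0 mul1r.
have -> : J s phi 0 = cos phi * s^-1.
  rewrite /J -(Rintegral_gauss10 s0) -RintegralZl//; last exact: integrable_gauss10.
  by apply: eq_Rintegral => a _; rewrite mul0r addr0 mulrC.
move=> e; rewrite /gauss1 expRN -/(E x) mulrA -e mulrC mulKf//.
by rewrite gt_eqF// expR_gt0.
Qed.

End gaussian1.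

(** * Measurability and the inner product on row vectors *)

Section measurable_rV.
Context {R : realType} {n : nat} d (T : measurableType d).
Implicit Types f g : T -> 'rV[R]_n.

Lemma measurable_coord f i : measurable_fun setT f ->
  measurable_fun setT (fun x => f x ord0 i : R).
Proof. by move=> mf; exact: (measurableT_comp (measurable_coord_rV i) mf). Qed.

Lemma measurable_rVD f g : measurable_fun setT f -> measurable_fun setT g ->
  measurable_fun setT (fun x => f x + g x).
Proof.
move=> mf mg; apply: measurable_fun_rV => i.
apply: (eq_measurable_fun (fun x => f x ord0 i + g x ord0 i)).
  by move=> x _; rewrite mxE.
by apply: measurable_funD; exact: measurable_coord.
Qed.

Lemma measurable_rVZ (k : T -> R) f : measurable_fun setT k ->
  measurable_fun setT f -> measurable_fun setT (fun x => k x *: f x).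
Proof.
move=> mk mf; apply: measurable_fun_rV => i.
apply: (eq_measurable_fun (fun x => k x * f x ord0 i)).
  by move=> x _; rewrite mxE.
by apply: measurable_funM => //; exact: measurable_coord.
Qed.

Lemma measurable_rVB f g : measurable_fun setT f -> measurable_fun setT g ->
  measurable_fun setT (fun x => f x - g x).
Proof.
move=> mf mg; apply: measurable_fun_rV => i.
apply: (eq_measurable_fun (fun x => f x ord0 i - g x ord0 i)).
  by move=> x _; rewrite !mxE.
by apply: measurable_funB; exact: measurable_coord.
Qed.

Lemma measurable_dotr f g : measurable_fun setT f -> measurable_fun setT g ->
  measurable_fun setT (fun x => dotr (f x) (g x)).
Proof.
move=> mf mg; apply: measurable_sum => i.
by apply: measurable_funM; exact: measurable_coord.
Qed.

End measurable_rV.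

Section dotr_theory.
Context {R : realType} {n : nat}.
Implicit Types x y z : 'rV[R]_n.

Lemma dotrC x y : dotr x y = dotr y x.
Proof. by apply: eq_bigr => i _; rewrite mulrC. Qed.

Lemma dotrDl x y z : dotr (x + y) z = dotr x z + dotr y z.
Proof. by rewrite -big_split; apply: eq_bigr => i _; rewrite mxE mulrDl. Qed.

Lemma dotrDr x y z : dotr z (x + y) = dotr z x + dotr z y.
Proof. by rewrite !(dotrC z) dotrDl. Qed.

Lemma dotrZl k x y : dotr (k *: x) y = k * dotr x y.
Proof. by rewrite mulr_sumr; apply: eq_bigr => i _; rewrite mxE mulrA. Qed.

Lemma dotrZr k x y : dotr x (k *: y) = k * dotr x y.
Proof. by rewrite dotrC dotrZl dotrC. Qed.

Lemma dotrNl x y : dotr (- x) y = - dotr x y.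
Proof. by rewrite -scaleN1r dotrZl mulN1r. Qed.

Lemma dotrNr x y : dotr x (- y) = - dotr x y.
Proof. by rewrite dotrC dotrNl dotrC. Qed.

Lemma dotrBl x y z : dotr (x - y) z = dotr x z - dotr y z.
Proof. by rewrite dotrDl dotrNl. Qed.

Lemma dotrBr x y z : dotr z (x - y) = dotr z x - dotr z y.
Proof. by rewrite dotrDr dotrNr. Qed.

Lemma dotr_ge0 x : 0 <= dotr x x.
Proof. by apply: sumr_ge0 => i _; rewrite -expr2 sqr_ge0. Qed.

Lemma enorm_sqr x : enorm x ^+ 2 = dotr x x.
Proof.
rewrite /enorm sqr_sqrtr; last by apply: sumr_ge0 => i _; exact: sqr_ge0.
by apply: eq_bigr => i _; rewrite expr2.
Qed.

Lemma enorm_ge0 x : 0 <= enorm x. Proof. exact: sqrtr_ge0. Qed.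

Lemma enormN x : enorm (- x) = enorm x.
Proof. by rewrite /enorm; congr Num.sqrt; apply: eq_bigr => i _; rewrite mxE sqrrN. Qed.

Lemma enormZ k x : enorm (k *: x) = `|k| * enorm x.
Proof.
apply/eqP; rewrite -(eqrXn2 (n := 2))// ?mulr_ge0 ?enorm_ge0//.
by rewrite exprMn !enorm_sqr dotrZl dotrZr real_normK ?num_real// mulrA expr2.
Qed.

(** Cauchy-Schwarz, from the squared norm of the component of [x] orthogonal to [y], scaled by
    [dotr y y] to avoid a division. *)
Lemma dotr_sqr_le x y : dotr x y ^+ 2 <= dotr x x * dotr y y.
Proof.
have [y0|y0] := eqVneq (dotr y y) 0.
  have -> : dotr x y = 0.
    apply: big1 => i _; have /eqP := y0.
    rewrite psumr_eq0; last by move=> j _; rewrite -expr2 sqr_ge0.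
    by move=> /allP/(_ i (mem_index_enum _)); rewrite mulf_eq0 orbb => /eqP ->; rewrite mulr0.
  by rewrite y0 mulr0 expr2 mulr0.
have yp : 0 < dotr y y by rewrite lt_neqAle eq_sym y0 dotr_ge0.
have := dotr_ge0 (dotr y y *: x - dotr x y *: y).
rewrite dotrBl !dotrBr !(dotrZl, dotrZr) (dotrC y x) => h.
rewrite -subr_ge0 -(pmulr_rge0 _ yp).
by apply: le_trans h _; rewrite le_eqVlt; apply/orP; left; apply/eqP; ring.
Qed.

Lemma norm_dotr_le x y : `|dotr x y| <= enorm x * enorm y.
Proof.
rewrite -(ler_pXn2r (n := 2))// ?nnegrE ?mulr_ge0 ?enorm_ge0//.
by rewrite real_normK ?num_real// exprMn !enorm_sqr dotr_sqr_le.
Qed.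

Lemma enormD x y : enorm (x + y) <= enorm x + enorm y.
Proof.
rewrite -(ler_pXn2r (n := 2))// ?nnegrE ?addr_ge0 ?enorm_ge0//.
rewrite enorm_sqr sqrrD !enorm_sqr dotrDl !dotrDr (dotrC y x).
have := norm_dotr_le x y; have := ler_norm (dotr x y).
by lra.
Qed.

Lemma enorm0 : enorm (0 : 'rV[R]_n) = 0.
Proof. by rewrite -(scale0r 0) enormZ normr0 mul0r. Qed.

Lemma coord_le_enorm x i : `|x ord0 i| <= enorm x.
Proof.
rewrite -(ler_pXn2r (n := 2))// ?nnegrE ?enorm_ge0//.
rewrite real_normK ?num_real// enorm_sqr /dotr (bigD1 i)//= expr2 lerDl.
by apply: sumr_ge0 => j _; rewrite -expr2 sqr_ge0.
Qed.

Lemma enorm_le_sum x : enorm x <= \sum_i `|x ord0 i|.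
Proof.
rewrite -(ler_pXn2r (n := 2))// ?nnegrE ?enorm_ge0 ?sumr_ge0//.
rewrite enorm_sqr expr2 mulr_suml; apply: ler_sum => i _.
rewrite -expr2 -(real_normK (num_real (x ord0 i))) expr2 ler_wpM2l//.
by rewrite (bigD1 i)//= lerDl sumr_ge0.
Qed.

End dotr_theory.

(** * Lebesgue measure one coordinate at a time, and Gaussians in dimension n *)

Section lebesgue_rVS.
Context {R : realType} {n : nat}.
Notation leb := (@lebesgue_measure R).
Implicit Types g : 'rV[R]_n.+1 -> R.

Lemma ge0_integral_rVS (g : 'rV[R]_n.+1 -> \bar R) :
  measurable_fun setT g -> (forall v, (0 <= g v)%E) ->
  (\int[lebesgue_rV n.+1]_v g v =
   \int[leb]_a \int[lebesgue_rV n]_u g (rV_cons (a, u)))%E.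
Proof.
move=> mg g0.
rewrite [LHS](@ge0_integral_pushforward _ _ _ _ _ (@rV_cons R n)
  (@measurable_rV_cons R n) (leb \x lebesgue_rV n)%E setT g)//.
rewrite preimage_setT fubini_tonelli1//; last by move=> z /=; exact: g0.
exact: (measurableT_comp mg (@measurable_rV_cons R n)).
Qed.

Variables (g : 'rV[R]_n.+1 -> R) (phi : R -> R) (psi : 'rV[R]_n -> R).
Hypothesis mg : measurable_fun setT g.
Hypothesis intphi : leb.-integrable setT (EFin \o phi).
Hypothesis intpsi : (lebesgue_rV n).-integrable setT (EFin \o psi).
Hypothesis gle : forall a u, `|g (rV_cons (a, u))| <= phi a * psi u.

Let mgc : measurable_fun setT (fun z : measurableTypeR R * 'rV[R]_n => g (rV_cons (z.1, z.2))).
Proof.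
apply: (eq_measurable_fun (g \o @rV_cons R n)); first by case.
exact: (measurableT_comp mg (@measurable_rV_cons R n)).
Qed.

Let intg2 := @integrable_dominated _ _ (measurableTypeR R) 'rV[R]_n R leb
  (lebesgue_rV n) phi psi (fun a u => g (rV_cons (a, u))) intphi intpsi mgc gle.

Let intg2' : (leb \x lebesgue_rV n)%E.-integrable setT
  ((EFin \o g) \o @rV_cons R n).
Proof. by apply: eq_integrable intg2 => //; case. Qed.

Lemma integrable_rVS : (lebesgue_rV n.+1).-integrable setT (EFin \o g).
Proof.
apply: (@integrable_pushforward _ _ _ _ _ (@rV_cons R n)
  (@measurable_rV_cons R n) (leb \x lebesgue_rV n)%E setT (EFin \o g)) => //.
exact/measurable_EFinP.
Qed.

Lemma Rintegral_rVS : \int[lebesgue_rV n.+1]_v g v =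
   \int[leb]_a \int[lebesgue_rV n]_u g (rV_cons (a, u)).
Proof.
rewrite {1}/Rintegral [X in fine X](@integral_pushforward _ _ _ _ _ (@rV_cons R n)
  (@measurable_rV_cons R n) (leb \x lebesgue_rV n)%E setT (EFin \o g))//;
  last exact/measurable_EFinP.
rewrite preimage_setT -(integral12_prod_meas1 intg2')/= /Rintegral.
congr fine; apply: eq_integral => a _.
rewrite fineK//; apply: integrable_fin_num => //.
by have := @integrable_dominated1 _ _ (measurableTypeR R) 'rV[R]_n R
  (lebesgue_rV n) phi psi (fun a u => g (rV_cons (a, u))) intpsi mgc gle a.
Qed.

End lebesgue_rVS.

Section gaussian.
Context {R : realType}.
Notation leb := (@lebesgue_measure R).
Implicit Types s r : R.

Definition gauss {n} s (v : 'rV[R]_n) : R := expR (- (pi * s ^+ 2 * dotr v v)).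

(** The Fourier transform of [gauss r], of total mass one. The parameter [r] is a length rather than
    a time: convolution adds the squares of the scales. *)
Definition heat {n} r (v : 'rV[R]_n) : R := r^-1 ^+ n * gauss r^-1 v.

Lemma gauss_gt0 n s (v : 'rV[R]_n) : 0 < gauss s v. Proof. exact: expR_gt0. Qed.

Lemma gauss_ge0 n s (v : 'rV[R]_n) : 0 <= gauss s v. Proof. exact: expR_ge0. Qed.

Lemma gauss_le1 n s (v : 'rV[R]_n) : gauss s v <= 1.
Proof.
rewrite /gauss -[leRHS]expR0 ler_expR oppr_le0.
by apply: mulr_ge0; [apply: mulr_ge0; [exact: pi_ge0|exact: sqr_ge0]|exact: dotr_ge0].
Qed.

Lemma heat_ge0 n r (v : 'rV[R]_n) : 0 < r -> 0 <= heat r v.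
Proof. by move=> r0; rewrite mulr_ge0 ?gauss_ge0// exprn_ge0// invr_ge0 ltW. Qed.

Lemma gaussN n s (v : 'rV[R]_n) : gauss s (- v) = gauss s v.
Proof. by rewrite /gauss dotrNl dotrNr opprK. Qed.

Lemma heatN n r (v : 'rV[R]_n) : heat r (- v) = heat r v.
Proof. by rewrite /heat gaussN. Qed.

Lemma measurable_gauss n d (T : measurableType d) (k : T -> R) (f : T -> 'rV[R]_n) :
  measurable_fun setT k -> measurable_fun setT f ->
  measurable_fun setT (fun x => gauss (k x) (f x)).
Proof.
move=> mk mf; apply: measurableT_comp => //; apply: measurableT_comp => //.
apply: measurable_funM; last exact: measurable_dotr.
by apply: measurable_funM => //; exact: measurable_funX.
Qed.

Lemma measurable_heat n r d (T : measurableType d) (f : T -> 'rV[R]_n) :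
  measurable_fun setT f -> measurable_fun setT (fun x => heat r (f x)).
Proof. by move=> mf; apply: measurable_funM => //; exact: measurable_gauss. Qed.

Lemma dotr_cons n z (y : 'rV[R]_n.+1) :
  dotr (rV_cons z) y = z.1 * (rV_uncons y).1 + dotr z.2 (rV_uncons y).2.
Proof.
rewrite /dotr big_ord_recl mxE unlift_none; congr (_ + _).
by apply: eq_bigr => i _; rewrite !mxE liftK.
Qed.

Lemma rV_unconsB n (x : 'rV[R]_n.+1) z :
  x - rV_cons z = rV_cons ((rV_uncons x).1 - z.1 : R, (rV_uncons x).2 - z.2).
Proof.
apply/rowP => i; rewrite !mxE.
by case: (unliftP ord0 i) => [j ->|->]; rewrite ?mxE.
Qed.

Lemma dotr_rV0 (x y : 'rV[R]_0) : dotr x y = 0.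
Proof. by rewrite /dotr big_ord0. Qed.

Lemma gauss_cons n s (a : R) (u : 'rV[R]_n) :
  gauss s (rV_cons (a, u)) = gauss1 s a * gauss s u.
Proof.
rewrite /gauss dotr_cons rV_consK /= /gauss1 -expRD; congr expR.
by rewrite exprMn; ring.
Qed.

Lemma heat_cons n r (a : R) (u : 'rV[R]_n) :
  heat r (rV_cons (a, u)) = r^-1 * gauss1 r^-1 a * heat r u.
Proof. by rewrite /heat gauss_cons exprS; ring. Qed.

Lemma integral_rV0 (f : 'rV[R]_0 -> \bar R) :
  (\int[lebesgue_rV 0]_v f v = f 0%R)%E.
Proof.
rewrite integral_dirac//= ?diracT ?mul1e//.
move=> _ Y mY; rewrite setTI; case: (pselect (Y (f 0%R))) => Yf.
  rewrite (_ : _ @^-1` _ = setT)//; apply/seteqP; split => // v _ /=.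
  by rewrite (_ : v = 0)//; apply/rowP; case.
rewrite (_ : _ @^-1` _ = set0)//; apply/seteqP; split => // v /=.
by rewrite (_ : v = 0)//; apply/rowP; case.
Qed.

Lemma integrable_gauss n s : 0 < s ->
  (lebesgue_rV n).-integrable setT (EFin \o @gauss n s).
Proof.
move=> s0; elim: n => [|n IH].
  apply/integrableP; split.
    by apply/measurable_EFinP; exact: measurable_gauss.
  by rewrite integral_rV0 ltry.
apply: (@integrable_rVS _ _ _ (gauss1 s) (gauss s)) => //.
- exact: measurable_gauss.
- exact: integrable_gauss10.
- move=> a u; rewrite gauss_cons.
  by rewrite (ger0_norm (mulr_ge0 (gauss1_ge0 s a) (gauss_ge0 s u))).
Qed.

Lemma measurable_cos_dotr n d (T : measurableType d) (k : T -> R)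
    (f g : T -> 'rV[R]_n) :
  measurable_fun setT k -> measurable_fun setT f -> measurable_fun setT g ->
  measurable_fun setT (fun x => cos (k x + 2 * pi * dotr (f x) (g x))).
Proof.
move=> mk mf mg; apply: measurableT_comp.
  by apply: continuous_measurable_fun; exact: continuous_cos.
by apply: measurable_funD => //; apply: measurable_funM => //; exact: measurable_dotr.
Qed.

Lemma fourier_gauss n s phi (x : 'rV[R]_n) : 0 < s ->
  \int[lebesgue_rV n]_v (gauss s v * cos (phi + 2 * pi * dotr v x)) =
  cos phi * heat s x.
Proof.
move=> s0; elim: n phi x => [|n IH] phi x.
  by rewrite /Rintegral integral_rV0/= /heat /gauss !dotr_rV0 !mulr0 oppr0 expR0 addr0 expr0 !mul1r mulr1.
rewrite (@Rintegral_rVS _ _ _ (gauss1 s) (gauss s)).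
- transitivity (\int[leb]_a (gauss1 s a * cos (phi + (rV_uncons x).1 * (2 * pi * a)) *
      heat s (rV_uncons x).2)).
    apply: eq_Rintegral => a _.
    transitivity (\int[lebesgue_rV n]_u (gauss1 s a * (gauss s u *
        cos (phi + (rV_uncons x).1 * (2 * pi * a) + 2 * pi * dotr u (rV_uncons x).2)))).
      apply: eq_Rintegral => u _; rewrite gauss_cons dotr_cons /=.
      by rewrite mulrA; congr (_ * cos _); ring.
    rewrite RintegralZl ?IH ?mulrA//.
    apply: (@le_integrableR _ _ _ _ _ (gauss s)) => //.
    + by apply: measurable_funM; [exact: measurable_gauss|exact: measurable_cos_dotr].
    + by move=> u; rewrite normrM ger0_norm ?gauss_ge0// ler_piMr ?gauss_ge0// cos_max.
    + exact: integrable_gauss.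
  rewrite RintegralZr//; last first.
    apply: (@le_integrableR _ _ _ leb _ (gauss1 s)) => //.
    + apply: measurable_funM; first exact: measurable_gauss1.
      by apply: measurable_cos_lin => //; exact: measurable_funM.
    + by move=> u; rewrite normrM ger0_norm ?gauss1_ge0// ler_piMr ?gauss1_ge0// cos_max.
    + exact: integrable_gauss10.
  rewrite fourier_gauss1// -mulrA; congr (_ * _).
  rewrite -(heat_cons s _ _); congr heat; apply/rowP => i; rewrite mxE.
  by case: (unliftP ord0 i) => [j ->|->] /=; rewrite ?mxE.
- by apply: measurable_funM; [exact: measurable_gauss|exact: measurable_cos_dotr].
- exact: integrable_gauss10.
- exact: integrable_gauss.
- move=> a u; have h := mulr_ge0 (gauss1_ge0 s a) (gauss_ge0 s u).
  by rewrite normrM gauss_cons (ger0_norm h) (ler_piMr h)// cos_max.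
Qed.

Lemma integral_heat n r (x : 'rV[R]_n) : 0 < r ->
  (\int[lebesgue_rV n]_v (heat r (x - v))%:E = 1)%E.
Proof.
move=> r0; elim: n x => [|n IH] x.
  by rewrite integral_rV0 /heat /gauss dotr_rV0 expr0 mulr0 oppr0 expR0 mulr1.
have mh : measurable_fun setT (fun v : 'rV[R]_n.+1 => (heat r (x - v))%:E).
  by apply/measurable_EFinP; apply: measurable_heat; exact: measurable_rVB.
rewrite ge0_integral_rVS//; last by move=> v; rewrite lee_fin heat_ge0.
rewrite -(@integral_gauss1 R r^-1 (rV_uncons x).1) ?invr_gt0//.
apply: eq_integral => a _; rewrite -[RHS]mule1 -(IH (rV_uncons x).2).
rewrite -ge0_integralZl//.
- apply: eq_integral => u _; rewrite rV_unconsB heat_cons /= -EFinM.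
  have -> : gauss1 r^-1 (a - x ord0 ord0) = gauss1 r^-1 (x ord0 ord0 - a).
    by rewrite /gauss1 -(opprB a) mulrN sqrrN.
  by [].
- by apply/measurable_EFinP; apply: measurable_heat; exact: measurable_rVB.
- by move=> u _; rewrite lee_fin heat_ge0.
- by rewrite lee_fin mulr_ge0 ?gauss1_ge0// invr_ge0 ltW.
Qed.

Lemma integrable_heat n r (x : 'rV[R]_n) : 0 < r ->
  (lebesgue_rV n).-integrable setT (EFin \o (fun v => heat r (x - v))).
Proof.
move=> r0; apply/integrableP; split.
  by apply/measurable_EFinP; apply: measurable_heat; exact: measurable_rVB.
under eq_integral do rewrite /= ger0_norm ?heat_ge0//.
by rewrite integral_heat// ltry.
Qed.

Lemma Rintegral_heat n r (x : 'rV[R]_n) : 0 < r ->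
  \int[lebesgue_rV n]_v heat r (x - v) = 1.
Proof. by move=> r0; rewrite /Rintegral integral_heat. Qed.

Lemma enorm_gauss_le n s (v : 'rV[R]_n) : 0 < s ->
  enorm v * gauss s v <= s^-1 * gauss (s / Num.sqrt 2) v.
Proof.
move=> s0; set b := pi * s ^+ 2 * dotr v v / 2.
have -> : gauss s v = gauss (s / Num.sqrt 2) v * expR (- b).
  rewrite /gauss -expRD; congr expR; rewrite /b !exprMn exprVn sqr_sqrtr//.
  by field.
rewrite mulrCA mulrC ler_wpM2r ?gauss_ge0//.
rewrite expRN ler_pdivrMr ?expR_gt0// mulrC ler_pdivlMr//.
apply: le_trans (expR_ge1Dx b).
have h : enorm v * s <= 1 + (enorm v * s) ^+ 2.
  by have := mulr_ge0 (enorm_ge0 v) (ltW s0); nra.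
apply: (le_trans h); rewrite lerD2l /b -enorm_sqr exprMn.
have p2 : (2 : R) <= pi by exact: pi_ge2.
have := mulr_ge0 (sqr_ge0 s) (sqr_ge0 (enorm v)).
by nra.
Qed.

Lemma enorm_heat_le n r (v : 'rV[R]_n) : 0 < r ->
  enorm v * heat r v <= r * Num.sqrt 2 ^+ n * heat (Num.sqrt 2 * r) v.
Proof.
move=> r0; have q0 : 0 < Num.sqrt 2 :> R by rewrite sqrtr_gt0.
have q0' := lt0r_neq0 q0; have r0' := lt0r_neq0 r0.
have ri : 0 < r^-1 by rewrite invr_gt0.
have e : r^-1 / Num.sqrt 2 = (Num.sqrt 2 * r)^-1 by rewrite invfM mulrC.
have := enorm_gauss_le v ri; rewrite invrK e /heat => h.
have -> : (Num.sqrt 2 * r)^-1 ^+ n = (Num.sqrt 2 ^+ n)^-1 * r^-1 ^+ n.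
  by rewrite exprVn exprMn invfM exprVn.
set g := gauss (Num.sqrt 2 * r)^-1 v in h *.
have -> : r * Num.sqrt 2 ^+ n * ((Num.sqrt 2 ^+ n)^-1 * r^-1 ^+ n * g) =
    r^-1 ^+ n * (r * g).
  by field; rewrite expf_neq0.
by rewrite mulrCA ler_wpM2l// exprn_ge0// ltW.
Qed.

End gaussian.

(** * Volumes of Euclidean balls *)

Section boxes.
Context {R : realType} {n : nat}.
Implicit Types x y : 'rV[R]_n.

Lemma measurable_eball x r : measurable (eball x r).
Proof.
have ms : measurable_fun setT (@Num.sqrt R).
  by apply: continuous_measurable_fun; exact: sqrt_continuous.
have md : measurable_fun setT (fun y : 'rV[R]_n => \sum_i (y - x) ord0 i ^+ 2).
  apply: measurable_sum => i; apply: measurable_funX.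
  by apply: measurable_coord; exact: measurable_rVB.
have m := measurableT_comp ms md.
have := m measurableT `]-oo, r[%classic (measurable_itv _).
rewrite setTI; congr measurable; apply/seteqP; split => y; rewrite /eball /= in_itv//=.
Qed.

Lemma eball_volume_le x (r : R) : 0 <= r ->
  (lebesgue_rV n (eball x r) <= ((2 * r) ^+ n)%:E)%E.
Proof.
move=> r0.
have := @lebesgue_rV_box R n (fun i => x ord0 i - r) (fun i => x ord0 i + r).
rewrite (eq_bigr (fun=> 2 * r)); last by move=> i _; ring.
rewrite prodr_const card_ord => <-; last by move=> i; lra.
apply: le_measure; rewrite ?inE; first exact: measurable_eball.
  rewrite (_ : [set v | _] = \bigcap_(i : 'I_n)
     (setT `&` (fun v : 'rV[R]_n => v ord0 i : R) @^-1` `[x ord0 i - r, x ord0 i + r]%classic)).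
    apply: fin_bigcap_measurable => // i _.
    exact: (measurable_coord_rV i measurableT (measurable_itv _)).
  by apply/seteqP; split=> [v vB i _|v vB i]; [split=> //; exact: vB|have [] := vB i I].
move=> y; rewrite /eball /= => yx i; rewrite in_itv/=.
have := le_lt_trans (coord_le_enorm (y - x) i) yx.
by rewrite !mxE ltr_norml => /andP[h1 h2]; apply/andP; split; lra.
Qed.

Lemma eball_volume_gt0 x (r : R) : 0 < r -> (0 < lebesgue_rV n (eball x r))%E.
Proof.
(* A cube of half-side [e] lies within Euclidean distance [n * e] of its centre, which is below [r]
   even for n = 0. *)
move=> r0; pose e := r / n.+1%:R.
have e0 : 0 < e by rewrite divr_gt0.
have := @lebesgue_rV_box R n (fun i => x ord0 i - e) (fun i => x ord0 i + e).
rewrite (eq_bigr (fun=> 2 * e)); last by move=> i _; ring.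
rewrite prodr_const card_ord => H.
apply: (@lt_le_trans _ _ ((2 * e) ^+ n)%:E).
  by rewrite lte_fin exprn_gt0// mulr_gt0.
rewrite -H; last by move=> i; lra.
apply: le_measure; rewrite ?inE; last 2 first.
- exact: measurable_eball.
- move=> y /= yx; rewrite /eball /=; apply: le_lt_trans (enorm_le_sum _) _.
  apply: (@le_lt_trans _ _ (\sum_(i < n) e)).
    apply: ler_sum => i _; rewrite !mxE; have := yx i; rewrite in_itv/= => /andP[h1 h2].
    by rewrite ler_norml; apply/andP; split; lra.
  rewrite sumr_const card_ord -mulr_natr /e mulrAC ltr_pdivrMr//.
  by rewrite ltr_pM2l// ltr_nat.
- rewrite (_ : [set v | _] = \bigcap_(i : 'I_n)
     (setT `&` (fun v : 'rV[R]_n => v ord0 i : R) @^-1` `[x ord0 i - e, x ord0 i + e]%classic)).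
    apply: fin_bigcap_measurable => // i _.
    exact: (measurable_coord_rV i measurableT (measurable_itv _)).
  by apply/seteqP; split=> [v vB i _|v vB i]; [split=> //; exact: vB|have [] := vB i I].
Qed.

End boxes.

Ltac nonneg := repeat first
  [ done | exact: sqr_ge0 | exact: expR_ge0 | exact: gauss_ge0 | exact: pi_ge0
  | exact: powR_ge0 | exact: enorm_ge0 | exact: dotr_ge0
  | apply: heat_ge0 | rewrite invr_ge0 | apply: exprn_ge0
  | apply: mulr_ge0 | apply: addr_ge0 | by apply: ltW ].

(** * Cosine and sine transforms, and Bessel's inequality *)

Section fourier_transforms.
Context {R : realType} {n : nat}.
Notation leb := (lebesgue_rV n : {sigma_finite_measure set 'rV[R]_n -> \bar R}).
Implicit Types (xi : 'rV[R]_n).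

(** The real part and the negated imaginary part of a Fourier transform are kept as two real
    functions. The map [g] lets one definition cover both a density with respect to Lebesgue measure
    ([g = id]) and the measure sigma composed with a truncation. *)
Definition fcos d (T : measurableType d) (mu : {measure set T -> \bar R})
  (f : T -> R) (g : T -> 'rV[R]_n) xi : R :=
  \int[mu]_y (f y * cos (2 * pi * dotr (g y) xi)).

Definition fsin d (T : measurableType d) (mu : {measure set T -> \bar R})
  (f : T -> R) (g : T -> 'rV[R]_n) xi : R :=
  \int[mu]_y (f y * sin (2 * pi * dotr (g y) xi)).

Definition heatop r (f : 'rV[R]_n -> R) x : R := \int[leb]_y (f y * heat r (x - y)).

Lemma measurable_cos2 d (T : measurableType d) (f g : T -> 'rV[R]_n) :
  measurable_fun setT f -> measurable_fun setT g ->
  measurable_fun setT (fun x => cos (2 * pi * dotr (f x) (g x))).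
Proof.
move=> mf mg; apply: measurableT_comp.
  by apply: continuous_measurable_fun; exact: continuous_cos.
by apply: measurable_funM => //; exact: measurable_dotr.
Qed.

Lemma measurable_sin2 d (T : measurableType d) (f g : T -> 'rV[R]_n) :
  measurable_fun setT f -> measurable_fun setT g ->
  measurable_fun setT (fun x => sin (2 * pi * dotr (f x) (g x))).
Proof.
move=> mf mg; apply: measurableT_comp.
  by apply: continuous_measurable_fun; exact: continuous_sin.
by apply: measurable_funM => //; exact: measurable_dotr.
Qed.

Lemma norm_mul_cos_le (u v : R) : `|u * cos v| <= `|u|.
Proof. by rewrite normrM ler_piMr// cos_max. Qed.

Lemma norm_mul_sin_le (u v : R) : `|u * sin v| <= `|u|.
Proof. by rewrite normrM ler_piMr// sin_max. Qed.

Section transform.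
Context d (T : measurableType d) (mu : {sigma_finite_measure set T -> \bar R}).
Variables (f : T -> R) (g : T -> 'rV[R]_n).
Hypotheses (mg : measurable_fun setT g) (intf : mu.-integrable setT (EFin \o f)).

Let mf : measurable_fun setT f.
Proof. by apply/measurable_EFinP; exact: measurable_int intf. Qed.

Lemma integrable_mul_cos xi :
  mu.-integrable setT (EFin \o (fun y => f y * cos (2 * pi * dotr (g y) xi))).
Proof.
apply: (@le_integrableR _ _ _ _ _ (fun y => `|f y|)) => [|y|].
- by apply: measurable_funM => //; exact: measurable_cos2.
- exact: norm_mul_cos_le.
- exact: integrable_norm intf.
Qed.

Lemma integrable_mul_sin xi :
  mu.-integrable setT (EFin \o (fun y => f y * sin (2 * pi * dotr (g y) xi))).
Proof.
apply: (@le_integrableR _ _ _ _ _ (fun y => `|f y|)) => [|y|].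
- by apply: measurable_funM => //; exact: measurable_sin2.
- exact: norm_mul_sin_le.
- exact: integrable_norm intf.
Qed.

Lemma measurable_fcos : measurable_fun setT (fcos mu f g).
Proof.
apply: (@measurable_Rintegral _ _ _ _ _ mu
  (fun xi y => f y * cos (2 * pi * dotr (g y) xi))).
apply: measurable_funM; first exact: measurableT_comp.
by apply: measurable_cos2 => //; exact: measurableT_comp.
Qed.

Lemma measurable_fsin : measurable_fun setT (fsin mu f g).
Proof.
apply: (@measurable_Rintegral _ _ _ _ _ mu
  (fun xi y => f y * sin (2 * pi * dotr (g y) xi))).
apply: measurable_funM; first exact: measurableT_comp.
by apply: measurable_sin2 => //; exact: measurableT_comp.
Qed.

Lemma norm_fcos_le xi : `|fcos mu f g xi| <= \int[mu]_y `|f y|.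
Proof.
apply: le_trans (le_normr_Rintegral measurableT (integrable_mul_cos xi)) _.
apply: le_Rintegral => //.
- exact: integrable_norm (integrable_mul_cos xi).
- exact: integrable_norm intf.
- by move=> y _; exact: norm_mul_cos_le.
Qed.

Lemma norm_fsin_le xi : `|fsin mu f g xi| <= \int[mu]_y `|f y|.
Proof.
apply: le_trans (le_normr_Rintegral measurableT (integrable_mul_sin xi)) _.
apply: le_Rintegral => //.
- exact: integrable_norm (integrable_mul_sin xi).
- exact: integrable_norm intf.
- by move=> y _; exact: norm_mul_sin_le.
Qed.

Lemma fcosD (a : R) xi :
  \int[mu]_y (f y * cos (a - 2 * pi * dotr (g y) xi)) =
  cos a * fcos mu f g xi + sin a * fsin mu f g xi.
Proof.
have i1 := integrableRZ (cos a) (integrable_mul_cos xi).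
have i2 := integrableRZ (sin a) (integrable_mul_sin xi).
rewrite /fcos /fsin -!RintegralZl//; last 2 first.
- exact: integrable_mul_sin.
- exact: integrable_mul_cos.
rewrite -RintegralD//; apply: eq_Rintegral => y _.
by rewrite cosB; ring.
Qed.

Lemma fsinD (a : R) xi :
  \int[mu]_y (f y * sin (a - 2 * pi * dotr (g y) xi)) =
  sin a * fcos mu f g xi - cos a * fsin mu f g xi.
Proof.
have i1 := integrableRZ (sin a) (integrable_mul_cos xi).
have i2 := integrableRZ (cos a) (integrable_mul_sin xi).
rewrite /fcos /fsin -!RintegralZl//; last 2 first.
- exact: integrable_mul_sin.
- exact: integrable_mul_cos.
rewrite -RintegralB//; apply: eq_Rintegral => y _.
by rewrite sinB; ring.
Qed.

End transform.

Notation fc f := (fcos leb f id).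
Notation fs f := (fsin leb f id).

(** Insert the Fourier representation of the heat kernel and exchange the integrals; the Gaussian
    provides absolute convergence, so no inversion theorem for [f] is involved. *)
Lemma heatop_fourier r (f : 'rV[R]_n -> R) x : 0 < r -> leb.-integrable setT (EFin \o f) ->
  heatop r f x = \int[leb]_xi (gauss r xi *
    (cos (2 * pi * dotr x xi) * fc f xi + sin (2 * pi * dotr x xi) * fs f xi)).
Proof.
move=> r0 intf; have mf : measurable_fun setT f.
  by apply/measurable_EFinP; exact: measurable_int intf.
have intg := @integrable_gauss R n r r0.
have mk1 : measurable_fun setT (fun z : 'rV[R]_n * 'rV[R]_n =>
    f z.1 * (gauss r z.2 * cos (2 * pi * dotr z.2 (x - z.1)))).
  apply: measurable_funM; first exact: measurableT_comp.
  apply: measurable_funM; first exact: measurable_gauss.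
  by apply: measurable_cos2 => //; exact: measurable_rVB.
have kle y xi : `|f y * (gauss r xi * cos (2 * pi * dotr xi (x - y)))| <= `|f y| * gauss r xi.
  rewrite normrM ler_wpM2l//; apply: le_trans (norm_mul_cos_le _ _) _.
  by rewrite ger0_norm ?gauss_ge0.
have intn := integrable_norm intf.
transitivity (\int[leb]_y \int[leb]_xi (f y * (gauss r xi * cos (2 * pi * dotr xi (x - y))))).
  apply: eq_Rintegral => y _; rewrite RintegralZl//.
    congr (_ * _); have := fourier_gauss 0 (x - y) r0; rewrite cos0 mul1r => <-.
    by apply: eq_Rintegral => xi _; rewrite add0r.
  apply: (@le_integrableR _ _ _ _ _ (gauss r)) => //.
  - by apply: measurable_funM; [exact: measurable_gauss|exact: measurable_cos2].
  - by move=> xi; apply: le_trans (norm_mul_cos_le _ _) _; rewrite ger0_norm ?gauss_ge0.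
rewrite (Rintegral_swap intn intg mk1 kle).
apply: eq_Rintegral => xi _.
transitivity (\int[leb]_y (gauss r xi * (f y * cos (2 * pi * dotr x xi - 2 * pi * dotr y xi)))).
  apply: eq_Rintegral => y _; rewrite mulrCA; congr (_ * (_ * cos _)).
  by rewrite dotrBr (dotrC xi x) (dotrC xi y) mulrBr.
rewrite RintegralZl//; last first.
  apply: (@le_integrableR _ _ _ _ _ (fun y => `|f y|)) => //.
  - apply: measurable_funM => //; apply: measurableT_comp.
      by apply: continuous_measurable_fun; exact: continuous_cos.
    by apply: measurable_funB => //; apply: measurable_funM => //; exact: measurable_dotr.
  - by move=> y; exact: norm_mul_cos_le.
by rewrite (fcosD (g := id))//; exact: measurable_id.
Qed.

End fourier_transforms.

Section fatou_bounds.
Local Open Scope ereal_scope.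
Context d (T : measurableType d) (R : realType) (mu : {measure set T -> \bar R}).

Lemma fatou_bound (f : (T -> \bar R)^nat) (c : \bar R) :
  (forall k, measurable_fun setT (f k)) -> (forall k x, 0 <= f k x) ->
  (forall k, \int[mu]_x f k x <= c) ->
  \int[mu]_x limn_einf (f ^~ x) <= c.
Proof.
move=> mf f0 fc.
apply: le_trans (fatou mu measurableT mf (fun k x _ => f0 k x)) _.
rewrite limn_einf_lim; apply: lime_le; first exact: is_cvg_einfs.
apply: nearW => k; apply: le_trans (fc k); apply: ereal_inf_lbound.
by exists k => //=.
Qed.

Lemma fatou_cvg_bound (f : (T -> \bar R)^nat) (g : T -> \bar R) (c : \bar R) :
  (forall k, measurable_fun setT (f k)) -> (forall k x, 0 <= f k x) ->
  (forall x, f ^~ x @ \oo --> g x) ->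
  (forall k, \int[mu]_x f k x <= c) -> \int[mu]_x g x <= c.
Proof.
move=> mf f0 fg fc; rewrite (eq_integral (fun x => limn_einf (f ^~ x))).
  exact: fatou_bound.
by move=> x _; have [-> _] := cvg_limn_einf_sup (fg x).
Qed.

End fatou_bounds.

Section bessel.
Context {R : realType} {n : nat}.
Notation leb := (lebesgue_rV n : {sigma_finite_measure set 'rV[R]_n -> \bar R}).
Notation fc f := (fcos leb f id).
Notation fs f := (fsin leb f id).

(** Schur's test: [|h x| * |h y|] is at most half the sum of the squares, and the kernel has mass
    one in each variable. *)
Lemma schur_heat r (h : 'rV[R]_n -> R) : 0 < r -> measurable_fun setT h ->
  (\int[leb]_x \int[leb]_y (`|h x| * (`|h y| * heat r (x - y)))%:E <=
   \int[leb]_x (h x ^+ 2)%:E)%E.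
Proof.
move=> r0 mh.
pose F (z : 'rV[R]_n * 'rV[R]_n) : \bar R := (2^-1 * (h z.1 ^+ 2 * heat r (z.1 - z.2)))%:E.
pose G (z : 'rV[R]_n * 'rV[R]_n) : \bar R := (2^-1 * (h z.2 ^+ 2 * heat r (z.1 - z.2)))%:E.
have mhx : measurable_fun setT (fun z : 'rV[R]_n * 'rV[R]_n => heat r (z.1 - z.2)).
  by apply: measurable_heat; exact: measurable_rVB.
have mF : measurable_fun setT F.
  apply/measurable_EFinP; apply: measurable_funM => //; apply: measurable_funM => //.
  by apply: measurable_funX; exact: measurableT_comp.
have mG : measurable_fun setT G.
  apply/measurable_EFinP; apply: measurable_funM => //; apply: measurable_funM => //.
  by apply: measurable_funX; exact: measurableT_comp.
have F0 z : (0 <= F z)%E by rewrite lee_fin; nonneg.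
have G0 z : (0 <= G z)%E by rewrite lee_fin; nonneg.
have mFx x : measurable_fun setT (fun y => F (x, y)).
  exact: (measurableT_comp mF (measurable_pair1 x)).
have mGx x : measurable_fun setT (fun y => G (x, y)).
  exact: (measurableT_comp mG (measurable_pair1 x)).
have mh2 : measurable_fun setT (fun x => (h x ^+ 2)%:E).
  by apply/measurable_EFinP; exact: measurable_funX.
apply: (@le_trans _ _ (\int[leb]_x (\int[leb]_y F (x, y) + \int[leb]_y G (x, y))))%E.
  apply: ge0_le_integralT => x; apply/andP; split.
    by apply: integral_ge0 => y _; rewrite lee_fin; nonneg.
  rewrite -ge0_integralD//; apply: ge0_le_integralT => y.
  have hp := heat_ge0 (x - y) r0.
  apply/andP; split; first by rewrite lee_fin; nonneg.
  have hxy : `|h x| * `|h y| <= 2^-1 * (h x ^+ 2 + h y ^+ 2).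
    rewrite -(real_normK (num_real (h x))) -(real_normK (num_real (h y))).
    by have := sqr_ge0 (`|h x| - `|h y|); lra.
  rewrite /F /G -EFinD lee_fin /= mulrA.
  by apply: le_trans (ler_wpM2r hp hxy) _; rewrite le_eqVlt; apply/orP; left; apply/eqP; ring.
rewrite ge0_integralD//; last 4 first.
- by move=> x _; exact: integral_ge0.
- exact: measurable_fun_fubini_tonelli_F.
- by move=> x _; exact: integral_ge0.
- exact: measurable_fun_fubini_tonelli_F.
have half : (\int[leb]_x (2^-1 * h x ^+ 2)%:E = (2^-1)%:E * \int[leb]_x (h x ^+ 2)%:E)%E.
  under eq_integral do rewrite EFinM.
  rewrite ge0_integralZl//; first by move=> x _; rewrite lee_fin sqr_ge0.
have e1 : (\int[leb]_x \int[leb]_y F (x, y) = (2^-1)%:E * \int[leb]_x (h x ^+ 2)%:E)%E.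
  rewrite -half; apply: eq_integral => x _.
  rewrite -[RHS]mule1 -(integral_heat x r0) -ge0_integralZl//.
  - by apply: eq_integral => y _; rewrite /F /= -EFinM mulrA.
  - by apply/measurable_EFinP; apply: measurable_heat; exact: measurable_rVB.
  - by move=> y _; rewrite lee_fin heat_ge0.
  - by rewrite lee_fin; nonneg.
have e2 : (\int[leb]_x \int[leb]_y G (x, y) = (2^-1)%:E * \int[leb]_x (h x ^+ 2)%:E)%E.
  rewrite (fubini_tonelli G mG G0) -half; apply: eq_integral => y _.
  rewrite -[RHS]mule1 -(integral_heat y r0) -ge0_integralZl//.
  - by apply: eq_integral => x _; rewrite /G /= -EFinM -(heatN _ (y - x)) opprB mulrA.
  - by apply/measurable_EFinP; apply: measurable_heat; exact: measurable_rVB.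
  - by move=> x _; rewrite lee_fin heat_ge0.
  - by rewrite lee_fin; nonneg.
rewrite e1 e2 -ge0_muleDl ?lee_fin ?invr_ge0//.
by rewrite -EFinD (_ : 2^-1 + 2^-1 = 1 :> R) ?mul1e//; field.
Qed.

Lemma measurable_heatop r (f : 'rV[R]_n -> R) :
  measurable_fun setT f -> measurable_fun setT (heatop r f).
Proof.
move=> mf; apply: (@measurable_Rintegral _ _ _ _ _ leb (fun x y : 'rV[R]_n => f y * heat r (x - y))).
apply: measurable_funM; first exact: measurableT_comp.
by apply: measurable_heat; exact: measurable_rVB.
Qed.

Lemma heat_le n' r (v : 'rV[R]_n') : 0 < r -> heat r v <= r^-1 ^+ n'.
Proof. by move=> r0; rewrite /heat ler_piMr ?gauss_le1// exprn_ge0// invr_ge0 ltW. Qed.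

Lemma integrable_mul_heat r (f : 'rV[R]_n -> R) (x : 'rV[R]_n) : 0 < r ->
  leb.-integrable setT (EFin \o f) ->
  leb.-integrable setT (EFin \o (fun y => f y * heat r (x - y))).
Proof.
move=> r0 intf; have mf : measurable_fun setT f.
  by apply/measurable_EFinP; exact: measurable_int intf.
apply: (@le_integrableR _ _ _ _ _ (fun y => r^-1 ^+ n * `|f y|)).
- by apply: measurable_funM => //; apply: measurable_heat; exact: measurable_rVB.
- move=> y; rewrite normrM mulrC ler_wpM2r// ger0_norm ?heat_ge0//.
  exact: heat_le.
- exact: integrableRZ (integrable_norm intf).
Qed.

(** By Fubini the left side is the integral of [h * heatop r h], to which Schur's test applies. *)
Lemma bessel_gauss r (h : 'rV[R]_n -> R) : 0 < r ->
  leb.-integrable setT (EFin \o h) ->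
  (\int[leb]_xi (gauss r xi * (fc h xi ^+ 2 + fs h xi ^+ 2))%:E <=
   \int[leb]_x (h x ^+ 2)%:E)%E.
Proof.
move=> r0 inth; have mh : measurable_fun setT h.
  by apply/measurable_EFinP; exact: measurable_int inth.
pose N := \int[leb]_y `|h y|.
have N0 : 0 <= N by apply: Rintegral_ge0.
have intg := @integrable_gauss R n r r0.
have mfc := measurable_fcos (@measurable_id _ _ _) inth.
have mfs := measurable_fsin (@measurable_id _ _ _) inth.
have fcN xi := norm_fcos_le (@measurable_id _ _ _) inth xi.
have fsN xi := norm_fsin_le (@measurable_id _ _ _) inth xi.
pose k x xi := h x * (gauss r xi *
    (cos (2 * pi * dotr x xi) * fc h xi + sin (2 * pi * dotr x xi) * fs h xi)).
have mk : measurable_fun setT (fun z : 'rV[R]_n * 'rV[R]_n => k z.1 z.2).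
  apply: measurable_funM; first exact: measurableT_comp.
  apply: measurable_funM; first exact: measurable_gauss.
  apply: measurable_funD; apply: measurable_funM.
  - exact: measurable_cos2.
  - exact: measurableT_comp.
  - exact: measurable_sin2.
  - exact: measurableT_comp.
have intn := integrable_norm inth.
have intg2 := integrableRZ (2 * N) intg.
have cle x xi : `|gauss r xi * (cos (2 * pi * dotr x xi) * fc h xi +
    sin (2 * pi * dotr x xi) * fs h xi)| <= 2 * N * gauss r xi.
  rewrite normrM ger0_norm ?gauss_ge0// mulrC ler_wpM2r ?gauss_ge0//.
  apply: le_trans (ler_normD _ _) _; rewrite (_ : 2 * N = N + N); last ring.
  apply: lerD; rewrite normrM -[leRHS]mul1r.
    by apply: ler_pM => //; exact: cos_max.
  by apply: ler_pM => //; exact: sin_max.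
have kle x xi : `|k x xi| <= `|h x| * (2 * N * gauss r xi).
  by rewrite /k normrM ler_wpM2l.
have intc xi := integrable_mul_cos (@measurable_id _ _ _) inth xi.
have ints xi := integrable_mul_sin (@measurable_id _ _ _) inth xi.
have hk x : \int[leb]_xi k x xi = h x * heatop r h x.
  rewrite heatop_fourier// -RintegralZl//.
  apply: (@le_integrableR _ _ _ _ _ (fun xi => 2 * N * gauss r xi)) => //.
  apply: measurable_funM; first exact: measurable_gauss.
  apply: measurable_funD; apply: measurable_funM => //.
    exact: measurable_cos2.
  exact: measurable_sin2.
have e : \int[leb]_x (h x * heatop r h x) =
    \int[leb]_xi (gauss r xi * (fc h xi ^+ 2 + fs h xi ^+ 2)).
  transitivity (\int[leb]_x \int[leb]_xi k x xi).
    by apply: eq_Rintegral => x _; rewrite -hk.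
  rewrite (Rintegral_swap intn intg2 mk kle).
  apply: eq_Rintegral => xi _.
  transitivity (\int[leb]_x (gauss r xi * fc h xi * (h x * cos (2 * pi * dotr x xi)) +
     gauss r xi * fs h xi * (h x * sin (2 * pi * dotr x xi)))).
    by apply: eq_Rintegral => x _; rewrite /k; ring.
  rewrite RintegralD//; [|exact: integrableRZ..].
  rewrite !RintegralZl// -/(fcos leb h id xi) -/(fsin leb h id xi).
  by rewrite /fcos /fsin; ring.
have intL : leb.-integrable setT (EFin \o (fun xi => gauss r xi * (fc h xi ^+ 2 + fs h xi ^+ 2))).
  apply: (@le_integrableR _ _ _ _ _ (fun xi => 2 * N ^+ 2 * gauss r xi)) => //.
  - apply: measurable_funM; first exact: measurable_gauss.
    by apply: measurable_funD; exact: measurable_funX.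
  - move=> xi; rewrite normrM ger0_norm ?gauss_ge0// mulrC ler_wpM2r ?gauss_ge0//.
    rewrite ger0_norm ?addr_ge0 ?sqr_ge0// (_ : 2 * N ^+ 2 = N ^+ 2 + N ^+ 2); last ring.
    rewrite -(real_normK (num_real (fc h xi))) -(real_normK (num_real (fs h xi))).
    by apply: lerD; rewrite ler_pXn2r ?nnegrE.
  - exact: integrableRZ.
have intm x := integrable_mul_heat x r0 inth.
rewrite -(EFin_Rintegral intL) -e.
have mhh : measurable_fun setT (fun x => (h x * heatop r h x)%:E).
  by apply/measurable_EFinP; apply: measurable_funM => //; exact: measurable_heatop.
have le1 x : (`|h x * heatop r h x|%:E <=
    \int[leb]_y (`|h x| * (`|h y| * heat r (x - y)))%:E)%E.
  have ia : leb.-integrable setT (EFin \o (fun y => `|h y| * heat r (x - y))).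
    have := integrable_norm (intm x); apply: eq_integrable => // y _ /=.
    by rewrite normrM (ger0_norm (heat_ge0 _ r0)).
  rewrite -EFin_Rintegral; last exact: integrableRZ.
  rewrite lee_fin normrM RintegralZl// ler_wpM2l//.
  apply: le_trans (le_normr_Rintegral measurableT (intm x)) _.
  rewrite le_eqVlt; apply/orP; left; apply/eqP; apply: eq_Rintegral => y _.
  by rewrite normrM (ger0_norm (heat_ge0 _ r0)).
have intH : leb.-integrable setT (EFin \o (fun x => h x * heatop r h x)).
  have := integrable_Rintegral1 intn intg2 mk kle.
  by apply: eq_integrable => // x _ /=; rewrite hk.
rewrite (EFin_Rintegral intH).
apply: le_trans (lee_abs _) _; apply: le_trans (le_abse_integral leb measurableT mhh) _.
apply: le_trans (schur_heat r0 mh); apply: ge0_le_integralT => x.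
by rewrite le1 andbT.
Qed.

(** The Gaussian weight tends to one as its scale tends to 0, and Fatou's lemma passes to the limit;
    the right side is allowed to be infinite. *)
Lemma bessel (h : 'rV[R]_n -> R) : leb.-integrable setT (EFin \o h) ->
  (\int[leb]_xi (fc h xi ^+ 2 + fs h xi ^+ 2)%:E <= \int[leb]_x (h x ^+ 2)%:E)%E.
Proof.
move=> inth.
have mfc := measurable_fcos (@measurable_id _ _ _) inth.
have mfs := measurable_fsin (@measurable_id _ _ _) inth.
apply: (@fatou_cvg_bound _ _ _ leb
  (fun k xi => (gauss (k.+1%:R^-1) xi * (fc h xi ^+ 2 + fs h xi ^+ 2))%:E)).
- move=> k; apply/measurable_EFinP; apply: measurable_funM; first exact: measurable_gauss.
  by apply: measurable_funD; exact: measurable_funX.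
- by move=> k x; rewrite lee_fin; nonneg.
- move=> xi; apply: cvg_EFin; first exact: nearW.
  rewrite -[X in _ --> X]mul1r; apply: cvgM; last exact: cvg_cst.
  rewrite /gauss -[X in _ --> X](@expR0 R) -[X in expR X](@oppr0 R).
  apply: continuous_cvg; first exact: continuous_expR.
  apply: cvgN; rewrite -(mul0r (dotr xi xi)); apply: cvgM; last exact: cvg_cst.
  rewrite -(mulr0 (pi : R)); apply: cvgM; first exact: cvg_cst.
  rewrite -(mulr0 (0 : R)) -expr2; under eq_fun do rewrite expr2.
  by apply: cvgM; exact: cvg_harmonic.
- by move=> k; apply: bessel_gauss => //; rewrite invr_gt0.
Qed.

End bessel.

(** * Sobolev inequality in the dilation parameter *)

Section sobolev.
Context {R : realType}.
Notation leb1 := (@lebesgue_measure R).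

Lemma integrable_itv_bounded (f : R -> R) (a b B : R) :
  measurable_fun setT f -> (forall x, a <= x <= b -> `|f x| <= B) ->
  leb1.-integrable `[a, b] (EFin \o f).
Proof.
move=> mf fB; apply: measurable_bounded_integrable => //.
- by rewrite /= lebesgue_measure_itv/=; case: ifP => // _; rewrite -EFinB ltry.
- exact: measurable_funTS.
- exists B; split; first exact: num_real.
  move=> M BM x /=; rewrite in_itv/= => xab.
  exact: le_trans (fB x xab) (ltW BM).
Qed.

Lemma Rintegral_itv_cst (a b c : R) : a <= b -> \int[leb1]_(x in `[a, b]) c = c * (b - a).
Proof.
move=> ab; rewrite Rintegral_cst//=; congr (_ * _).
rewrite lebesgue_measure_itv/= lte_fin; case: ltgtP ab => //= -> _.
by rewrite subrr.
Qed.

Lemma Rintegral_sqr_le (f : R -> R) (a d B : R) : 0 < d ->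
  measurable_fun setT f -> (forall x, a <= x <= a + d -> `|f x| <= B) ->
  (\int[leb1]_(x in `[a, a + d]) `|f x|) ^+ 2 <=
  d * \int[leb1]_(x in `[a, a + d]) (f x ^+ 2).
Proof.
move=> d0 mf fB; set X := Rintegral _ _ _; set Y := Rintegral _ _ _.
have ad : a <= a + d by rewrite lerDl ltW.
have mI : measurable ([set` `[a, a + d]] : set (measurableTypeR R)).
  exact: measurable_itv.
have mn : measurable_fun setT (fun x => `|f x|) by exact: measurableT_comp.
have m2 : measurable_fun setT (fun x => f x ^+ 2) by exact: measurable_funX.
have i1 : leb1.-integrable `[a, a + d] (EFin \o (fun x => `|f x|)).
  by apply: (@integrable_itv_bounded _ _ _ B) => // x /fB; rewrite normr_id.
have i2 : leb1.-integrable `[a, a + d] (EFin \o (fun x => f x ^+ 2)).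
  apply: (@integrable_itv_bounded _ _ _ (B ^+ 2)) => // x /fB h.
  by rewrite normrX ler_pXn2r ?nnegrE// (le_trans _ h).
(* Cauchy-Schwarz by integrating a square: [c] is the mean of [|f|], and [(c - |f x|) ^+ 2] is
   nonnegative. *)
pose c := X / d.
have : 2 * c * X <= c ^+ 2 * d + Y.
  rewrite -[X in _ * X + _](addrK a) -[X in _ * (X - _) + _]addrC -Rintegral_itv_cst//.
  have ic : leb1.-integrable `[a, a + d] (EFin \o (fun=> c ^+ 2)).
    by apply: (@integrable_itv_bounded _ _ _ (`|c ^+ 2|)).
  rewrite -RintegralD// -RintegralZl//; apply: le_Rintegral => //.
  - by have := integrableZl mI (2 * c) i1.
  - by have := integrableD mI ic i2.
  - move=> x _; rewrite -(real_normK (num_real (f x))).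
    by have := sqr_ge0 (c - `|f x|); lra.
rewrite /c => h.
have -> : X ^+ 2 = d * (2 * (X / d) * X - (X / d) ^+ 2 * d) by field; rewrite gt_eqF.
by apply: ler_wpM2l; [exact: ltW|lra].
Qed.

(** [F u] differs from every [F t] by at most the integral of [|H|]; square, average over t and
    apply Cauchy-Schwarz. The length [d] balances the two terms and will be the smoothing scale. *)
Lemma sobolev_itv (F H : R -> R) (a d u B : R) : 0 < d -> a <= u <= a + d ->
  measurable_fun setT F -> measurable_fun setT H ->
  (forall x, a <= x <= a + d -> `|F x| <= B) ->
  (forall x, a <= x <= a + d -> `|H x| <= B) ->
  (forall x y, a <= x -> x <= y -> y <= a + d -> F y - F x = \int[leb1]_(t in `[x, y]) H t) ->
  F u ^+ 2 <= \int[leb1]_(t in `[a, a + d]) (2 / d * F t ^+ 2 + 2 * d * H t ^+ 2).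
Proof.
move=> d0 /andP[au ud] mF mH FB HB FH.
have ad : a <= a + d by rewrite lerDl ltW.
have mI : measurable ([set` `[a, a + d]] : set (measurableTypeR R)).
  exact: measurable_itv.
set X := \int[leb1]_(x in `[a, a + d]) `|H x|.
set Y := \int[leb1]_(x in `[a, a + d]) (H x ^+ 2).
set Z := \int[leb1]_(x in `[a, a + d]) (F x ^+ 2).
have m2 (G : R -> R) : measurable_fun setT G -> measurable_fun setT (fun x => G x ^+ 2).
  by move=> mG; exact: measurable_funX.
have iF : leb1.-integrable `[a, a + d] (EFin \o (fun x => F x ^+ 2)).
  apply: (@integrable_itv_bounded _ _ _ (B ^+ 2)); [exact: m2|move=> x /FB h].
  by rewrite normrX ler_pXn2r ?nnegrE// (le_trans _ h).
have iH : leb1.-integrable `[a, a + d] (EFin \o (fun x => H x ^+ 2)).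
  apply: (@integrable_itv_bounded _ _ _ (B ^+ 2)); [exact: m2|move=> x /HB h].
  by rewrite normrX ler_pXn2r ?nnegrE// (le_trans _ h).
have mn : measurable_fun setT (fun x => `|H x|) by exact: measurableT_comp.
have iN : leb1.-integrable `[a, a + d] (EFin \o (fun x => `|H x|)).
  by apply: (@integrable_itv_bounded _ _ _ B) => // x /HB; rewrite normr_id.
have XY : X ^+ 2 <= d * Y by exact: (@Rintegral_sqr_le _ _ _ B).
have sub x y : a <= x -> x <= y -> y <= a + d -> `|F y - F x| <= X.
  move=> ax xy yd; rewrite FH//.
  have ss : [set` `[x, y]] `<=` [set` `[a, a + d]].
    by move=> t /=; rewrite !in_itv/= => /andP[t1 t2]; rewrite (le_trans ax t1) (le_trans t2 yd).
  have iH' : leb1.-integrable `[x, y] (EFin \o H).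
    apply: (@integrable_itv_bounded _ _ _ B) => // t /andP[t1 t2].
    by apply: HB; rewrite (le_trans ax t1) (le_trans t2 yd).
  apply: le_trans (le_normr_Rintegral _ iH') _ => //.
  have iN' : leb1.-integrable `[x, y] (EFin \o (fun x => `|H x|)).
    by apply: integrableS iN.
  rewrite /X /Rintegral fine_le ?integrable_fin_num//.
  apply: ge0_subset_integral => //.
  by apply/measurable_EFinP; exact: measurable_funTS.
have FuFt t : a <= t <= a + d -> `|F u| <= `|F t| + X.
  move=> /andP[at_ td]; rewrite -[F u](subrK (F t)) addrC.
  apply: le_trans (ler_normD _ _) _; rewrite lerD2l.
  have [ut|tu] := leP u t; last exact: (sub _ _ at_ (ltW tu) ud).
  by rewrite distrC; exact: sub.
have step : F u ^+ 2 * d <= 2 * Z + 2 * X ^+ 2 * d.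
  rewrite -[X in _ * X <= _](addrK a) -[X in _ * (X - _) <= _]addrC -Rintegral_itv_cst//.
  rewrite -[X in _ <= _ + _ * X](addrK a) -[X in _ <= _ + _ * (X - _)]addrC -Rintegral_itv_cst//.
  have ic c : leb1.-integrable `[a, a + d] (EFin \o (fun=> c : R)).
    by apply: (@integrable_itv_bounded _ _ _ `|c|).
  rewrite -RintegralZl// -RintegralD//; last first.
    by have := integrableZl mI 2 iF.
  apply: le_Rintegral => //.
    have i2 := integrableZl mI 2 iF.
    by have := integrableD mI i2 (ic (2 * X ^+ 2)).
  move=> t /=; rewrite in_itv/= => /FuFt h.
  rewrite -(real_normK (num_real (F u))) -(real_normK (num_real (F t))).
  have := sqr_ge0 (`|F t| - X).
  have : `|F u| ^+ 2 <= (`|F t| + X) ^+ 2.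
    by rewrite ler_pXn2r ?nnegrE// (le_trans _ h).
  by rewrite sqrrD sqrrB; lra.
rewrite RintegralD//; last 2 first.
- by have := integrableZl mI (2 / d) iF.
- by have := integrableZl mI (2 * d) iH.
rewrite !RintegralZl// -/Y -/Z -(ler_pM2r d0).
apply: (le_trans step).
have -> : (2 / d * Z + 2 * d * Y) * d = 2 * Z + 2 * (d * Y) * d by field; rewrite gt_eqF.
by rewrite lerD2l ler_wpM2r ?(ltW d0)// ler_wpM2l.
Qed.

Lemma sobolev12 (F H : R -> R) (d u B : R) : 0 < d -> d <= 2^-1 -> 1 <= u <= 2 ->
  measurable_fun setT F -> measurable_fun setT H ->
  (forall x, 1 <= x <= 2 -> `|F x| <= B) ->
  (forall x, 1 <= x <= 2 -> `|H x| <= B) ->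
  (forall x y, 1 <= x -> x <= y -> y <= 2 -> F y - F x = \int[leb1]_(t in `[x, y]) H t) ->
  ((F u ^+ 2)%:E <= \int[leb1]_(t in `[1%R, 2%R]) (2 / d * F t ^+ 2 + 2 * d * H t ^+ 2)%:E)%E.
Proof.
move=> d0 dh /andP[u1 u2] mF mH FB HB FH.
(* A window of length [d] inside [1, 2] that contains [u]: it starts at [u], or ends there when [u]
   is close to 2. *)
have [a [a1 a2 au ua]] : exists a, [/\ 1 <= a, a + d <= 2, a <= u & u <= a + d].
  have [uh|uh] := leP u (2 - d); first by exists u; split=> //; lra.
  by exists (u - d); split; lra.
have mI : measurable_fun setT (fun t => 2 / d * F t ^+ 2 + 2 * d * H t ^+ 2).
  by apply: measurable_funD; apply: measurable_funM => //; exact: measurable_funX.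
have pos t : 0 <= 2 / d * F t ^+ 2 + 2 * d * H t ^+ 2.
  by nonneg.
have h : F u ^+ 2 <= \int[leb1]_(t in `[a, a + d]) (2 / d * F t ^+ 2 + 2 * d * H t ^+ 2).
  apply: (@sobolev_itv _ _ _ _ _ B) => //.
  - by rewrite au.
  - by move=> x /andP[x1 x2]; apply: FB; apply/andP; split; lra.
  - by move=> x /andP[x1 x2]; apply: HB; apply/andP; split; lra.
  - by move=> x y ax xy yd; apply: FH => //; lra.
have iI : leb1.-integrable `[a, a + d] (EFin \o (fun t => 2 / d * F t ^+ 2 + 2 * d * H t ^+ 2)).
  apply: (@integrable_itv_bounded _ _ _ (2 / d * B ^+ 2 + 2 * d * B ^+ 2)) => // x xa.
  have x12 : 1 <= x <= 2 by case/andP: xa => *; apply/andP; split; lra.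
  have B0 := le_trans (normr_ge0 _) (FB x x12).
  rewrite ger0_norm//; apply: lerD; apply: ler_wpM2l; try nonneg.
    by rewrite -(real_normK (num_real (F x))) ler_pXn2r ?nnegrE// FB.
  by rewrite -(real_normK (num_real (H x))) ler_pXn2r ?nnegrE// HB.
apply: (@le_trans _ _ (\int[leb1]_(t in `[a, a + d]) (2 / d * F t ^+ 2 + 2 * d * H t ^+ 2))%:E).
  by rewrite lee_fin.
rewrite /Rintegral fineK; last exact: integrable_fin_num.
apply: ge0_subset_integral => //.
- by apply/measurable_EFinP; exact: measurable_funTS.
- by move=> t _; rewrite lee_fin.
- by move=> t /=; rewrite !in_itv/= => /andP[t1 t2]; apply/andP; split; lra.
Qed.

End sobolev.

(** * Square functions for families of multipliers *)

Section square_function.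
Context {R : realType} {n : nat}.
Notation leb1 := (@lebesgue_measure R).
Notation leb := (lebesgue_rV n : {sigma_finite_measure set 'rV[R]_n -> \bar R}).
Notation fc f := (fcos leb f id).
Notation fs f := (fsin leb f id).
Variable f : 'rV[R]_n -> R.
Hypothesis intf : leb.-integrable setT (EFin \o f).

(* The value at x of the operator with the complex multiplier a + i b, when f is
   real and b is the opposite of the imaginary part. *)
Definition multop (a b : 'rV[R]_n -> R) x : R :=
  \int[leb]_xi (a xi * (fc f xi * cos (2 * pi * dotr xi x) + fs f xi * sin (2 * pi * dotr xi x))
    + b xi * (fc f xi * sin (2 * pi * dotr xi x) - fs f xi * cos (2 * pi * dotr xi x))).

Let N := \int[leb]_y `|f y|.
Let N0 : 0 <= N. Proof. exact: Rintegral_ge0. Qed.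
Let mfc : measurable_fun setT (fc f).
Proof. exact: (measurable_fcos (@measurable_id _ _ _) intf). Qed.
Let mfs : measurable_fun setT (fs f).
Proof. exact: (measurable_fsin (@measurable_id _ _ _) intf). Qed.
Let fcN xi : `|fc f xi| <= N.
Proof. exact: (norm_fcos_le (@measurable_id _ _ _) intf xi). Qed.
Let fsN xi : `|fs f xi| <= N.
Proof. exact: (norm_fsin_le (@measurable_id _ _ _) intf xi). Qed.

Lemma norm_multop_integrand (a b : R) x xi (theta : R) : `|a| <= theta -> `|b| <= theta ->
  `|a * (fc f xi * cos (2 * pi * dotr xi x) + fs f xi * sin (2 * pi * dotr xi x))
    + b * (fc f xi * sin (2 * pi * dotr xi x) - fs f xi * cos (2 * pi * dotr xi x))|
  <= 4 * N * theta.
Proof.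
move=> ha hb; have t0 : 0 <= theta by exact: le_trans (normr_ge0 _) ha.
have B (u v w z : R) : `|u| <= N -> `|v| <= N -> `|w| <= 1 -> `|z| <= 1 ->
    `|u * w + v * z| <= 2 * N.
  move=> hu hv hw hz; apply: le_trans (ler_normD _ _) _.
  rewrite (_ : 2 * N = N * 1 + N * 1); last ring.
  by apply: lerD; rewrite normrM; apply: ler_pM.
apply: le_trans (ler_normD _ _) _.
rewrite (_ : 4 * N * theta = theta * (2 * N) + theta * (2 * N)); last ring.
apply: lerD; rewrite normrM; apply: ler_pM => //.
  by apply: B; rewrite ?cos_max ?sin_max.
by rewrite -mulrN; apply: B; rewrite ?normrN ?cos_max ?sin_max.
Qed.

Lemma integrable_multop (a b theta : 'rV[R]_n -> R) x :
  measurable_fun setT a -> measurable_fun setT b ->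
  leb.-integrable setT (EFin \o theta) ->
  (forall xi, `|a xi| <= theta xi) -> (forall xi, `|b xi| <= theta xi) ->
  leb.-integrable setT (EFin \o (fun xi =>
    a xi * (fc f xi * cos (2 * pi * dotr xi x) + fs f xi * sin (2 * pi * dotr xi x))
    + b xi * (fc f xi * sin (2 * pi * dotr xi x) - fs f xi * cos (2 * pi * dotr xi x)))).
Proof.
move=> ma mb intt at_ bt.
apply: (@le_integrableR _ _ _ _ _ (fun xi => 4 * N * theta xi)).
- apply: measurable_funD; apply: measurable_funM => //.
    by apply: measurable_funD; apply: measurable_funM => //; [exact: measurable_cos2|exact: measurable_sin2].
  by apply: measurable_funB; apply: measurable_funM => //; [exact: measurable_sin2|exact: measurable_cos2].
- by move=> xi; exact: norm_multop_integrand.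
- exact: integrableRZ.
Qed.

(** Up to sign, [b1] and [b2] are the real and imaginary parts of the multiplier times the transform
    of [f], and the operator is a cosine transform of [b1] plus a sine transform of [b2]. Bessel's
    inequality for these two stands in for Plancherel's identity, at the price of a factor 2. *)
Lemma multop_sqr_le (a b theta : 'rV[R]_n -> R) :
  measurable_fun setT a -> measurable_fun setT b ->
  leb.-integrable setT (EFin \o theta) ->
  (forall xi, `|a xi| <= theta xi) -> (forall xi, `|b xi| <= theta xi) ->
  (\int[leb]_x (multop a b x ^+ 2)%:E <=
   \int[leb]_xi (2 * ((fc f xi ^+ 2 + fs f xi ^+ 2) * (a xi ^+ 2 + b xi ^+ 2)))%:E)%E.
Proof.
move=> ma mb intt at_ bt.
pose b1 xi := a xi * fc f xi - b xi * fs f xi.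
pose b2 xi := a xi * fs f xi + b xi * fc f xi.
have mb1 : measurable_fun setT b1 by apply: measurable_funB; exact: measurable_funM.
have mb2 : measurable_fun setT b2 by apply: measurable_funD; exact: measurable_funM.
have bd (u v w z t : R) : `|u| <= t -> `|v| <= t -> `|w| <= N -> `|z| <= N ->
    `|u * w + v * z| <= 2 * N * t.
  move=> hu hv hw hz; apply: le_trans (ler_normD _ _) _.
  rewrite (_ : 2 * N * t = t * N + t * N); last ring.
  by apply: lerD; rewrite normrM; apply: ler_pM.
have i1 : leb.-integrable setT (EFin \o b1).
  apply: (@le_integrableR _ _ _ _ _ (fun xi => 2 * N * theta xi)) => //; last exact: integrableRZ.
  by move=> xi; rewrite /b1 -mulNr; apply: bd; rewrite ?normrN.
have i2 : leb.-integrable setT (EFin \o b2).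
  apply: (@le_integrableR _ _ _ _ _ (fun xi => 2 * N * theta xi)) => //; last exact: integrableRZ.
  by move=> xi; apply: bd.
have E x : multop a b x = fc b1 x + fs b2 x.
  have ic := integrable_mul_cos (@measurable_id _ _ _) i1 x.
  have isn := integrable_mul_sin (@measurable_id _ _ _) i2 x.
  rewrite /fcos /fsin -RintegralD//; apply: eq_Rintegral => xi _.
  by rewrite /b1 /b2; ring.
have m1c := measurable_fcos (@measurable_id _ _ _) i1.
have m1s := measurable_fsin (@measurable_id _ _ _) i1.
have m2c := measurable_fcos (@measurable_id _ _ _) i2.
have m2s := measurable_fsin (@measurable_id _ _ _) i2.
have sq (g : 'rV[R]_n -> R) : measurable_fun setT g -> measurable_fun setT (fun x => (g x ^+ 2)%:E).
  by move=> mg; apply/measurable_EFinP; exact: measurable_funX.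
have sq2 (g h : 'rV[R]_n -> R) : measurable_fun setT g -> measurable_fun setT h ->
    measurable_fun setT (fun x => (g x ^+ 2 + h x ^+ 2)%:E).
  by move=> mg mh; apply/measurable_EFinP; apply: measurable_funD; exact: measurable_funX.
apply: (@le_trans _ _ (\int[leb]_x (2%:E * ((fc b1 x ^+ 2 + fs b1 x ^+ 2)%:E +
    (fc b2 x ^+ 2 + fs b2 x ^+ 2)%:E)))%E).
  apply: ge0_le_integralT => x; rewrite lee_fin sqr_ge0/= E -EFinD -EFinM lee_fin.
  have := sqr_ge0 (fc b1 x - fs b2 x); have := sqr_ge0 (fs b1 x); have := sqr_ge0 (fc b2 x).
  by rewrite sqrrB sqrrD; lra.
have p2 (g h : 'rV[R]_n -> R) x : (0 <= (g x ^+ 2 + h x ^+ 2)%:E)%E.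
  by rewrite lee_fin; nonneg.
rewrite ge0_integralZl//; last 2 first.
- by apply: emeasurable_funD; exact: sq2.
- by move=> x _; apply: adde_ge0; exact: p2.
rewrite ge0_integralD//; try exact: sq2.
apply: (@le_trans _ _ (2%:E * (\int[leb]_x (b1 x ^+ 2)%:E + \int[leb]_x (b2 x ^+ 2)%:E))%E).
  by apply: lee_wpmul2l; rewrite ?lee_fin//; apply: leeD; exact: bessel.
rewrite -ge0_integralD//; try exact: sq; try by move=> x _; rewrite lee_fin sqr_ge0.
rewrite -ge0_integralZl//; last 2 first.
- by apply: emeasurable_funD; exact: sq.
- by move=> x _; rewrite -EFinD lee_fin; nonneg.
rewrite le_eqVlt; apply/orP; left; apply/eqP; apply: eq_integral => xi _.
by rewrite -EFinD -EFinM; congr EFin; rewrite /b1 /b2; ring.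
Qed.

Lemma measurable_indic_itv_fst (a b : R) :
  measurable_fun setT (fun z : measurableTypeR R * 'rV[R]_n =>
    \1_(`[a, b]%classic : set (measurableTypeR R)) z.1 : R).
Proof.
have mi : measurable_fun setT (\1_(`[a, b]%classic : set (measurableTypeR R)) : measurableTypeR R -> R).
  by apply: measurable_indic; exact: measurable_itv.
pose g : measurableTypeR R -> R := \1_(`[a, b]%classic).
have mfst : measurable_fun setT (fst : measurableTypeR R * 'rV[R]_n -> measurableTypeR R) by [].
exact: (measurableT_comp (mi : measurable_fun setT g) mfst).
Qed.

(** The multipliers [kc u] and [ks u] depend on a dilation u in [1, 2]; the primed families are
    their derivatives in u, known through the integrated form only. The common majorant [theta] does
    not depend on u, which is what justifies Fubini. *)
Variables (kc ks kc' ks' : R -> 'rV[R]_n -> R) (theta : 'rV[R]_n -> R).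
Hypothesis inttheta : leb.-integrable setT (EFin \o theta).
Hypothesis mkc : measurable_fun setT (fun z : measurableTypeR R * 'rV[R]_n => kc z.1 z.2).
Hypothesis mks : measurable_fun setT (fun z : measurableTypeR R * 'rV[R]_n => ks z.1 z.2).
Hypothesis mkc' : measurable_fun setT (fun z : measurableTypeR R * 'rV[R]_n => kc' z.1 z.2).
Hypothesis mks' : measurable_fun setT (fun z : measurableTypeR R * 'rV[R]_n => ks' z.1 z.2).
Hypothesis kcle : forall u xi, 1 <= u <= 2 -> `|kc u xi| <= theta xi.
Hypothesis ksle : forall u xi, 1 <= u <= 2 -> `|ks u xi| <= theta xi.
Hypothesis kcle' : forall u xi, 1 <= u <= 2 -> `|kc' u xi| <= theta xi.
Hypothesis ksle' : forall u xi, 1 <= u <= 2 -> `|ks' u xi| <= theta xi.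
Hypothesis kcftc : forall a b xi, 1 <= a -> a <= b -> b <= 2 ->
  kc b xi - kc a xi = \int[leb1]_(t in `[a, b]) kc' t xi.
Hypothesis ksftc : forall a b xi, 1 <= a -> a <= b -> b <= 2 ->
  ks b xi - ks a xi = \int[leb1]_(t in `[a, b]) ks' t xi.

Let F u x := multop (kc u) (ks u) x.
Let H u x := multop (kc' u) (ks' u) x.

Let section2 (k : R -> 'rV[R]_n -> R) :
  measurable_fun setT (fun z : measurableTypeR R * 'rV[R]_n => k z.1 z.2) ->
  forall u, measurable_fun setT (k u).
Proof. by move=> mk u; exact: (measurableT_comp mk (measurable_pair1 (u : measurableTypeR R))). Qed.

Let section1 (k : R -> 'rV[R]_n -> R) :
  measurable_fun setT (fun z : measurableTypeR R * 'rV[R]_n => k z.1 z.2) ->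
  forall xi, measurable_fun [set: measurableTypeR R] (k^~ xi).
Proof. by move=> mk xi; exact: (measurableT_comp mk (measurable_pair2 xi)). Qed.

Let measurable_multop2 (k l : R -> 'rV[R]_n -> R) :
  measurable_fun setT (fun z : measurableTypeR R * 'rV[R]_n => k z.1 z.2) ->
  measurable_fun setT (fun z : measurableTypeR R * 'rV[R]_n => l z.1 z.2) ->
  measurable_fun setT (fun z : measurableTypeR R * 'rV[R]_n => multop (k z.1) (l z.1) z.2).
Proof.
move=> mk ml.
have m2 : measurable_fun setT (fun z : measurableTypeR R * 'rV[R]_n * 'rV[R]_n => (z.1.1, z.2)).
  apply: measurable_fun_pair => //.
  by apply: measurableT_comp => //.
have mz1 : measurable_fun setT (fun z : measurableTypeR R * 'rV[R]_n * 'rV[R]_n => z.1.2).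
  by apply: measurableT_comp => //.
have cmp (g : 'rV[R]_n -> R) : measurable_fun setT g ->
    measurable_fun setT (fun z : measurableTypeR R * 'rV[R]_n * 'rV[R]_n => g z.2).
  by move=> mg; exact: measurableT_comp.
apply: (@measurable_Rintegral _ _ _ _ _ leb (fun (z : measurableTypeR R * 'rV[R]_n) xi =>
  k z.1 xi * (fc f xi * cos (2 * pi * dotr xi z.2) + fs f xi * sin (2 * pi * dotr xi z.2))
    + l z.1 xi * (fc f xi * sin (2 * pi * dotr xi z.2) - fs f xi * cos (2 * pi * dotr xi z.2)))).
apply: measurable_funD; apply: measurable_funM.
- exact: (measurableT_comp mk m2).
- by apply: measurable_funD; apply: measurable_funM; rewrite //; try exact: cmp;
    [exact: measurable_cos2|exact: measurable_sin2].
- exact: (measurableT_comp ml m2).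
- by apply: measurable_funB; apply: measurable_funM; rewrite //; try exact: cmp;
    [exact: measurable_sin2|exact: measurable_cos2].
Qed.

Let multop_ftc x a b : 1 <= a -> a <= b -> b <= 2 ->
  F b x - F a x = \int[leb1]_(t in `[a, b]) H t x.
Proof.
move=> a1 ab b2.
have a12 : 1 <= a <= 2 by rewrite a1 (le_trans ab b2).
have b12 : 1 <= b <= 2 by rewrite b2 (le_trans a1 ab).
have ia := integrable_multop x (section2 mkc a) (section2 mks a) inttheta
  (fun xi => kcle xi a12) (fun xi => ksle xi a12).
have ib := integrable_multop x (section2 mkc b) (section2 mks b) inttheta
  (fun xi => kcle xi b12) (fun xi => ksle xi b12).
rewrite /F /multop -RintegralB//.
pose P xi := fc f xi * cos (2 * pi * dotr xi x) + fs f xi * sin (2 * pi * dotr xi x).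
pose S xi := fc f xi * sin (2 * pi * dotr xi x) - fs f xi * cos (2 * pi * dotr xi x).
have mP : measurable_fun setT P.
  by apply: measurable_funD; apply: measurable_funM => //; [exact: measurable_cos2|exact: measurable_sin2].
have mS : measurable_fun setT S.
  by apply: measurable_funB; apply: measurable_funM => //; [exact: measurable_sin2|exact: measurable_cos2].
(* The indicator turns the integral over [a, b] into one over the line, the form in which the
   dominated exchange of integrals is available. *)
pose k (t : measurableTypeR R) xi := \1_(`[a, b]%classic) t * (kc' t xi * P xi + ks' t xi * S xi).
have in12 t : t \in `[a, b]%classic -> 1 <= t <= 2.
  by rewrite inE /= in_itv/= => /andP[t1 t2]; rewrite (le_trans a1 t1) (le_trans t2 b2).
have mk : measurable_fun setT (fun z : measurableTypeR R * 'rV[R]_n => k z.1 z.2).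
  apply: measurable_funM.
    exact: measurable_indic_itv_fst.
  by apply: measurable_funD; apply: measurable_funM => //; exact: measurableT_comp.
have kle t xi : `|k t xi| <= \1_(`[a, b]%classic : set (measurableTypeR R)) t * (4 * N * theta xi).
  rewrite /k !indicE; case: (boolP (t \in _)) => tab; last by rewrite !mul0r normr0.
  rewrite !mul1r; have t12 := in12 _ tab.
  exact: (@norm_multop_integrand _ _ x xi _ (kcle' xi t12) (ksle' xi t12)).
have int1 : leb1.-integrable setT (EFin \o (\1_(`[a, b]%classic : set (measurableTypeR R)) : measurableTypeR R -> R)).
  exact: integrable_indic_itv.
have intt2 := integrableRZ (4 * N) inttheta.
have := @Rintegral_swap _ _ (measurableTypeR R) 'rV[R]_n R leb1 leb _ _ k int1 intt2 mk kle.
move=> sw; transitivity (\int[leb]_xi \int[leb1]_t k t xi).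
  apply: eq_Rintegral => xi _.
  transitivity ((kc b xi - kc a xi) * P xi + (ks b xi - ks a xi) * S xi).
    by rewrite /P /S; ring.
  rewrite kcftc// ksftc//.
  have ic : leb1.-integrable `[a, b] (EFin \o kc'^~ xi).
    apply: (@integrable_itv_bounded _ _ _ _ (theta xi)); first exact: section1.
    by move=> t /andP[t1 t2]; apply: kcle'; rewrite (le_trans a1 t1) (le_trans t2 b2).
  have is_ : leb1.-integrable `[a, b] (EFin \o ks'^~ xi).
    apply: (@integrable_itv_bounded _ _ _ _ (theta xi)); first exact: section1.
    by move=> t /andP[t1 t2]; apply: ksle'; rewrite (le_trans a1 t1) (le_trans t2 b2).
  have mI : measurable ([set` `[a, b]] : set (measurableTypeR R)) by exact: measurable_itv.
  rewrite -(@RintegralZr _ _ _ leb1 _ _ (P xi) mI ic) -(@RintegralZr _ _ _ leb1 _ _ (S xi) mI is_) -RintegralD//; last 2 first.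
  - by have := integrableZr mI (P xi) ic.
  - by have := integrableZr mI (S xi) is_.
  rewrite Rintegral_mkcond; apply: eq_Rintegral => t _.
  by rewrite patchE /k indicE; case: (t \in _); rewrite ?mul1r ?mul0r.
rewrite -sw [RHS]Rintegral_mkcond; apply: eq_Rintegral => t _.
rewrite patchE; case: ifPn => tab.
  by apply: eq_Rintegral => xi _; rewrite /k indicE tab mul1r.
rewrite /k indicE (negbTE tab) /Rintegral integral0_eq// => xi _.
by rewrite mul0r.
Qed.

(** Free of the dilation u: one function of x that dominates the squared values of the operators for
    all u in [1, 2] at once. *)
Definition square_fun (d : R) x : \bar R :=
  \int[leb1]_(t in `[1%R, 2%R]) (2 / d * F t x ^+ 2 + 2 * d * H t x ^+ 2)%:E.

Lemma multop_le_square (d u : R) x : 0 < d -> d <= 2^-1 -> 1 <= u <= 2 ->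
  ((multop (kc u) (ks u) x ^+ 2)%:E <= square_fun d x)%E.
Proof.
move=> d0 dh u12.
pose B := 4 * N * \int[leb]_xi theta xi.
have bd (k l : R -> 'rV[R]_n -> R) :
  measurable_fun setT (fun z : measurableTypeR R * 'rV[R]_n => k z.1 z.2) ->
  measurable_fun setT (fun z : measurableTypeR R * 'rV[R]_n => l z.1 z.2) ->
  (forall u xi, 1 <= u <= 2 -> `|k u xi| <= theta xi) ->
  (forall u xi, 1 <= u <= 2 -> `|l u xi| <= theta xi) ->
  forall t, 1 <= t <= 2 -> `|multop (k t) (l t) x| <= B.
  move=> mk ml kt lt t t12.
  have i := integrable_multop x (section2 mk t) (section2 ml t) inttheta
    (fun xi => kt t xi t12) (fun xi => lt t xi t12).
  apply: le_trans (le_normr_Rintegral measurableT i) _.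
  rewrite /B -RintegralZl//; apply: le_Rintegral => //.
  - exact: integrable_norm i.
  - exact: integrableRZ.
  - by move=> xi _; apply: norm_multop_integrand; [exact: kt|exact: lt].
have mF := measurableT_comp (measurable_multop2 mkc mks) (measurable_pair2 x).
have mH := measurableT_comp (measurable_multop2 mkc' mks') (measurable_pair2 x).
apply: (@sobolev12 _ (F^~ x) (H^~ x) d u B) => //.
- exact: bd.
- exact: bd.
- by move=> a b a1 ab b2; exact: multop_ftc.
Qed.

Let sq d (z : measurableTypeR R * 'rV[R]_n) : \bar R :=
  (\1_(`[1%R, 2%R]%classic) z.1 * (2 / d * F z.1 z.2 ^+ 2 + 2 * d * H z.1 z.2 ^+ 2))%:E.

Let square_funE d : square_fun d = (fun x => \int[leb1]_t sq d (t, x))%E.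
Proof.
apply/funext => x; rewrite /square_fun integral_mkcond; apply: eq_integral => t _.
by rewrite patchE /sq indicE /=; case: (t \in _); rewrite ?mul1r ?mul0r.
Qed.

Let mI : measurable_fun setT (fun z : measurableTypeR R * 'rV[R]_n =>
  \1_(`[1%R, 2%R]%classic : set (measurableTypeR R)) z.1 : R).
Proof. exact: measurable_indic_itv_fst. Qed.

Let msq d : measurable_fun setT (sq d).
Proof.
apply/measurable_EFinP; apply: measurable_funM => //.
apply: measurable_funD; apply: measurable_funM => //; apply: measurable_funX.
  exact: (measurable_multop2 mkc mks).
exact: (measurable_multop2 mkc' mks').
Qed.

Let sq_ge0 d z : 0 < d -> (0 <= sq d z)%E.
Proof. by move=> d0; rewrite lee_fin; apply: mulr_ge0; [rewrite indicE|nonneg]. Qed.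

Lemma square_fun_ge0 d x : 0 < d -> (0 <= square_fun d x)%E.
Proof.
by move=> d0; apply: integral_ge0 => t _; rewrite lee_fin; nonneg.
Qed.

Lemma measurable_square_fun d : 0 < d -> measurable_fun setT (square_fun d).
Proof.
move=> d0; rewrite square_funE.
exact: (measurable_fun_fubini_tonelli_G (sq d) (msq d) (fun z => sq_ge0 z d0)).
Qed.

(** Tonelli and the L^2 bound at each fixed t. The 4 is the 2 of the Sobolev inequality times the 2
    of [multop_sqr_le]. *)
Lemma integral_square_fun_le d : 0 < d ->
  (\int[leb]_x square_fun d x <=
   \int[leb]_xi ((4 * (fc f xi ^+ 2 + fs f xi ^+ 2))%:E *
     \int[leb1]_(t in `[1%R, 2%R]) ((kc t xi ^+ 2 + ks t xi ^+ 2) / d +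
        d * (kc' t xi ^+ 2 + ks' t xi ^+ 2))%:E))%E.
Proof.
move=> d0; rewrite square_funE.
have dV0 : 0 <= 2 / d by nonneg.
have d20 : 0 <= 2 * d by nonneg.
rewrite -(fubini_tonelli (sq d) (msq d) (fun z => sq_ge0 z d0)).
pose A xi := fc f xi ^+ 2 + fs f xi ^+ 2.
have A0 xi : 0 <= A xi by nonneg.
have mA : measurable_fun setT A by apply: measurable_funD; exact: measurable_funX.
pose V t xi := (kc t xi ^+ 2 + ks t xi ^+ 2) / d + d * (kc' t xi ^+ 2 + ks' t xi ^+ 2).
have V0 t xi : 0 <= V t xi by nonneg.
have mV : measurable_fun setT (fun z : measurableTypeR R * 'rV[R]_n => V z.1 z.2).
  by apply: measurable_funD; apply: measurable_funM => //; apply: measurable_funD; exact: measurable_funX.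
pose G (z : measurableTypeR R * 'rV[R]_n) : \bar R :=
  (\1_(`[1%R, 2%R]%classic : set (measurableTypeR R)) z.1 * (4 * A z.2 * V z.1 z.2))%:E.
have G0 z : (0 <= G z)%E.
  by rewrite lee_fin; apply: mulr_ge0; [rewrite indicE|apply: mulr_ge0 => //; nonneg].
have mG : measurable_fun setT G.
  apply/measurable_EFinP; apply: measurable_funM => //; apply: measurable_funM => //.
  by apply: measurable_funM => //; exact: measurableT_comp.
apply: (@le_trans _ _ (\int[leb1]_t \int[leb]_xi G (t, xi))%E); last first.
  rewrite (fubini_tonelli G mG G0); apply: ge0_le_integralT => xi.
  apply/andP; split; first by apply: integral_ge0.
  rewrite [X in (_ * X)%E]integral_mkcond -ge0_integralZl//.
  - rewrite le_eqVlt; apply/orP; left; apply/eqP; apply: eq_integral => t _.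
    by rewrite patchE /G indicE /=; case: (t \in _); rewrite ?mul1r ?mul0r ?mule0.
  - apply/measurable_restrict => //.
    apply: measurable_funTS; apply/measurable_EFinP.
    exact: (section1 mV).
  - by move=> t _; rewrite patchE; case: ifP => // _; rewrite lee_fin V0.
  - by rewrite lee_fin; nonneg.
apply: ge0_le_integralT => t; apply/andP; split.
  by apply: integral_ge0 => x _; exact: sq_ge0.
have [t12|t12] := boolP (t \in (`[1, 2]%classic : set (measurableTypeR R))); last first.
  rewrite integral0_eq; first by apply: integral_ge0.
  by move=> x _; rewrite /sq indicE /= (negbTE t12) mul0r.
have t12' : 1 <= t <= 2 by move: t12; rewrite inE /= in_itv.
have hF := multop_sqr_le (section2 mkc t) (section2 mks t) inttheta
  (fun xi => kcle xi t12') (fun xi => ksle xi t12').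
have hH := multop_sqr_le (section2 mkc' t) (section2 mks' t) inttheta
  (fun xi => kcle' xi t12') (fun xi => ksle' xi t12').
have mF := measurableT_comp (measurable_multop2 mkc mks) (measurable_pair1 (t : measurableTypeR R)).
have mH := measurableT_comp (measurable_multop2 mkc' mks') (measurable_pair1 (t : measurableTypeR R)).
have sqm (g : 'rV[R]_n -> R) : measurable_fun setT g -> measurable_fun setT (fun x => (g x ^+ 2)%:E).
  by move=> mg; apply/measurable_EFinP; exact: measurable_funX.
have mAk (k l : R -> 'rV[R]_n -> R) :
  measurable_fun setT (fun z : measurableTypeR R * 'rV[R]_n => k z.1 z.2) ->
  measurable_fun setT (fun z : measurableTypeR R * 'rV[R]_n => l z.1 z.2) ->
  measurable_fun setT (fun xi => (2 * ((fc f xi ^+ 2 + fs f xi ^+ 2) * (k t xi ^+ 2 + l t xi ^+ 2)))%:E).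
  move=> mk ml; apply/measurable_EFinP; apply: measurable_funM => //; apply: measurable_funM => //.
  by apply: measurable_funD; apply: measurable_funX; [exact: (section2 mk t)|exact: (section2 ml t)].
rewrite (eq_integral (fun x => (2 / d)%:E * (F t x ^+ 2)%:E + (2 * d)%:E * (H t x ^+ 2)%:E)%E); last first.
  by move=> x _; rewrite /sq indicE /= t12 mul1r -!EFinM -EFinD.
have s0 (g : 'rV[R]_n -> R) x : (0 <= (g x ^+ 2)%:E)%E by rewrite lee_fin sqr_ge0.
have smF := sqm _ mF; have smH := sqm _ mH.
rewrite ge0_integralD//; try (by move=> x _; apply: mule_ge0);
  try by apply: emeasurable_funM.
rewrite !ge0_integralZl//.
apply: (le_trans (leeD (lee_wpmul2l _ hF) (lee_wpmul2l _ hH))); rewrite ?lee_fin//.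
have Ak0 (k l : R -> 'rV[R]_n -> R) xi :
    (0 <= (2 * ((fc f xi ^+ 2 + fs f xi ^+ 2) * (k t xi ^+ 2 + l t xi ^+ 2)))%:E)%E.
  by rewrite lee_fin; nonneg.
have mA1 := mAk kc ks mkc mks; have mA2 := mAk kc' ks' mkc' mks'.
rewrite -!ge0_integralZl//.
rewrite -ge0_integralD//; try (by move=> x _; apply: mule_ge0);
  try by apply: emeasurable_funM.
rewrite le_eqVlt; apply/orP; left; apply/eqP; apply: eq_integral => xi _.
by rewrite /G indicE /= t12 mul1r -!EFinM -EFinD /V /A; congr EFin; ring.
Qed.
End square_function.

(** * The Fourier transform of sigma and its gradient *)

Section measure_transform.
Context {R : realType} {n : nat}.
Notation leb1 := (@lebesgue_measure R).
Variable sigma : {finite_measure set 'rV[R]_n -> \bar R}.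
(** [g] will be the identity cut to 0 off the compact support. It is bounded at every point and
    equal to the identity sigma-almost everywhere, so integrands in [g z] obey everywhere bounds
    that integrands in [z] obey only on the support. *)
Variable g : 'rV[R]_n -> 'rV[R]_n.
Hypothesis mg : measurable_fun setT g.
Variable B : R.
Hypothesis gB : forall z, enorm (g z) <= B.

Definition mcos eta := fcos sigma (cst 1) g eta.
Definition msin eta := fsin sigma (cst 1) g eta.
Definition dmcos (t : R) eta : R :=
  - \int[sigma]_z (2 * pi * dotr (g z) eta * sin (2 * pi * dotr (g z) (t *: eta))).
Definition dmsin (t : R) eta : R :=
  \int[sigma]_z (2 * pi * dotr (g z) eta * cos (2 * pi * dotr (g z) (t *: eta))).

Lemma integrable_bounded_finite (h : 'rV[R]_n -> R) (C : R) :
  measurable_fun setT h -> (forall z, `|h z| <= C) ->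
  sigma.-integrable setT (EFin \o h).
Proof.
move=> mh hC; apply: (@le_integrableR _ _ _ _ _ (cst C)) => //.
exact: finite_measure_integrable_cst.
Qed.

Let int1 : sigma.-integrable setT (EFin \o (cst (1:R) : 'rV[R]_n -> R)).
Proof. exact: finite_measure_integrable_cst. Qed.

Definition mass : R := fine (sigma setT).

Lemma mass_ge0 : 0 <= mass. Proof. exact: fine_ge0. Qed.

Let massE : \int[sigma]_z `|cst (1:R) z| = mass.
Proof.
transitivity (\int[sigma]_z (1 : R)).
  by apply: eq_Rintegral => z _; rewrite normr1.
by rewrite Rintegral_cst// mul1r.
Qed.

Lemma norm_mcos_le eta : `|mcos eta| <= mass.
Proof. by rewrite -massE; exact: norm_fcos_le. Qed.

Lemma norm_msin_le eta : `|msin eta| <= mass.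
Proof. by rewrite -massE; exact: norm_fsin_le. Qed.

Lemma measurable_mcos : measurable_fun setT mcos.
Proof. exact: measurable_fcos. Qed.

Lemma measurable_msin : measurable_fun setT msin.
Proof. exact: measurable_fsin. Qed.

Lemma norm_dotr_g_le eta z : `|2 * pi * dotr (g z) eta| <= 2 * pi * B * enorm eta.
Proof.
rewrite normrM ger0_norm; last by nonneg.
rewrite -[leRHS]mulrA ler_wpM2l; [by []|by nonneg|].
by apply: le_trans (norm_dotr_le _ _) _; rewrite ler_wpM2r ?enorm_ge0.
Qed.

Let mdot eta : measurable_fun setT (fun z => 2 * pi * dotr (g z) eta).
Proof. by apply: measurable_funM => //; exact: measurable_dotr. Qed.

Let intdot eta : sigma.-integrable setT
  (EFin \o (fun z => 1 * (2 * pi * dotr (g z) eta))).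
Proof.
apply: (@integrable_bounded_finite _ (2 * pi * B * enorm eta)) => [|z].
  by apply: measurable_funM => //; exact: mdot.
by rewrite mul1r norm_dotr_g_le.
Qed.

Lemma is_derive_mcos_lin (xi eta : 'rV[R]_n) (t : R) :
  is_derive t (1:R) (fun t => mcos (xi + t *: eta))
    (- \int[sigma]_z (2 * pi * dotr (g z) eta * sin (2 * pi * dotr (g z) (xi + t *: eta)))).
Proof.
have := @is_derive_integral_cos _ _ R sigma (cst 1) (fun z => 2 * pi * dotr (g z) xi)
  (fun z => 2 * pi * dotr (g z) eta) (@measurable_cst _ _ _ _ _ _) (mdot xi) (mdot eta) int1 (intdot eta) t.
have E s z : 2 * pi * dotr (g z) (xi + s *: eta) =
    2 * pi * dotr (g z) xi + s * (2 * pi * dotr (g z) eta).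
  by rewrite dotrDr dotrZr; ring.
rewrite (_ : (fun x => Rintegral _ _ _) = (fun t => mcos (xi + t *: eta))); last first.
  by apply/funext => s; rewrite /mcos /fcos; apply: eq_Rintegral => z _; rewrite E.
rewrite (_ : Rintegral _ _ _ = \int[sigma]_z (2 * pi * dotr (g z) eta *
    sin (2 * pi * dotr (g z) (xi + t *: eta))))//.
by apply: eq_Rintegral => z _; rewrite E mul1r.
Qed.

Lemma is_derive_msin_lin (xi eta : 'rV[R]_n) (t : R) :
  is_derive t (1:R) (fun t => msin (xi + t *: eta))
    (\int[sigma]_z (2 * pi * dotr (g z) eta * cos (2 * pi * dotr (g z) (xi + t *: eta)))).
Proof.
have ma : measurable_fun setT (fun z => 2 * pi * dotr (g z) xi - pi / 2).
  by apply: measurable_funB => //; exact: mdot.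
have := @is_derive_integral_cos _ _ R sigma (cst 1) (fun z => 2 * pi * dotr (g z) xi - pi / 2)
  (fun z => 2 * pi * dotr (g z) eta) (@measurable_cst _ _ _ _ _ _) ma (mdot eta) int1 (intdot eta) t.
have E s z : 2 * pi * dotr (g z) xi - pi / 2 + s * (2 * pi * dotr (g z) eta) =
    2 * pi * dotr (g z) (xi + s *: eta) - pi / 2.
  by rewrite dotrDr dotrZr; ring.
have cB (x : R) : cos (x - pi / 2) = sin x by rewrite cosB cos_pihalf sin_pihalf mulr0 mulr1 add0r.
have sB (x : R) : sin (x - pi / 2) = - cos x.
  by rewrite sinB cos_pihalf sin_pihalf mulr0 mulr1 add0r.
rewrite (_ : (fun x => Rintegral _ _ _) = (fun t => msin (xi + t *: eta))); last first.
  by apply/funext => s; rewrite /msin /fsin; apply: eq_Rintegral => z _; rewrite E cB.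
rewrite (_ : - Rintegral _ _ _ = \int[sigma]_z (2 * pi * dotr (g z) eta *
    cos (2 * pi * dotr (g z) (xi + t *: eta))))//.
rewrite -mulN1r -RintegralZl//.
  by apply: eq_Rintegral => z _; rewrite E sB mul1r; ring.
apply: (@integrable_bounded_finite _ (2 * pi * B * enorm eta)).
  apply: measurable_funM; first by apply: measurable_funM => //; exact: mdot.
  by apply: measurable_sin_lin => //; exact: mdot.
by move=> z; apply: le_trans (norm_mul_sin_le _ _) _; rewrite mul1r norm_dotr_g_le.
Qed.

Lemma is_derive_mcos eta (t : R) : is_derive t (1:R) (fun t => mcos (t *: eta)) (dmcos t eta).
Proof.
have := is_derive_mcos_lin 0 eta t.
by under eq_fun do rewrite add0r; under eq_Rintegral do rewrite add0r.
Qed.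

Lemma is_derive_msin eta (t : R) : is_derive t (1:R) (fun t => msin (t *: eta)) (dmsin t eta).
Proof.
have := is_derive_msin_lin 0 eta t.
by under eq_fun do rewrite add0r; under eq_Rintegral do rewrite add0r.
Qed.

Let bnd_sin eta xi : sigma.-integrable setT
  (EFin \o (fun z => 2 * pi * dotr (g z) eta * sin (2 * pi * dotr (g z) xi))).
Proof.
apply: (@integrable_bounded_finite _ (2 * pi * B * enorm eta)).
  by apply: measurable_funM; [exact: mdot|exact: measurable_sin2].
by move=> z; apply: le_trans (norm_mul_sin_le _ _) _; rewrite norm_dotr_g_le.
Qed.

Let bnd_cos eta xi : sigma.-integrable setT
  (EFin \o (fun z => 2 * pi * dotr (g z) eta * cos (2 * pi * dotr (g z) xi))).
Proof.
apply: (@integrable_bounded_finite _ (2 * pi * B * enorm eta)).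
  by apply: measurable_funM; [exact: mdot|exact: measurable_cos2].
by move=> z; apply: le_trans (norm_mul_cos_le _ _) _; rewrite norm_dotr_g_le.
Qed.

Lemma norm_dmcos_le t eta : `|dmcos t eta| <= 2 * pi * B * enorm eta * mass.
Proof.
rewrite /dmcos normrN; apply: le_trans (le_normr_Rintegral measurableT (bnd_sin _ _)) _.
rewrite -Rintegral_cst//; apply: le_Rintegral => //.
- exact: integrable_norm (bnd_sin _ _).
- exact: finite_measure_integrable_cst.
- by move=> z _; apply: le_trans (norm_mul_sin_le _ _) _; rewrite norm_dotr_g_le.
Qed.

Lemma norm_dmsin_le t eta : `|dmsin t eta| <= 2 * pi * B * enorm eta * mass.
Proof.
apply: le_trans (le_normr_Rintegral measurableT (bnd_cos _ _)) _.
rewrite -Rintegral_cst//; apply: le_Rintegral => //.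
- exact: integrable_norm (bnd_cos _ _).
- exact: finite_measure_integrable_cst.
- by move=> z _; apply: le_trans (norm_mul_cos_le _ _) _; rewrite norm_dotr_g_le.
Qed.

Lemma measurable_dmcos : measurable_fun setT
  (fun z : measurableTypeR R * 'rV[R]_n => dmcos z.1 z.2).
Proof.
apply: measurableT_comp => //.
apply: (@measurable_Rintegral _ _ _ _ _ sigma (fun (w : measurableTypeR R * 'rV[R]_n) z =>
  2 * pi * dotr (g z) w.2 * sin (2 * pi * dotr (g z) (w.1 *: w.2)))).
have m1 : measurable_fun setT (fun z : measurableTypeR R * 'rV[R]_n * 'rV[R]_n => g z.2).
  exact: measurableT_comp.
have m2 : measurable_fun setT (fun z : measurableTypeR R * 'rV[R]_n * 'rV[R]_n => z.1.2).
  by apply: measurableT_comp => //.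
have m3 : measurable_fun setT (fun z : measurableTypeR R * 'rV[R]_n * 'rV[R]_n => z.1.1).
  by apply: measurableT_comp => //.
apply: measurable_funM.
  by apply: measurable_funM => //; exact: measurable_dotr.
by apply: measurable_sin2 => //; exact: measurable_rVZ.
Qed.

Lemma measurable_dmsin : measurable_fun setT
  (fun z : measurableTypeR R * 'rV[R]_n => dmsin z.1 z.2).
Proof.
apply: (@measurable_Rintegral _ _ _ _ _ sigma (fun (w : measurableTypeR R * 'rV[R]_n) z =>
  2 * pi * dotr (g z) w.2 * cos (2 * pi * dotr (g z) (w.1 *: w.2)))).
have m1 : measurable_fun setT (fun z : measurableTypeR R * 'rV[R]_n * 'rV[R]_n => g z.2).
  exact: measurableT_comp.
have m2 : measurable_fun setT (fun z : measurableTypeR R * 'rV[R]_n * 'rV[R]_n => z.1.2).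
  by apply: measurableT_comp => //.
have m3 : measurable_fun setT (fun z : measurableTypeR R * 'rV[R]_n * 'rV[R]_n => z.1.1).
  by apply: measurableT_comp => //.
apply: measurable_funM.
  by apply: measurable_funM => //; exact: measurable_dotr.
by apply: measurable_cos2 => //; exact: measurable_rVZ.
Qed.

(** Continuity comes from differentiability: [dmcos] is again a cosine integral, with weight
    [2 * pi * dotr (g z) eta] and phase [- (pi / 2)], and a second moment of the weight is
    finite. *)
Lemma continuous_dmcos eta : continuous (dmcos^~ eta).
Proof.
have b2 : sigma.-integrable setT (EFin \o (fun z => 2 * pi * dotr (g z) eta * (2 * pi * dotr (g z) eta))).
  apply: (@integrable_bounded_finite _ ((2 * pi * B * enorm eta) ^+ 2)).
    by apply: measurable_funM; exact: mdot.
  by move=> z; rewrite normrM expr2; apply: ler_pM => //; exact: norm_dotr_g_le.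
have b1 : sigma.-integrable setT (EFin \o (fun z => 2 * pi * dotr (g z) eta)).
  by have := intdot eta; apply: eq_integrable => // z _ /=; rewrite mul1r.
have ma : measurable_fun setT (cst (- (pi / 2)) : 'rV[R]_n -> R) by [].
have D t := @is_derive_integral_cos _ _ R sigma (fun z => 2 * pi * dotr (g z) eta) (cst (- (pi / 2)))
  (fun z => 2 * pi * dotr (g z) eta) (mdot eta) ma (mdot eta) b1 b2 t.
have C := is_derive_continuous D.
rewrite (_ : dmcos^~ eta = - (fun x => \int[sigma]_y (2 * pi * dotr (g y) eta *
    cos (cst (- (pi / 2)) y + x * (2 * pi * dotr (g y) eta))))).
  by move=> t; apply: cvgN; exact: C.
apply/funext => t; rewrite /dmcos fctE; congr (- _); apply: eq_Rintegral => z _.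
rewrite dotrZr; congr (_ * _).
rewrite (_ : cst _ _ + _ = t * (2 * pi * dotr (g z) eta) - pi / 2); last by rewrite /cst; ring.
by rewrite cosB cos_pihalf sin_pihalf mulr0 mulr1 add0r; congr sin; ring.
Qed.

Lemma continuous_dmsin eta : continuous (dmsin^~ eta).
Proof.
have b2 : sigma.-integrable setT (EFin \o (fun z => 2 * pi * dotr (g z) eta * (2 * pi * dotr (g z) eta))).
  apply: (@integrable_bounded_finite _ ((2 * pi * B * enorm eta) ^+ 2)).
    by apply: measurable_funM; exact: mdot.
  by move=> z; rewrite normrM expr2; apply: ler_pM => //; exact: norm_dotr_g_le.
have b1 : sigma.-integrable setT (EFin \o (fun z => 2 * pi * dotr (g z) eta)).
  by have := intdot eta; apply: eq_integrable => // z _ /=; rewrite mul1r.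
have ma : measurable_fun setT (cst 0 : 'rV[R]_n -> R) by [].
have D t := @is_derive_integral_cos _ _ R sigma (fun z => 2 * pi * dotr (g z) eta) (cst 0)
  (fun z => 2 * pi * dotr (g z) eta) (mdot eta) ma (mdot eta) b1 b2 t.
have C := is_derive_continuous D.
rewrite (_ : dmsin^~ eta = (fun x => \int[sigma]_y (2 * pi * dotr (g y) eta *
    cos (cst 0 y + x * (2 * pi * dotr (g y) eta)))))//.
apply/funext => t; rewrite /dmsin; apply: eq_Rintegral => z _.
by rewrite dotrZr add0r; congr (_ * cos _); ring.
Qed.

Hypothesis gsigma : {ae sigma, forall z, g z = z}.

Lemma ae_eq_g (h : 'rV[R]_n -> R) : measurable_fun setT h ->
  \int[sigma]_z h z = \int[sigma]_z h (g z).
Proof.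
move=> mh; congr fine; apply: ae_eq_integral => //.
- exact/measurable_EFinP.
- by apply/measurable_EFinP; exact: measurableT_comp.
- by apply: filterS gsigma => z gz _; rewrite gz.
Qed.

Lemma Re_fourier xi : complex.Re (fourier sigma xi) = mcos xi.
Proof.
rewrite /fourier /cintegral /= (@ae_eq_g (fun z => cos (2 * pi * dotr z xi))).
  by rewrite /mcos /fcos; apply: eq_Rintegral => z _; rewrite mul1r.
exact: measurable_cos2.
Qed.

Lemma Im_fourier xi : complex.Im (fourier sigma xi) = - msin xi.
Proof.
have ms := measurable_sin2 mg (@measurable_cst _ _ _ _ setT xi).
rewrite /fourier /cintegral /= (@ae_eq_g (fun z => - sin (2 * pi * dotr z xi))).
  rewrite /msin /fsin -mulN1r -RintegralZl//.
    by apply: eq_Rintegral => z _; rewrite mul1r mulN1r.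
  apply: (@integrable_bounded_finite _ 1) => [|z]; last by rewrite mul1r sin_max.
  by apply: measurable_funM.
by apply: measurableT_comp => //; exact: measurable_sin2.
Qed.

End measure_transform.

Lemma ge0_le_integral_in d (T : measurableType d) (R : realType)
    (mu : {measure set T -> \bar R}) (D : set T) (f g : T -> \bar R) :
  (forall x, D x -> (0 <= f x <= g x)%E) ->
  (\int[mu]_(x in D) f x <= \int[mu]_(x in D) g x)%E.
Proof.
move=> fg; rewrite (integral_mkcond D f) (integral_mkcond D g).
apply: ge0_le_integralT => x; rewrite !patchE; case: ifPn => [|_]; last by rewrite lexx.
by rewrite inE => /fg.
Qed.

Section gradient.
Context {R : realType} {n : nat}.
Notation leb1 := (@lebesgue_measure R).
Variable sigma : {finite_measure set 'rV[R]_n -> \bar R}.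
Variable g : 'rV[R]_n -> 'rV[R]_n.
Hypothesis mg : measurable_fun setT g.
Variable B : R.
Hypothesis gB : forall z, enorm (g z) <= B.
Hypothesis gsigma : {ae sigma, forall z, g z = z}.

Lemma derive_line (h : 'rV[R]_n -> R) (xi v : 'rV[R]_n) (l : R) :
  is_derive (0:R) (1:R) (fun t => h (xi + t *: v)) l -> 'D_v h xi = l.
Proof.
move=> [_ <-]; rewrite /derive; congr (lim _).
rewrite (_ : (fun t => _) = (fun t : R => t^-1 *: (((fun t => h (xi + t *: v)) \o shift (0:R)) (t *: (1:R)) - h (xi + 0 *: v))))//.
apply/funext => t /=; congr (_ *: (h _ - h _)); last by rewrite scale0r addr0.
by rewrite addr0 /GRing.scale/= mulr1 addrC.
Qed.

Lemma normc_sqr (z : R[i]) : normc z ^+ 2 = complex.Re z ^+ 2 + complex.Im z ^+ 2.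
Proof. by case: z => a b; rewrite /normc sqr_sqrtr ?addr_ge0 ?sqr_ge0. Qed.

Let A xi i := \int[sigma]_z (2 * pi * dotr (g z) (delta_mx ord0 i) * sin (2 * pi * dotr (g z) xi)).
Let S xi i := \int[sigma]_z (2 * pi * dotr (g z) (delta_mx ord0 i) * cos (2 * pi * dotr (g z) xi)).

Lemma cenorm_cgradient_sqr xi :
  cenorm (cgradient (fourier sigma) xi) ^+ 2 = \sum_i (A xi i ^+ 2 + S xi i ^+ 2).
Proof.
rewrite /cenorm sqr_sqrtr; last by apply: sumr_ge0 => i _; exact: sqr_ge0.
apply: eq_bigr => i _; rewrite normc_sqr mxE.
transitivity ('D_(delta_mx ord0 i) (fun y => complex.Re (fourier sigma y)) xi ^+ 2 +
  'D_(delta_mx ord0 i) (fun y => complex.Im (fourier sigma y)) xi ^+ 2); first by [].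
rewrite (_ : (fun y => complex.Re _) = mcos sigma g); last first.
  by apply/funext => y; rewrite (Re_fourier mg gsigma).
rewrite (_ : (fun y => complex.Im _) = (fun y => - msin sigma g y)); last first.
  by apply/funext => y; rewrite (Im_fourier mg gsigma).
have d1 := is_derive_mcos_lin sigma mg gB xi (delta_mx ord0 i) 0.
have d2 := is_derive_msin_lin sigma mg gB xi (delta_mx ord0 i) 0.
have d3 : is_derive (0:R) (1:R) (fun t => - msin sigma g (xi + t *: delta_mx ord0 i)) (- S xi i).
  apply: is_deriveN; move: d2.
  rewrite (_ : Rintegral _ _ _ = S xi i)//.
  by apply: eq_Rintegral => z _; rewrite scale0r addr0.
rewrite (derive_line d1) (derive_line (h := fun y => - msin sigma g y) d3) !sqrrN.
congr (_ ^+ 2 + _); apply: eq_Rintegral => z _; by rewrite scale0r addr0.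
Qed.

Let dotr_delta (x eta : 'rV[R]_n) : dotr x eta = \sum_i eta ord0 i * dotr x (delta_mx ord0 i).
Proof.
rewrite {1}/dotr; apply: eq_bigr => i _; rewrite mulrC; congr (_ * _).
rewrite /dotr (bigD1 i)//= mxE !eqxx mulr1 big1 ?addr0// => j ji.
by rewrite mxE eqxx (negbTE ji) mulr0.
Qed.

Let bsin v xi : sigma.-integrable setT
  (EFin \o (fun z => 2 * pi * dotr (g z) v * sin (2 * pi * dotr (g z) xi))).
Proof.
apply: (@integrable_bounded_finite _ _ _ _ (2 * pi * B * enorm v)).
  apply: measurable_funM; first by apply: measurable_funM => //; exact: measurable_dotr.
  exact: measurable_sin2.
by move=> z; apply: le_trans (norm_mul_sin_le _ _) _; exact: norm_dotr_g_le.
Qed.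

Let bcos v xi : sigma.-integrable setT
  (EFin \o (fun z => 2 * pi * dotr (g z) v * cos (2 * pi * dotr (g z) xi))).
Proof.
apply: (@integrable_bounded_finite _ _ _ _ (2 * pi * B * enorm v)).
  apply: measurable_funM; first by apply: measurable_funM => //; exact: measurable_dotr.
  exact: measurable_cos2.
by move=> z; apply: le_trans (norm_mul_cos_le _ _) _; exact: norm_dotr_g_le.
Qed.

(** By the chain rule the derivative in t is the inner product of [eta] with the gradient at
    [t *: eta]; Cauchy-Schwarz is applied to the real and imaginary parts separately. *)
Lemma dm_sqr_le_cgradient t eta :
  dmcos sigma g t eta ^+ 2 + dmsin sigma g t eta ^+ 2 <=
  enorm eta ^+ 2 * cenorm (cgradient (fourier sigma) (t *: eta)) ^+ 2.
Proof.
have E1 : dmcos sigma g t eta = - dotr eta (\row_i A (t *: eta) i).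
  rewrite (_ : dotr eta _ = \sum_i eta ord0 i * A (t *: eta) i); last first.
    by apply: eq_bigr => i _; rewrite mxE.
  rewrite /dmcos /A; congr (- _).
  under [RHS]eq_bigr do rewrite -RintegralZl//.
  rewrite -Rintegral_sum; last by move=> i; exact: integrableRZ.
  apply: eq_Rintegral => z _; rewrite (dotr_delta (g z) eta) mulr_sumr mulr_suml.
  by apply: eq_bigr => i _; ring.
have E2 : dmsin sigma g t eta = dotr eta (\row_i S (t *: eta) i).
  rewrite (_ : dotr eta _ = \sum_i eta ord0 i * S (t *: eta) i); last first.
    by apply: eq_bigr => i _; rewrite mxE.
  rewrite /dmsin /S.
  under [RHS]eq_bigr do rewrite -RintegralZl//.
  rewrite -Rintegral_sum; last by move=> i; exact: integrableRZ.
  apply: eq_Rintegral => z _; rewrite (dotr_delta (g z) eta) mulr_sumr mulr_suml.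
  by apply: eq_bigr => i _; ring.
rewrite cenorm_cgradient_sqr big_split/= mulrDr E1 E2 sqrrN enorm_sqr.
apply: lerD; apply: le_trans (dotr_sqr_le _ _) _; rewrite ler_wpM2l ?dotr_ge0//.
  by rewrite le_eqVlt; apply/orP; left; apply/eqP; apply: eq_bigr => i _; rewrite mxE expr2.
by rewrite le_eqVlt; apply/orP; left; apply/eqP; apply: eq_bigr => i _; rewrite mxE expr2.
Qed.

Lemma sqrt_Rintegral_le (h : R -> R) (M C w : R) : measurable_fun setT h ->
  (forall t, 0 <= h t) -> (forall t, 1 <= t <= 2 -> h t <= M) -> 0 <= w ->
  Num.sqrt (\int[leb1]_(t in `[1, 2]) h t) <= C * w ->
  (\int[leb1]_(t in `[1%R, 2%R]) (h t)%:E <= (C ^+ 2 * w ^+ 2)%:E)%E.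
Proof.
move=> mh h0 hM w0 hs.
have ih : leb1.-integrable `[1, 2] (EFin \o h).
  by apply: (@integrable_itv_bounded _ _ _ _ M) => // t /hM; rewrite ger0_norm.
have I0 : 0 <= \int[leb1]_(t in `[1, 2]) h t by exact: Rintegral_ge0.
rewrite -[leLHS]fineK ?integrable_fin_num// lee_fin.
rewrite -[leLHS](sqr_sqrtr I0) -exprMn ler_pXn2r ?nnegrE ?sqrtr_ge0//.
exact: le_trans (sqrtr_ge0 _) hs.
Qed.

Variable alpha : R.

Let measurable_line eta (h : 'rV[R]_n -> R) : measurable_fun setT h ->
  measurable_fun [set: measurableTypeR R] (fun t : R => h (t *: eta)).
Proof. by move=> mh; apply: (measurableT_comp mh); exact: measurable_rVZ. Qed.

Lemma fourier_decay : (exists C : R, forall xi : 'rV[R]_n,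
      Num.sqrt (\int[lebesgue_measure]_(t in `[1, 2])
        normc (fourier sigma (t *: xi)) ^+ 2)
      <= C * (1 + enorm xi) `^ (- alpha)) ->
  exists2 C : R, 0 <= C & forall eta,
    (\int[leb1]_(t in `[1%R, 2%R]) (mcos sigma g (t *: eta) ^+ 2 + msin sigma g (t *: eta) ^+ 2)%:E
     <= (C * ((1 + enorm eta) `^ (- alpha)) ^+ 2)%:E)%E.
Proof.
move=> [C hC]; exists (C ^+ 2); first exact: sqr_ge0.
move=> eta; apply: (@sqrt_Rintegral_le _ (mass sigma ^+ 2 + mass sigma ^+ 2)).
- apply: measurable_funD; apply: measurable_funX; apply: measurable_line.
    exact: measurable_mcos.
  exact: measurable_msin.
- by move=> t; nonneg.
- move=> t _; rewrite -(real_normK (num_real (mcos _ _ _))) -(real_normK (num_real (msin _ _ _))).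
  apply: lerD; rewrite ler_pXn2r ?nnegrE ?mass_ge0//; [exact: norm_mcos_le|exact: norm_msin_le].
- exact: powR_ge0.
- have := hC eta; congr (Num.sqrt _ <= _); apply: eq_Rintegral => t _.
  by rewrite normc_sqr (Re_fourier mg gsigma) (Im_fourier mg gsigma) sqrrN.
Qed.

(** The factor [enorm eta ^+ 2] is the cost of differentiating in the dilation t instead of in the
    frequency variable. *)
Lemma gradient_decay : (exists C : R, forall xi : 'rV[R]_n,
      Num.sqrt (\int[lebesgue_measure]_(t in `[1, 2])
        cenorm (cgradient (fourier sigma) (t *: xi)) ^+ 2)
      <= C * (1 + enorm xi) `^ (- alpha)) ->
  exists2 C : R, 0 <= C & forall eta,
    (\int[leb1]_(t in `[1%R, 2%R]) (dmcos sigma g t eta ^+ 2 + dmsin sigma g t eta ^+ 2)%:E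
     <= (C * enorm eta ^+ 2 * ((1 + enorm eta) `^ (- alpha)) ^+ 2)%:E)%E.
Proof.
move=> [C hC]; exists (C ^+ 2); first exact: sqr_ge0.
move=> eta.
have cE xi : cenorm (cgradient (fourier sigma) xi) ^+ 2 = \sum_i (A xi i ^+ 2 + S xi i ^+ 2).
  exact: cenorm_cgradient_sqr.
have mA i : measurable_fun setT (A^~ i).
  apply: (@measurable_Rintegral _ _ _ _ _ sigma (fun xi z =>
    2 * pi * dotr (g z) (delta_mx ord0 i) * sin (2 * pi * dotr (g z) xi))).
  have mgs : measurable_fun setT (fun z : 'rV[R]_n * 'rV[R]_n => g z.2) by exact: measurableT_comp.
  apply: measurable_funM; last exact: measurable_sin2.
  by apply: measurable_funM => //; exact: measurable_dotr.
have mS i : measurable_fun setT (S^~ i).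
  apply: (@measurable_Rintegral _ _ _ _ _ sigma (fun xi z =>
    2 * pi * dotr (g z) (delta_mx ord0 i) * cos (2 * pi * dotr (g z) xi))).
  have mgs : measurable_fun setT (fun z : 'rV[R]_n * 'rV[R]_n => g z.2) by exact: measurableT_comp.
  apply: measurable_funM; last exact: measurable_cos2.
  by apply: measurable_funM => //; exact: measurable_dotr.
pose M i := 2 * pi * B * enorm (delta_mx ord0 i : 'rV[R]_n) * mass sigma.
have bnd (h : 'rV[R]_n -> R) C' : sigma.-integrable setT (EFin \o h) ->
    (forall z, `|h z| <= C') -> `|\int[sigma]_z h z| <= C' * mass sigma.
  move=> ih hC'; apply: le_trans (le_normr_Rintegral measurableT ih) _.
  rewrite -Rintegral_cst//; apply: le_Rintegral => //.
    exact: integrable_norm ih.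
  exact: finite_measure_integrable_cst.
have Ab xi i : `|A xi i| <= M i.
  apply: bnd => // z; apply: le_trans (norm_mul_sin_le _ _) _.
  exact: norm_dotr_g_le.
have Sb xi i : `|S xi i| <= M i.
  apply: bnd => // z; apply: le_trans (norm_mul_cos_le _ _) _.
  exact: norm_dotr_g_le.
have M0 i : 0 <= M i by exact: le_trans (normr_ge0 _) (Ab 0 i).
have mc : measurable_fun setT (fun xi => cenorm (cgradient (fourier sigma) xi) ^+ 2).
  rewrite (funext cE); apply: measurable_sum => i.
  by apply: measurable_funD; apply: measurable_funX.
have H : (\int[leb1]_(t in `[1%R, 2%R]) (cenorm (cgradient (fourier sigma) (t *: eta)) ^+ 2)%:E
     <= (C ^+ 2 * ((1 + enorm eta) `^ (- alpha)) ^+ 2)%:E)%E.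
  apply: (@sqrt_Rintegral_le _ (\sum_i (M i ^+ 2 + M i ^+ 2))) => //.
  - exact: measurable_line mc.
  - by move=> t; exact: sqr_ge0.
  - move=> t _; rewrite cE; apply: ler_sum => i _.
    rewrite -(real_normK (num_real (A _ _))) -(real_normK (num_real (S _ _))).
    by apply: lerD; rewrite ler_pXn2r ?nnegrE.
  - exact: powR_ge0.
have mI : measurable ([set` `[1%R, 2%R]] : set (measurableTypeR R)) by exact: measurable_itv.
apply: (@le_trans _ _ ((enorm eta ^+ 2)%:E *
   \int[leb1]_(t in `[1%R, 2%R]) (cenorm (cgradient (fourier sigma) (t *: eta)) ^+ 2)%:E)%E).
  have mce : measurable_fun ([set` `[1%R, 2%R]] : set (measurableTypeR R)) (fun t : measurableTypeR R => (cenorm (cgradient (fourier sigma) (t *: eta)) ^+ 2)%:E).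
    by apply: measurable_funTS; apply/measurable_EFinP; exact: measurable_line mc.
  rewrite -ge0_integralZl//; try (by rewrite lee_fin sqr_ge0); try by move=> t _; rewrite lee_fin sqr_ge0.
  apply: ge0_le_integral_in => t _.
  rewrite -EFinM !lee_fin dm_sqr_le_cgradient andbT.
  by nonneg.
apply: le_trans (lee_wpmul2l _ H) _; first by rewrite lee_fin sqr_ge0.
by rewrite -EFinM lee_fin le_eqVlt; apply/orP; left; apply/eqP; ring.
Qed.

End gradient.

(** * Geometric sums and Gaussian cutoffs *)

Section geometric_sum.
Context {R : realType}.
Implicit Types x q : R.

Definition peak x : R := Num.min x x^-1.

(* The increments of x / (1 + x) along a geometric progression dominate peak, so
   the sums telescope. *)
Lemma peak_le q x : 1 < q -> 0 <= x ->
  peak x <= 2 * (1 + q) / (q - 1) * (q * x / (1 + q * x) - x / (1 + x)).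
Proof.
move=> q1 x0; have q0 : 0 < q - 1 by rewrite subr_gt0.
have p1 : 0 < 1 + q * x by rewrite ltr_wpDr// mulr_ge0//; lra.
have p2 : 0 < 1 + x by rewrite ltr_wpDr.
have -> : 2 * (1 + q) / (q - 1) * (q * x / (1 + q * x) - x / (1 + x)) =
    2 * (1 + q) * x / ((1 + x) * (1 + q * x)).
  by field; rewrite !gt_eqF.
have p0 : 0 <= (1 + x) * (1 + q * x) by apply: mulr_ge0; exact: ltW.
rewrite ler_pdivlMr ?mulr_gt0// /peak.
have [x1|x1] := leP x 1.
  apply: (@le_trans _ _ (x * ((1 + x) * (1 + q * x)))).
    by rewrite ler_wpM2r// ge_min lexx.
  rewrite [leRHS]mulrC ler_wpM2l//.
  by apply: ler_pM; nra.
apply: (@le_trans _ _ (x^-1 * ((1 + x) * (1 + q * x)))).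
  by rewrite ler_wpM2r// ge_min lexx orbT.
have xp : 0 < x by exact: lt_trans x1.
rewrite ler_pdivrMl// mulrCA -expr2.
have : (1 + x) * (1 + q * x) <= (2 * x) * ((1 + q) * x) by apply: ler_pM; nra.
by rewrite expr2; move=> h; apply: (le_trans h); rewrite le_eqVlt; apply/orP; left; apply/eqP; ring.
Qed.

(** The bound depends neither on the number of terms nor on [x]: this is why all dyadic dilations
    together cost no more than a constant times one. *)
Lemma sum_peak_le q x M : 1 < q -> 0 <= x ->
  \sum_(i < M) peak (x * q ^+ i) <= 2 * (1 + q) / (q - 1).
Proof.
move=> q1 x0; have q0 : 0 < q - 1 by rewrite subr_gt0.
pose Xi y : R := y / (1 + y).
have C0 : 0 <= 2 * (1 + q) / (q - 1) by apply: divr_ge0; [apply: mulr_ge0 => //; lra|exact: ltW].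
have qi i : 0 <= x * q ^+ i by rewrite mulr_ge0// exprn_ge0//; lra.
apply: (@le_trans _ _ (\sum_(i < M) 2 * (1 + q) / (q - 1) * (Xi (x * q ^+ i.+1) - Xi (x * q ^+ i)))).
  apply: ler_sum => i _; apply: le_trans (peak_le q1 (qi i)) _.
  by rewrite exprS mulrCA.
rewrite -mulr_sumr -(big_mkord xpredT (fun i => Xi (x * q ^+ i.+1) - Xi (x * q ^+ i))).
rewrite telescope_sumr// ler_piMr//.
have X0 y : 0 <= y -> 0 <= Xi y by move=> y0; rewrite divr_ge0// addr_ge0.
have X1 y : 0 <= y -> Xi y <= 1.
  by move=> y0; rewrite ler_pdivrMr ?mul1r ?lerDr// ltr_wpDr.
by rewrite lerBlDr (le_trans (X1 _ (qi M)))// lerDl X0.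
Qed.

End geometric_sum.

Section cutoff.
Context {R : realType}.
Variable K : nat.
Implicit Types e x : R.

(** For [e = gauss r eta] the power [e ^+ 4] is [gauss (2 * r) eta], so this is the difference of
    the smoothing multipliers 1 - (1 - e)^(K+1) at the scales r and 2 r. It vanishes to order K+1 at
    e = 1, that is at frequency zero, and to first order at e = 0. *)
Definition psi e : R := (1 - e ^+ 4) ^+ K.+1 - (1 - e) ^+ K.+1.

Definition dpsi e : R := K.+1%:R * (1 - e) ^+ K - K.+1%:R * 4 * e ^+ 3 * (1 - e ^+ 4) ^+ K.

Lemma is_derive_psi e : is_derive e (1:R) psi (dpsi e).
Proof.
have d1 : is_derive e (1:R) (fun e => 1 - e ^+ 4) (- (4 * e ^+ 3)).
  by apply: is_derive_eq; rewrite /GRing.scale/=; ring.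
have d2 : is_derive e (1:R) (fun e => 1 - e) (- 1).
  by apply: is_derive_eq; rewrite /GRing.scale/=; ring.
have dX (y : R) : is_derive y (1:R) (fun y => y ^+ K.+1) (K.+1%:R * y ^+ K).
  by apply: DeriveDef; [exact: exprn_derivable|rewrite exp_derive /GRing.scale/= mulr1].
have c1 := @is_derive1_comp _ (fun y => y ^+ K.+1) (fun e => 1 - e ^+ 4) e _ _ (dX _) d1.
have c2 := @is_derive1_comp _ (fun y => y ^+ K.+1) (fun e => 1 - e) e _ _ (dX _) d2.
have := is_deriveB c1 c2; rewrite (_ : _ - _ = dpsi e)//.
by rewrite /dpsi; ring.
Qed.

Lemma bernoulli_le e m : 0 <= e <= 1 -> 1 - m%:R * e <= (1 - e) ^+ m.
Proof.
move=> /andP[e0 e1]; elim: m => [|m IH]; first by rewrite mul0r subr0 expr0.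
rewrite exprS; apply: le_trans (ler_wpM2l _ IH); last by lra.
have : 0 <= m%:R * e * e by rewrite !mulr_ge0.
by rewrite -natr1; lra.
Qed.

Lemma psi_ge0 e : 0 <= e <= 1 -> 0 <= psi e.
Proof.
move=> /andP[e0 e1]; rewrite subr_ge0 lerXn2r// ?nnegrE ?subr_ge0//.
  by rewrite exprn_ile1.
by rewrite lerD2l lerN2 exprS ler_piMr// exprn_ile1.
Qed.

Lemma psi_le_mul e : 0 <= e <= 1 -> psi e <= K.+1%:R * e.
Proof.
move=> e01; have := bernoulli_le K.+1 e01; case/andP: e01 => e0 e1.
have : (1 - e ^+ 4) ^+ K.+1 <= 1.
  by rewrite exprn_ile1 ?subr_ge0 ?exprn_ile1// lerBlDr lerDl exprn_ge0.
by rewrite /psi; lra.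
Qed.

Lemma psi_le_expr x : 0 <= x -> psi (expR (- x)) <= (4 * x) ^+ K.+1.
Proof.
move=> x0; have e0 := expR_gt0 (- x); have e1 : expR (- x) <= 1 by rewrite -[leRHS]expR0 ler_expR oppr_le0.
have : (1 - expR (- x) ^+ 4) ^+ K.+1 <= (4 * x) ^+ K.+1.
  have e40 : expR (- x) ^+ 4 <= 1 by rewrite exprn_ile1// expR_ge0.
  rewrite lerXn2r// ?nnegrE ?mulr_ge0// ?subr_ge0//.
  by rewrite -expRM_natr; have := expR_ge1Dx (- x * 4%:R); lra.
have : 0 <= (1 - expR (- x)) ^+ K.+1 by rewrite exprn_ge0// subr_ge0.
by rewrite /psi; lra.
Qed.

Lemma norm_dpsi_le e : 0 <= e <= 1 -> `|dpsi e| <= 5 * K.+1%:R.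
Proof.
move=> /andP[e0 e1]; apply: le_trans (ler_normB _ _) _.
have e40 : 0 <= e ^+ 4 by rewrite exprn_ge0.
have e30 : 0 <= e ^+ 3 by rewrite exprn_ge0.
have e41 : e ^+ 4 <= 1 by rewrite exprn_ile1.
have e31 : e ^+ 3 <= 1 by rewrite exprn_ile1.
have a0 : 0 <= (1 - e) ^+ K by rewrite exprn_ge0// subr_ge0.
have a1 : (1 - e) ^+ K <= 1 by rewrite exprn_ile1 ?subr_ge0// lerBlDr lerDl.
have b0 : 0 <= (1 - e ^+ 4) ^+ K by rewrite exprn_ge0// subr_ge0.
have b1 : (1 - e ^+ 4) ^+ K <= 1 by rewrite exprn_ile1 ?subr_ge0// lerBlDr lerDl.
have K0 : 0 <= K.+1%:R :> R by [].
rewrite !ger0_norm ?mulr_ge0//.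
have : K.+1%:R * (1 - e) ^+ K <= K.+1%:R by rewrite ler_piMr.
have : K.+1%:R * 4 * e ^+ 3 * (1 - e ^+ 4) ^+ K <= K.+1%:R * 4.
  by rewrite -[leRHS]mulr1 -mulrA ler_wpM2l ?mulr_ge0// mulr_ile1.
by lra.
Qed.

(** At e = 1 the derivative is small only to order K; the factor [x], which differentiating the
    Gaussian supplies, restores the order K+1. *)
Lemma norm_dpsi_le_expr x : 0 <= x -> `|dpsi (expR (- x))| * x <= 5 * K.+1%:R * (4 * x) ^+ K.+1.
Proof.
move=> x0; have e0 := expR_gt0 (- x); have e1 : expR (- x) <= 1 by rewrite -[leRHS]expR0 ler_expR oppr_le0.
set e := expR (- x) in e0 e1 *.
have e30 : 0 <= e ^+ 3 by rewrite exprn_ge0// ltW.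
have e31 : e ^+ 3 <= 1 by rewrite exprn_ile1// ltW.
have e41 : e ^+ 4 <= 1 by rewrite exprn_ile1// ltW.
have x4 : 1 - e ^+ 4 <= 4 * x.
  by rewrite /e -expRM_natr; have := expR_ge1Dx (- x * 4%:R); lra.
have e0' := ltW e0.
have x1 : 1 - e <= 4 * x by have := expR_ge1Dx (- x); rewrite -/e; lra.
have a0 : 0 <= (1 - e) ^+ K by rewrite exprn_ge0// subr_ge0.
have a1 : (1 - e) ^+ K <= (4 * x) ^+ K by rewrite lerXn2r// ?nnegrE ?mulr_ge0// subr_ge0.
have b0 : 0 <= (1 - e ^+ 4) ^+ K by rewrite exprn_ge0// subr_ge0.
have b1 : (1 - e ^+ 4) ^+ K <= (4 * x) ^+ K by rewrite lerXn2r// ?nnegrE ?mulr_ge0// subr_ge0.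
have K0 : 0 <= K.+1%:R :> R by [].
have z0 : 0 <= (4 * x) ^+ K by rewrite exprn_ge0// mulr_ge0.
have h : `|dpsi e| <= 5 * K.+1%:R * (4 * x) ^+ K.
  apply: le_trans (ler_normB _ _) _; rewrite !ger0_norm ?mulr_ge0//.
  have : K.+1%:R * (1 - e) ^+ K <= K.+1%:R * (4 * x) ^+ K by rewrite ler_wpM2l.
  have : K.+1%:R * 4 * e ^+ 3 * (1 - e ^+ 4) ^+ K <= K.+1%:R * 4 * (1 * (4 * x) ^+ K).
    by rewrite -mulrA ler_wpM2l ?mulr_ge0// ler_pM.
  by lra.
apply: le_trans (ler_wpM2r x0 h) _; rewrite exprSr.
have : 0 <= 5 * K.+1%:R * (4 * x) ^+ K * x by rewrite !mulr_ge0.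
by rewrite [X in _ -> _ <= X](_ : _ = 4 * (5 * K.+1%:R * (4 * x) ^+ K * x)); [lra|ring].
Qed.

Lemma mul_expRN_le1 x : 0 <= x -> x * expR (- x) <= 1.
Proof.
move=> x0; rewrite expRN ler_pdivrMr ?expR_gt0// mul1r.
by have := expR_ge1Dx x; lra.
Qed.

Lemma sqr_mul_expRN_le x : 0 <= x -> x ^+ 2 * expR (- x) <= 4.
Proof.
move=> x0; have -> : expR (- x) = expR (- (x / 2)) ^+ 2.
  by rewrite -expRM_natr; congr expR; field.
have x20 : 0 <= x / 2 by rewrite divr_ge0.
have -> : x ^+ 2 * expR (- (x / 2)) ^+ 2 = 4 * (x / 2 * expR (- (x / 2))) ^+ 2 by field.
rewrite ler_piMr// exprn_ile1//; last exact: mul_expRN_le1.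
by rewrite mulr_ge0// expR_ge0.
Qed.

End cutoff.

Section cutoff_gauss.
Context {R : realType} {n : nat}.
Variable K : nat.
Implicit Types (eta : 'rV[R]_n) (r u : R).

Definition dgauss r u eta : R := - (2 * pi * r ^+ 2 * u * dotr eta eta) * gauss (r * u) eta.

Definition cutoff r u eta : R := psi K (gauss (r * u) eta).

Definition dcutoff r u eta : R := dpsi K (gauss (r * u) eta) * dgauss r u eta.

Lemma gauss01 s eta : 0 <= gauss s eta <= 1.
Proof. by rewrite gauss_ge0 gauss_le1. Qed.

Lemma is_derive_gauss r u eta :
  is_derive u (1:R) (fun u => gauss (r * u) eta) (dgauss r u eta).
Proof.
have H : is_derive u (1:R) (fun u => - (pi * (r * u) ^+ 2 * dotr eta eta))
    (- (2 * pi * r ^+ 2 * u * dotr eta eta)).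
  by apply: is_derive_eq; rewrite /GRing.scale/= ?expr2; ring.
have := @is_derive1_comp _ expR (fun u => - (pi * (r * u) ^+ 2 * dotr eta eta)) u _ _
  (is_derive_expR _) H.
by rewrite mulrC.
Qed.

Lemma is_derive_cutoff r u eta :
  is_derive u (1:R) (fun u => cutoff r u eta) (dcutoff r u eta).
Proof.
exact: (@is_derive1_comp _ (psi K) (fun u => gauss (r * u) eta) u _ _
  (is_derive_psi K _) (is_derive_gauss r u eta)).
Qed.

Lemma continuous_dcutoff r eta : continuous (fun u => dcutoff r u eta).
Proof.
move=> u; have cg : continuous (fun u => gauss (r * u) eta).
  exact: is_derive_continuous (fun u => is_derive_gauss r u eta).
apply: cvgM; last first.
  apply: cvgM; last exact: cg.
  apply: cvgN; apply: cvgM; last exact: cvg_cst.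
  by apply: cvgM; [exact: cvg_cst|exact: cvg_id].
have cX (h : R -> R) m : h u @[u --> u] --> h u -> h u ^+ m @[u --> u] --> h u ^+ m.
  by move=> ch; apply: (@cvg_comp _ _ _ h (fun x : R => x ^+ m) _ _ _ ch); exact: exprn_continuous.
have ce := cg u.
rewrite /dpsi; apply: cvgB; apply: cvgM.
- exact: cvg_cst.
- by apply: (cX (fun u => 1 - gauss (r * u) eta)); apply: cvgB; [exact: cvg_cst|exact: ce].
- by apply: cvgM; [exact: cvg_cst|exact: (cX (fun u => gauss (r * u) eta))].
- apply: (cX (fun u => 1 - gauss (r * u) eta ^+ 4)).
  by apply: cvgB; [exact: cvg_cst|exact: (cX (fun u => gauss (r * u) eta))].
Qed.

Lemma measurable_cutoff r d (T : measurableType d) (k : T -> R) (h : T -> 'rV[R]_n) :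
  measurable_fun setT k -> measurable_fun setT h ->
  measurable_fun setT (fun x => cutoff r (k x) (h x)).
Proof.
move=> mk mh; have mgs : measurable_fun setT (fun x => gauss (r * k x) (h x)).
  by apply: measurable_gauss => //; exact: measurable_funM.
apply: measurable_funB; apply: measurable_funX; apply: measurable_funB => //.
exact: measurable_funX.
Qed.

Lemma measurable_dcutoff r d (T : measurableType d) (k : T -> R) (h : T -> 'rV[R]_n) :
  measurable_fun setT k -> measurable_fun setT h ->
  measurable_fun setT (fun x => dcutoff r (k x) (h x)).
Proof.
move=> mk mh; have mgs : measurable_fun setT (fun x => gauss (r * k x) (h x)).
  by apply: measurable_gauss => //; exact: measurable_funM.
apply: measurable_funM.
  apply: measurable_funB; apply: measurable_funM => //.
  - by apply: measurable_funX; exact: measurable_funB.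
  - by apply: measurable_funM => //; exact: measurable_funX.
  - by apply: measurable_funX; apply: measurable_funB => //; exact: measurable_funX.
apply: measurable_funM => //; apply: measurableT_comp => //.
by apply: measurable_funM; [exact: measurable_funM|exact: measurable_dotr].
Qed.

Lemma cutoff_ge0 r u eta : 0 <= cutoff r u eta.
Proof. exact: psi_ge0 (gauss01 _ _). Qed.

Lemma cutoff_le_gauss r u eta : cutoff r u eta <= K.+1%:R * gauss (r * u) eta.
Proof. exact: psi_le_mul (gauss01 _ _). Qed.

Let X r u eta : R := pi * (r * u) ^+ 2 * dotr eta eta.

Let X0 r u eta : 0 <= X r u eta. Proof. by rewrite /X; nonneg. Qed.

Lemma norm_dcutoffE r u eta : 1 <= u ->
  `|dcutoff r u eta| = 2 / u * (`|dpsi K (gauss (r * u) eta)| * X r u eta) * gauss (r * u) eta.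
Proof.
move=> u1; have u0 : 0 < u by exact: lt_le_trans u1.
have p0 := @pi_ge0 R.
have a0 : 0 <= 2 * pi * r ^+ 2 * u * dotr eta eta.
  by have := ltW u0 => ?; nonneg.
rewrite /dcutoff /dgauss normrM normrM normrN (ger0_norm a0) (ger0_norm (gauss_ge0 _ _)).
by rewrite /X; field; rewrite gt_eqF.
Qed.

Lemma gauss_anti s t eta : 0 <= s -> s <= t -> gauss t eta <= gauss s eta.
Proof.
move=> s0 st; rewrite ler_expR lerN2 ler_wpM2r ?dotr_ge0// ler_wpM2l ?pi_ge0//.
by rewrite lerXn2r// nnegrE// (le_trans s0).
Qed.

(** Gives an integrable majorant independent of u. Half of the exponent absorbs the polynomial
    factor [X], whence the scale [r / sqrt 2]. *)
Lemma norm_dcutoff_le_gauss r u eta : 0 < r -> 1 <= u ->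
  `|dcutoff r u eta| <= 20 * K.+1%:R * gauss (r / Num.sqrt 2) eta.
Proof.
move=> r0 u1; have u0 : 0 < u by exact: lt_le_trans u1.
have q0 : 0 < Num.sqrt 2 :> R by rewrite sqrtr_gt0.
rewrite norm_dcutoffE//.
have h1 := norm_dpsi_le K (gauss01 (r * u) eta).
have u2 : 2 / u <= 2 by rewrite ler_pdivrMr// ler_peMr.
have u20 : 0 <= 2 / u by nonneg.
have xx : X r u eta * gauss (r * u) eta <= 2 * gauss (r / Num.sqrt 2) eta.
  have -> : gauss (r * u) eta = expR (- (X r u eta / 2)) * expR (- (X r u eta / 2)).
    by rewrite -expRD /gauss; congr expR; rewrite /X; field.
  have l1 := @mul_expRN_le1 R (X r u eta / 2) ltac:(by rewrite divr_ge0).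
  have l2 : expR (- (X r u eta / 2)) <= gauss (r / Num.sqrt 2) eta.
    have -> : expR (- (X r u eta / 2)) = gauss (r * u / Num.sqrt 2) eta.
      by rewrite /gauss /X; congr expR; rewrite (exprMn _ _ (Num.sqrt 2)^-1) exprVn sqr_sqrtr//; field.
    apply: gauss_anti; first by rewrite divr_ge0 ?ltW.
    by rewrite ler_wpM2r ?invr_ge0 ?sqrtr_ge0// ler_peMr// ltW.
  have e0 := expR_ge0 (- (X r u eta / 2)).
  have -> : X r u eta * (expR (- (X r u eta / 2)) * expR (- (X r u eta / 2))) =
    2 * ((X r u eta / 2 * expR (- (X r u eta / 2))) * expR (- (X r u eta / 2))) by field.
  rewrite ler_wpM2l//; apply: le_trans l2; rewrite ler_piMl//.
have g0 := gauss_ge0 (r * u) eta.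
have d0 := normr_ge0 (dpsi K (gauss (r * u) eta)); have x0 := X0 r u eta.
have xg0 := mulr_ge0 x0 g0.
have dxg := mulr_ge0 d0 xg0.
have -> : 2 / u * (`|dpsi K (gauss (r * u) eta)| * X r u eta) * gauss (r * u) eta =
    2 / u * (`|dpsi K (gauss (r * u) eta)| * (X r u eta * gauss (r * u) eta)) by ring.
have := ler_pM u20 dxg u2 (ler_pM d0 xg0 h1 xx).
by move/le_trans; apply; rewrite le_eqVlt; apply/orP; left; apply/eqP; ring.
Qed.

Let Xle r u eta : 0 <= r -> 1 <= u <= 2 -> X r u eta <= 4 * pi * (r * enorm eta) ^+ 2.
Proof.
move=> r0 /andP[u1 u2]; rewrite /X !exprMn -enorm_sqr.
have u4 : u ^+ 2 <= 4 by rewrite expr2; nra.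
have : 0 <= pi * r ^+ 2 * enorm eta ^+ 2 by nonneg.
have -> : pi * (r ^+ 2 * u ^+ 2) * enorm eta ^+ 2 = (pi * r ^+ 2 * enorm eta ^+ 2) * u ^+ 2 by ring.
have -> : 4 * pi * (r ^+ 2 * enorm eta ^+ 2) = (pi * r ^+ 2 * enorm eta ^+ 2) * 4 by ring.
by move=> p0; rewrite ler_wpM2l.
Qed.

Let Xge r u eta : 0 <= r -> 1 <= u <= 2 -> (r * enorm eta) ^+ 2 <= X r u eta.
Proof.
move=> r0 /andP[u1 u2]; rewrite /X !exprMn -enorm_sqr.
have u4 : 1 <= u ^+ 2 by rewrite expr2; nra.
have p2 : 2 <= pi :> R by exact: pi_ge2.
have : 0 <= r ^+ 2 * enorm eta ^+ 2 by nonneg.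
have -> : pi * (r ^+ 2 * u ^+ 2) * enorm eta ^+ 2 = (r ^+ 2 * enorm eta ^+ 2) * (pi * u ^+ 2) by ring.
by move=> p0; rewrite ler_peMr//; nra.
Qed.

(** Large enough for the four bounds below: 16 pi comes from
    [4 * X <= 16 * pi * (r * enorm eta) ^+ 2], and 40 = 2 * 5 * 4 from [2 / u <= 2], from the bound
    on [dpsi] and from x^2 exp(-x) <= 4. *)
Definition cutcst : R := 40 * K.+1%:R * (16 * pi) ^+ K.+1.

Let pi16 : 1 <= 16 * pi :> R.
Proof. by have := @pi_ge2 R; lra. Qed.

Let cst1 : 40 * K.+1%:R <= cutcst.
Proof. by rewrite /cutcst ler_peMr ?mulr_ge0// exprn_ege1. Qed.

Lemma cutcst_ge0 : 0 <= cutcst.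
Proof. by apply: le_trans cst1; rewrite mulr_ge0. Qed.

Let pow4X_le r u eta : 0 <= r -> 1 <= u <= 2 ->
  (4 * X r u eta) ^+ K.+1 <= (16 * pi) ^+ K.+1 * (r * enorm eta) ^+ (2 * K.+1).
Proof.
move=> r0 u12; rewrite exprM -exprMn.
have h1 : 0 <= 4 * X r u eta by rewrite mulr_ge0.
have h2 : 4 * X r u eta <= 16 * pi * (r * enorm eta) ^+ 2 by have := Xle eta r0 u12; lra.
by rewrite lerXn2r// nnegrE// (le_trans h1).
Qed.

Lemma cutoff_le_small r u eta : 0 <= r -> 1 <= u <= 2 ->
  cutoff r u eta <= cutcst * (r * enorm eta) ^+ (2 * K.+1).
Proof.
move=> r0 u12; have := psi_le_expr K (X0 r u eta) => h; apply: (le_trans h).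
have rho0 : 0 <= r * enorm eta by nonneg.
apply: (@le_trans _ _ ((16 * pi) ^+ K.+1 * (r * enorm eta) ^+ (2 * K.+1))).
  exact: pow4X_le.
rewrite ler_wpM2r ?exprn_ge0// /cutcst ler_peMl ?exprn_ge0 ?mulr_ge0 ?pi_ge0//.
by rewrite -natrM ler1n.
Qed.

Lemma norm_dcutoff_le_small r u eta : 0 <= r -> 1 <= u <= 2 ->
  `|dcutoff r u eta| <= cutcst * (r * enorm eta) ^+ (2 * K.+1).
Proof.
move=> r0 u12; have /andP[u1 u2] := u12; have u0 : 0 < u by exact: lt_le_trans u1.
have rho0 : 0 <= r * enorm eta by nonneg.
rewrite norm_dcutoffE//.
have h := norm_dpsi_le_expr K (X0 r u eta); rewrite -/(gauss (r * u) eta) in h.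
have uu : 2 / u <= 2 by rewrite ler_pdivrMr// ler_peMr.
have u20 : 0 <= 2 / u by nonneg.
have h2 : (4 * X r u eta) ^+ K.+1 <= (16 * pi) ^+ K.+1 * (r * enorm eta) ^+ (2 * K.+1).
  exact: pow4X_le.
have dx0 : 0 <= `|dpsi K (gauss (r * u) eta)| * X r u eta by rewrite mulr_ge0.
have z0 : 0 <= (16 * pi) ^+ K.+1 * (r * enorm eta) ^+ (2 * K.+1).
  by apply: mulr_ge0; apply: exprn_ge0 => //; exact: le_trans pi16.
apply: (@le_trans _ _ (2 * (5 * K.+1%:R * ((16 * pi) ^+ K.+1 * (r * enorm eta) ^+ (2 * K.+1))) * 1)).
  have hh : `|dpsi K (gauss (r * u) eta)| * X r u eta <=
      5 * K.+1%:R * ((16 * pi) ^+ K.+1 * (r * enorm eta) ^+ (2 * K.+1)).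
    by apply: (le_trans h); rewrite ler_wpM2l// mulr_ge0.
  exact: (ler_pM (mulr_ge0 u20 dx0) (gauss_ge0 _ _) (ler_pM u20 dx0 uu hh) (gauss_le1 _ _)).
have := mulr_ge0 (ler0n R K.+1) z0; rewrite /cutcst.
set a := K.+1%:R; set b := _ ^+ K.+1; set c := _ ^+ (2 * K.+1) => abc.
have -> : 2 * (5 * a * (b * c)) * 1 = 10 * (a * (b * c)) by ring.
have -> : 40 * a * b * c = 40 * (a * (b * c)) by ring.
by lra.
Qed.

Lemma cutoff_le_large r u eta : 0 < r * enorm eta -> 0 <= r -> 1 <= u <= 2 ->
  cutoff r u eta <= cutcst / (r * enorm eta) ^+ 2.
Proof.
move=> rho0 r0 u12; have xg := Xge eta r0 u12.
have rho2 : 0 < (r * enorm eta) ^+ 2 by rewrite exprn_gt0.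
rewrite ler_pdivlMr//; apply: (@le_trans _ _ (K.+1%:R * (X r u eta * gauss (r * u) eta))).
  have := ler_pM (cutoff_ge0 r u eta) (ltW rho2) (cutoff_le_gauss r u eta) xg.
  by rewrite [X in _ <= X -> _](_ : _ = K.+1%:R * (X r u eta * gauss (r * u) eta)); last ring.
have l1 := @mul_expRN_le1 R _ (X0 r u eta).
apply: le_trans cst1; apply: (@le_trans _ _ (K.+1%:R * 1)); first by rewrite ler_wpM2l.
by rewrite mulr1 ler_peMl// ler1n.
Qed.

Lemma norm_dcutoff_le_large r u eta : 0 < r * enorm eta -> 0 <= r -> 1 <= u <= 2 ->
  `|dcutoff r u eta| <= cutcst / (r * enorm eta) ^+ 2.
Proof.
move=> rho0 r0 u12; have xg := Xge eta r0 u12.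
have /andP[u1 u2] := u12; have u0 : 0 < u by exact: lt_le_trans u1.
have rho2 : 0 < (r * enorm eta) ^+ 2 by rewrite exprn_gt0.
rewrite ler_pdivlMr// norm_dcutoffE//.
have h1 := norm_dpsi_le K (gauss01 (r * u) eta).
have uu : 2 / u <= 2 by rewrite ler_pdivrMr// ler_peMr.
have u20 : 0 <= 2 / u by nonneg.
have l1 := @sqr_mul_expRN_le R _ (X0 r u eta).
have g0 := gauss_ge0 (r * u) eta; have x0 := X0 r u eta.
apply: (@le_trans _ _ (2 * (5 * K.+1%:R * (X r u eta ^+ 2 * gauss (r * u) eta)))).
  set D := `|dpsi K _| in h1 *; have d0 : 0 <= D by exact: normr_ge0.
  have -> : 2 / u * (D * X r u eta) * gauss (r * u) eta * (r * enorm eta) ^+ 2 =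
    2 / u * (D * (X r u eta * (r * enorm eta) ^+ 2 * gauss (r * u) eta)) by ring.
  have y0 : 0 <= X r u eta * (r * enorm eta) ^+ 2 * gauss (r * u) eta.
    by apply: mulr_ge0 => //; apply: mulr_ge0 => //; exact: ltW.
  have yle : X r u eta * (r * enorm eta) ^+ 2 * gauss (r * u) eta <= X r u eta ^+ 2 * gauss (r * u) eta.
    by rewrite ler_wpM2r// expr2 ler_wpM2l.
  exact: (ler_pM u20 (mulr_ge0 d0 y0) uu (ler_pM d0 y0 h1 yle)).
apply: le_trans cst1.
have -> : 40 * K.+1%:R = 2 * (5 * K.+1%:R * 4) :> R by ring.
by rewrite ler_wpM2l// ler_wpM2l// mulr_ge0.
Qed.

End cutoff_gauss.

(** * L^2 bounds for the high-frequency pieces *)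

Section family.
Context {R : realType} {n : nat}.
Notation leb1 := (@lebesgue_measure R).
Notation leb := (lebesgue_rV n : {sigma_finite_measure set 'rV[R]_n -> \bar R}).
Variable sigma : {finite_measure set 'rV[R]_n -> \bar R}.
Variable g : 'rV[R]_n -> 'rV[R]_n.
Hypothesis mg : measurable_fun setT g.
Variable B : R.
Hypothesis gB : forall z, enorm (g z) <= B.
Variable K : nat.
Implicit Types (eta xi : 'rV[R]_n) (r u t L : R).
Local Notation mc := (mcos sigma g).
Local Notation ms := (msin sigma g).
Local Notation dmc := (dmcos sigma g).
Local Notation dms := (dmsin sigma g).
Local Notation W := (mass sigma).

Definition pcos r u eta : R := cutoff K r u eta * mc (u *: eta).
Definition psin r u eta : R := cutoff K r u eta * ms (u *: eta).
Definition dpcos r u eta : R := dcutoff K r u eta * mc (u *: eta) + cutoff K r u eta * dmc u eta.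
Definition dpsin r u eta : R := dcutoff K r u eta * ms (u *: eta) + cutoff K r u eta * dms u eta.

Let B0 : 0 <= B. Proof. exact: le_trans (enorm_ge0 _) (gB 0). Qed.

Lemma is_derive_pcos r u eta : is_derive u (1:R) (fun u => pcos r u eta) (dpcos r u eta).
Proof.
have := @is_deriveM _ _ (fun u => cutoff K r u eta) (fun u => mc (u *: eta)) u 1 _ _
  (is_derive_cutoff K r u eta) (is_derive_mcos sigma mg gB eta u).
by rewrite /GRing.scale/= addrC (mulrC (mc _)).
Qed.

Lemma is_derive_psin r u eta : is_derive u (1:R) (fun u => psin r u eta) (dpsin r u eta).
Proof.
have := @is_deriveM _ _ (fun u => cutoff K r u eta) (fun u => ms (u *: eta)) u 1 _ _
  (is_derive_cutoff K r u eta) (is_derive_msin sigma mg gB eta u).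
by rewrite /GRing.scale/= addrC (mulrC (ms _)).
Qed.

Lemma continuous_dpcos r eta : continuous (fun u => dpcos r u eta).
Proof.
move=> u; apply: cvgD; apply: cvgM.
- exact: continuous_dcutoff.
- exact: (is_derive_continuous (is_derive_mcos sigma mg gB eta)).
- exact: (is_derive_continuous (fun u => is_derive_cutoff K r u eta)).
- exact: (@continuous_dmcos _ _ sigma g mg B gB eta u).
Qed.

Lemma continuous_dpsin r eta : continuous (fun u => dpsin r u eta).
Proof.
move=> u; apply: cvgD; apply: cvgM.
- exact: continuous_dcutoff.
- exact: (is_derive_continuous (is_derive_msin sigma mg gB eta)).
- exact: (is_derive_continuous (fun u => is_derive_cutoff K r u eta)).
- exact: (@continuous_dmsin _ _ sigma g mg B gB eta u).
Qed.

Section meas.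
Variables (r L : R).
Notation T := (measurableTypeR R * 'rV[R]_n)%type.

Let mz : measurable_fun setT (fun z : T => L *: z.2).
Proof. exact: measurable_rVZ. Qed.
Let mf : measurable_fun setT (fun z : T => z.1 : R). Proof. exact: measurable_fst. Qed.
Let mzz : measurable_fun setT (fun z : T => z.1 *: (L *: z.2)).
Proof. exact: measurable_rVZ. Qed.
Let mmc : measurable_fun setT (fun z : T => mc (z.1 *: (L *: z.2))).
Proof. exact: (measurableT_comp (measurable_mcos sigma mg) mzz). Qed.
Let mms : measurable_fun setT (fun z : T => ms (z.1 *: (L *: z.2))).
Proof. exact: (measurableT_comp (measurable_msin sigma mg) mzz). Qed.
Let mpair : measurable_fun setT (fun z : T => (z.1, L *: z.2) : T).
Proof. exact: measurable_fun_pair. Qed.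
Let mdmc : measurable_fun setT (fun z : T => dmc z.1 (L *: z.2)).
Proof. exact: (measurableT_comp (measurable_dmcos sigma mg) mpair). Qed.
Let mdms : measurable_fun setT (fun z : T => dms z.1 (L *: z.2)).
Proof. exact: (measurableT_comp (measurable_dmsin sigma mg) mpair). Qed.

Lemma measurable_pcos : measurable_fun setT (fun z : T => pcos r z.1 (L *: z.2)).
Proof. by apply: measurable_funM => //; exact: measurable_cutoff. Qed.
Lemma measurable_psin : measurable_fun setT (fun z : T => psin r z.1 (L *: z.2)).
Proof. by apply: measurable_funM => //; exact: measurable_cutoff. Qed.
Lemma measurable_dpcos : measurable_fun setT (fun z : T => dpcos r z.1 (L *: z.2)).
Proof.
apply: measurable_funD; apply: measurable_funM => //.
  exact: measurable_dcutoff.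
exact: measurable_cutoff.
Qed.
Lemma measurable_dpsin : measurable_fun setT (fun z : T => dpsin r z.1 (L *: z.2)).
Proof.
apply: measurable_funD; apply: measurable_funM => //.
  exact: measurable_dcutoff.
exact: measurable_cutoff.
Qed.
End meas.

Let sqrt2_ge1 : 1 <= Num.sqrt 2 :> R.
Proof. by rewrite -[leLHS]sqrtr1 ler_sqrt// ler1n. Qed.

Let gauss_half r u eta : 0 < r -> 1 <= u -> gauss (r * u) eta <= gauss (r / Num.sqrt 2) eta.
Proof.
move=> r0 u1; apply: gauss_anti; first by rewrite divr_ge0// ltW.
rewrite ler_pM2l//; apply: le_trans u1.
by rewrite invf_le1// (lt_le_trans ltr01).
Qed.

Definition pcst r : R := (20 * K.+1%:R + K.+1%:R * (2 * pi * B * r^-1)) * W.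

Let pbound r u eta (a da : R) : 0 < r -> 1 <= u <= 2 -> `|a| <= W -> 
  `|da| <= 2 * pi * B * enorm eta * W ->
  `|cutoff K r u eta * a| <= pcst r * gauss (r / Num.sqrt 2) eta /\
  `|dcutoff K r u eta * a + cutoff K r u eta * da| <= pcst r * gauss (r / Num.sqrt 2) eta.
Proof.
move=> r0 /andP[u1 u2] ha hda; set G := gauss (r / _) _.
have G0 : 0 <= G by exact: gauss_ge0.
have W0 := mass_ge0 sigma.
have c0 := cutoff_ge0 K r u eta.
have c1 : cutoff K r u eta <= K.+1%:R * G.
  by apply: le_trans (cutoff_le_gauss _ _ _ _) _; rewrite ler_wpM2l// gauss_half.
have rV : 0 <= r^-1 by rewrite invr_ge0 ltW.
have p0 := @pi_ge0 R.
have e1 : 0 <= K.+1%:R * (2 * pi * B * r^-1) * W * G by rewrite !mulr_ge0.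
have e2 : 0 <= K.+1%:R * W * G by rewrite !mulr_ge0.
have n1 : `|cutoff K r u eta * a| <= K.+1%:R * W * G.
  rewrite normrM (ger0_norm c0); apply: le_trans (ler_pM c0 (normr_ge0 _) c1 ha) _.
  by rewrite mulrAC.
have n2 : `|dcutoff K r u eta * a| <= 20 * K.+1%:R * W * G.
  rewrite normrM; have := ler_pM (normr_ge0 _) (normr_ge0 _) (norm_dcutoff_le_gauss K eta r0 u1) ha.
  by rewrite mulrAC.
have n3 : `|cutoff K r u eta * da| <= K.+1%:R * (2 * pi * B * r^-1) * W * G.
  rewrite normrM (ger0_norm c0).
  have h1 : cutoff K r u eta <= K.+1%:R * gauss r eta.
    apply: le_trans (cutoff_le_gauss _ _ _ _) _; rewrite ler_wpM2l//.
    by apply: gauss_anti; [exact: ltW|rewrite ler_peMr// ltW].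
  have h2 := enorm_gauss_le eta r0.
  apply: le_trans (ler_pM c0 (normr_ge0 _) h1 hda) _.
  have -> : K.+1%:R * gauss r eta * (2 * pi * B * enorm eta * W) =
    K.+1%:R * (2 * pi * B) * W * (enorm eta * gauss r eta) by ring.
  have -> : K.+1%:R * (2 * pi * B * r^-1) * W * G = K.+1%:R * (2 * pi * B) * W * (r^-1 * G) by ring.
  by rewrite ler_wpM2l// !mulr_ge0.
have -> : pcst r * G = 20 * K.+1%:R * W * G + K.+1%:R * (2 * pi * B * r^-1) * W * G.
  by rewrite /pcst; ring.
split.
  apply: le_trans n1 _; apply: ler_wpDr => //.
  have -> : 20 * K.+1%:R * W * G = 20 * (K.+1%:R * W * G) by ring.
  by rewrite ler_peMl// ler1n.
by apply: le_trans (ler_normD _ _) _; exact: lerD.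
Qed.

Lemma pcos_le r u eta : 0 < r -> 1 <= u <= 2 -> `|pcos r u eta| <= pcst r * gauss (r / Num.sqrt 2) eta.
Proof.
move=> r0 u12; have [] // := @pbound r u eta (mc (u *: eta)) (dmc u eta) r0 u12.
  exact: norm_mcos_le.
exact: norm_dmcos_le.
Qed.
Lemma psin_le r u eta : 0 < r -> 1 <= u <= 2 -> `|psin r u eta| <= pcst r * gauss (r / Num.sqrt 2) eta.
Proof.
move=> r0 u12; have [] // := @pbound r u eta (ms (u *: eta)) (dms u eta) r0 u12.
  exact: norm_msin_le.
exact: norm_dmsin_le.
Qed.
Lemma dpcos_le r u eta : 0 < r -> 1 <= u <= 2 -> `|dpcos r u eta| <= pcst r * gauss (r / Num.sqrt 2) eta.
Proof.
move=> r0 u12; have [] // := @pbound r u eta (mc (u *: eta)) (dmc u eta) r0 u12.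
  exact: norm_mcos_le.
exact: norm_dmcos_le.
Qed.
Lemma dpsin_le r u eta : 0 < r -> 1 <= u <= 2 -> `|dpsin r u eta| <= pcst r * gauss (r / Num.sqrt 2) eta.
Proof.
move=> r0 u12; have [] // := @pbound r u eta (ms (u *: eta)) (dms u eta) r0 u12.
  exact: norm_msin_le.
exact: norm_dmsin_le.
Qed.

Variable alpha : R.
Hypothesis alpha0 : 0 < alpha.
Hypothesis alphaK : alpha <= K.+1%:R.
Local Notation w eta := ((1 + enorm eta) `^ (- alpha)).

Let key r eta : 0 <= r -> (r * enorm eta) `^ alpha * w eta <= r `^ alpha.
Proof.
move=> r0; have e0 := enorm_ge0 eta.
rewrite powRM// -mulrA ler_piMr ?powR_ge0//.
have -> : w eta = ((1 + enorm eta) `^ alpha)^-1 by rewrite powRN.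
rewrite ler_pdivrMr ?powR_gt0 ?mul1r ?ltr_wpDr//.
by apply: ge0_ler_powR; rewrite ?nnegrE ?addr_ge0 ?lerDr// ltW.
Qed.

(** Put rho = r |eta|. For rho > 1 the decay of the multiplier already gives r^alpha, and [b]
    contributes rho^-2. For rho <= 1 that decay falls short by rho^alpha: of the 2 (K+1) orders of
    vanishing of [b], K+1 >= alpha make up for it and the others produce [peak]. The term rho^2 in
    the last factor accounts for the derivative in t. *)
Let beta_key r eta (b : R) : 0 < r -> 0 <= b ->
  b <= cutcst K * (r * enorm eta) ^+ (2 * K.+1) ->
  (0 < r * enorm eta -> b <= cutcst K / (r * enorm eta) ^+ 2) ->
  b ^+ 2 * w eta ^+ 2 * (1 + (r * enorm eta) ^+ 2) <=
  2 * cutcst K ^+ 2 * (r `^ alpha) ^+ 2 * peak (r * enorm eta).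
Proof.
move=> r0 b0 small large; have := key eta (ltW r0).
have A0 := @cutcst_ge0 R K; have w0 : 0 <= w eta by exact: powR_ge0.
have rho0 : 0 <= r * enorm eta by apply: mulr_ge0; [exact: ltW|exact: enorm_ge0].
move: small large; set rho := r * enorm eta in rho0 *.
set A : R := cutcst _ in A0 *; set ra := r `^ alpha; set v := w eta in w0 *.
have ra0 : 0 <= ra by exact: powR_ge0.
move=> small large kk; clearbody A ra v rho.
have [r1|r1] := leP rho 1; last first.
  have rp : 0 < rho by exact: lt_trans r1.
  have {}large := large rp.
  have v1 : v <= ra.
    apply: le_trans kk; rewrite ler_peMl//.
    by rewrite -(powRr0 rho) ler_powR// ltW.
  have -> : peak rho = rho^-1.
    by rewrite /peak min_r// (le_trans _ (ltW r1))// invf_le1// ltW.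
  have h : (b * v) ^+ 2 <= (A / rho ^+ 2 * ra) ^+ 2.
    rewrite ler_pXn2r ?nnegrE//; [exact: ler_pM|exact: mulr_ge0|].
    by nonneg.
  rewrite -exprMn; apply: (@le_trans _ _ ((A / rho ^+ 2 * ra) ^+ 2 * (2 * rho ^+ 2))).
    have : 1 <= rho ^+ 2 by rewrite exprn_ege1// ltW.
    by move=> rho1; apply: ler_pM => //; [exact: sqr_ge0|lra|lra].
  have -> : (A / rho ^+ 2 * ra) ^+ 2 * (2 * rho ^+ 2) = 2 * A ^+ 2 * ra ^+ 2 * (rho^-1 * rho^-1).
    by field; rewrite gt_eqF.
  rewrite ler_wpM2l ?mulr_ge0 ?exprn_ge0// ler_piMl ?invr_ge0//.
  by rewrite invf_le1// ltW.
have pk : peak rho = rho.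
  move: r1; rewrite /peak; have [->|rn] := eqVneq rho 0; first by rewrite invr0 minxx.
  have rp : 0 < rho by rewrite lt_neqAle eq_sym rn.
  by move=> r1; rewrite min_l// (le_trans r1)// invf_ge1.
rewrite pk; have rK : rho ^+ K.+1 <= rho `^ alpha.
  rewrite -powR_mulrn//; have [->|rn] := eqVneq rho 0.
    by rewrite !powR0 ?gt_eqF//.
  by apply: ger_powR => //; rewrite r1 lt_neqAle eq_sym rn rho0.
have h : b * v <= A * (rho ^+ K.+1 * ra).
  apply: (@le_trans _ _ (A * rho ^+ (2 * K.+1) * v)); first exact: ler_wpM2r.
  rewrite mul2n -addnn exprD -!mulrA ler_wpM2l// ler_wpM2l ?exprn_ge0//.
  by apply: le_trans kk; rewrite ler_wpM2r.
have {}h : (b * v) ^+ 2 <= (A * (rho ^+ K.+1 * ra)) ^+ 2.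
  rewrite ler_pXn2r ?nnegrE//; first exact: mulr_ge0.
  by rewrite !mulr_ge0// exprn_ge0.
rewrite -exprMn; apply: (@le_trans _ _ ((A * (rho ^+ K.+1 * ra)) ^+ 2 * 2)).
  have rho1 : rho ^+ 2 <= 1 by rewrite exprn_ile1.
  have rho2 : 0 <= rho ^+ 2 by exact: sqr_ge0.
  by apply: ler_pM => //; [exact: sqr_ge0|lra|lra].
have -> : (A * (rho ^+ K.+1 * ra)) ^+ 2 * 2 = 2 * A ^+ 2 * ra ^+ 2 * (rho ^+ K * rho ^+ K.+1 * rho).
  by rewrite (exprS rho K); ring.
rewrite ler_wpM2l ?mulr_ge0 ?exprn_ge0// ler_piMl// mulr_ile1 ?exprn_ge0//; exact: exprn_ile1.
Qed.


Variables C1 C2 : R.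
Hypothesis C10 : 0 <= C1.
Hypothesis C20 : 0 <= C2.
Hypothesis decay : forall eta,
  (\int[leb1]_(t in `[1%R, 2%R]) (mc (t *: eta) ^+ 2 + ms (t *: eta) ^+ 2)%:E
     <= (C1 * w eta ^+ 2)%:E)%E.
Hypothesis ddecay : forall eta,
  (\int[leb1]_(t in `[1%R, 2%R]) (dmc t eta ^+ 2 + dms t eta ^+ 2)%:E
     <= (C2 * enorm eta ^+ 2 * w eta ^+ 2)%:E)%E.

Definition famcst : R := 4 * (C1 + C2) * cutcst K ^+ 2.

Lemma famcst_ge0 : 0 <= famcst.
Proof. by rewrite /famcst; nonneg. Qed.

Let tm eta : measurable_fun [set: measurableTypeR R]
  (fun t => mc (t *: eta) ^+ 2 + ms (t *: eta) ^+ 2).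
Proof.
have h : measurable_fun [set: measurableTypeR R] (fun t : measurableTypeR R => (t : R) *: eta).
  exact: measurable_rVZ.
apply: measurable_funD; apply: measurable_funX.
  exact: (measurableT_comp (measurable_mcos sigma mg) h).
exact: (measurableT_comp (measurable_msin sigma mg) h).
Qed.

Let tdm eta : measurable_fun [set: measurableTypeR R]
  (fun t => dmc t eta ^+ 2 + dms t eta ^+ 2).
Proof.
apply: measurable_funD; apply: measurable_funX.
  exact: (measurableT_comp (measurable_dmcos sigma mg) (measurable_pair2 eta)).
exact: (measurableT_comp (measurable_dmsin sigma mg) (measurable_pair2 eta)).
Qed.

(** The Sobolev length is the scale [r] itself: a derivative costs |eta|, about 1/r where the cutoff
    lives, so both terms have size r^-1 r^(2 alpha). The factor r^-1 is the loss of 1/2 in alpha. *)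
Lemma family_square_le r eta : 0 < r -> r <= 2^-1 ->
  (\int[leb1]_(t in `[1%R, 2%R]) ((pcos r t eta ^+ 2 + psin r t eta ^+ 2) / r +
     r * (dpcos r t eta ^+ 2 + dpsin r t eta ^+ 2))%:E <=
   (famcst * (r^-1 * (r `^ alpha) ^+ 2 * peak (r * enorm eta)))%:E)%E.
Proof.
move=> r0 rh; have A0 := @cutcst_ge0 R K.
have rho0 : 0 <= r * enorm eta by apply: mulr_ge0; [exact: ltW|exact: enorm_ge0].
(* One bound for the cutoff and its derivative at every frequency. At [eta = 0] the second entry is
   0 by the convention on division, which is harmless because the first one vanishes there too. *)
set b := Num.min (cutcst K * (r * enorm eta) ^+ (2 * K.+1)) (cutcst K / (r * enorm eta) ^+ 2).
have b0 : 0 <= b by rewrite le_min; apply/andP; split; nonneg.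
have le_b (x : R) : x <= cutcst K * (r * enorm eta) ^+ (2 * K.+1) ->
   (0 < r * enorm eta -> x <= cutcst K / (r * enorm eta) ^+ 2) -> x <= b.
  move=> h1 h2; rewrite le_min h1/=; have [/h2//|] := ltP 0 (r * enorm eta).
  move=> rho1; have E : r * enorm eta = 0 by apply/eqP; rewrite eq_le rho1.
  by move: h1; rewrite E expr0n mulnS/= mulr0 expr0n invr0 mulr0.
have bs : b <= cutcst K * (r * enorm eta) ^+ (2 * K.+1) by rewrite ge_min lexx.
have bl : 0 < r * enorm eta -> b <= cutcst K / (r * enorm eta) ^+ 2.
  by move=> _; rewrite ge_min lexx orbT.
have key2 := beta_key r0 b0 bs bl.
have cb t : 1 <= t <= 2 -> `|cutoff K r t eta| <= b.
  move=> t12; apply: le_b.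
    by rewrite ger0_norm ?cutoff_ge0//; apply: cutoff_le_small => //; exact: ltW.
  by move=> rp; rewrite ger0_norm ?cutoff_ge0//; apply: cutoff_le_large => //; exact: ltW.
have db t : 1 <= t <= 2 -> `|dcutoff K r t eta| <= b.
  move=> t12; apply: le_b; first by apply: norm_dcutoff_le_small => //; exact: ltW.
  by move=> rp; apply: norm_dcutoff_le_large => //; exact: ltW.
have sq (x : R) : `|x| <= b -> x ^+ 2 <= b ^+ 2.
  by move=> xb; rewrite -real_normK ?num_real// ler_pXn2r ?nnegrE.
pose m t := mc (t *: eta) ^+ 2 + ms (t *: eta) ^+ 2.
pose d t := dmc t eta ^+ 2 + dms t eta ^+ 2.
have m0 t : 0 <= m t by rewrite /m; nonneg.
have d0 t : 0 <= d t by rewrite /d; nonneg.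
have rV : 0 <= r^-1 by rewrite invr_ge0 ltW.
have p1 t : 1 <= t <= 2 -> pcos r t eta ^+ 2 + psin r t eta ^+ 2 <= b ^+ 2 * m t.
  move=> t12; rewrite /pcos /psin !exprMn -mulrDr ler_wpM2r ?m0//.
  exact/sq/cb.
have quad (x y u v : R) : `|x| <= b -> `|y| <= b ->
    (x * u + y * v) ^+ 2 <= 2 * b ^+ 2 * u ^+ 2 + 2 * b ^+ 2 * v ^+ 2.
  move=> /sq hx /sq hy.
  have h1 : x ^+ 2 * u ^+ 2 <= b ^+ 2 * u ^+ 2 by rewrite ler_wpM2r ?sqr_ge0.
  have h2 : y ^+ 2 * v ^+ 2 <= b ^+ 2 * v ^+ 2 by rewrite ler_wpM2r ?sqr_ge0.
  have := sqr_ge0 (x * u - y * v).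
  have -> : (x * u + y * v) ^+ 2 = 2 * (x ^+ 2 * u ^+ 2) + 2 * (y ^+ 2 * v ^+ 2) - (x * u - y * v) ^+ 2 by ring.
  by lra.
have p2 t : 1 <= t <= 2 -> dpcos r t eta ^+ 2 + dpsin r t eta ^+ 2 <=
    2 * b ^+ 2 * m t + 2 * b ^+ 2 * d t.
  move=> t12; have h1 := quad _ _ (mc (t *: eta)) (dmc t eta) (db t t12) (cb t t12).
  have h2 := quad _ _ (ms (t *: eta)) (dms t eta) (db t t12) (cb t t12).
  apply: le_trans (lerD h1 h2) _; rewrite /m /d le_eqVlt; apply/orP; left; apply/eqP; ring.
(* Lets the term from the derivative of the cutoff be absorbed in the undifferentiated term. *)
have r2 : 2 * r <= r^-1.
  have : 1 <= r^-1 by rewrite invf_ge1//; lra.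
  by lra.
apply: (@le_trans _ _ (\int[leb1]_(t in `[1%R, 2%R])
   ((2 * b ^+ 2 / r)%:E * (m t)%:E + (2 * r * b ^+ 2)%:E * (d t)%:E)))%E.
  apply: ge0_le_integral_in => t; rewrite /= in_itv/= => t12.
  rewrite -!EFinM -EFinD !lee_fin; apply/andP; split; first by nonneg.
  have h1 := ler_wpM2r rV (p1 t t12); have h2 := ler_wpM2l (ltW r0) (p2 t t12).
  apply: le_trans (lerD h1 h2) _.
  have h3 : 2 * r * (b ^+ 2 * m t) <= r^-1 * (b ^+ 2 * m t).
    by rewrite ler_wpM2r// mulr_ge0// sqr_ge0.
  rewrite -subr_ge0 (_ : _ - _ = r^-1 * (b ^+ 2 * m t) - 2 * r * (b ^+ 2 * m t)); last by ring.
  by rewrite subr_ge0.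
have mI : measurable (`[1%R, 2%R]%classic : set (measurableTypeR R)) by exact: measurable_itv.
have mm : measurable_fun (`[1%R, 2%R]%classic : set (measurableTypeR R)) (fun t => (m t)%:E).
  by apply/measurable_EFinP; apply: measurable_funTS; exact: tm.
have md : measurable_fun (`[1%R, 2%R]%classic : set (measurableTypeR R)) (fun t => (d t)%:E).
  by apply/measurable_EFinP; apply: measurable_funTS; exact: tdm.
have c0 : 0 <= 2 * b ^+ 2 / r by nonneg.
have c0' : 0 <= 2 * r * b ^+ 2 by nonneg.
rewrite ge0_integralD//; last 4 first.
- by move=> t _; rewrite -EFinM lee_fin mulr_ge0.
- by apply: measurable_funeM.
- by move=> t _; rewrite -EFinM lee_fin mulr_ge0.
- by apply: measurable_funeM.
rewrite !ge0_integralZl//; try (by move=> t _; rewrite lee_fin); try (by rewrite lee_fin).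
apply: le_trans (leeD (lee_wpmul2l _ (decay eta)) (lee_wpmul2l _ (ddecay eta))) _.
- by rewrite lee_fin.
- by rewrite lee_fin.
rewrite -!EFinM -EFinD lee_fin.
apply: (@le_trans _ _ (2 * (C1 + C2) / r * (b ^+ 2 * w eta ^+ 2 * (1 + (r * enorm eta) ^+ 2)))).
  have e1 : 0 <= C2 * (b ^+ 2 * w eta ^+ 2 / r) by nonneg.
  have e2 : 0 <= C1 * (b ^+ 2 * w eta ^+ 2 / r) * (r * enorm eta) ^+ 2 by nonneg.
  rewrite -subr_ge0 (_ : _ - _ = 2 * (C2 * (b ^+ 2 * w eta ^+ 2 / r)) +
    2 * (C1 * (b ^+ 2 * w eta ^+ 2 / r) * (r * enorm eta) ^+ 2)); first by lra.
  by field; rewrite gt_eqF.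
have c1 : 0 <= 2 * (C1 + C2) / r by nonneg.
apply: le_trans (ler_wpM2l c1 key2) _.
by rewrite /famcst le_eqVlt; apply/orP; left; apply/eqP; ring.
Qed.

Section square.
Variable f : 'rV[R]_n -> R.
Hypothesis intf : leb.-integrable setT (EFin \o f).
Variable M : nat.

(** For i < M + M the scales run from 2^-M to 2^(M-1). The bounds on integrals below are uniform in
    [M]. *)
Definition dyad i : R := 2 ^+ i / 2 ^+ M.

Lemma dyad_gt0 i : 0 < dyad i.
Proof. by rewrite divr_gt0// exprn_gt0. Qed.

Definition dyadic_square r x : \bar R := (\sum_(i < M + M)
  square_fun f (fun u xi => pcos r u (dyad i *: xi)) (fun u xi => psin r u (dyad i *: xi))
    (fun u xi => dpcos r u (dyad i *: xi)) (fun u xi => dpsin r u (dyad i *: xi)) r x)%E.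

Let theta r i xi := pcst r * gauss (r / Num.sqrt 2 * dyad i) xi.

Let gaussZ s L xi : gauss s (L *: xi) = gauss (s * L) xi.
Proof. by rewrite /gauss dotrZl dotrZr; congr expR; ring. Qed.

Let inttheta r i : 0 < r -> leb.-integrable setT (EFin \o theta r i).
Proof.
move=> r0; apply: integrableRZ; apply: integrable_gauss.
by rewrite mulr_gt0 ?dyad_gt0// divr_gt0// (lt_le_trans ltr01).
Qed.

Let lepc r i u xi : 0 < r -> 1 <= u <= 2 -> `|pcos r u (dyad i *: xi)| <= theta r i xi.
Proof. by move=> r0 u12; rewrite /theta -gaussZ; exact: pcos_le. Qed.
Let leps r i u xi : 0 < r -> 1 <= u <= 2 -> `|psin r u (dyad i *: xi)| <= theta r i xi.
Proof. by move=> r0 u12; rewrite /theta -gaussZ; exact: psin_le. Qed.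
Let ledpc r i u xi : 0 < r -> 1 <= u <= 2 -> `|dpcos r u (dyad i *: xi)| <= theta r i xi.
Proof. by move=> r0 u12; rewrite /theta -gaussZ; exact: dpcos_le. Qed.
Let ledps r i u xi : 0 < r -> 1 <= u <= 2 -> `|dpsin r u (dyad i *: xi)| <= theta r i xi.
Proof. by move=> r0 u12; rewrite /theta -gaussZ; exact: dpsin_le. Qed.

Lemma dyadic_square_ge0 r x : 0 < r -> (0 <= dyadic_square r x)%E.
Proof. by move=> r0; apply: sume_ge0 => i _; exact: square_fun_ge0. Qed.

Lemma measurable_dyadic_square r : 0 < r -> measurable_fun setT (dyadic_square r).
Proof.
move=> r0; apply: emeasurable_sum => i.
apply: measurable_square_fun => //.
- exact: measurable_pcos.
- exact: measurable_psin.
- exact: measurable_dpcos.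
- exact: measurable_dpsin.
Qed.

Lemma multop_le_dyadic_square r t x : 0 < r -> r <= 2^-1 -> (2 ^+ M)^-1 <= t -> t < 2 ^+ M ->
  ((multop f (fun xi => cutoff K r 1 (t *: xi) * mc (t *: xi))
             (fun xi => cutoff K r 1 (t *: xi) * ms (t *: xi)) x ^+ 2)%:E <= dyadic_square r x)%E.
Proof.
move=> r0 rh tM1 tM2.
(* The least [i] with [t <= 2 * dyad i]; when it is 0 the lower bound on t takes over. Thus t is a
   dyadic scale times some u in [1, 2]. *)
have [i iM /andP[i1 i2]] : exists2 i, (i < M + M)%N & dyad i <= t <= 2 * dyad i.
  have P : exists i, (i < M + M)%N && (t <= 2 * dyad i).
    have M0 : (0 < M + M)%N.
      rewrite addn_gt0 orbb lt0n; apply/eqP => M0.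
      by move: tM1 tM2; rewrite M0 expr0 invr1 => h1 h2; have := le_lt_trans h1 h2; rewrite ltxx.
    exists (M + M).-1; rewrite prednK// leqnn/= /dyad mulrA -exprS prednK// exprD.
    by rewrite mulfK ?expf_neq0// ltW.
  case: (ex_minnP P) => i /andP[iM ti] imin; exists i => //; rewrite ti andbT.
  case: i iM ti imin => [|i] iM ti imin; first by rewrite /dyad expr0 mul1r.
  rewrite leNgt; apply/negP => ti2.
  have := imin i; rewrite ltnn => h; have : false; last by [].
  apply: h; rewrite (ltn_trans _ iM)//=; move: ti2; rewrite /dyad exprS -mulrA => ti2.
  exact: ltW.
have L0 := dyad_gt0 i; set u := t / dyad i.
have u12 : 1 <= u <= 2 by rewrite /u ler_pdivlMr// mul1r i1 ler_pdivrMr.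
have E : t = u * dyad i by rewrite /u divfK// gt_eqF.
have cE xi : cutoff K r 1 (t *: xi) = cutoff K r u (dyad i *: xi).
  by rewrite /cutoff E -scalerA (gaussZ (r * 1)) mulr1.
have := multop_le_square intf (inttheta i r0) (measurable_pcos r (dyad i)) (measurable_psin r (dyad i))
  (measurable_dpcos r (dyad i)) (measurable_dpsin r (dyad i))
  (fun u xi => lepc i xi r0) (fun u xi => leps i xi r0)
  (fun u xi => ledpc i xi r0) (fun u xi => ledps i xi r0) _ _ x r0 rh u12.
have fc a b xi : 1 <= a -> a <= b -> b <= 2 ->
    pcos r b (dyad i *: xi) - pcos r a (dyad i *: xi) =
    \int[leb1]_(t in `[a, b]) dpcos r t (dyad i *: xi).
  move=> _ ab _; rewrite (FTC2_is_derive ab (fun u => is_derive_pcos r u _))//.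
  exact: continuous_dpcos.
have fs a b xi : 1 <= a -> a <= b -> b <= 2 ->
    psin r b (dyad i *: xi) - psin r a (dyad i *: xi) =
    \int[leb1]_(t in `[a, b]) dpsin r t (dyad i *: xi).
  move=> _ ab _; rewrite (FTC2_is_derive ab (fun u => is_derive_psin r u _))//.
  exact: continuous_dpsin.
move=> /(_ fc fs) H.
have ->  : (fun xi => cutoff K r 1 (t *: xi) * mc (t *: xi)) = (fun xi => pcos r u (dyad i *: xi)).
  by apply/funext => xi; rewrite cE /pcos E scalerA.
have ->  : (fun xi => cutoff K r 1 (t *: xi) * ms (t *: xi)) = (fun xi => psin r u (dyad i *: xi)).
  by apply/funext => xi; rewrite cE /psin E scalerA.
apply: (le_trans H); rewrite /dyadic_square (bigD1 (Ordinal iM))//= leeDl//.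
by apply: sume_ge0 => j _; exact: square_fun_ge0.
Qed.

(** Each scale is localised in frequency by [peak], and the sum over scales of ratio 2 is at most 6;
    then 24 is this 6 times the 4 of [integral_square_fun_le]. A second use of Bessel's inequality
    returns to [f]. *)
Lemma integral_dyadic_square_le r : 0 < r -> r <= 2^-1 ->
  (\int[leb]_x dyadic_square r x <=
   (24 * famcst * (r^-1 * (r `^ alpha) ^+ 2))%:E * \int[leb]_x (f x ^+ 2)%:E)%E.
Proof.
move=> r0 rh; rewrite /dyadic_square ge0_integral_sum//; last 2 first.
- move=> i; apply: measurable_square_fun => //; [exact: measurable_pcos|exact: measurable_psin|
    exact: measurable_dpcos|exact: measurable_dpsin].
- by move=> i x _; exact: square_fun_ge0.
pose D := famcst * (r^-1 * (r `^ alpha) ^+ 2).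
have rV : 0 <= r^-1 by rewrite invr_ge0 ltW.
have D0 : 0 <= D by have := famcst_ge0; rewrite /D => ?; nonneg.
pose A xi := fcos leb f id xi ^+ 2 + fsin leb f id xi ^+ 2.
have A0 xi : 0 <= A xi by rewrite /A; nonneg.
have mA : measurable_fun setT A.
  by apply: measurable_funD; apply: measurable_funX;
    [exact: (measurable_fcos (@measurable_id _ _ _) intf)|exact: (measurable_fsin (@measurable_id _ _ _) intf)].
pose p (i : nat) xi := peak (r * enorm (dyad i *: xi)).
have rE (i : nat) xi : r * enorm (dyad i *: xi) = r * enorm xi / 2 ^+ M * 2 ^+ i.
  by rewrite enormZ gtr0_norm ?dyad_gt0// /dyad; ring.
have p0 (i : nat) xi : 0 <= p i xi.
  have h : 0 <= r * enorm (dyad i *: xi) by apply: mulr_ge0; [exact: ltW|exact: enorm_ge0].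
  by rewrite /p /peak le_min h invr_ge0.
have menorm : measurable_fun setT (@enorm R n).
  apply: (@measurableT_comp _ _ _ _ _ _ (Num.sqrt : measurableTypeR R -> measurableTypeR R)).
    by apply: continuous_measurable_fun; exact: sqrt_continuous.
  by apply: measurable_sum => i; apply: measurable_funX; exact: measurable_coord.
have mp (i : nat) : measurable_fun setT (p i).
  have mh : measurable_fun setT (fun xi : 'rV[R]_n => r * enorm (dyad i *: xi)).
    by apply: measurable_funM => //; apply: (measurableT_comp menorm); exact: measurable_rVZ.
  rewrite (_ : p i = (fun xi => Num.min (r * enorm (dyad i *: xi)) ((r * enorm (dyad i *: xi)) `^ (-1)))).
    by apply: measurable_minr => //; apply: (measurableT_comp (measurable_powR (-1))).
  apply/funext => xi; rewrite /p /peak powR_inv1//.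
  by apply: mulr_ge0; [exact: ltW|exact: enorm_ge0].
apply: (@le_trans _ _ (\sum_(i < M + M) \int[leb]_xi (4 * D * (A xi * p i xi))%:E)%E).
  apply: lee_sum => i _.
  apply: le_trans (integral_square_fun_le intf (inttheta i r0) (measurable_pcos r (dyad i)) (measurable_psin r (dyad i))
    (measurable_dpcos r (dyad i)) (measurable_dpsin r (dyad i))
    (fun u xi => lepc i xi r0) (fun u xi => leps i xi r0)
    (fun u xi => ledpc i xi r0) (fun u xi => ledps i xi r0) r0) _.
  apply: ge0_le_integralT => xi; apply/andP; split.
    by apply: mule_ge0; [rewrite lee_fin mulr_ge0//; exact: A0|
       apply: integral_ge0 => t _; rewrite lee_fin; nonneg].
  have h : (0 <= (4 * A xi)%:E)%E by rewrite lee_fin mulr_ge0.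
  apply: le_trans (lee_wpmul2l h (family_square_le (dyad i *: xi) r0 rh)) _.
  rewrite -EFinM lee_fin /p /D le_eqVlt; apply/orP; left; apply/eqP; ring.
rewrite -ge0_integral_sum//; last 2 first.
- by move=> i; apply/measurable_EFinP; apply: measurable_funM => //; apply: measurable_funM => //; exact: mp.
- by move=> i xi _; rewrite lee_fin; exact: (mulr_ge0 (mulr_ge0 (ler0n R 4) D0) (mulr_ge0 (A0 xi) (p0 i xi))).
apply: (@le_trans _ _ (\int[leb]_xi ((24 * D)%:E * (A xi)%:E))%E).
  apply: ge0_le_integralT => xi; apply/andP; split.
    by apply: sume_ge0 => i _; rewrite lee_fin; exact: (mulr_ge0 (mulr_ge0 (ler0n R 4) D0) (mulr_ge0 (A0 xi) (p0 i xi))).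
  rewrite sumEFin -EFinM lee_fin -mulr_sumr -mulr_sumr.
  have x0 : 0 <= r * enorm xi / 2 ^+ M.
    by rewrite !mulr_ge0 ?enorm_ge0 ?invr_ge0 ?exprn_ge0// ltW.
  have := @sum_peak_le R 2 (r * enorm xi / 2 ^+ M) (M + M) _ x0.
  rewrite ltr1n => /(_ isT).
  under eq_bigr do rewrite -rE.
  rewrite (_ : 2 * (1 + 2) / (2 - 1) = 6); last by field.
  move=> h; have := ler_wpM2l (mulr_ge0 (mulr_ge0 (ler0n R 4) D0) (A0 xi)) h.
  rewrite (_ : 4 * D * A xi * 6 = 24 * D * A xi); last ring.
  by rewrite -!mulrA.
rewrite ge0_integralZl//; try (by move=> t _; rewrite lee_fin); last 2 first.
- exact/measurable_EFinP.
- by rewrite lee_fin mulr_ge0.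
rewrite /D mulrA; apply: lee_wpmul2l; last exact: bessel.
by rewrite lee_fin -mulrA mulr_ge0.
Qed.

End square.

End family.

(** * Gaussian averages of sigma as multiplier operators *)

Section multop_linear.
Context {R : realType} {n : nat}.
Notation leb := (lebesgue_rV n : {sigma_finite_measure set 'rV[R]_n -> \bar R}).
Variable f : 'rV[R]_n -> R.
Hypothesis intf : leb.-integrable setT (EFin \o f).

Lemma multop_sum m (c : 'I_m -> R) (a b : 'I_m -> 'rV[R]_n -> R) (theta : 'rV[R]_n -> R) x :
  (forall i, measurable_fun setT (a i)) -> (forall i, measurable_fun setT (b i)) ->
  leb.-integrable setT (EFin \o theta) ->
  (forall i xi, `|a i xi| <= theta xi) -> (forall i xi, `|b i xi| <= theta xi) ->
  \sum_i c i * multop f (a i) (b i) x =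
  multop f (fun xi => \sum_i c i * a i xi) (fun xi => \sum_i c i * b i xi) x.
Proof.
move=> ma mb it ha hb.
have I i := integrable_multop intf x (ma i) (mb i) it (ha i) (hb i).
rewrite /multop; under eq_bigr do rewrite -RintegralZl//.
rewrite -Rintegral_sum; last by move=> i; exact: integrableRZ.
apply: eq_Rintegral => xi _; rewrite !big_distrl/= -big_split/=.
by apply: eq_bigr => i _; ring.
Qed.

Lemma multopB (a b a' b' : 'rV[R]_n -> R) (theta : 'rV[R]_n -> R) x :
  measurable_fun setT a -> measurable_fun setT b ->
  measurable_fun setT a' -> measurable_fun setT b' ->
  leb.-integrable setT (EFin \o theta) ->
  (forall xi, `|a xi| <= theta xi) -> (forall xi, `|b xi| <= theta xi) ->
  (forall xi, `|a' xi| <= theta xi) -> (forall xi, `|b' xi| <= theta xi) ->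
  multop f a b x - multop f a' b' x =
  multop f (fun xi => a xi - a' xi) (fun xi => b xi - b' xi) x.
Proof.
move=> ma mb ma' mb' it ha hb ha' hb'; rewrite /multop -RintegralB//.
- by apply: eq_Rintegral => xi _; ring.
- exact: (integrable_multop intf x ma mb it ha hb).
- exact: (integrable_multop intf x ma' mb' it ha' hb').
Qed.
End multop_linear.

Section averages.
Context {R : realType} {n : nat}.
Notation leb := (lebesgue_rV n : {sigma_finite_measure set 'rV[R]_n -> \bar R}).
Variable sigma : {finite_measure set 'rV[R]_n -> \bar R}.
Variable g : 'rV[R]_n -> 'rV[R]_n.
Hypothesis mg : measurable_fun setT g.
Implicit Types (f h : 'rV[R]_n -> R) (x xi : 'rV[R]_n) (r s t : R).
Local Notation mc := (mcos sigma g).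
Local Notation ms := (msin sigma g).
Local Notation W := (mass sigma).

(** The smoothing length is [t * s]: it follows the dilation, so [s] is the scale relative to the
    dilated measure. *)
Definition avg f t s x : R := \int[sigma]_z heatop (t * s) f (x - t *: g z).

Let int1 : sigma.-integrable setT (EFin \o (cst (1:R) : 'rV[R]_n -> R)).
Proof. exact: finite_measure_integrable_cst. Qed.

Lemma avg_multop f t s x : leb.-integrable setT (EFin \o f) -> 0 < t -> 0 < s ->
  avg f t s x = multop f (fun xi => gauss (t * s) xi * mc (t *: xi))
                         (fun xi => gauss (t * s) xi * ms (t *: xi)) x.
Proof.
move=> intf t0 s0; have ts0 : 0 < t * s by exact: mulr_gt0.
pose fc := fcos leb f id; pose fs := fsin leb f id.
have mfc : measurable_fun setT fc by exact: (measurable_fcos (@measurable_id _ _ _) intf).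
have mfs : measurable_fun setT fs by exact: (measurable_fsin (@measurable_id _ _ _) intf).
set N := \int[leb]_y `|f y|.
have fcN xi : `|fc xi| <= N by exact: (norm_fcos_le (@measurable_id _ _ _) intf xi).
have fsN xi : `|fs xi| <= N by exact: (norm_fsin_le (@measurable_id _ _ _) intf xi).
pose k (z xi : 'rV[R]_n) := gauss (t * s) xi *
   (cos (2 * pi * dotr (x - t *: g z) xi) * fc xi + sin (2 * pi * dotr (x - t *: g z) xi) * fs xi).
transitivity (\int[sigma]_z \int[leb]_xi k z xi).
  by apply: eq_Rintegral => z _; rewrite heatop_fourier.
have m2 : measurable_fun setT (fun z : 'rV[R]_n * 'rV[R]_n => x - t *: g z.1).
  by apply: measurable_rVB => //; apply: measurable_rVZ => //; exact: measurableT_comp.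
rewrite (@Rintegral_swap _ _ 'rV[R]_n 'rV[R]_n R sigma leb (cst (1:R)) (fun xi => 2 * N * gauss (t * s) xi) k)//; last 3 first.
- by apply: integrableRZ; exact: integrable_gauss.
- apply: measurable_funM; first exact: measurable_gauss.
  apply: measurable_funD; apply: measurable_funM.
  + exact: measurable_cos2.
  + exact: (measurableT_comp mfc).
  + exact: measurable_sin2.
  + exact: (measurableT_comp mfs).
- move=> z xi; rewrite mul1r normrM (ger0_norm (gauss_ge0 _ _)) mulrC ler_wpM2r ?gauss_ge0//.
  apply: le_trans (ler_normD _ _) _; rewrite (_ : 2 * N = N + N); last ring.
  by apply: lerD; rewrite mulrC; apply: le_trans (norm_mul_cos_le _ _) _ || apply: le_trans (norm_mul_sin_le _ _) _.
apply: eq_Rintegral => xi _; rewrite /k.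
set a := 2 * pi * dotr x xi.
have E z : 2 * pi * dotr (x - t *: g z) xi = a - 2 * pi * dotr (g z) (t *: xi).
  by rewrite /a dotrBl dotrZl dotrZr; ring.
have Ic := @integrable_bounded_finite _ _ sigma (fun z => cos (2 * pi * dotr (x - t *: g z) xi)) 1.
have Is := @integrable_bounded_finite _ _ sigma (fun z => sin (2 * pi * dotr (x - t *: g z) xi)) 1.
have m1 : measurable_fun setT (fun z => x - t *: g z).
  by apply: measurable_rVB => //; exact: measurable_rVZ.
have {}Ic := Ic (measurable_cos2 m1 (@measurable_cst _ _ _ _ _ xi)).
have {}Is := Is (measurable_sin2 m1 (@measurable_cst _ _ _ _ _ xi)).
have c1 z : `|cos (2 * pi * dotr (x - t *: g z) xi)| <= 1 by rewrite ler_norml cos_geN1 cos_le1.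
have s1 z : `|sin (2 * pi * dotr (x - t *: g z) xi)| <= 1 by rewrite ler_norml sin_geN1 sin_le1.
have {}Ic := Ic c1; have {}Is := Is s1.
have IC : \int[sigma]_z cos (2 * pi * dotr (x - t *: g z) xi) = cos a * mc (t *: xi) + sin a * ms (t *: xi).
  rewrite -(@fcosD _ _ _ _ _ (cst 1) g mg int1 a (t *: xi)).
  by apply: eq_Rintegral => z _; rewrite E mul1r.
have IS : \int[sigma]_z sin (2 * pi * dotr (x - t *: g z) xi) = sin a * mc (t *: xi) - cos a * ms (t *: xi).
  rewrite -(@fsinD _ _ _ _ _ (cst 1) g mg int1 a (t *: xi)).
  by apply: eq_Rintegral => z _; rewrite E mul1r.
transitivity (\int[sigma]_z (gauss (t * s) xi * fc xi * cos (2 * pi * dotr (x - t *: g z) xi) +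
   gauss (t * s) xi * fs xi * sin (2 * pi * dotr (x - t *: g z) xi))).
  by apply: eq_Rintegral => z _; ring.
rewrite RintegralD//; try exact: integrableRZ.
rewrite !RintegralZl// IC IS (dotrC xi x) -/a -/fc -/fs.
by ring.
Qed.

Variable K : nat.

(** The coefficients of 1 - (1 - e)^(K+1) as a polynomial in e. Since the power i+1 of a Gaussian is
    the Gaussian with scale multiplied by sqrt (i+1), the smoothing is a finite combination of
    Gaussian averages, which the bounds by positive kernels require. *)
Definition bincoef (i : nat) : R := (-1) ^+ i *+ 'C(K.+1, i.+1).

Lemma sum_bincoef (e : R) : \sum_(i < K.+1) bincoef i * e ^+ i.+1 = 1 - (1 - e) ^+ K.+1.
Proof.
rewrite exprDn [in RHS]big_ord_recl/= expr1n expr0 mulr1 bin0 mulr1n opprD addrA subrr add0r -sumrN.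
apply: eq_bigr => i _; rewrite /bincoef /bump add1n expr1n mul1r [in RHS]exprNn exprS.
by rewrite mulrnAl -mulNrn; congr (_ *+ _); rewrite (exprS (-1)); ring.
Qed.

Definition smooth f r t x : R := \sum_(i < K.+1) bincoef i * avg f t (r * Num.sqrt i.+1%:R) x.

Let sqrt_gt0' i : 0 < Num.sqrt i.+1%:R :> R.
Proof. by rewrite sqrtr_gt0. Qed.

Let gauss_sqrt r i xi : gauss (r * Num.sqrt i.+1%:R) xi = gauss r xi ^+ i.+1.
Proof.
by rewrite /gauss -expRM_natl; congr expR; rewrite exprMn sqr_sqrtr//; ring.
Qed.

Let gauss_decr s s' xi : 0 <= s -> s <= s' -> gauss s' xi <= gauss s xi.
Proof. exact: gauss_anti. Qed.

Lemma smooth_multop f r t x : leb.-integrable setT (EFin \o f) -> 0 < t -> 0 < r ->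
  smooth f r t x =
  multop f (fun xi => (1 - (1 - gauss r (t *: xi)) ^+ K.+1) * mc (t *: xi))
           (fun xi => (1 - (1 - gauss r (t *: xi)) ^+ K.+1) * ms (t *: xi)) x.
Proof.
move=> intf t0 r0; rewrite /smooth.
have mt : measurable_fun setT (fun xi : 'rV[R]_n => t *: xi) by exact: measurable_rVZ.
have mmc : measurable_fun setT (fun xi => mc (t *: xi)) by exact: (measurableT_comp (measurable_mcos sigma mg) mt).
have mms : measurable_fun setT (fun xi => ms (t *: xi)) by exact: (measurableT_comp (measurable_msin sigma mg) mt).
under eq_bigr => i _ do rewrite (avg_multop x intf t0 (mulr_gt0 r0 (sqrt_gt0' i))).
have bd i (u : R) xi : `|u| <= W -> `|gauss (t * (r * Num.sqrt i.+1%:R)) xi * u| <= W * gauss (t * r) xi.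
  move=> uW; rewrite normrM (ger0_norm (gauss_ge0 _ _)) mulrC.
  have tr : 0 <= t * r by rewrite mulr_ge0 ?ltW.
  have h : gauss (t * (r * Num.sqrt i.+1%:R)) xi <= gauss (t * r) xi.
    apply: gauss_decr => //; rewrite mulrA ler_peMr//.
    by rewrite -[leLHS]sqrtr1 ler_sqrt// ler1n.
  exact: (ler_pM (normr_ge0 _) (gauss_ge0 _ _) uW h).
rewrite (@multop_sum _ _ f intf K.+1 _ _ _ (fun xi => W * gauss (t * r) xi))//.
- have E u : (fun xi => \sum_(i < K.+1) bincoef i * (gauss (t * (r * Num.sqrt i.+1%:R)) xi * u (t *: xi))) =
     (fun xi => (1 - (1 - gauss r (t *: xi)) ^+ K.+1) * u (t *: xi)).
    apply/funext => xi; rewrite -sum_bincoef big_distrl/=; apply: eq_bigr => i _.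
    rewrite mulrA (mulrA t) gauss_sqrt; congr (_ * _ ^+ _ * _).
    by rewrite /gauss dotrZl dotrZr; congr expR; ring.
  by rewrite (E mc) (E ms).
- by move=> i; apply: measurable_funM => //; exact: measurable_gauss.
- by move=> i; apply: measurable_funM => //; exact: measurable_gauss.
- by apply: integrableRZ; apply: integrable_gauss; exact: mulr_gt0.
- by move=> i xi; apply: bd; exact: norm_mcos_le.
- by move=> i xi; apply: bd; exact: norm_msin_le.
Qed.

Lemma smoothB_multop f r t x : leb.-integrable setT (EFin \o f) -> 0 < t -> 0 < r ->
  smooth f r t x - smooth f (2 * r) t x =
  multop f (fun xi => cutoff K r 1 (t *: xi) * mc (t *: xi))
           (fun xi => cutoff K r 1 (t *: xi) * ms (t *: xi)) x.
Proof.
move=> intf t0 r0; rewrite !smooth_multop//; last by rewrite mulr_gt0.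
have mt : measurable_fun setT (fun xi : 'rV[R]_n => t *: xi) by exact: measurable_rVZ.
have mmc : measurable_fun setT (fun xi => mc (t *: xi)) by exact: (measurableT_comp (measurable_mcos sigma mg) mt).
have mms : measurable_fun setT (fun xi => ms (t *: xi)) by exact: (measurableT_comp (measurable_msin sigma mg) mt).
have W0 := mass_ge0 sigma.
have gt (s : R) xi : gauss s (t *: xi) = gauss (s * t) xi.
  by rewrite /gauss dotrZl dotrZr; congr expR; ring.
have bd (s u : R) xi : 0 < s -> r <= s -> `|u| <= W ->
    `|(1 - (1 - gauss s (t *: xi)) ^+ K.+1) * u| <= K.+1%:R * W * gauss (r * t) xi.
  move=> s0 rs uW; have /andP[g0 g1] := @gauss01 R n s (t *: xi).
  have := @bernoulli_le _ _ K.+1 (gauss01 s (t *: xi)) => h'.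
  have h : 1 - (1 - gauss s (t *: xi)) ^+ K.+1 <= K.+1%:R * gauss s (t *: xi) by lra.
  have h0 : 0 <= 1 - (1 - gauss s (t *: xi)) ^+ K.+1.
    by rewrite subr_ge0 exprn_ile1 ?subr_ge0// gerBl.
  rewrite normrM (ger0_norm h0).
  apply: (@le_trans _ _ (K.+1%:R * gauss (r * t) xi * W)).
    have t0' := ltW t0; have r0' := ltW r0.
    have h1 : gauss s (t *: xi) <= gauss (r * t) xi.
      by rewrite gt; apply: gauss_decr; [exact: mulr_ge0|exact: ler_wpM2r].
    have h2 := le_trans h (ler_wpM2l (ler0n R K.+1) h1).
    exact: (ler_pM h0 (normr_ge0 _) h2 uW).
  by rewrite mulrAC.
have mm (s : R) (u : 'rV[R]_n -> R) : measurable_fun setT (fun xi => u (t *: xi)) ->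
   measurable_fun setT (fun xi => (1 - (1 - gauss s (t *: xi)) ^+ K.+1) * u (t *: xi)).
  move=> mu; apply: measurable_funM => //; apply: measurable_funB => //.
  by apply: measurable_funX; apply: measurable_funB => //; exact: measurable_gauss.
have r20 : 0 < 2 * r by rewrite mulr_gt0.
have r2 : r <= 2 * r by rewrite ler_peMl ?ltW// ltr1n.
rewrite (@multopB _ _ f intf _ _ _ _ (fun xi => K.+1%:R * W * gauss (r * t) xi))//; try exact: mm.
- have E u : (fun xi => (1 - (1 - gauss r (t *: xi)) ^+ K.+1) * u (t *: xi) -
     (1 - (1 - gauss (2 * r) (t *: xi)) ^+ K.+1) * u (t *: xi)) = (fun xi => cutoff K r 1 (t *: xi) * u (t *: xi)).
    apply/funext => xi; rewrite /cutoff /psi mulr1.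
    have -> : gauss (2 * r) (t *: xi) = gauss r (t *: xi) ^+ 4.
      by rewrite /gauss -expRM_natl; congr expR; ring.
    by ring.
  by rewrite (E mc) (E ms).
- by apply: integrableRZ; apply: integrable_gauss; exact: mulr_gt0.
- by move=> xi; apply: bd => //; exact: norm_mcos_le.
- by move=> xi; apply: bd => //; exact: norm_msin_le.
- by move=> xi; apply: bd => //; exact: norm_mcos_le.
- by move=> xi; apply: bd => //; exact: norm_msin_le.
Qed.

End averages.

(** * Domination by the Hardy-Littlewood maximal function *)

Section shells.
Context {R : realType}.

(** For the least i with a < 2^i, pi a^2 is at least 4^(i-1) unless i = 0, and exp x >= x^(m+1) /
    (m+1)!. With m = n this polynomial rate already beats the two factors 2^(i n) met below. *)
Lemma gaussian_shell m (a : R) : 0 <= a -> exists2 i, a < 2 ^+ i &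
  expR (- (pi * a ^+ 2)) <= m.+1`!%:R * 4 ^+ m.+1 / 4 ^+ (i * m.+1).
Proof.
move=> a0.
have P : exists i, a < 2 ^+ i.
  exists (Num.truncn a).+1; apply: lt_le_trans (truncnS_gt a) _.
  by rewrite -natrX ler_nat ltnW// ltn_expl.
case: (ex_minnP P) => i ai imin; exists i => //.
have D1 : 1 <= m.+1`!%:R * 4 ^+ m.+1 :> R.
  by rewrite mulr_ege1// ?ler1n ?fact_gt0// exprn_ege1// ler1n.
case: i ai imin => [|i] ai imin.
  rewrite mul0n expr0 divr1; apply: le_trans D1.
  by rewrite -expR0 ler_expR oppr_le0; nonneg.
have ia : 2 ^+ i <= a by rewrite leNgt; apply/negP => /imin; rewrite ltnn.
have x4 : 4 ^+ i <= pi * a ^+ 2.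
  have h : (2 ^+ i) ^+ 2 <= a ^+ 2 by rewrite ler_pXn2r ?nnegrE// exprn_ge0.
  have -> : 4 ^+ i = (2 ^+ i) ^+ 2 :> R by rewrite exprAC; congr (_ ^+ _); rewrite -natrX.
  by apply: (le_trans h); rewrite ler_peMl ?sqr_ge0//; have := pi_ge2 R; lra.
have x0 : 0 < pi * a ^+ 2 by apply: lt_le_trans x4; rewrite exprn_gt0.
have := expR_ge1Dxn m (ltW x0) => h.
have f0 : 0 < m.+1`!%:R :> R by rewrite ltr0n fact_gt0.
have {}h : (pi * a ^+ 2) ^+ m.+1 / m.+1`!%:R <= expR (pi * a ^+ 2) by lra.
have h4 : 4 ^+ (i * m.+1) / m.+1`!%:R <= expR (pi * a ^+ 2).
  apply: le_trans h; rewrite ler_pM2r ?invr_gt0// exprM ler_pXn2r ?nnegrE ?exprn_ge0//.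
  exact: ltW.
rewrite expRN -[leRHS]invrK lef_pV2 ?posrE ?expR_gt0 ?invr_gt0 ?divr_gt0 ?mulr_gt0 ?exprn_gt0//.
apply: le_trans h4; rewrite le_eqVlt; apply/orP; left; apply/eqP.
by rewrite mulSn exprD; field; rewrite !expf_neq0//= gt_eqF.
Qed.

End shells.

Section maximal_bound.
Context {R : realType} {n : nat}.
Notation leb := (lebesgue_rV n : {sigma_finite_measure set 'rV[R]_n -> \bar R}).
Variable sigma : {finite_measure set 'rV[R]_n -> \bar R}.
Variable g : 'rV[R]_n -> 'rV[R]_n.
Hypothesis mg : measurable_fun setT g.
Variable B : R.
Hypothesis gB : forall z, enorm (g z) <= B.
Hypothesis gsigma : {ae sigma, forall z, g z = z}.
Implicit Types (h : 'rV[R]_n -> R) (x y z : 'rV[R]_n) (r s t : R).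
Local Notation W := (mass sigma).

Let B0 : 0 <= B. Proof. exact: le_trans (enorm_ge0 _) (gB 0). Qed.

Lemma measure_preimage_ae (A : set 'rV[R]_n) : measurable A -> sigma (g @^-1` A) = sigma A.
Proof.
move=> mA; have mgA : measurable (g @^-1` A) by rewrite -[X in measurable X]setTI; exact: mg.
have mi : measurable_fun setT (\1_A : 'rV[R]_n -> R) by exact: measurable_indic.
have := @ae_eq_g _ _ sigma g mg gsigma (\1_A) mi.
rewrite /Rintegral integral_indic// setIT.
rewrite (_ : (\int[sigma]_x (\1_A (g x))%:E)%E = (\int[sigma]_x (\1_(g @^-1` A) x)%:E)%E); last first.
  by apply: eq_integral => z _; rewrite !indicE; congr (_%:R%:E); apply/idP/idP => /set_mem ?; apply/mem_set.
rewrite integral_indic// setIT => E.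
rewrite -[LHS]fineK ?fin_num_measure// -[RHS]fineK ?fin_num_measure//.
by rewrite E.
Qed.

Lemma norm_heatop_le h r x : 0 < r -> leb.-integrable setT (EFin \o h) ->
  ((`|heatop r h x|)%:E <= \int[leb]_y (`|h y| * heat r (x - y))%:E)%E.
Proof.
move=> r0 ih; have I := integrable_mul_heat x r0 ih.
rewrite /heatop (_ : (`|_|%:E) = `|(\int[leb]_y (h y * heat r (x - y)))%:E|)%E//.
rewrite EFin_Rintegral//; apply: le_trans (le_abse_integral _ _ _) _ => //.
  by case/integrableP : I.
apply: ge0_le_integralT => y; rewrite abse_ge0/= lee_fin normrM.
by rewrite (ger0_norm (heat_ge0 _ r0)).
Qed.

Let msub t x : measurable_fun setT (fun z => x - t *: g z).
Proof. by apply: measurable_rVB => //; exact: measurable_rVZ. Qed.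

Lemma integrable_heatop_comp h r t x : 0 < r -> leb.-integrable setT (EFin \o h) ->
  sigma.-integrable setT (EFin \o (fun z => heatop r h (x - t *: g z))).
Proof.
move=> r0 ih; have mh : measurable_fun setT h.
  by apply/measurable_EFinP; case/integrableP : ih.
apply: (@integrable_bounded_finite _ _ sigma _ (r^-1 ^+ n * \int[leb]_y `|h y|)).
  exact: (measurableT_comp (measurable_heatop r mh) (msub t x)).
move=> z; rewrite /heatop; apply: le_trans (le_normr_Rintegral _ (integrable_mul_heat _ r0 ih)) _ => //.
rewrite -RintegralZl//; last exact: integrable_norm ih.
apply: le_Rintegral => //.
- by have := integrable_norm (integrable_mul_heat (x - t *: g z) r0 ih).
- apply: integrableRZ; exact: integrable_norm ih.
- move=> y _; rewrite normrM mulrC ler_wpM2r// (ger0_norm (heat_ge0 _ r0)).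
  exact: heat_le.
Qed.

Lemma norm_avg_le h t s x : 0 < t -> 0 < s -> leb.-integrable setT (EFin \o h) ->
  ((`|avg sigma g h t s x|)%:E <=
   \int[leb]_y ((`|h y|)%:E * \int[sigma]_z (heat (t * s) (x - t *: g z - y))%:E))%E.
Proof.
move=> t0 s0 ih; have ts0 : 0 < t * s by exact: mulr_gt0.
have mh : measurable_fun setT h by apply/measurable_EFinP; case/integrableP : ih.
have I := integrable_heatop_comp t x ts0 ih.
rewrite /avg (_ : (`|_|%:E) = `|(\int[sigma]_z heatop (t * s) h (x - t *: g z))%:E|)%E//.
rewrite EFin_Rintegral//; apply: le_trans (le_abse_integral _ _ _) _ => //.
  by case/integrableP : I.
pose k (w : 'rV[R]_n * 'rV[R]_n) : \bar R := (`|h w.2| * heat (t * s) (x - t *: g w.1 - w.2))%:E.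
have mk : measurable_fun setT k.
  apply/measurable_EFinP; apply: measurable_funM.
    by apply: measurableT_comp => //; exact: (measurableT_comp mh).
  apply: measurable_heat; apply: measurable_rVB => //.
  exact: (measurableT_comp (msub t x)).
have k0 w : (0 <= k w)%E by rewrite lee_fin mulr_ge0//; exact: heat_ge0.
apply: (@le_trans _ _ (\int[sigma]_z \int[leb]_y k (z, y))%E).
  apply: ge0_le_integralT => z; rewrite abse_ge0/=.
  exact: norm_heatop_le.
rewrite (fubini_tonelli k mk k0).
apply: ge0_le_integralT => y; apply/andP; split; first by apply: integral_ge0 => z _; exact: k0.
rewrite -ge0_integralZl//.
- by apply/measurable_EFinP; apply: measurable_heat; apply: measurable_rVB.
- by move=> z _; rewrite lee_fin; exact: heat_ge0.
Qed.

(** The real-valued form of [hardy_littlewood], with which it is identified later. *)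
Definition hlmax h x : \bar R := ereal_sup [set ((lebesgue_rV n (eball x r))^-1 *
    \int[lebesgue_rV n]_(y in eball x r) (`|h y|)%:E)%E | r in [set r : R | 0 < r]].

Lemma hlmax_ge0 h x : (0 <= hlmax h x)%E.
Proof.
apply: le_trans (ereal_sup_ubound _); last by exists 1 => //=.
apply: mule_ge0; last by apply: integral_ge0.
have := @eball_volume_gt0 R n x 1 ltr01.
have : (lebesgue_rV n (eball x (1:R)) \is a fin_num)%E.
  by rewrite ge0_fin_numE//; apply: le_lt_trans (eball_volume_le _ _) _ => //; exact: ltry.
by case: (lebesgue_rV n _) => // v _; rewrite lte_fin => v0; rewrite inver gt_eqF// lee_fin invr_ge0 ltW.
Qed.

Lemma integral_eball_le h x r : 0 < r ->
  (\int[leb]_(y in eball x r) (`|h y|)%:E <= ((2 * r) ^+ n)%:E * hlmax h x)%E.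
Proof.
move=> r0; have v0 := eball_volume_gt0 x r0; have vle := eball_volume_le x (ltW r0).
apply: (@le_trans _ _ (lebesgue_rV n (eball x r) * hlmax h x)%E); last first.
  by apply: lee_wpmul2r => //; exact: hlmax_ge0.
have vf : (lebesgue_rV n (eball x r) \is a fin_num)%E.
  by rewrite ge0_fin_numE//; apply: le_lt_trans vle _; exact: ltry.
have : ((lebesgue_rV n (eball x r))^-1 * \int[leb]_(y in eball x r) (`|h y|)%:E <= hlmax h x)%E.
  by apply: ereal_sup_ubound; exists r.
move: v0 vf {vle}; case: (lebesgue_rV n (eball x r)) => // v; rewrite lte_fin => v0 _.
by rewrite inver gt_eqF// lee_pdivrMl.
Qed.

Variables (beta C S0 : R).
Hypothesis beta0n : 0 <= beta <= n%:R.
Hypothesis C0 : 0 <= C.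
Hypothesis S00 : 0 < S0.
Hypothesis dim : forall x r, 0 < r -> (sigma (eball x r) <= (C * r `^ beta)%:E)%E.

Let D : R := n.+1`!%:R * 4 ^+ n.+1.
Let D0 : 0 <= D. Proof. by rewrite /D; nonneg. Qed.
Let w i : R := D / 4 ^+ (i * n.+1).
Let w0 i : 0 <= w i. Proof. by rewrite /w; nonneg. Qed.
Let b t s i : R := (t * s)^-1 ^+ n * w i * (C * (2 ^+ i * s) `^ beta).
Let b0 t s i : 0 < t -> 0 < s -> 0 <= b t s i.
Proof. by move=> t0 s0; have ts := ltW (mulr_gt0 t0 s0); rewrite /b; nonneg. Qed.
Let Rad i : R := 2 ^+ i * (B + S0).

(** On the i-th shell [x - t *: g z - y] has length below t s 2^i. This confines [g z] to a ball of
    radius s 2^i, whose mass the dimension of sigma controls, and [y] to a ball around x of radius t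
    (B + s 2^i). *)
Let sigma_heat_le t s x y : 0 < t -> 0 < s -> s <= S0 ->
  (\int[sigma]_z (heat (t * s) (x - t *: g z - y))%:E <=
   \sum_(i <oo) (b t s i * \1_(eball x (t * Rad i)) y)%:E)%E.
Proof.
move=> t0 s0 sS; have ts0 : 0 < t * s by exact: mulr_gt0.
pose E i : set 'rV[R]_n := [set z | enorm (x - t *: g z - y) < t * s * 2 ^+ i].
pose c i : R := (t * s)^-1 ^+ n * w i.
have c0 i : 0 <= c i by have := ltW ts0 => ?; rewrite /c; nonneg.
have vE z : g z - t^-1 *: (x - y) = (- t^-1) *: (x - t *: g z - y).
  by apply/rowP => j; rewrite !mxE; field; rewrite gt_eqF.
have EE i : E i = g @^-1` (eball (t^-1 *: (x - y)) (s * 2 ^+ i)).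
  apply/seteqP; split => z; rewrite /E /eball/= vE enormZ normrN gtr0_norm ?invr_gt0//;
    by rewrite (mulrC t^-1) ltr_pdivrMr// (mulrC _ t) mulrA.
have mE i : measurable (E i).
  by rewrite EE -[X in measurable X]setTI; apply: mg => //; exact: measurable_eball.
apply: (@le_trans _ _ (\int[sigma]_z \sum_(i <oo) (c i * \1_(E i) z)%:E)%E).
  apply: ge0_le_integralT => z; rewrite lee_fin heat_ge0//=.
  set v := x - t *: g z - y.
  have a0 : 0 <= enorm v / (t * s) by rewrite divr_ge0// ?enorm_ge0// ltW.
  have [i ai hi] := gaussian_shell n a0.
  apply: (@le_trans _ _ (c i * \1_(E i) z)%:E).
    rewrite indicE mem_set; last by move: ai; rewrite ltr_pdivrMr// mulrC.
    rewrite mulr1 lee_fin /heat /c -/(w i) ler_wpM2l//; first by rewrite exprn_ge0// invr_ge0 ltW.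
    apply: le_trans hi; rewrite /gauss -enorm_sqr le_eqVlt; apply/orP; left; apply/eqP.
    by congr expR; rewrite exprMn; ring.
  apply: le_trans (nneseries_lim_ge i.+1 _); last by move=> k _ _; rewrite lee_fin mulr_ge0.
  rewrite big_nat_recr//= leeDr// sume_ge0// => k _.
  by rewrite lee_fin mulr_ge0.
rewrite integral_nneseries//; last 2 first.
- by move=> i; apply/measurable_EFinP; apply: measurable_funM => //; exact: measurable_indic.
- by move=> i z _; rewrite lee_fin mulr_ge0.
apply: lee_nneseries => [i _ _|i _]; first by apply: integral_ge0 => z _; rewrite lee_fin mulr_ge0.
under eq_integral do rewrite EFinM.
rewrite ge0_integralZl//; try (by rewrite lee_fin); try (by apply/measurable_EFinP; exact: measurable_indic).
rewrite integral_indic// setIT.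
have [xy|xy] := ltP (enorm (y - x)) (t * Rad i).
  rewrite indicE mem_set// mulr1 /b -/(c i) [leRHS]EFinM; apply: lee_wpmul2l; first by rewrite lee_fin.
  apply: (@le_trans _ _ (sigma (eball (t^-1 *: (x - y)) (s * 2 ^+ i)))); first by rewrite -(measure_preimage_ae (measurable_eball _ _)) -EE.
  by apply: le_trans (dim _ _) _; rewrite ?mulr_gt0 ?exprn_gt0// (mulrC s).
rewrite indicE memNset/=; last by apply/negP; rewrite -leNgt.
rewrite mulr0 (_ : E i = set0) ?measure0 ?mule0//.
apply/seteqP; split => z //=; rewrite /E/= => h.
have : enorm (y - x) < t * Rad i; last by rewrite ltNge xy.
have -> : y - x = - (x - t *: g z - y) + (- t) *: g z.
  by apply/rowP => j; rewrite !mxE; ring.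
apply: le_lt_trans (enormD _ _) _; rewrite enormN enormZ normrN gtr0_norm//.
apply: (@lt_le_trans _ _ (t * s * 2 ^+ i + t * B)); first by rewrite ltr_leD// ler_wpM2l// ltW.
rewrite /Rad -mulrA -mulrDr ler_pM2l//.
have i1 : 1 <= 2 ^+ i :> R by rewrite exprn_ege1// ler1n.
have h1 : s * 2 ^+ i <= 2 ^+ i * S0 by rewrite mulrC ler_wpM2l// ltW// exprn_gt0.
have h2 : B <= 2 ^+ i * B by rewrite ler_peMl.
by lra.
Qed.

Definition hlcst : R := 2 * (D * C * (2 * (B + S0)) ^+ n).

Lemma hlcst_ge0 : 0 <= hlcst.
Proof. by have := ltW S00; rewrite /hlcst => ?; nonneg. Qed.

Let geom_le : (\sum_(i <oo) (4 ^- i)%:E <= (2 : R)%:E)%E.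
Proof.
apply: lime_le.
  by apply: is_cvg_nneseries => i _ _; rewrite lee_fin; nonneg.
near=> N; rewrite sumEFin lee_fin.
have -> : \sum_(0 <= i < N) 4 ^- i = (4 / 3) * (1 - 4 ^- N) :> R.
  elim: (N) => [|k IH]; first by rewrite big_geq// expr0 invr1 subrr mulr0.
  by rewrite big_nat_recr//= IH exprS; field; rewrite expf_neq0.
have : 0 <= 4 ^- N :> R by rewrite invr_ge0 exprn_ge0.
by lra.
Unshelve. all: by end_near. Qed.

(** Count powers of 2^i: at most n from the mass of the sigma ball (as beta <= n), n from the volume
    of the ball around x, and the weight 4^(-i (n+1)); what remains is 4^-i. The dilation t cancels,
    and s^(beta - n) compares the mass s^beta of a small ball with its volume. *)
Lemma avg_le_hlmax h t s x : 0 < t -> 0 < s -> s <= S0 -> leb.-integrable setT (EFin \o h) ->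
  ((`|avg sigma g h t s x|)%:E <= (hlcst * s `^ (beta - n%:R))%:E * hlmax h x)%E.
Proof.
move=> t0 s0 sS ih; have mh : measurable_fun setT h by apply/measurable_EFinP; case/integrableP : ih.
apply: le_trans (norm_avg_le x t0 s0 ih) _.
have s0' := ltW s0; have S0' := ltW S00.
have BS : 0 < B + S0 by rewrite ltr_wpDl.
have H0 := hlmax_ge0 h x.
pose e := D * C * (2 * (B + S0)) ^+ n * s `^ (beta - n%:R).
have e0 : 0 <= e by rewrite /e; nonneg.
apply: (@le_trans _ _ (\int[leb]_y \sum_(i <oo) ((b t s i)%:E * (`|h y| * \1_(eball x (t * Rad i)) y)%:E))%E).
  apply: ge0_le_integralT => y; apply/andP; split.
    by apply: mule_ge0 => //; apply: integral_ge0 => z _; rewrite lee_fin heat_ge0// mulr_gt0.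
  apply: le_trans (lee_wpmul2l _ (sigma_heat_le x y t0 s0 sS)) _ => //.
  rewrite -nneseriesZl//; last by move=> i _; rewrite lee_fin mulr_ge0// b0.
  apply: lee_nneseries => [i _ _|i _]; first by rewrite mule_ge0// lee_fin mulr_ge0// b0.
  by rewrite -!EFinM lee_fin le_eqVlt; apply/orP; left; apply/eqP; ring.
have mI i : measurable_fun setT (fun y => (`|h y| * \1_(eball x (t * Rad i)) y)%:E).
  apply/measurable_EFinP; apply: measurable_funM; first exact: measurableT_comp.
  by apply: measurable_indic; exact: measurable_eball.
have I0 i y : (0 <= (`|h y| * \1_(eball x (t * Rad i)) y)%:E)%E by rewrite lee_fin mulr_ge0.
rewrite integral_nneseries//; last 2 first.
- by move=> i; exact: measurable_funeM.
- by move=> i y _; apply: mule_ge0 => //; rewrite lee_fin b0.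
apply: (@le_trans _ _ (\sum_(i <oo) ((e%:E * hlmax h x) * (4 ^- i)%:E))%E).
  apply: lee_nneseries => [i _ _|i _].
    by apply: integral_ge0 => y _; apply: mule_ge0 => //; rewrite lee_fin b0.
  rewrite ge0_integralZl//; last by rewrite lee_fin b0.
  have Ri : 0 < t * Rad i by rewrite mulr_gt0// mulr_gt0// exprn_gt0.
  have E : (\int[leb]_y (`|h y| * \1_(eball x (t * Rad i)) y)%:E =
            \int[leb]_(y in eball x (t * Rad i)) (`|h y|)%:E)%E.
    rewrite [RHS]integral_mkcond; apply: eq_integral => y _.
    by rewrite patchE indicE; case: (y \in _); rewrite ?mulr1 ?mulr0.
  rewrite E; have bb : (0 <= (b t s i)%:E)%E by rewrite lee_fin b0.
  apply: le_trans (lee_wpmul2l bb (integral_eball_le h x Ri)) _.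
  rewrite muleA -EFinM (muleC _ (hlmax h x)) (muleC _ (hlmax h x)) -muleA.
  apply: lee_wpmul2l => //; rewrite -EFinM lee_fin.
  have bn : (2 ^+ i * s) `^ beta <= (2 ^+ i) ^+ n * s `^ beta.
    rewrite powRM ?exprn_ge0// ler_wpM2r ?powR_ge0// -(powR_mulrn n) ?exprn_ge0//.
    by rewrite ler_powR//; [rewrite exprn_ege1// ler1n|case/andP: beta0n].
  have sn : s `^ (beta - n%:R) = s `^ beta * s^-1 ^+ n.
    have sn0 : s != 0 by rewrite gt_eqF.
    rewrite (@powRD _ s beta (- n%:R)); last by rewrite sn0 implybT.
    by rewrite powRN powR_mulrn// exprVn.
  have ts' : 0 <= (t * s)^-1 by rewrite invr_ge0 mulr_ge0// ltW.
  rewrite /e /b sn.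
  apply: (@le_trans _ _ ((t * s)^-1 ^+ n * w i * (C * ((2 ^+ i) ^+ n * s `^ beta)) * (2 * (t * Rad i)) ^+ n)).
    rewrite ler_wpM2r//; first by rewrite exprn_ge0// mulr_ge0// ltW.
    by rewrite ler_wpM2l//; [nonneg|rewrite ler_wpM2l].
  rewrite le_eqVlt; apply/orP; left; apply/eqP.
  have -> : (t * s)^-1 ^+ n = t^-1 ^+ n * s^-1 ^+ n by rewrite invfM exprMn.
  have -> : (2 * (t * Rad i)) ^+ n = t ^+ n * (2 ^+ i) ^+ n * (2 * (B + S0)) ^+ n.
    by rewrite /Rad -!exprMn; congr (_ ^+ _); ring.
  have -> : w i = D * 4 ^- i / ((2 ^+ i) ^+ n * (2 ^+ i) ^+ n).
    rewrite /w mulnS exprD invfM mulrA; congr (_ * _^-1).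
    by rewrite exprM -[in RHS]exprMn -[in RHS]exprMn -natrM.
  have tn : t^-1 ^+ n * t ^+ n = 1 by rewrite -exprMn mulVf ?gt_eqF// expr1n.
  have -> : t^-1 ^+ n * s^-1 ^+ n * (D * 4 ^- i / ((2 ^+ i) ^+ n * (2 ^+ i) ^+ n)) *
      (C * ((2 ^+ i) ^+ n * s `^ beta)) * (t ^+ n * (2 ^+ i) ^+ n * (2 * (B + S0)) ^+ n) =
    (t^-1 ^+ n * t ^+ n) * (s^-1 ^+ n * (D * 4 ^- i / ((2 ^+ i) ^+ n * (2 ^+ i) ^+ n)) *
      (C * ((2 ^+ i) ^+ n * s `^ beta)) * ((2 ^+ i) ^+ n * (2 * (B + S0)) ^+ n)) by ring.
  by rewrite tn mul1r; field; rewrite !expf_neq0.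
have -> : hlcst * s `^ (beta - n%:R) = 2 * e by rewrite /hlcst /e !mulrA.
(* For [e = 0] both sides vanish even against an infinite maximal function, since 0 times infinity
   is 0. *)
have [->|en] := eqVneq e 0.
  by rewrite mulr0 !mul0e eseries0// => i _ _; rewrite mul0e.
have ep : 0 < e by rewrite lt_neqAle eq_sym en.
move: H0; case: (hlmax h x) => [v||] //; rewrite ?lee_fin => H0; last first.
  have e2 : (0 < (2 * e)%:E)%E by rewrite lte_fin mulr_gt0.
  by rewrite (gt0_muley e2) leey.
have ev : 0 <= e * v by exact: mulr_ge0.
rewrite -!EFinM nneseriesZl//; try (by move=> i _; rewrite lee_fin; nonneg).
rewrite (_ : 2 * e * v = e * v * 2); last ring.
by rewrite [leRHS]EFinM; apply: lee_wpmul2l => //; rewrite lee_fin.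
Qed.

End maximal_bound.

(** * The maximal heat operator over dyadic scales on L^2 *)

Section lacunary_maximal.
Context {R : realType} {n : nat}.
Notation leb := (lebesgue_rV n : {sigma_finite_measure set 'rV[R]_n -> \bar R}).
Implicit Types (h u v : 'rV[R]_n -> R) (x y z : 'rV[R]_n) (r s t : R).

(** Nonnegative, bounded and integrable functions: a class stable under sums, products and heat
    operators, on which every inner product below is a finite real integral. *)
Definition bint h : Prop := [/\ forall x, 0 <= h x, exists A, forall x, h x <= A &
  leb.-integrable setT (EFin \o h)].

Lemma bint_ge0 h x : bint h -> 0 <= h x. Proof. by case. Qed.
Lemma bint_int h : bint h -> leb.-integrable setT (EFin \o h). Proof. by case. Qed.
Lemma bint_measurable h : bint h -> measurable_fun setT h.
Proof. by case=> _ _ /integrableP[/measurable_EFinP]. Qed.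

Lemma bint_le h u : bint u -> measurable_fun setT h -> (forall x, 0 <= h x <= u x) -> bint h.
Proof.
move=> [u0 [A uA] iu] mh hu; split.
- by move=> x; case/andP: (hu x).
- by exists A => x; case/andP: (hu x) => _ /le_trans; apply.
- by apply: le_integrableR iu => // x; case/andP: (hu x) => h0 h1; rewrite ger0_norm.
Qed.

Lemma bint_mul u v : bint u -> bint v -> bint (fun x => u x * v x).
Proof.
move=> bu bv; have [u0 [A uA] iu] := bu; have [v0 [C vC] iv] := bv; split.
- by move=> x; rewrite mulr_ge0.
- by exists (A * C) => x; exact: ler_pM.
- apply: (@le_integrableR _ _ _ _ _ (fun x => C * u x)).
  + by apply: measurable_funM; exact: bint_measurable.
  + by move=> x; rewrite ger0_norm ?mulr_ge0// mulrC ler_wpM2r.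
  + exact: integrableRZ.
Qed.

Lemma bint_sum m (v : 'I_m -> 'rV[R]_n -> R) : (forall i, bint (v i)) ->
  bint (fun x => \sum_i v i x).
Proof.
move=> bv; split.
- by move=> x; apply: sumr_ge0 => i _; exact: bint_ge0.
- have /choice[A hA] : forall i, exists A, forall x, v i x <= A by move=> i; case: (bv i).
  by exists (\sum_i A i) => x; apply: ler_sum.
- by apply: integrableR_sum => i; exact: bint_int.
Qed.

Definition ip u v : R := \int[leb]_x (u x * v x).

Lemma ipC u v : ip u v = ip v u.
Proof. by apply: eq_Rintegral => x _; rewrite mulrC. Qed.

Lemma ip_ge0 u v : bint u -> bint v -> 0 <= ip u v.
Proof. by move=> bu bv; apply: Rintegral_ge0 => x _; rewrite mulr_ge0//; exact: bint_ge0. Qed.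

Lemma ip_sumr m u (v : 'I_m -> 'rV[R]_n -> R) : bint u -> (forall i, bint (v i)) ->
  ip u (fun x => \sum_i v i x) = \sum_i ip u (v i).
Proof.
move=> bu bv; rewrite /ip -Rintegral_sum; last by move=> i; exact: (bint_int (bint_mul bu (bv i))).
by apply: eq_Rintegral => x _; rewrite big_distrr.
Qed.

Lemma ip_suml m u (v : 'I_m -> 'rV[R]_n -> R) : bint u -> (forall i, bint (v i)) ->
  ip (fun x => \sum_i v i x) u = \sum_i ip (v i) u.
Proof. by move=> bu bv; rewrite ipC ip_sumr//; apply: eq_bigr => i _; rewrite ipC. Qed.

Lemma ip_le u v v' : bint u -> bint v -> bint v' -> (forall x, v x <= v' x) -> ip u v <= ip u v'.
Proof.
move=> bu bv bv' vv; apply: le_Rintegral => //; try exact: (bint_int (bint_mul bu _)).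
by move=> x _; rewrite ler_wpM2l//; exact: bint_ge0.
Qed.

Lemma ip_young (c : R) u v : 0 < c -> bint u -> bint v ->
  ip u v <= c / 2 * ip u u + (2 * c)^-1 * ip v v.
Proof.
move=> c0 bu bv; have iuu := bint_int (bint_mul bu bu); have ivv := bint_int (bint_mul bv bv).
rewrite /ip -!RintegralZl// -RintegralD//; try exact: integrableRZ.
apply: le_Rintegral => //.
- exact: (bint_int (bint_mul bu bv)).
- by apply: integrableRD; exact: integrableRZ.
move=> x _; rewrite -subr_ge0.
have -> : c / 2 * (u x * u x) + (2 * c)^-1 * (v x * v x) - u x * v x = (2 * c)^-1 * (c * u x - v x) ^+ 2.
  by field; rewrite gt_eqF.
by rewrite mulr_ge0 ?sqr_ge0// invr_ge0 mulr_ge0// ltW.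
Qed.

Let mul_heat_int r h x : 0 < r -> bint h ->
  leb.-integrable setT (EFin \o (fun y => h y * heat r (x - y))).
Proof. by move=> r0 bh; apply: integrable_mul_heat => //; exact: bint_int. Qed.

Lemma bint_heatop r h : 0 < r -> bint h -> bint (heatop r h).
Proof.
move=> r0 bh; have [h0 [A hA] ih] := bh; have mh := bint_measurable bh.
split.
- by move=> x; apply: Rintegral_ge0 => y _; rewrite mulr_ge0//; exact: heat_ge0.
- exists A => x; rewrite -[leRHS]mulr1 -(Rintegral_heat x r0) -RintegralZl//; last exact: integrable_heat.
  apply: le_Rintegral => //; first exact: mul_heat_int.
    by apply: integrableRZ; exact: integrable_heat.
  by move=> y _; rewrite ler_wpM2r//; exact: heat_ge0.
apply/integrableP; split; first by apply/measurable_EFinP; exact: measurable_heatop.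
pose k (w : 'rV[R]_n * 'rV[R]_n) : \bar R := (`|h w.2| * heat r (w.1 - w.2))%:E.
have mk : measurable_fun setT k.
  apply/measurable_EFinP; apply: measurable_funM.
    by apply: measurableT_comp => //; exact: (measurableT_comp mh).
  by apply: measurable_heat; apply: measurable_rVB.
have k0 w : (0 <= k w)%E by rewrite lee_fin mulr_ge0//; exact: heat_ge0.
apply: (@le_lt_trans _ _ (\int[leb]_x \int[leb]_y k (x, y))%E).
  apply: ge0_le_integralT => x; rewrite abse_ge0/=; exact: norm_heatop_le.
rewrite (fubini_tonelli k mk k0).
rewrite (_ : (fun y => \int[leb]_x k (x, y))%E = (fun y => `|(h y)%:E|)%E); first by case/integrableP : ih.
apply/funext => y; rewrite /k /=.
under eq_integral do rewrite EFinM.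
rewrite ge0_integralZl//.
- have := integral_heat y r0; under eq_integral do rewrite -heatN opprB.
  by move=> ->; rewrite mule1.
- by apply/measurable_EFinP; apply: measurable_heat; exact: measurable_rVB.
- by move=> x _; rewrite lee_fin heat_ge0.
Qed.

Lemma ip_heatop r u v : 0 < r -> bint u -> bint v ->
  ip u (heatop r v) = ip (heatop r u) v.
Proof.
move=> r0 bu bv; have mu := bint_measurable bu; have mv := bint_measurable bv.
pose k x y := u x * (v y * heat r (x - y)).
transitivity (\int[leb]_x \int[leb]_y k x y).
  by apply: eq_Rintegral => x _; rewrite /k /heatop RintegralZl//; exact: mul_heat_int.
rewrite (@Rintegral_swap _ _ 'rV[R]_n 'rV[R]_n R leb leb u (fun y => r^-1 ^+ n * v y) k)//; last 4 first.
- exact: bint_int.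
- by apply: integrableRZ; exact: bint_int.
- apply: measurable_funM; first exact: measurableT_comp.
  apply: measurable_funM; first exact: (measurableT_comp mv).
  by apply: measurable_heat; exact: measurable_rVB.
- move=> x y; have u0 := bint_ge0 x bu; have v0 := bint_ge0 y bv; have h0 := heat_ge0 (x - y) r0.
  have hl := ler_wpM2r v0 (heat_le (x - y) r0).
  have kk : 0 <= k x y := mulr_ge0 u0 (mulr_ge0 v0 h0).
  by rewrite (ger0_norm kk) /k (mulrC (v y)); exact: ler_wpM2l.
transitivity (\int[leb]_y (v y * \int[leb]_x (u x * heat r (y - x)))); last first.
  by rewrite /ip; apply: eq_Rintegral => y _; rewrite mulrC.
apply: eq_Rintegral => y _.
rewrite -(RintegralZl (v y) measurableT (mul_heat_int y r0 bu)).
apply: eq_Rintegral => x _; rewrite /k.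
rewrite -(heatN r (y - x)) opprB.
move: (heat r _) => t.
by ring.
Qed.

Lemma heatop_le r u v x : 0 < r -> bint u -> bint v -> (forall y, u y <= v y) ->
  heatop r u x <= heatop r v x.
Proof.
move=> r0 bu bv uv; apply: le_Rintegral => //; try exact: mul_heat_int.
by move=> y _; rewrite ler_wpM2r//; exact: heat_ge0.
Qed.

Lemma heatop_sum m r (v : 'I_m -> 'rV[R]_n -> R) x : 0 < r -> (forall i, bint (v i)) ->
  heatop r (fun x => \sum_i v i x) x = \sum_i heatop r (v i) x.
Proof.
move=> r0 bv; rewrite /heatop -Rintegral_sum; last by move=> i; exact: mul_heat_int.
by apply: eq_Rintegral => y _; rewrite big_distrl.
Qed.

Definition heatcst : R := (2 * Num.sqrt 2) ^+ n.
Local Notation kappa := heatcst.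

Let sq2 : 0 < Num.sqrt 2 :> R. Proof. by rewrite sqrtr_gt0. Qed.

Lemma heatcst_gt0 : 0 < kappa.
Proof. by rewrite exprn_gt0// mulr_gt0. Qed.

(** A pointwise substitute for the semigroup law. Since |x-z|^2 <= 2 |x-y|^2 + 2 |y-z|^2 and
    [b <= a], the finer kernel pays for the second term with half of its exponent; the kernel it
    leaves still has mass one in y. *)
Lemma mul_heat_le a b x y z : 0 < b -> b <= a ->
  heat a (x - y) * heat b (y - z) <= kappa * heat (2 * a) (x - z) * heat (Num.sqrt 2 * b) (y - z).
Proof.
move=> b0 ba; have a0 : 0 < a by exact: lt_le_trans ba.
have bn := gt_eqF b0; have an := gt_eqF a0; have s2n := gt_eqF sq2.
rewrite /heat /kappa.
have -> : (2 * Num.sqrt 2) ^+ n * ((2 * a)^-1 ^+ n * gauss (2 * a)^-1 (x - z)) *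
    ((Num.sqrt 2 * b)^-1 ^+ n * gauss (Num.sqrt 2 * b)^-1 (y - z)) =
    (a^-1 ^+ n * b^-1 ^+ n) * (gauss (2 * a)^-1 (x - z) * gauss (Num.sqrt 2 * b)^-1 (y - z)).
  have -> : (2 * Num.sqrt 2) ^+ n * ((2 * a)^-1 ^+ n * gauss (2 * a)^-1 (x - z)) *
    ((Num.sqrt 2 * b)^-1 ^+ n * gauss (Num.sqrt 2 * b)^-1 (y - z)) =
    ((2 * Num.sqrt 2) ^+ n * (2 * a)^-1 ^+ n * (Num.sqrt 2 * b)^-1 ^+ n) * (gauss (2 * a)^-1 (x - z) *
     gauss (Num.sqrt 2 * b)^-1 (y - z)) by ring.
  by rewrite -!exprMn; congr (_ ^+ _ * _); field; rewrite an bn s2n.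
rewrite mulrACA ler_wpM2l//; first by have := ltW a0; have := ltW b0 => *; nonneg.
rewrite /gauss -!expRD ler_expR -!opprD lerN2.
have -> : (Num.sqrt 2 * b)^-1 ^+ 2 = b^-1 ^+ 2 / 2.
  by rewrite exprVn exprMn sqr_sqrtr// exprVn; field; rewrite bn.
have -> : (2 * a)^-1 ^+ 2 = a^-1 ^+ 2 / 4 by field; rewrite an.
have ab : a^-1 ^+ 2 <= b^-1 ^+ 2.
  rewrite ler_pXn2r ?nnegrE ?invr_ge0//; try exact: ltW.
  by rewrite lef_pV2.
set A := a^-1 ^+ 2 in ab *; set C := b^-1 ^+ 2 in ab *.
have A0 : 0 <= A by exact: sqr_ge0.
set p := dotr (x - y) (x - y); set q := dotr (y - z) (y - z).
have xz : dotr (x - z) (x - z) <= 2 * p + 2 * q.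
  rewrite /p /q; have -> : x - z = (x - y) + (y - z) by rewrite addrA subrK.
  move: (x - y) (y - z) => P Q; have := dotr_ge0 (P - Q).
  by rewrite !dotrBl !dotrBr !dotrDl !dotrDr (dotrC Q P); lra.
have q0 : 0 <= q by exact: dotr_ge0.
have h1 : A * dotr (x - z) (x - z) <= A * (2 * p + 2 * q) by rewrite ler_wpM2l.
have h2 : A * q <= C * q by rewrite ler_wpM2r.
have p0 := @pi_ge0 R.
rewrite -subr_ge0 (_ : _ - _ = pi * (A * p + C * q / 2 - A * dotr (x - z) (x - z) / 4)); last by field.
have Ap : 0 <= A * p by apply: mulr_ge0 => //; exact: dotr_ge0.
by apply: mulr_ge0 => //; lra.
Qed.

Lemma heatop_heatop a b v x : 0 < b -> b <= a -> bint v ->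
  heatop a (heatop b v) x <= kappa * heatop (2 * a) v x.
Proof.
move=> b0 ba bv; have a0 : 0 < a by exact: lt_le_trans ba.
have mv := bint_measurable bv; have s2b : 0 < Num.sqrt 2 * b by exact: mulr_gt0.
have a20 : 0 < 2 * a by exact: mulr_gt0.
pose k y z := heat a (x - y) * (v z * heat b (y - z)).
have kle y z : `|k y z| <= heat a (x - y) * (b^-1 ^+ n * v z).
  have v0 := bint_ge0 z bv; have h0 := heat_ge0 (x - y) a0; have h1 := heat_ge0 (y - z) b0.
  have hl := ler_wpM2r v0 (heat_le (y - z) b0).
  have kk : 0 <= k y z := mulr_ge0 h0 (mulr_ge0 v0 h1).
  by rewrite (ger0_norm kk) /k (mulrC (v z)); exact: ler_wpM2l.
have mk : measurable_fun setT (fun w : 'rV[R]_n * 'rV[R]_n => k w.1 w.2).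
  apply: measurable_funM; first by apply: measurable_heat; exact: measurable_rVB.
  apply: measurable_funM; first exact: (measurableT_comp mv).
  by apply: measurable_heat; exact: measurable_rVB.
have I1 := integrable_heat x a0.
have I2 : leb.-integrable setT (EFin \o (fun z => b^-1 ^+ n * v z)).
  by apply: integrableRZ; exact: bint_int.
have -> : heatop a (heatop b v) x = \int[leb]_y \int[leb]_z k y z.
  apply: eq_Rintegral => y _; rewrite /k mulrC /heatop RintegralZl//; exact: mul_heat_int.
rewrite (@Rintegral_swap _ _ 'rV[R]_n 'rV[R]_n R leb leb _ _ k I1 I2)//.
rewrite /heatop -RintegralZl//; last exact: mul_heat_int.
apply: le_Rintegral => //.
- apply: (@integrable_Rintegral1 _ _ 'rV[R]_n 'rV[R]_n R leb leb _ _ (fun z y => k y z) I2 I1).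
    have msw : measurable_fun setT (fun w : 'rV[R]_n * 'rV[R]_n => (w.2, w.1)).
      by apply: measurable_fun_pair.
    exact: (measurableT_comp mk msw).
  by move=> z y; rewrite mulrC.
- by apply: integrableRZ; exact: mul_heat_int.
move=> z _.
have I3 : leb.-integrable setT (EFin \o (fun y => heat (Num.sqrt 2 * b) (y - z))).
  by have := integrable_heat z s2b; apply: eq_integrable => // y _ /=; rewrite -heatN opprB.
have v0 := bint_ge0 z bv.
apply: (@le_trans _ _ (\int[leb]_y (kappa * (v z * heat (2 * a) (x - z)) * heat (Num.sqrt 2 * b) (y - z)))).
  apply: le_Rintegral => //.
  - exact: (@integrable_dominated2 _ _ 'rV[R]_n 'rV[R]_n R leb (fun y => heat a (x - y)) (fun z => b^-1 ^+ n * v z) k I1 mk kle z).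
  - exact: integrableRZ.
  move=> y _; rewrite /k.
  have := ler_wpM2l v0 (mul_heat_le x y z b0 ba).
  by rewrite mulrCA => h; apply: (le_trans h); rewrite le_eqVlt; apply/orP; left; apply/eqP; ring.
rewrite RintegralZl//.
have -> : \int[leb]_y heat (Num.sqrt 2 * b) (y - z) = 1.
  transitivity (\int[leb]_y heat (Num.sqrt 2 * b) (z - y)); last exact: Rintegral_heat.
  by apply: eq_Rintegral => y _; rewrite -heatN opprB.
by rewrite mulr1.
Qed.

Lemma ip_heatop_le r h : 0 < r -> bint h -> ip h (heatop r h) <= ip h h.
Proof.
move=> r0 bh; have mh := bint_measurable bh; have bhh := bint_heatop r0 bh.
rewrite -lee_fin /ip !EFin_Rintegral; try exact: bint_int (bint_mul _ _).
have := schur_heat r0 mh.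
rewrite (_ : (\int[leb]_x (h x ^+ 2)%:E)%E = (\int[leb]_x (h x * h x)%:E)%E); last first.
  by apply: eq_integral => x _; rewrite expr2.
apply: le_trans; apply: ge0_le_integralT => x.
have x0 := bint_ge0 x bh; rewrite lee_fin mulr_ge0 ?bint_ge0//=.
rewrite /heatop -RintegralZl//; last exact: mul_heat_int.
rewrite EFin_Rintegral; last by apply: integrableRZ; exact: mul_heat_int.
by rewrite le_eqVlt; apply/orP; left; apply/eqP; apply: eq_integral => y _; rewrite !ger0_norm// bint_ge0.
Qed.

Let absorb_half (a c d l : R) : a <= l / 2 * c + d -> d <= a / 2 -> a <= l * c.
Proof. by move=> h1 h2; have := lerD h1 h2; lra. Qed.

Section scales.
Variable m : nat.

(** Measurable selectors that linearise a supremum over scales: for suitable weights the function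
    [wheat] dominates every single scale. *)
Definition weights (w : 'I_m -> 'rV[R]_n -> R) : Prop :=
  [/\ forall i, measurable_fun setT (w i), forall i x, 0 <= w i x & forall x, \sum_i w i x <= 1].

Definition wheat r (w : 'I_m -> 'rV[R]_n -> R) h x : R := \sum_i w i x * heatop (r * 2 ^+ i) h x.

Definition wheat_bound (b : R) : Prop := forall r h w, 0 < r -> bint h -> weights w ->
  ip (wheat r w h) (wheat r w h) <= b * ip h h.

Let r2 r i : 0 < r -> 0 < r * 2 ^+ i.
Proof. by move=> r0; rewrite mulr_gt0// exprn_gt0. Qed.

Let w_le1 w i x : weights w -> w i x <= 1.
Proof.
move=> [_ w0 w1]; apply: le_trans (w1 x); rewrite (bigD1 i)//= lerDl.
by apply: sumr_ge0 => j _.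
Qed.

Let bint_w w i h : weights w -> bint h -> bint (fun x => w i x * h x).
Proof.
move=> ww bh; have [mw w0 w1] := ww; apply: (bint_le bh).
  by apply: measurable_funM => //; exact: bint_measurable.
move=> x; have h0 := bint_ge0 x bh; rewrite mulr_ge0//= ler_piMl//; exact: w_le1.
Qed.

Lemma bint_wheat r w h : 0 < r -> weights w -> bint h -> bint (wheat r w h).
Proof.
by move=> r0 ww bh; apply: bint_sum => i; apply: bint_w => //; apply: bint_heatop => //; exact: r2.
Qed.

(** The larger of the two scales, once doubled, absorbs the smaller. Adding both alternatives gives
    a bound symmetric in the two scales, so the sum over all pairs need not be ordered. *)
Let pair_le r i k u v : 0 < r -> bint u -> bint v ->
  ip (heatop (r * 2 ^+ i) u) (heatop (r * 2 ^+ k) v) <=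
  kappa * (ip u (heatop (2 * r * 2 ^+ i) v) + ip v (heatop (2 * r * 2 ^+ k) u)).
Proof.
move=> r0.
have base a b u' v' : 0 < b -> b <= a -> bint u' -> bint v' ->
    ip (heatop a u') (heatop b v') <= kappa * ip u' (heatop (2 * a) v').
  move=> b0 ba bu bv; have a0 : 0 < a by exact: lt_le_trans ba.
  have a20 : 0 < 2 * a by exact: mulr_gt0.
  have k0 := ltW heatcst_gt0.
  have bb := bint_heatop b0 bv.
  have b2 := bint_heatop a20 bv.
  have bk : bint (fun x => kappa * heatop (2 * a) v' x).
    have [h0 [A hA] ih] := b2; split.
    - by move=> x; rewrite mulr_ge0.
    - by exists (kappa * A) => x; rewrite ler_wpM2l.
    - exact: integrableRZ.
  rewrite -ip_heatop//; apply: le_trans (ip_le bu (bint_heatop a0 bb) bk _) _.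
    by move=> x; exact: heatop_heatop.
  rewrite /ip -RintegralZl//; last exact: (bint_int (bint_mul bu b2)).
  by apply: le_Rintegral => //; [exact: (bint_int (bint_mul bu bk))|
    apply: integrableRZ; exact: (bint_int (bint_mul bu b2))|move=> x _; rewrite mulrCA].
move=> bu bv; have k0 := ltW heatcst_gt0.
have p1 : 0 <= ip u (heatop (2 * r * 2 ^+ i) v).
  by apply: ip_ge0 => //; apply: bint_heatop => //; rewrite r2// mulr_gt0.
have p2 : 0 <= ip v (heatop (2 * r * 2 ^+ k) u).
  by apply: ip_ge0 => //; apply: bint_heatop => //; rewrite r2// mulr_gt0.
have [ik|ik] := leP (r * 2 ^+ k) (r * 2 ^+ i).
  apply: le_trans (base _ _ _ _ (r2 k r0) ik bu bv) _.
  rewrite (_ : 2 * (r * 2 ^+ i) = 2 * r * 2 ^+ i); last by rewrite mulrA.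
  by apply: ler_wpM2l; [exact: k0|rewrite lerDl; exact: p2].
rewrite ipC; apply: le_trans (base _ _ _ _ (r2 i r0) (ltW ik) bv bu) _.
rewrite (_ : 2 * (r * 2 ^+ k) = 2 * r * 2 ^+ k); last by rewrite mulrA.
by apply: ler_wpM2l; [exact: k0|rewrite lerDr; exact: p1].
Qed.

(** A crude bound that grows with the number of scales; it only provides a finite bound from which
    the improvement can start. *)
Lemma wheat_bound0 : exists2 b, 0 < b & wheat_bound b.
Proof.
exists (2 * kappa * m%:R ^+ 2 + 1).
  by rewrite ltr_wpDl// mulr_ge0 ?exprn_ge0// mulr_ge0// ltW ?heatcst_gt0.
move=> r h w r0 bh ww; have k0 := ltW heatcst_gt0.
have bP i : bint (heatop (r * 2 ^+ i) h) by apply: bint_heatop => //; exact: r2.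
have hh0 := ip_ge0 bh bh.
have bG := bint_wheat r0 ww bh.
pose P x := \sum_(i < m) heatop (r * 2 ^+ i) h x.
have bPP : bint P by apply: bint_sum.
have GP x : wheat r w h x <= P x.
  by apply: ler_sum => i _; rewrite ler_piMl ?bint_ge0//; exact: w_le1.
apply: (@le_trans _ _ (ip P P)).
  apply: le_trans (ip_le bG bG bPP GP) _; rewrite ipC; exact: ip_le.
rewrite {1}/P ip_suml//; under eq_bigr do rewrite ip_sumr//.
apply: (@le_trans _ _ (\sum_(i < m) \sum_(k < m) 2 * kappa * ip h h)); last first.
  rewrite !sumr_const card_ord -[X in X <= _]mulr_natl -[X in m%:R * X <= _]mulr_natl.
  have -> : m%:R * (m%:R * (2 * kappa * ip h h)) = 2 * kappa * m%:R ^+ 2 * ip h h by ring.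
  by rewrite [leRHS]mulrDl mul1r lerDl.
apply: ler_sum => i _; apply: ler_sum => k _.
apply: le_trans (pair_le i k r0 bh bh) _.
have h1 := @ip_heatop_le (2 * r * 2 ^+ i) h (r2 i (mulr_gt0 (ltr0n R 2) r0)) bh.
have h2 := @ip_heatop_le (2 * r * 2 ^+ k) h (r2 k (mulr_gt0 (ltr0n R 2) r0)) bh.
rewrite (_ : 2 * kappa * ip h h = kappa * (ip h h + ip h h)); last ring.
exact: (ler_wpM2l k0 (lerD h1 h2)).
Qed.

(* The TT* argument: a bound [b] improves to a multiple of [sqrt b]. *)
Lemma wheat_boundS (b : R) : 0 < b -> wheat_bound b -> wheat_bound (2 * kappa * Num.sqrt b).
Proof.
move=> b0 Hb r h w r0 bh ww; have kp := heatcst_gt0; have k0 := ltW kp.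
have [mw w0 w1] := ww; have rr : 0 < 2 * r by exact: mulr_gt0.
pose G := wheat r w h; have bG : bint G by exact: bint_wheat.
pose u (i : 'I_m) x := w i x * G x; have bu i : bint (u i) by exact: bint_w.
have bPh (i : 'I_m) : bint (heatop (r * 2 ^+ i) h) by apply: bint_heatop => //; exact: r2.
have bPu (i : 'I_m) : bint (heatop (r * 2 ^+ i) (u i)) by apply: bint_heatop => //; exact: r2.
pose T x := \sum_(i < m) heatop (r * 2 ^+ i) (u i) x; have bT : bint T by exact: bint_sum.
pose G' := wheat (2 * r) w G; have bG' : bint G' by exact: bint_wheat.
have X1 : ip G G = ip T h.
  rewrite {2}/G /wheat ip_sumr//; last by move=> i; apply: bint_w.
  rewrite /T ip_suml//; apply: eq_bigr => i _.
  rewrite -ip_heatop//; last exact: r2.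
  by apply: eq_Rintegral => x _; rewrite /u; ring.
have bH (i : 'I_m) v : bint v -> bint (heatop (2 * r * 2 ^+ i) v).
  by move=> bv; apply: bint_heatop => //; exact: r2.
(* The scales are decoupled here: by symmetry the two halves of [pair_le] give equal double sums,
   and the sum of the [u k] is at most [G] because the weights add up to at most one. *)
have T2 : ip T T <= 2 * kappa * ip G G'.
  rewrite {1}/T ip_suml//; under eq_bigr do rewrite ip_sumr//.
  apply: (@le_trans _ _ (\sum_(i < m) \sum_(k < m)
      (kappa * ip (u i) (heatop (2 * r * 2 ^+ i) (u k)) + kappa * ip (u k) (heatop (2 * r * 2 ^+ k) (u i))))).
    apply: ler_sum => i _; apply: ler_sum => k _; rewrite -mulrDr; exact: pair_le.
  under eq_bigr do rewrite big_split/=.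
  rewrite big_split/= [X in _ + X]exchange_big/=.
  have -> : \sum_(i < m) \sum_(k < m) kappa * ip (u i) (heatop (2 * r * 2 ^+ i) (u k)) =
     kappa * \sum_(i < m) \sum_(k < m) ip (u i) (heatop (2 * r * 2 ^+ i) (u k)).
    by rewrite mulr_sumr; apply: eq_bigr => i _; rewrite mulr_sumr.
  set SS := \sum_(i < m) _.
  rewrite (_ : kappa * SS + kappa * SS = 2 * kappa * SS); last ring.
  apply: ler_wpM2l; first by rewrite mulr_ge0.
  rewrite {}/SS.
  rewrite /G' /wheat ip_sumr//; last by move=> i; apply: bint_w => //; exact: bH.
  apply: ler_sum => i _; rewrite -(ip_sumr (bu i) (fun k => bH i _ (bu k))).
  apply: (@le_trans _ _ (ip (u i) (heatop (2 * r * 2 ^+ i) G))).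
    apply: ip_le; [exact: bu|by apply: bint_sum => k; exact: bH|exact: bH|].
    move=> x; rewrite -heatop_sum//; last exact: r2.
    apply: heatop_le => //; [exact: r2|exact: bint_sum|].
    move=> y; rewrite /u -mulr_suml ler_piMl// bint_ge0//.
  by rewrite le_eqVlt; apply/orP; left; apply/eqP; apply: eq_Rintegral => x _; rewrite /u; ring.
have Hb' := Hb _ _ _ rr bG ww.
have sb : 0 < Num.sqrt b by rewrite sqrtr_gt0.
have Z1 : ip G G' <= Num.sqrt b * ip G G.
  apply: le_trans (ip_young sb bG bG') _.
  have hq : (2 * Num.sqrt b)^-1 * ip G' G' <= (2 * Num.sqrt b)^-1 * (b * ip G G).
    by apply: ler_wpM2l; [rewrite invr_ge0 mulr_ge0// ltW|exact: Hb'].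
  apply: le_trans (lerD (lexx _) hq) _.
  have -> : (2 * Num.sqrt b)^-1 * (b * ip G G) = Num.sqrt b / 2 * ip G G.
    by rewrite -{2}(sqr_sqrtr (ltW b0)); field; rewrite gt_eqF.
  by rewrite le_eqVlt; apply/orP; left; apply/eqP; field.
pose lam := 2 * kappa * Num.sqrt b; have lam0 : 0 < lam by rewrite !mulr_gt0.
have X2 : ip G G <= lam / 2 * ip h h + (2 * lam)^-1 * ip T T.
  by rewrite {1}X1 ipC; exact: ip_young.
have h3 : (2 * lam)^-1 * ip T T <= (2 * lam)^-1 * (lam * ip G G).
  apply: ler_wpM2l; first by rewrite invr_ge0 mulr_ge0// ltW.
  apply: (le_trans T2).
  have := ler_wpM2l (mulr_ge0 (ler0n R 2) k0) Z1.
  by rewrite /lam !mulrA.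
have h4 : (2 * lam)^-1 * (lam * ip G G) = ip G G / 2 by field; rewrite gt_eqF.
rewrite h4 in h3.
exact: (absorb_half X2 h3).
Qed.

(** The map b -> 2 kappa sqrt b has the fixed point 4 kappa^2, so the infimum of the admissible
    bounds cannot exceed it. The added 1 leaves room for a contradiction, as the infimum is not
    known to be attained. The outcome does not depend on [m]. *)
Lemma wheat_bound_abs : wheat_bound (4 * kappa ^+ 2 + 1).
Proof.
have kp := heatcst_gt0; have k0 := ltW kp.
pose S := [set b | 0 < b /\ wheat_bound b].
have [b1 b10 wb1] := wheat_bound0.
have S0 : S !=set0 by exists b1.
have Slb : has_lbound S by exists 0 => b [/ltW].
have hi : has_inf S by split.
have mono b : S b -> b <= 4 * kappa ^+ 2 + 1 -> wheat_bound (4 * kappa ^+ 2 + 1).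
  move=> [_ wb] ble r h w r0 bh ww; apply: le_trans (wb _ _ _ r0 bh ww) _.
  by rewrite ler_wpM2r//; exact: ip_ge0.
have [//|nb] := pselect (wheat_bound (4 * kappa ^+ 2 + 1)).
have big b : S b -> 4 * kappa ^+ 2 + 1 <= b.
  by move=> Sb; rewrite leNgt; apply/negP => /ltW /(mono _ Sb).
have i1 : 4 * kappa ^+ 2 + 1 <= inf S by apply: lb_le_inf.
have k2 : 0 < 4 * kappa ^+ 2 by rewrite mulr_gt0// exprn_gt0.
have ip0 : 0 < inf S by apply: lt_le_trans i1; rewrite ltr_wpDl// ltW.
have i2 b : S b -> inf S ^+ 2 / (4 * kappa ^+ 2) <= b.
  move=> [bp wb].
  have h1 : inf S <= 2 * kappa * Num.sqrt b.
    apply: ge_inf => //; split; last exact: wheat_boundS.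
    by rewrite !mulr_gt0// sqrtr_gt0.
  rewrite ler_pdivrMr// expr2; apply: le_trans (ler_pM (ltW ip0) (ltW ip0) h1 h1) _.
  by rewrite -{3}(sqr_sqrtr (ltW bp)) le_eqVlt; apply/orP; left; apply/eqP; ring.
have i3 : inf S ^+ 2 / (4 * kappa ^+ 2) <= inf S by apply: lb_le_inf.
move: i3; rewrite ler_pdivrMr// expr2 ler_pM2l// => i3.
by move: (le_trans i1 i3); rewrite -subr_le0 addrAC subrr add0r ler10.
Qed.

End scales.

(** By induction on the number of scales: the new index takes the whole weight exactly where its
    value strictly exceeds the maximum selected so far. *)
Lemma weights_max m (p : nat -> 'rV[R]_n -> R) : (forall i, measurable_fun setT (p i)) ->
  (forall i x, 0 <= p i x) ->
  exists2 w : 'I_m -> 'rV[R]_n -> R, weights w &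
    forall (i : 'I_m) x, p i x <= \sum_k w k x * p k x.
Proof.
move=> mp p0.
suff [w [mw w0 w1 wp]] : exists w : nat -> 'rV[R]_n -> R,
   [/\ forall i, measurable_fun setT (w i), forall i x, 0 <= w i x,
     forall x, \sum_(i < m) w i x <= 1 &
     forall i x, (i < m)%N -> p i x <= \sum_(k < m) w k x * p k x].
  by exists (fun i => w i); [split|move=> i x; exact: wp].
elim: m => [|m [w [mw w0 w1 wp]]].
  by exists (fun _ _ => 0); split => // x; rewrite big_ord0.
pose F x := \sum_(k < m) w k x * p k x.
have mF : measurable_fun setT F by apply: measurable_sum => i; exact: measurable_funM.
have mA : measurable [set x | F x < p m x].
  have := measurable_fun_ltr mF (mp m); rewrite /measurable_fun => /(_ measurableT [set true]).
  rewrite setTI => h; rewrite (_ : [set x | _] = (fun x => F x < p m x) @^-1` [set true])//.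
  exact: h.
pose c x : R := \1_[set x | F x < p m x] x.
have mc : measurable_fun setT c by exact: measurable_indic.
have cE x : c x = (F x < p m x)%R%:R.
  rewrite /c indicE; have [h|h] := ltP (F x) (p m x); first by rewrite mem_set.
  by rewrite memNset//=; apply/negP; rewrite -leNgt.
exists (fun i x => if i == m then c x else (1 - c x) * w i x).
have E x : \sum_(i < m.+1) (if val i == m then c x else (1 - c x) * w i x) =
     (1 - c x) * (\sum_(i < m) w i x) + c x.
  rewrite big_ord_recr/= eqxx; congr (_ + _); rewrite big_distrr/=; apply: eq_bigr => i _.
  by rewrite ltn_eqF.
have E' x : \sum_(k < m.+1) (if val k == m then c x else (1 - c x) * w k x) * p k x =
     (1 - c x) * F x + c x * p m x.
  rewrite big_ord_recr/= eqxx; congr (_ + _); rewrite big_distrr/=; apply: eq_bigr => i _.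
  by rewrite ltn_eqF// mulrA.
have c01 x : 0 <= c x <= 1 by rewrite cE; case: (_ < _); rewrite ?ler01 ?lexx.
split.
- move=> i; case: eqP => _ //; apply: measurable_funM => //; exact: measurable_funB.
- by move=> i x; have /andP[c0 c1] := c01 x; case: eqP => _ //; rewrite mulr_ge0// subr_ge0.
- move=> x; rewrite E; have /andP[c0 c1] := c01 x.
  have : (1 - c x) * (\sum_(i < m) w i x) <= (1 - c x) * 1 by rewrite ler_wpM2l// subr_ge0.
  by lra.
move=> i x im; rewrite E' cE.
have : (i == m) || (i < m)%N by rewrite -leq_eqVlt -ltnS.
case: ltP => [Fp|pF]; rewrite ?subrr ?subr0 !mul0r ?mul1r ?add0r ?addr0 => /orP[/eqP->//|im'].
  exact: le_trans (wp _ _ im') (ltW Fp).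
exact: wp.
Qed.

End lacunary_maximal.

(** * The low-frequency piece *)

Section low_frequency.
Context {R : realType} {n : nat}.
Notation leb := (lebesgue_rV n : {sigma_finite_measure set 'rV[R]_n -> \bar R}).
Variable sigma : {finite_measure set 'rV[R]_n -> \bar R}.
Variable g : 'rV[R]_n -> 'rV[R]_n.
Hypothesis mg : measurable_fun setT g.
Variable B : R.
Hypothesis gB : forall z, enorm (g z) <= B.
Variable K : nat.
Implicit Types (h : 'rV[R]_n -> R) (x y z : 'rV[R]_n) (r s t L : R).
Local Notation W := (mass sigma).

(** The largest of the scale factors sqrt (i+1) in the smoothing. *)
Definition S0 : R := Num.sqrt K.+1%:R.

Let S0_gt0 : 0 < S0. Proof. by rewrite sqrtr_gt0. Qed.

(** The 2 accounts for [t <= 2 * L], [S0] for the scale factors, and sqrt 2 for the half of the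
    exponent lost to the shift by [t *: g z]. *)
Definition lowscale : R := 2 * Num.sqrt 2 * S0.

Let lowscale_gt0 : 0 < lowscale. Proof. by rewrite /lowscale !mulr_gt0// sqrtr_gt0. Qed.

Definition lowcst : R := lowscale ^+ n * expR (pi * B ^+ 2).

Lemma lowcst_ge0 : 0 <= lowcst.
Proof. by have := ltW lowscale_gt0; rewrite /lowcst => ?; nonneg. Qed.

(** As [s >= 1], the shift is at most B times the width of the kernel and costs only a constant, so
    a single scale serves all t in [L, 2 L]. *)
Lemma heat_shift_le t s L u z : 0 < L -> L <= t <= 2 * L -> 1 <= s -> s <= S0 ->
  heat (t * s) (u - t *: g z) <= lowcst * heat (lowscale * L) u.
Proof.
move=> L0 /andP[Lt tL] s1 sS; have t0 : 0 < t by exact: lt_le_trans Lt.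
have s0 : 0 < s by exact: lt_le_trans s1.
have ts0 : 0 < t * s by exact: mulr_gt0.
have Lts : L <= t * s by apply: (le_trans Lt); rewrite ler_peMr// ltW.
have sc := lowscale_gt0; have p0 := @pi_ge0 R.
rewrite /heat /lowcst.
have -> : lowscale ^+ n * expR (pi * B ^+ 2) * ((lowscale * L)^-1 ^+ n * gauss (lowscale * L)^-1 u) =
    L^-1 ^+ n * (expR (pi * B ^+ 2) * gauss (lowscale * L)^-1 u).
  have -> : (lowscale * L)^-1 ^+ n = lowscale^-1 ^+ n * L^-1 ^+ n by rewrite invfM exprMn.
  have E : lowscale ^+ n * lowscale^-1 ^+ n = 1 by rewrite -exprMn divff ?gt_eqF// expr1n.
  rewrite (_ : _ * _ * (_ * _) = (lowscale ^+ n * lowscale^-1 ^+ n) * (L^-1 ^+ n * (expR (pi * B ^+ 2) * gauss (lowscale * L)^-1 u))); last ring.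
  by rewrite E mul1r.
have h1 : (t * s)^-1 ^+ n <= L^-1 ^+ n.
  apply: lerXn2r; rewrite ?nnegrE ?invr_ge0; [exact: ltW|exact: ltW|].
  by rewrite lef_pV2 ?posrE.
have g0 := gauss_ge0 (t * s)^-1 (u - t *: g z).
apply: ler_pM h1 _ => //; first by rewrite exprn_ge0// invr_ge0 ltW.
rewrite /gauss -expRD ler_expR.
have B2 : dotr (g z) (g z) <= B ^+ 2.
  by rewrite -enorm_sqr; apply: lerXn2r; rewrite ?nnegrE ?enorm_ge0//; exact: le_trans (enorm_ge0 _) (gB z).
set q := dotr (u - t *: g z) (u - t *: g z).
have uq : dotr u u <= 2 * q + 2 * (t ^+ 2 * B ^+ 2).
  have tB : t ^+ 2 * dotr (g z) (g z) <= t ^+ 2 * B ^+ 2 by rewrite ler_wpM2l// sqr_ge0.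
  have := dotr_ge0 (u - 2 *: (t *: g z)); rewrite /q.
  by move: tB; rewrite !dotrBl !dotrBr !dotrZl !dotrZr (dotrC (g z) u) => tB; lra.
have i1 : (t * s)^-1 ^+ 2 * t ^+ 2 <= 1.
  rewrite -exprMn (_ : (t * s)^-1 * t = s^-1); last first.
    by field; rewrite (gt_eqF t0) (gt_eqF s0).
  by apply: exprn_ile1; [rewrite invr_ge0 ltW|rewrite invf_le1].
have i2 : (lowscale * L)^-1 ^+ 2 <= (t * s)^-1 ^+ 2 / 2.
  have e : (lowscale * L) ^+ 2 = 2 * (2 * L * S0) ^+ 2.
    by rewrite /lowscale !exprMn sqr_sqrtr//; ring.
  rewrite exprVn e invfM exprVn mulrC ler_pM2r// lef_pV2 ?posrE ?exprn_gt0 ?mulr_gt0//.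
  by apply: lerXn2r; rewrite ?nnegrE; [exact: ltW|rewrite !mulr_ge0// ltW|apply: ler_pM => //; exact: ltW].
set a := (t * s)^-1 ^+ 2 in i1 i2 *; set b := (lowscale * L)^-1 ^+ 2 in i2 *.
have a0 : 0 <= a by exact: sqr_ge0.
have q0 : 0 <= q by exact: dotr_ge0.
have u0 : 0 <= dotr u u by exact: dotr_ge0.
have h2 : b * dotr u u <= a / 2 * dotr u u by rewrite ler_wpM2r.
have h3 : a / 2 * dotr u u <= a / 2 * (2 * q + 2 * (t ^+ 2 * B ^+ 2)) by rewrite ler_wpM2l// divr_ge0.
have h4 : a * t ^+ 2 * B ^+ 2 <= 1 * B ^+ 2 by rewrite ler_wpM2r// sqr_ge0.
rewrite -subr_ge0 (_ : _ - _ = pi * (B ^+ 2 + a * q - b * dotr u u)); last ring.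
by apply: mulr_ge0 => //; lra.
Qed.

Lemma norm_avg_low h t s L x : 0 < L -> L <= t <= 2 * L -> 1 <= s -> s <= S0 ->
  leb.-integrable setT (EFin \o h) ->
  `|avg sigma g h t s x| <= lowcst * W * heatop (lowscale * L) (fun y => `|h y|) x.
Proof.
move=> L0 tL s1 sS ih; have t0 : 0 < t by case/andP: tL => /(lt_le_trans L0).
have s0 : 0 < s by exact: lt_le_trans s1.
have cL : 0 < lowscale * L by exact: mulr_gt0.
have ian : leb.-integrable setT (EFin \o (fun y => `|h y|)) by exact: integrable_norm ih.
have I := integrable_mul_heat x cL ian.
have c0 : 0 <= lowcst * W by rewrite mulr_ge0 ?lowcst_ge0 ?mass_ge0.
rewrite -lee_fin; have NA := norm_avg_le sigma mg x t0 s0 ih; apply: (le_trans NA).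
rewrite /heatop -RintegralZl// EFin_Rintegral; last exact: integrableRZ.
apply: ge0_le_integralT => y; apply/andP; split.
  by apply: mule_ge0 => //; apply: integral_ge0 => z _; rewrite lee_fin heat_ge0// mulr_gt0.
have h1 : (\int[sigma]_z (heat (t * s) (x - t *: g z - y))%:E <= (lowcst * heat (lowscale * L) (x - y) * W)%:E)%E.
  apply: (@le_trans _ _ (\int[sigma]_z (lowcst * heat (lowscale * L) (x - y))%:E)%E).
    apply: ge0_le_integralT => z; rewrite !lee_fin; apply/andP; split; first by rewrite heat_ge0// mulr_gt0.
    by rewrite addrAC; exact: heat_shift_le.
  by rewrite integral_cst// [leRHS]EFinM /mass fineK ?fin_num_measure.
apply: le_trans (lee_wpmul2l _ h1) _; first by rewrite lee_fin.
by rewrite -EFinM lee_fin le_eqVlt; apply/orP; left; apply/eqP; ring.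
Qed.

Definition bincoef_sum : R := \sum_(i < K.+1) `|bincoef K i : R|.

Lemma bincoef_sum_ge0 : 0 <= bincoef_sum.
Proof. exact: sumr_ge0. Qed.

Lemma norm_smooth_low h t L x : 0 < L -> L <= t <= 2 * L ->
  leb.-integrable setT (EFin \o h) ->
  `|smooth sigma g K h 1 t x| <=
  bincoef_sum * (lowcst * W) * heatop (lowscale * L) (fun y => `|h y|) x.
Proof.
move=> L0 tL ih; apply: le_trans (ler_norm_sum _ _ _) _.
rewrite -mulrA /bincoef_sum mulr_suml; apply: ler_sum => i _.
rewrite normrM ler_wpM2l//; apply: norm_avg_low => //.
  by rewrite mul1r -[leLHS]sqrtr1 ler_sqrt// ler1n.
by rewrite mul1r /S0 ler_sqrt// ler_nat.
Qed.

Lemma dyadic_exists (M : nat) t : (2 ^+ M)^-1 <= t -> t < 2 ^+ M ->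
  exists2 i, (i < M + M)%N & dyad M i <= t <= 2 * dyad M i.
Proof.
move=> tM1 tM2.
have P : exists i, (i < M + M)%N && (t <= 2 * dyad M i).
  have M0 : (0 < M + M)%N.
    rewrite addn_gt0 orbb lt0n; apply/eqP => M0.
    by move: tM1 tM2; rewrite M0 expr0 invr1 => h1 h2; have := le_lt_trans h1 h2; rewrite ltxx.
  exists (M + M).-1; rewrite prednK// leqnn/= /dyad mulrA -exprS prednK// exprD.
  by rewrite mulfK ?expf_neq0// ltW.
case: (ex_minnP P) => i /andP[iM ti] imin; exists i => //; rewrite ti andbT.
case: i iM ti imin => [|i] iM ti imin; first by rewrite /dyad expr0 mul1r.
rewrite leNgt; apply/negP => ti2.
have := imin i; rewrite ltnn => h; have : false; last by [].
apply: h; rewrite (ltn_trans _ iM)//=; move: ti2; rewrite /dyad exprS -mulrA => ti2.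
exact: ltW.
Qed.

Definition lowsquare_cst : R :=
  (bincoef_sum * (lowcst * W)) ^+ 2 * (4 * heatcst (R := R) (n := n) ^+ 2 + 1).

Lemma lowsquare_cst_ge0 : 0 <= lowsquare_cst.
Proof.
by rewrite mulr_ge0 ?sqr_ge0// addr_ge0// mulr_ge0// sqr_ge0.
Qed.

Lemma low_square (M : nat) h (A : R) : leb.-integrable setT (EFin \o h) ->
  (forall x, `|h x| <= A) ->
  exists Q : 'rV[R]_n -> \bar R, [/\ measurable_fun setT Q, forall x, (0 <= Q x)%E,
    forall t x, (2 ^+ M)^-1 <= t -> t < 2 ^+ M -> ((smooth sigma g K h 1 t x ^+ 2)%:E <= Q x)%E &
    (\int[leb]_x Q x <= lowsquare_cst%:E * \int[leb]_x (h x ^+ 2)%:E)%E].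
Proof.
move=> ih hA; pose a y := `|h y|.
have ba : bint a.
  by split; [move=> x; exact: normr_ge0|exists A => x; exact: hA|exact: integrable_norm ih].
pose r := lowscale / 2 ^+ M.
have r0 : 0 < r by rewrite divr_gt0// exprn_gt0.
have rE i : lowscale * dyad M i = r * 2 ^+ i by rewrite /r /dyad; ring.
have ri (i : nat) : 0 < r * 2 ^+ i by rewrite mulr_gt0// exprn_gt0.
have bP (i : nat) : bint (heatop (r * 2 ^+ i) a) by exact: bint_heatop.
have [w ww wmax] := @weights_max R n (M + M) (fun i => heatop (r * 2 ^+ i) a)
  (fun i => bint_measurable (bP i)) (fun i x => bint_ge0 x (bP i)).
pose G := wheat r w a; have bG : bint G by exact: bint_wheat.
pose c := bincoef_sum * (lowcst * W).
have c0 : 0 <= c by rewrite mulr_ge0 ?bincoef_sum_ge0// mulr_ge0 ?lowcst_ge0 ?mass_ge0.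
have mG := bint_measurable bG.
exists (fun x => (c ^+ 2 * (G x * G x))%:E); split.
- by apply/measurable_EFinP; apply: measurable_funM => //; exact: measurable_funM.
- by move=> x; rewrite lee_fin mulr_ge0 ?sqr_ge0// mulr_ge0// bint_ge0.
- move=> t x tM1 tM2; have [i iM ti] := dyadic_exists tM1 tM2.
  have N := norm_smooth_low x (dyad_gt0 M i) ti ih.
  have Gx := wmax (Ordinal iM) x; rewrite /= -rE in Gx.
  have {}N := le_trans N (ler_wpM2l c0 Gx).
  rewrite lee_fin -expr2 -exprMn -real_normK ?num_real//.
  apply: lerXn2r; rewrite ?nnegrE //.
  exact: mulr_ge0 c0 (bint_ge0 x bG).
have Hb := wheat_bound_abs r0 ba ww.
under eq_integral do rewrite EFinM.
have bGG := bint_mul bG bG.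
rewrite ge0_integralZl//; last 3 first.
- by apply/measurable_EFinP; exact: bint_measurable bGG.
- by move=> x _; rewrite lee_fin; exact: bint_ge0 bGG.
- by rewrite lee_fin sqr_ge0.
rewrite -(EFin_Rintegral (bint_int bGG)).
have -> : lowsquare_cst%:E = ((c ^+ 2)%:E * (4 * heatcst (R := R) (n := n) ^+ 2 + 1)%:E)%E by rewrite -EFinM.
rewrite -muleA.
apply: lee_wpmul2l; first by rewrite lee_fin sqr_ge0.
rewrite (_ : (\int[leb]_x (h x ^+ 2)%:E)%E = (\int[leb]_x (a x * a x)%:E)%E); last first.
  by apply: eq_integral => x _; rewrite /a -expr2 real_normK ?num_real.
rewrite -(EFin_Rintegral (bint_int (bint_mul ba ba))) -EFinM lee_fin.
exact: Hb.
Qed.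

End low_frequency.

(** * The pieces and their two bounds *)

Section smooth_theory.
Context {R : realType} {n : nat}.
Notation leb := (lebesgue_rV n : {sigma_finite_measure set 'rV[R]_n -> \bar R}).
Variable sigma : {finite_measure set 'rV[R]_n -> \bar R}.
Variable g : 'rV[R]_n -> 'rV[R]_n.
Hypothesis mg : measurable_fun setT g.
Variable K : nat.
Implicit Types (h : 'rV[R]_n -> R) (x y z : 'rV[R]_n) (r s t L : R).
Local Notation W := (mass sigma).
Local Notation bsum := (@bincoef_sum R K).

Let sqrtS i : 0 < Num.sqrt i.+1%:R :> R. Proof. by rewrite sqrtr_gt0. Qed.

Lemma avg_sum m (v : 'I_m -> 'rV[R]_n -> R) t s x : 0 < t -> 0 < s ->
  (forall i, leb.-integrable setT (EFin \o v i)) ->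
  avg sigma g (fun y => \sum_i v i y) t s x = \sum_i avg sigma g (v i) t s x.
Proof.
move=> t0 s0 iv; have ts0 : 0 < t * s by exact: mulr_gt0.
rewrite /avg -Rintegral_sum; last by move=> i; exact: integrable_heatop_comp.
apply: eq_Rintegral => z _; rewrite /heatop -Rintegral_sum; last by move=> i; exact: integrable_mul_heat.
by apply: eq_Rintegral => y _; rewrite big_distrl.
Qed.

Lemma smooth_sum m (v : 'I_m -> 'rV[R]_n -> R) r t x : 0 < t -> 0 < r ->
  (forall i, leb.-integrable setT (EFin \o v i)) ->
  smooth sigma g K (fun y => \sum_i v i y) r t x = \sum_i smooth sigma g K (v i) r t x.
Proof.
move=> t0 r0 iv; rewrite /smooth exchange_big/=; apply: eq_bigr => i _.
by rewrite avg_sum ?mulr_gt0// mulr_sumr.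
Qed.

Lemma norm_heatop_sup h r x (eta : R) : 0 < r -> leb.-integrable setT (EFin \o h) ->
  (forall y, `|h y| <= eta) -> `|heatop r h x| <= eta.
Proof.
move=> r0 ih hb; rewrite /heatop.
apply: le_trans (le_normr_Rintegral _ (integrable_mul_heat _ r0 ih)) _ => //.
apply: (@le_trans _ _ (\int[leb]_y (eta * heat r (x - y)))).
  apply: le_Rintegral => //.
  - exact: integrable_norm (integrable_mul_heat x r0 ih).
  - by apply: integrableRZ; exact: integrable_heat.
  by move=> y _; rewrite normrM (ger0_norm (heat_ge0 _ r0)) ler_wpM2r//; exact: heat_ge0.
by rewrite RintegralZl ?Rintegral_heat ?mulr1//; exact: integrable_heat.
Qed.

Let cst_int (c : R) : sigma.-integrable setT (EFin \o (cst c : 'rV[R]_n -> R)).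
Proof. exact: finite_measure_integrable_cst. Qed.

Lemma norm_avg_sup h t s x (eta : R) : 0 < t -> 0 < s -> leb.-integrable setT (EFin \o h) ->
  (forall y, `|h y| <= eta) -> `|avg sigma g h t s x| <= eta * W.
Proof.
move=> t0 s0 ih hb; have ts0 : 0 < t * s by exact: mulr_gt0.
have I := integrable_heatop_comp sigma mg t x ts0 ih.
apply: le_trans (le_normr_Rintegral measurableT I) _.
rewrite /mass -[leRHS](@Rintegral_cst _ _ _ sigma setT measurableT eta).
apply: le_Rintegral => //; [exact: integrable_norm I|exact: cst_int|].
by move=> z _; exact: norm_heatop_sup.
Qed.

Lemma norm_smooth_sup h r t x (eta : R) : 0 < t -> 0 < r -> leb.-integrable setT (EFin \o h) ->
  (forall y, `|h y| <= eta) -> `|smooth sigma g K h r t x| <= bsum * (eta * W).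
Proof.
move=> t0 r0 ih hb; apply: le_trans (ler_norm_sum _ _ _) _.
rewrite /bincoef_sum mulr_suml; apply: ler_sum => i _.
by rewrite normrM ler_wpM2l//; apply: norm_avg_sup; rewrite ?mulr_gt0.
Qed.

Definition avgop h t x : R := \int[sigma]_z h (x - t *: g z).

Lemma heatop_approx h r x (Lp : R) : 0 < r -> 0 <= Lp -> leb.-integrable setT (EFin \o h) ->
  (forall y z, `|h y - h z| <= Lp * enorm (y - z)) ->
  `|heatop r h x - h x| <= Lp * (r * Num.sqrt 2 ^+ n).
Proof.
move=> r0 Lp0 ih lip; have I := integrable_mul_heat x r0 ih; have Ih := integrable_heat x r0.
have s2r : 0 < Num.sqrt 2 * r by rewrite mulr_gt0// sqrtr_gt0.
have -> : heatop r h x - h x = \int[leb]_y (h y * heat r (x - y) - h x * heat r (x - y)).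
  rewrite RintegralB//; last exact: integrableRZ.
  by rewrite RintegralZl// Rintegral_heat// mulr1.
have I2 : leb.-integrable setT (EFin \o (fun y => h y * heat r (x - y) - h x * heat r (x - y))).
  by apply: integrableRB => //; exact: integrableRZ.
apply: le_trans (le_normr_Rintegral measurableT I2) _.
apply: (@le_trans _ _ (\int[leb]_y (Lp * (r * Num.sqrt 2 ^+ n) * heat (Num.sqrt 2 * r) (x - y)))).
  apply: le_Rintegral => //; [exact: integrable_norm I2|by apply: integrableRZ; exact: integrable_heat|].
  move=> y _; rewrite -mulrBl normrM (ger0_norm (heat_ge0 _ r0)).
  apply: (@le_trans _ _ (Lp * enorm (x - y) * heat r (x - y))).
    rewrite ler_wpM2r//; first exact: heat_ge0.
    by rewrite distrC.
  by rewrite -!mulrA ler_wpM2l// mulrA; exact: enorm_heat_le.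
rewrite RintegralZl; [|by []|exact: integrable_heat].
by rewrite Rintegral_heat// mulr1.
Qed.

Lemma smooth_approx h r t x (Lp A : R) : 0 < t -> 0 < r -> 0 <= Lp ->
  leb.-integrable setT (EFin \o h) -> (forall y, `|h y| <= A) ->
  (forall y z, `|h y - h z| <= Lp * enorm (y - z)) ->
  `|smooth sigma g K h r t x - avgop h t x| <=
  bsum * (Lp * (t * (r * S0 K) * Num.sqrt 2 ^+ n) * W).
Proof.
move=> t0 r0 Lp0 ih hA lip; have mh : measurable_fun setT h by apply/measurable_EFinP; case/integrableP : ih.
(* The value of [sum_bincoef] at e = 1: the coefficients of the smoothing sum to one, so the error
   is a combination of the errors of single averages. *)
have c1 : \sum_(i < K.+1) bincoef K i = 1 :> R.
  have := @sum_bincoef R K 1; rewrite subrr expr0n/= subr0 => <-.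
  by apply: eq_bigr => i _; rewrite expr1n mulr1.
have -> : smooth sigma g K h r t x - avgop h t x =
    \sum_(i < K.+1) bincoef K i * (avg sigma g h t (r * Num.sqrt i.+1%:R) x - avgop h t x).
  under [RHS]eq_bigr do rewrite mulrBr.
  by rewrite sumrB -mulr_suml c1 mul1r.
apply: le_trans (ler_norm_sum _ _ _) _; rewrite /bincoef_sum mulr_suml; apply: ler_sum => i _.
rewrite normrM ler_wpM2l//.
set s := r * Num.sqrt i.+1%:R; have s0 : 0 < s by rewrite mulr_gt0.
have ts0 : 0 < t * s by exact: mulr_gt0.
have sS : s <= r * S0 K.
  apply: ler_wpM2l; first exact: ltW.
  by rewrite /S0 ler_sqrt// ler_nat.
have I := integrable_heatop_comp sigma mg t x ts0 ih.
have msub : measurable_fun setT (fun z => x - t *: g z).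
  by apply: measurable_rVB => //; exact: measurable_rVZ.
have I' : sigma.-integrable setT (EFin \o (fun z => h (x - t *: g z))).
  by apply: (@integrable_bounded_finite _ _ sigma _ A) => //; exact: (measurableT_comp mh msub).
rewrite /avg /avgop -RintegralB//.
have I2 := integrableRB I I'.
apply: le_trans (le_normr_Rintegral measurableT I2) _.
rewrite /mass -[leRHS](@Rintegral_cst _ _ _ sigma setT measurableT (Lp * (t * (r * S0 K) * Num.sqrt 2 ^+ n))).
apply: le_Rintegral => //; [exact: integrable_norm I2|exact: cst_int|].
move=> z _; apply: le_trans (heatop_approx _ ts0 Lp0 ih lip) _.
rewrite ler_wpM2l// ler_wpM2r ?exprn_ge0 ?sqrtr_ge0//.
by apply: ler_wpM2l => //; exact: ltW.
Qed.

Definition piece (j : nat) h t x : R :=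
  if j is 0 then smooth sigma g K h 1 t x
  else smooth sigma g K h (2 ^- j) t x - smooth sigma g K h (2 * 2 ^- j) t x.

Lemma sum_piece h t x J : \sum_(j < J.+1) piece j h t x = smooth sigma g K h (2 ^- J) t x.
Proof.
elim: J => [|J IH]; first by rewrite big_ord_recl big_ord0 addr0 /= expr0 invr1.
have r2 : 2 * 2 ^- J.+1 = 2 ^- J :> R by rewrite exprS invfM mulrA divff// mul1r.
rewrite big_ord_recr/= IH r2.
by move: (smooth sigma g K h (2 ^- J) t x) (smooth sigma g K h (2 ^- J.+1) t x) => b a; rewrite addrC subrK.
Qed.

Lemma piece_sum m (v : 'I_m -> 'rV[R]_n -> R) j t x : 0 < t ->
  (forall i, leb.-integrable setT (EFin \o v i)) ->
  piece j (fun y => \sum_i v i y) t x = \sum_i piece j (v i) t x.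
Proof.
move=> t0 iv; case: j => [|j] /=; first exact: smooth_sum.
have r0 : 0 < 2 ^- j.+1 :> R by rewrite invr_gt0 exprn_gt0.
by rewrite !smooth_sum// ?mulr_gt0// sumrB.
Qed.

Variable B : R.
Hypothesis gB : forall z, enorm (g z) <= B.
Hypothesis gsigma : {ae sigma, forall z, g z = z}.
Variables (beta C : R).
Hypothesis beta0n : 0 <= beta <= n%:R.
Hypothesis C0 : 0 <= C.
Hypothesis dim : forall x r, 0 < r -> (sigma (eball x r) <= (C * r `^ beta)%:E)%E.

Definition piece_hlcst : R := 2 * (bsum * @hlcst R n B C (S0 K)).

Lemma piece_hlcst_ge0 : 0 <= piece_hlcst.
Proof.
apply: mulr_ge0 => //; apply: mulr_ge0; first exact: bincoef_sum_ge0.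
exact: (hlcst_ge0 gB C0 (sqrtS K)).
Qed.

Lemma norm_smooth_hl h r t x : 0 < t -> 0 < r -> r <= 1 -> leb.-integrable setT (EFin \o h) ->
  ((`|smooth sigma g K h r t x|)%:E <= (bsum * @hlcst R n B C (S0 K) * r `^ (beta - n%:R))%:E * hlmax h x)%E.
Proof.
move=> t0 r0 r1 ih; have H0 := hlmax_ge0 h x.
have S0p : 0 < S0 K :> R by exact: sqrtS.
have hc0 := hlcst_ge0 gB C0 S0p.
apply: (@le_trans _ _ (\sum_(i < K.+1) (`|bincoef K i|)%:E * ((@hlcst R n B C (S0 K) * r `^ (beta - n%:R))%:E * hlmax h x))%E); last first.
  rewrite -ge0_sume_distrl; last by move=> i _; rewrite lee_fin.
  by rewrite sumEFin muleA -EFinM mulrA.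
apply: (@le_trans _ _ (\sum_(i < K.+1) (`|bincoef K i * avg sigma g h t (r * Num.sqrt i.+1%:R) x|)%:E)%E).
  by rewrite sumEFin lee_fin; exact: ler_norm_sum.
apply: lee_sum => i _; rewrite normrM EFinM; apply: lee_wpmul2l; first by rewrite lee_fin.
have s0 : 0 < r * Num.sqrt i.+1%:R by rewrite mulr_gt0.
have si : r <= r * Num.sqrt i.+1%:R.
  by have r0' := ltW r0; rewrite ler_peMr// -[leLHS]sqrtr1 ler_sqrt// ler1n.
have sS : r * Num.sqrt i.+1%:R <= S0 K.
  apply: (@le_trans _ _ (Num.sqrt i.+1%:R)); first by rewrite ler_piMl// sqrtr_ge0.
  by rewrite /S0 ler_sqrt// ler_nat.
apply: le_trans (avg_le_hlmax mg gB gsigma beta0n C0 S0p dim x t0 s0 sS ih) _.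
apply: lee_wpmul2r => //; rewrite lee_fin ler_wpM2l//.
rewrite -(opprB n%:R) !powRN lef_pV2 ?posrE ?powR_gt0//.
apply: ge0_ler_powR; rewrite ?nnegrE ?subr_ge0//; [by case/andP: beta0n|exact: ltW|exact: ltW].
Qed.

(** No cancellation is used: the two smoothings of a difference are bounded separately, the finer
    scale being the worse one because beta <= n. *)
Lemma norm_piece_hl j h t x : 0 < t -> leb.-integrable setT (EFin \o h) ->
  ((`|piece j h t x|)%:E <= (piece_hlcst * (2 ^- j) `^ (beta - n%:R))%:E * hlmax h x)%E.
Proof.
move=> t0 ih; have H0 := hlmax_ge0 h x.
have S0p : 0 < S0 K :> R by exact: sqrtS.
have hc0 := hlcst_ge0 gB C0 S0p.
have b0 := @bincoef_sum_ge0 R K.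
have p0 (y : R) : 0 <= bsum * @hlcst R n B C (S0 K) * y `^ (beta - n%:R).
  by apply: mulr_ge0; [exact: mulr_ge0|exact: powR_ge0].
case: j => [|j].
  rewrite /piece expr0 invr1; apply: le_trans (norm_smooth_hl x t0 ltr01 (lexx _) ih) _.
  apply: lee_wpmul2r => //; rewrite lee_fin /piece_hlcst.
  by have := p0 1; rewrite -!mulrA; lra.
rewrite /piece; have r0 : 0 < 2 ^- j.+1 :> R by rewrite invr_gt0 exprn_gt0.
have r20 : 0 < 2 * 2 ^- j.+1 :> R by rewrite mulr_gt0.
have r2 : 2 * 2 ^- j.+1 = 2 ^- j :> R by rewrite exprS invfM mulrA divff// mul1r.
have r1 : 2 * 2 ^- j.+1 <= 1 :> R by rewrite r2 invf_le1 ?exprn_gt0// exprn_ege1// ler1n.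
have rr : 2 ^- j.+1 <= 2 * 2 ^- j.+1 :> R by rewrite ler_peMl ?ltW// ltr1n.
have e1 := norm_smooth_hl x t0 r0 (le_trans rr r1) ih.
have e2 := norm_smooth_hl x t0 r20 r1 ih.
apply: (@le_trans _ _ ((`|smooth sigma g K h (2 ^- j.+1) t x|)%:E + (`|smooth sigma g K h (2 * 2 ^- j.+1) t x|)%:E)%E).
  by rewrite -EFinD lee_fin; exact: ler_normB.
apply: le_trans (leeD e1 e2) _.
rewrite -ge0_muleDl ?lee_fin//.
apply: lee_wpmul2r => //; rewrite -EFinD lee_fin /piece_hlcst.
have : (2 * 2 ^- j.+1) `^ (beta - n%:R) <= (2 ^- j.+1) `^ (beta - n%:R) :> R.
  rewrite -(opprB n%:R) !powRN lef_pV2 ?posrE ?powR_gt0//.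
  apply: ge0_ler_powR; rewrite ?nnegrE ?subr_ge0//; by case/andP: beta0n.
move=> hle; have := ler_wpM2l (mulr_ge0 b0 hc0) hle.
by rewrite -!mulrA; lra.
Qed.

Variables (alpha C1 C2 : R).
Hypothesis alpha_half : 1 / 2 < alpha.
Hypothesis alphaK : alpha <= K.+1%:R.
Hypothesis C10 : 0 <= C1.
Hypothesis C20 : 0 <= C2.
Notation leb1 := (@lebesgue_measure R).
Hypothesis decay : forall eta : 'rV[R]_n,
  (\int[leb1]_(t in `[1%R, 2%R]) (mcos sigma g (t *: eta) ^+ 2 + msin sigma g (t *: eta) ^+ 2)%:E
     <= (C1 * ((1 + enorm eta) `^ (- alpha)) ^+ 2)%:E)%E.
Hypothesis ddecay : forall eta : 'rV[R]_n,
  (\int[leb1]_(t in `[1%R, 2%R]) (dmcos sigma g t eta ^+ 2 + dmsin sigma g t eta ^+ 2)%:E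
     <= (C2 * enorm eta ^+ 2 * ((1 + enorm eta) `^ (- alpha)) ^+ 2)%:E)%E.

Definition piece_sqcst : R := lowsquare_cst sigma B K + 24 * famcst K C1 C2.

Lemma piece_sqcst_ge0 : 0 <= piece_sqcst.
Proof. by rewrite addr_ge0 ?lowsquare_cst_ge0// mulr_ge0// famcst_ge0. Qed.

(** The majorant [Q] depends on the range of t through [M], the bound on its integral does not; this
    is what survives the passage to all t > 0. *)
Lemma piece_square (M j : nat) h (A : R) : leb.-integrable setT (EFin \o h) ->
  (forall x, `|h x| <= A) ->
  exists Q : 'rV[R]_n -> \bar R, [/\ measurable_fun setT Q, forall x, (0 <= Q x)%E,
    forall t x, (2 ^+ M)^-1 <= t -> t < 2 ^+ M -> ((piece j h t x ^+ 2)%:E <= Q x)%E &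
    (\int[leb]_x Q x <= (piece_sqcst * (2 ^- j) `^ (2 * alpha - 1))%:E * \int[leb]_x (h x ^+ 2)%:E)%E].
Proof.
move=> ih hA; have l0 := lowsquare_cst_ge0 sigma B K; have fc0 := famcst_ge0 K C10 C20.
have int0 : (0 <= \int[leb]_x (h x ^+ 2)%:E)%E by apply: integral_ge0 => x _; rewrite lee_fin sqr_ge0.
have f240 : 0 <= 24 * famcst K C1 C2 by exact: mulr_ge0.
case: j => [|j].
  have [Q [mQ Q0 Qle Qint]] := low_square sigma mg gB K M ih hA.
  exists Q; split => //; apply: (le_trans Qint); apply: lee_wpmul2r => //.
  by rewrite lee_fin expr0 invr1 powR1 mulr1 /piece_sqcst lerDl.
set r : R := 2 ^- j.+1; have r0 : 0 < r by rewrite invr_gt0 exprn_gt0.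
have rh : r <= 2^-1.
  by rewrite /r lef_pV2 ?posrE ?exprn_gt0// -[leLHS]expr1 ler_weXn2l// ler1n.
exists (dyadic_square sigma g K h M r); split.
- exact: measurable_dyadic_square.
- by move=> x; exact: dyadic_square_ge0.
- move=> t x tM1 tM2; have t0 : 0 < t by apply: lt_le_trans tM1; rewrite invr_gt0 exprn_gt0.
  rewrite /piece -/r smoothB_multop//.
  exact: (multop_le_dyadic_square sigma mg gB K ih x r0 rh tM1 tM2).
have al0 : 0 < alpha by apply: lt_trans alpha_half; rewrite divr_gt0.
have HH := integral_dyadic_square_le mg gB al0 alphaK C10 C20 decay ddecay ih M r0 rh.
apply: (le_trans HH).
apply: lee_wpmul2r => //; rewrite lee_fin.
have -> : r^-1 * (r `^ alpha) ^+ 2 = r `^ (2 * alpha - 1).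
  have rn : r != 0 by rewrite gt_eqF.
  rewrite (@powRD _ r (2 * alpha) (-1)); last by rewrite rn implybT.
  by rewrite powR_inv1 ?ltW// mulrC (mulrC 2) powRrM (powR_mulrn 2)// powR_ge0.
by rewrite ler_wpM2r ?powR_ge0// /piece_sqcst lerDr.
Qed.

End smooth_theory.

(** * Summation of interpolated bounds *)

Section interpolation_sums.
Context {R : realType}.
Implicit Types a b l x y : R.

Lemma powR_expR a (r : R) : expR a `^ r = expR (a * r).
Proof. by rewrite expRM. Qed.

Lemma two_expR (j : nat) : 2 ^+ j = expR (j%:R * ln 2) :> R.
Proof. by rewrite expRM_natl lnK// posrE. Qed.

Lemma twoN_expR (j : nat) : 2 ^- j = expR (- (j%:R * ln 2)) :> R.
Proof. by rewrite expRN -two_expR. Qed.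

Lemma dyad_expR (N k : nat) : dyad N k = expR ((k%:R - N%:R) * ln 2) :> R.
Proof. by rewrite /dyad !two_expR -expRN -expRD; congr expR; ring. Qed.

(** One bound grows in [l] and the other decays. They cross at l = b - a, where both equal the
    interpolated value, and away from there the smaller one decays at a rate of at least [c]. *)
Lemma interp_pair (theta c a b l D : R) : 0 <= c -> c <= theta -> c <= 1 - theta ->
  D <= expR (theta * l + a) -> D <= expR (b - (1 - theta) * l) ->
  D <= expR ((1 - theta) * a + theta * b) * peak (expR (c * (l + a - b))).
Proof.
move=> c0 c1 c2 h1 h2; set G := (1 - theta) * a + theta * b; set s := l + a - b.
have E1 : theta * l + a = G + theta * s by rewrite /G /s; ring.
have E2 : b - (1 - theta) * l = G - (1 - theta) * s by rewrite /G /s; ring.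
rewrite E1 in h1; rewrite E2 in h2.
rewrite /peak -expRN; have [s0|s0] := leP s 0.
  have cs : c * s <= 0 by rewrite mulr_ge0_le0.
  rewrite min_l ?ler_expR; last by lra.
  rewrite -expRD; apply: (le_trans h1); rewrite ler_expR lerD2l.
  by rewrite ler_wnM2r.
have cs : 0 <= c * s by rewrite mulr_ge0// ltW.
rewrite min_r ?ler_expR; last by lra.
rewrite -expRD; apply: (le_trans h2); rewrite ler_expR lerD2l lerN2.
by rewrite ler_wpM2r// ltW.
Qed.

Lemma sum_geom_le x (J : nat) : 0 <= x -> x < 1 -> \sum_(j < J) x ^+ j <= (1 - x)^-1.
Proof.
move=> x0 x1; have d0 : 0 < 1 - x by rewrite subr_gt0.
rewrite -[leRHS]mul1r ler_pdivlMr//.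
have -> : (\sum_(j < J) x ^+ j) * (1 - x) = 1 - x ^+ J.
  elim: J => [|J IH]; first by rewrite big_ord0 mul0r expr0 subrr.
  by rewrite big_ord_recr/= mulrDl IH exprS; ring.
by rewrite lerBlDr lerDl exprn_ge0.
Qed.

Lemma sum_twoN_le (kap : R) (J : nat) : 0 < kap ->
  \sum_(j < J) (2 ^- j) `^ kap <= (1 - expR (- (kap * ln 2)))^-1.
Proof.
move=> k0; have l2 : 0 < ln 2 :> R by rewrite ln_gt0// ltr1n.
rewrite (eq_bigr (fun j : 'I_J => expR (- (kap * ln 2)) ^+ j)); last first.
  by move=> j _; rewrite twoN_expR powR_expR -expRM_natl; congr expR; ring.
apply: sum_geom_le; first exact: expR_ge0.
by rewrite expR_lt1 oppr_lt0 mulr_gt0.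
Qed.

Variables (theta d nu : R).
Hypothesis theta01 : 0 < theta < 1.
Hypothesis dnu : 0 < d * (1 - theta) - nu * theta.

Let c : R := Num.min theta (1 - theta).
Let q : R := expR (c * ln 2).

Definition interp_cst : R :=
  2 * (1 + q) / (q - 1) * (1 - expR (- ((d * (1 - theta) - nu * theta) * ln 2)))^-1.

Let ln2 : 0 < ln 2 :> R. Proof. by rewrite ln_gt0// ltr1n. Qed.
Let c0 : 0 < c. Proof. by rewrite lt_min subr_gt0. Qed.
Let q1 : 1 < q. Proof. by rewrite expR_gt1 mulr_gt0. Qed.
Let Cq0 : 0 <= 2 * (1 + q) / (q - 1).
Proof. by rewrite divr_ge0 ?subr_ge0 ?(ltW q1)// mulr_ge0// addr_ge0// expR_ge0. Qed.
Let geom0 : 0 <= (1 - expR (- ((d * (1 - theta) - nu * theta) * ln 2)))^-1.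
Proof. by rewrite invr_ge0 subr_ge0 ltW// expR_lt1 oppr_lt0 mulr_gt0. Qed.

Lemma interp_cst_ge0 : 0 <= interp_cst.
Proof. exact: mulr_ge0. Qed.

(** For each j the sum over k is a sum of [peak] along a geometric progression; where the bounds
    cross depends on j, [A] and [B], but the sum does not. What remains is (2^-j)^(d (1-theta) - nu
    theta), summable by [dnu]. *)
Lemma interp_sum (N J M : nat) (D : nat -> nat -> R) (A B : R) : 0 <= A -> 0 <= B ->
  (forall j k, 0 <= D j k) ->
  (forall j k, (j < J)%N -> (k < M)%N -> D j k <= (2 ^- j) `^ d * dyad N k `^ theta * A) ->
  (forall j k, (j < J)%N -> (k < M)%N -> D j k <= (2 ^- j) `^ (- nu) * dyad N k `^ (- (1 - theta)) * B) ->
  \sum_(j < J) \sum_(k < M) D j k <= interp_cst * (A `^ (1 - theta) * B `^ theta).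
Proof.
have /andP[th0 th1] := theta01.
move=> A0 B0 D0 DA DB.
(* If [A] or [B] vanishes, then so does every term; otherwise both may be written as
   exponentials. *)
have triv : A * B = 0 -> \sum_(j < J) \sum_(k < M) D j k <= interp_cst * (A `^ (1 - theta) * B `^ theta).
  move=> AB; rewrite big1; first by rewrite mulr_ge0 ?interp_cst_ge0// mulr_ge0// powR_ge0.
  move=> j _; rewrite big1// => k _; apply/eqP; rewrite eq_le D0 andbT.
  have hA := DA j k (ltn_ord j) (ltn_ord k); have hB := DB j k (ltn_ord j) (ltn_ord k).
  by move/eqP: AB; rewrite mulf_eq0 => /orP[/eqP E|/eqP E]; [move: hA|move: hB]; rewrite E mulr0.
have [E|An] := eqVneq A 0; first by apply: triv; rewrite E mul0r.
have [E|Bn] := eqVneq B 0; first by apply: triv; rewrite E mulr0.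
have Ap : 0 < A by rewrite lt_neqAle eq_sym An.
have Bp : 0 < B by rewrite lt_neqAle eq_sym Bn.
have EA : A = expR (ln A) by rewrite lnK// posrE.
have EB : B = expR (ln B) by rewrite lnK// posrE.
move: EA EB; move: (ln A) (ln B) => a b EA EB {triv}.
pose aj (j : nat) := a - j%:R * ln 2 * d.
pose bj (j : nat) := b + j%:R * ln 2 * nu.
pose lk (k : nat) : R := (k%:R - N%:R) * ln 2.
have c1 : c <= theta by rewrite ge_min lexx.
have c2 : c <= 1 - theta by rewrite ge_min lexx orbT.
have main (j : 'I_J) (k : 'I_M) : D j k <= expR ((1 - theta) * aj j + theta * bj j) *
    peak (expR (c * (aj j - bj j - N%:R * ln 2)) * q ^+ k).
  have -> : expR (c * (aj j - bj j - N%:R * ln 2)) * q ^+ k = expR (c * (lk k + aj j - bj j)).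
    by rewrite /q -expRM_natl -expRD /lk; congr expR; ring.
  apply: interp_pair => //; first exact: ltW.
    apply: le_trans (DA _ _ (ltn_ord j) (ltn_ord k)) _.
    rewrite EA twoN_expR dyad_expR !powR_expR -!expRD ler_expR /lk /aj le_eqVlt; apply/orP; left; apply/eqP; ring.
  apply: le_trans (DB _ _ (ltn_ord j) (ltn_ord k)) _.
  rewrite EB twoN_expR dyad_expR !powR_expR -!expRD ler_expR /lk /bj le_eqVlt; apply/orP; left; apply/eqP; ring.
apply: (@le_trans _ _ (\sum_(j < J) (A `^ (1 - theta) * B `^ theta * (2 ^- j) `^ (d * (1 - theta) - nu * theta)) *
    (2 * (1 + q) / (q - 1)))).
  apply: ler_sum => j _.
  apply: (@le_trans _ _ (\sum_(k < M) expR ((1 - theta) * aj j + theta * bj j) *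
    peak (expR (c * (aj j - bj j - N%:R * ln 2)) * q ^+ k))).
    by apply: ler_sum => k _; exact: main.
  rewrite -mulr_sumr.
  have -> : A `^ (1 - theta) * B `^ theta * (2 ^- j) `^ (d * (1 - theta) - nu * theta) =
     expR ((1 - theta) * aj j + theta * bj j).
    by rewrite EA EB twoN_expR !powR_expR -!expRD /aj /bj; congr expR; ring.
  by rewrite ler_wpM2l ?expR_ge0// sum_peak_le// expR_ge0.
rewrite -mulr_suml -mulr_sumr /interp_cst.
have AB0 : 0 <= A `^ (1 - theta) * B `^ theta by rewrite mulr_ge0// powR_ge0.
have := sum_twoN_le J dnu.
set G := (1 - _)^-1; set SS := \sum_(j < J) _; set C := 2 * (1 + q) / (q - 1); set X := _ `^ _ * _.
move=> h; have := ler_wpM2l (mulr_ge0 AB0 Cq0) h.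
rewrite -/X -/C => h'; rewrite (_ : X * SS * C = X * C * SS); last ring.
by rewrite (_ : C * G * X = X * C * G); last ring.
Qed.

(** A crude form of Young's inequality that holds at the end points with 0^0 = 1; the end point s =
    1 occurs where q is infinite. *)
Lemma powR_mul_le_add x y (s : R) : 0 <= x -> 0 <= y -> 0 <= s <= 1 -> x `^ s * y `^ (1 - s) <= x + y.
Proof.
move=> x0 y0 /andP[s0 s1]; pose m := x + y.
have m0 : 0 <= m by exact: addr_ge0.
have [mE|mn] := eqVneq m 0.
  have xE : x = 0 by rewrite /m in mE; lra.
  have yE : y = 0 by rewrite /m in mE; lra.
  rewrite xE yE addr0; have [->|sn] := eqVneq s 0.
    by rewrite subr0 powRr0 powRr1// mul1r.
  by rewrite powR0// mul0r.
have h1 : x `^ s <= m `^ s by apply: ge0_ler_powR; rewrite ?nnegrE// /m lerDl.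
have h2 : y `^ (1 - s) <= m `^ (1 - s).
  by apply: ge0_ler_powR; rewrite ?nnegrE ?subr_ge0// /m lerDr.
apply: le_trans (ler_pM (powR_ge0 _ _) (powR_ge0 _ _) h1 h2) _.
by rewrite -powRD ?mn ?implybT// addrC subrK powRr1.
Qed.

End interpolation_sums.

(** * Measurability of powers and auxiliary limits *)

Section measurability.
Context d (T : measurableType d) (R : realType).
Implicit Types f h : T -> R.

Lemma measurable_bool (b : T -> bool) : measurable_fun setT b ->
  measurable_fun setT (fun x => (b x)%:R : R).
Proof.
move=> mb; have mE : measurable (b @^-1` [set true]) by rewrite -[X in measurable X]setTI; exact: mb.
rewrite (_ : (fun x => _) = \1_(b @^-1` [set true])); first exact: measurable_indic.
apply/funext => x; rewrite indicE; case: (boolP (b x)) => bx; first by rewrite mem_set.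
by rewrite memNset//= => h; rewrite h in bx.
Qed.

Lemma measurable_powR2 f h : measurable_fun setT f -> measurable_fun setT h ->
  (forall x, 0 <= f x) -> measurable_fun setT (fun x => f x `^ h x).
Proof.
move=> mf mh f0.
have mb1 : measurable_fun setT (fun x => (0 < f x)%R) by exact: measurable_fun_ltr.
have mb2 : measurable_fun setT (fun x => (h x == 0)%R).
  rewrite (_ : (fun x => _) = (fun x => ((h x <= 0) && (0 <= h x))%R)); last first.
    by apply/funext => x; rewrite -eq_le.
  by apply: measurable_and; exact: measurable_fun_ler.
(* The second summand records that a zero base gives 1 when the exponent is 0 and 0 otherwise. *)
rewrite (_ : (fun x => _) = (fun x => (0 < f x)%R%:R * expR (h x * ln (f x)) +
   (1 - (0 < f x)%R%:R) * (h x == 0)%R%:R)); last first.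
  apply/funext => x; rewrite /powR; have [->|fn] := eqVneq (f x) 0.
    by rewrite ltxx mul0r add0r subr0 mul1r.
  by rewrite lt_neqAle eq_sym fn f0/= mul1r subrr mul0r addr0.
apply: measurable_funD; apply: measurable_funM.
- exact: measurable_bool.
- apply: measurableT_comp => //; apply: measurable_funM => //.
  exact: (measurableT_comp (@measurable_ln R)).
- by apply: measurable_funB => //; exact: measurable_bool.
- exact: measurable_bool.
Qed.
End measurability.

Lemma limn_einf_ge (R : realType) (v : (\bar R)^nat) (c : \bar R) (N : nat) :
  (forall m, (N <= m)%N -> (c <= v m)%E) -> (c <= limn_einf v)%E.
Proof.
move=> h; rewrite limn_einf_lim; apply: lime_ge; first exact: is_cvg_einfs.
exists N => // m /= Nm; apply: le_ereal_inf_tmp => _ [k /= mk] <-.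
by apply: h; exact: leq_trans mk.
Qed.

Lemma norm_split_le (R : realType) (p q w m : R) :
  `|q| <= m / 2 -> `|p + q - w| <= m / 2 -> `|p - w| <= m.
Proof.
move=> h1 h2; rewrite (_ : p - w = (p + q - w) - q); last ring.
by apply: le_trans (ler_normB _ _) _; lra.
Qed.

Lemma norm_close_le (R : realType) (p w c : R) :
  `|p - w| <= `|w| / 2 -> `|p| <= c -> `|w| <= `|w| / 2 + c.
Proof.
by move=> h1 h2; have := ler_normB p (p - w); rewrite subKr; lra.
Qed.

Section hl_scale.
Context {R : realType} {n : nat}.
Notation leb := (lebesgue_rV n : {sigma_finite_measure set 'rV[R]_n -> \bar R}).

Lemma hlmax_scale (h F : 'rV[R]_n -> R) (c : R) x : measurable_fun setT F -> 0 <= c ->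
  (forall y, `|h y| <= c * `|F y|) -> (hlmax h x <= c%:E * hlmax F x)%E.
Proof.
move=> mF c0 hF; apply: ge_ereal_sup => _ [r /= r0] <-.
have v0 := eball_volume_gt0 x r0.
have vi : (0 <= (lebesgue_rV n (eball x r))^-1)%E.
  have : (lebesgue_rV n (eball x r) \is a fin_num)%E.
    by rewrite ge0_fin_numE//; apply: le_lt_trans (eball_volume_le _ (ltW r0)) _; exact: ltry.
  by move: v0; case: (lebesgue_rV n (eball x r)) => // v; rewrite lte_fin => v0 _; rewrite inver gt_eqF// lee_fin invr_ge0 ltW.
have mb := @measurable_eball R n x r.
have mF' : measurable_fun (eball x r) (fun y => (`|F y|)%:E).
  by apply/measurable_EFinP; apply: measurable_funTS; exact: measurableT_comp.
apply: (@le_trans _ _ (c%:E * ((lebesgue_rV n (eball x r))^-1 * \int[lebesgue_rV n]_(y in eball x r) (`|F y|)%:E))%E).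
  rewrite muleCA; apply: lee_wpmul2l => //.
  rewrite -ge0_integralZl//; try (by rewrite lee_fin).
  by apply: ge0_le_integral_in => y _; rewrite !lee_fin normr_ge0/= hF.
apply: lee_wpmul2l; first by rewrite lee_fin.
by apply: ereal_sup_ubound; exists r.
Qed.
End hl_scale.

(** * Pointwise interpolation along level sets *)

Section interpolation.
Context {R : realType} {n : nat}.
Notation leb := (lebesgue_rV n : {sigma_finite_measure set 'rV[R]_n -> \bar R}).
Notation leb1 := (@lebesgue_measure R).
Variable sigma : {finite_measure set 'rV[R]_n -> \bar R}.
Variable g : 'rV[R]_n -> 'rV[R]_n.
Hypothesis mg : measurable_fun setT g.
Variable K : nat.
Variable B : R.
Hypothesis gB : forall z, enorm (g z) <= B.
Hypothesis gsigma : {ae sigma, forall z, g z = z}.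
Variables (beta C : R).
Hypothesis beta0n : 0 <= beta <= n%:R.
Hypothesis C0 : 0 <= C.
Hypothesis dim : forall (x : 'rV[R]_n) r, 0 < r -> (sigma (eball x r) <= (C * r `^ beta)%:E)%E.
Variables (alpha C1 C2 : R).
Hypothesis alpha_half : 1 / 2 < alpha.
Hypothesis alphaK : alpha <= K.+1%:R.
Hypothesis C10 : 0 <= C1.
Hypothesis C20 : 0 <= C2.
Hypothesis decay : forall eta : 'rV[R]_n,
  (\int[leb1]_(t in `[1%R, 2%R]) (mcos sigma g (t *: eta) ^+ 2 + msin sigma g (t *: eta) ^+ 2)%:E
     <= (C1 * ((1 + enorm eta) `^ (- alpha)) ^+ 2)%:E)%E.
Hypothesis ddecay : forall eta : 'rV[R]_n,
  (\int[leb1]_(t in `[1%R, 2%R]) (dmcos sigma g t eta ^+ 2 + dmsin sigma g t eta ^+ 2)%:E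
     <= (C2 * enorm eta ^+ 2 * ((1 + enorm eta) `^ (- alpha)) ^+ 2)%:E)%E.
(** [d] is a decay exponent strictly below alpha - 1/2: by [dtheta] it is still large enough to sum
    the interpolated bounds over j, and by [dalpha] the part given up sums the squares. *)
Variables (theta d : R).
Hypothesis theta01 : 0 < theta < 1.
Hypothesis dtheta : 0 < d * (1 - theta) - (n%:R - beta) * theta.
Hypothesis dalpha : 0 < 2 * alpha - 1 - 2 * d.

(** [u] will be the real or imaginary part of f divided by its norm bound, [a] the modulus of the
    same quotient, and [pp] a Borel version of the exponent. *)
Variables (u a pp : 'rV[R]_n -> R).
Hypothesis iu : leb.-integrable setT (EFin \o u).
Hypothesis ma : measurable_fun setT a.
Hypothesis mpp : measurable_fun setT pp.
Hypothesis a0 : forall x, 0 <= a x.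
Hypothesis ua : forall x, `|u x| <= a x.
Hypothesis app : (\int[leb]_x (a x `^ pp x)%:E <= 1)%E.
Variable A1 : R.
Hypothesis aA1 : forall x, a x <= A1.

Let th0 : 0 < theta. Proof. by case/andP: theta01. Qed.
Let th1 : 0 < 1 - theta. Proof. by rewrite subr_gt0; case/andP: theta01. Qed.
Let mu : measurable_fun setT u.
Proof. by apply/measurable_EFinP; case/integrableP : iu. Qed.

(** The quotient f1 / f0, with exponent p/q - p/2, and [fone] is f1 itself. Both are written without
    q, so they keep a meaning where q is infinite and p/q = 0. *)
Definition ratio x : R := a x `^ ((2 - pp x) / (2 * theta)).
Definition fone x : R := a x `^ ((2 - (1 - theta) * pp x) / (2 * theta)).
Definition inlevel N k x : bool := (dyad N k <= ratio x) && (ratio x < dyad N k.+1).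
Definition level N k x : R := u x * (inlevel N k x)%:R.
Definition cut N x : R := u x * ((dyad N 0 <= ratio x) && (ratio x < dyad N (N + N)))%R%:R.

Lemma measurable_ratio : measurable_fun setT ratio.
Proof.
by apply: measurable_powR2 => //; apply: measurable_funM => //; exact: measurable_funB.
Qed.

Lemma measurable_fone : measurable_fun setT fone.
Proof.
apply: measurable_powR2 => //; apply: measurable_funM => //; apply: measurable_funB => //.
exact: measurable_funM.
Qed.

Let mapp : measurable_fun setT (fun x => a x `^ pp x).
Proof. exact: measurable_powR2. Qed.

Let mb (x1 x2 : R) : measurable_fun setT (fun x => ((x1 <= ratio x) && (ratio x < x2))%R%:R : R).
Proof.
apply: measurable_bool; have mr := measurable_ratio.
by apply: measurable_and; [exact: measurable_fun_ler|exact: measurable_fun_ltr].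
Qed.

Let imul (b : 'rV[R]_n -> bool) : measurable_fun setT (fun x => (b x)%:R : R) ->
  leb.-integrable setT (EFin \o (fun x => u x * (b x)%:R)).
Proof.
move=> mbb; apply: (@le_integrableR _ _ _ _ _ (fun x => `|u x|)).
- exact: measurable_funM.
- by move=> x; case: (b x); rewrite ?mulr1// mulr0 normr0.
- exact: integrable_norm iu.
Qed.

Lemma integrable_level N k : leb.-integrable setT (EFin \o level N k).
Proof. by apply: imul; exact: mb. Qed.

Lemma integrable_cut N : leb.-integrable setT (EFin \o cut N).
Proof. by apply: (@imul (fun x => (dyad N 0 <= ratio x) && (ratio x < dyad N (N + N)))); exact: mb. Qed.

Let dyad_le N k : dyad N k <= dyad N k.+1 :> R.
Proof. by rewrite /dyad exprS -mulrA ler_peMl ?ler1n// mulr_ge0 ?invr_ge0 ?exprn_ge0. Qed.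

Lemma sum_inlevel N m x :
  \sum_(k < m) (inlevel N k x)%:R = ((dyad N 0 <= ratio x) && (ratio x < dyad N m))%R%:R :> R.
Proof.
elim: m => [|m IH].
  by rewrite big_ord0 ltNge; case: (dyad N 0 <= ratio x).
rewrite big_ord_recr/= IH /inlevel.
have d0 : dyad N 0 <= dyad N m :> R by elim: (m) => [|i IHi] //; exact: le_trans IHi (dyad_le _ _).
have dm := dyad_le N m.
have [h0|h0] := leP (dyad N 0) (ratio x); last first.
  by rewrite (leNgt (dyad N m)) (lt_le_trans h0 d0)/= addr0.
have [h1|h1] := ltP (ratio x) (dyad N m); last by rewrite /= add0r.
by rewrite /= addr0 (lt_le_trans h1 dm).
Qed.

Lemma cut_sum N : cut N = (fun x => \sum_(k < N + N) level N k x).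
Proof. by apply/funext => x; rewrite /cut -sum_inlevel mulr_sumr. Qed.

Let aexp x : 0 < a x -> exists l, a x = expR l.
Proof. by move=> ax; exists (ln (a x)); rewrite lnK// posrE. Qed.

(** Rests on a = ratio^theta a^(p/2) and the upper end of the level; the companion bound rests on a
    = ratio^(theta-1) f1 and the lower end. *)
Lemma level_sqr_le N k x : level N k x ^+ 2 <=
  ((2 * dyad N k) `^ theta) ^+ 2 * (a x `^ pp x * (inlevel N k x)%:R).
Proof.
rewrite /level; have [|_] := boolP (inlevel N k x); last by rewrite !mulr0 expr0n.
move=> /andP[_ h2]; rewrite !mulr1 -real_normK ?num_real//.
have [az|an] := eqVneq (a x) 0.
  have -> : `|u x| = 0 by apply/eqP; rewrite eq_le normr_ge0 -az ua.
  by rewrite expr0n/= mulr_ge0 ?sqr_ge0 ?powR_ge0.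
have ap : 0 < a x by rewrite lt_neqAle eq_sym an a0.
have [l lE] := aexp ap.
have dE : 2 * dyad N k = dyad N k.+1 :> R by rewrite /dyad exprS mulrA.
rewrite dE; apply: (@le_trans _ _ (a x ^+ 2)); first by apply: lerXn2r; rewrite ?nnegrE.
have -> : a x ^+ 2 = (ratio x `^ theta) ^+ 2 * a x `^ pp x.
  rewrite /ratio lE !powR_expR -!expRM_natl -expRD; congr expR.
  by field; rewrite gt_eqF.
apply: ler_wpM2r; first exact: powR_ge0.
apply: lerXn2r; rewrite ?nnegrE ?powR_ge0//.
by apply: ge0_ler_powR; rewrite ?nnegrE ?powR_ge0 ?(ltW h2) ?(ltW th0)// (le_trans _ (ltW h2))// powR_ge0.
Qed.

Lemma norm_level_le N k x : `|level N k x| <= dyad N k `^ (- (1 - theta)) * `|fone x|.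
Proof.
have r0 : 0 <= dyad N k `^ (- (1 - theta)) * `|fone x| by rewrite mulr_ge0 ?powR_ge0.
rewrite /level; have [|_] := boolP (inlevel N k x); last by rewrite mulr0 normr0.
move=> /andP[h1 _]; rewrite mulr1 (le_trans (ua x))//.
have [az|an] := eqVneq (a x) 0; first by rewrite az.
have ap : 0 < a x by rewrite lt_neqAle eq_sym an a0.
have [l lE] := aexp ap.
rewrite ger0_norm ?powR_ge0//.
have aE : a x = ratio x `^ (- (1 - theta)) * fone x.
  rewrite /ratio /fone lE !powR_expR -expRD; congr expR.
  by field; rewrite gt_eqF.
rewrite {1}aE; apply: ler_wpM2r; first exact: powR_ge0.
have dk := dyad_gt0 N k : 0 < dyad N k :> R.
have rp : 0 < ratio x by exact: lt_le_trans h1.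
rewrite !powRN lef_pV2 ?posrE ?powR_gt0//.
by apply: ge0_ler_powR; rewrite ?nnegrE ?(ltW th1) ?(ltW dk)// powR_ge0.
Qed.

Local Notation sqc := (piece_sqcst sigma K B C1 C2).
Local Notation hlc := (@piece_hlcst R n K B C).
Local Notation icst := (interp_cst theta d (n%:R - beta)).

Definition sqbound : R :=
  sqc * (2 `^ theta) ^+ 2 * (1 - expR (- ((2 * alpha - 1 - 2 * d) * ln 2)))^-1.

(** The inverse square of the coefficient of [A] in the first bound of [interp_sum]. With these
    weights one sum controls each piece on each level by the same number. *)
Let wgt N (j k : nat) : R := (2 ^- j) `^ (- (2 * d)) * dyad N k `^ (- (2 * theta)).
Let wgt0 N j k : 0 <= wgt N j k. Proof. by rewrite mulr_ge0 ?powR_ge0. Qed.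

(** [U] is the weighted sum of the square functions over all pieces and levels. Each summand bounds
    its piece for all t in the range simultaneously, so the interpolation may be done at a fixed
    point with a [U] free of t. *)
Lemma interp_square N : exists U : 'rV[R]_n -> \bar R, [/\ measurable_fun setT U,
  forall x, (0 <= U x)%E, (\int[leb]_x U x <= sqbound%:E)%E &
  forall t x v V, (2 ^+ N)^-1 <= t -> t < 2 ^+ N -> (U x <= v%:E)%E -> 0 <= v -> 0 <= V ->
    (hlmax fone x <= V%:E)%E ->
    `|smooth sigma g K (cut N) (2 ^- N) t x| <=
      icst * (Num.sqrt v `^ (1 - theta) * (hlc * V) `^ theta)].
Proof.
have lb N' k x : `|level N' k x| <= A1.
  rewrite /level; case: (inlevel _ _ _); rewrite ?mulr1 ?mulr0 ?normr0; first exact: le_trans (aA1 x).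
  exact: le_trans (a0 x) (aA1 x).
have /choice[Q HQ] : forall jk : nat * nat, exists Q : 'rV[R]_n -> \bar R,
    [/\ measurable_fun setT Q, forall x, (0 <= Q x)%E,
    forall t x, (2 ^+ N)^-1 <= t -> t < 2 ^+ N -> ((piece sigma g K jk.1 (level N jk.2) t x ^+ 2)%:E <= Q x)%E &
    (\int[leb]_x Q x <= (sqc * (2 ^- jk.1) `^ (2 * alpha - 1))%:E * \int[leb]_x (level N jk.2 x ^+ 2)%:E)%E].
  move=> jk; exact: (piece_square mg gB alpha_half alphaK C10 C20 decay ddecay N jk.1 (integrable_level N jk.2) (lb N jk.2)).
pose U x := (\sum_(j < N.+1) \sum_(k < N + N) ((wgt N j k)%:E * Q (val j, val k) x))%E.
have q0 (j k : nat) x : (0 <= Q (j, k) x)%E by case: (HQ (j, k)).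
have mq (j k : nat) : measurable_fun setT (Q (j, k)) by case: (HQ (j, k)).
have t0' (j k : nat) x : (0 <= (wgt N j k)%:E * Q (j, k) x)%E by rewrite mule_ge0// lee_fin.
have mt (j k : nat) : measurable_fun setT (fun x => (wgt N j k)%:E * Q (j, k) x)%E by exact: measurable_funeM.
exists U; split.
- by apply: emeasurable_sum => j; apply: emeasurable_sum => k; exact: mt.
- by move=> x; apply: sume_ge0 => j _; apply: sume_ge0 => k _; exact: t0'.
- rewrite /U ge0_integral_sum//; last 2 first.
  + by move=> j; apply: emeasurable_sum => k; exact: mt.
  + by move=> j x _; apply: sume_ge0 => k _; exact: t0'.
  rewrite (eq_bigr (fun j : 'I_N.+1 => \sum_(k < N + N) ((wgt N j k)%:E * \int[leb]_x Q (val j, val k) x))%E); last first.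
    move=> j _; rewrite ge0_integral_sum//; try (by move=> k; exact: mt); try (by move=> k x _; exact: t0').
    apply: eq_bigr => k _; rewrite ge0_integralZl//; try (by rewrite lee_fin); try (by move=> x _; exact: q0).

  have sqc0 : 0 <= sqc by exact: (piece_sqcst_ge0 sigma K B C10 C20).
  pose m (k : nat) : \bar R := (\int[leb]_x (a x `^ pp x * (inlevel N k x)%:R)%:E)%E.
  have m0 k : (0 <= m k)%E by apply: integral_ge0 => x _; rewrite lee_fin mulr_ge0// powR_ge0.
  have mk (k : nat) : measurable_fun setT (fun x => (a x `^ pp x * (inlevel N k x)%:R)%:E).
    by apply/measurable_EFinP; apply: measurable_funM => //; exact: mb.
  have kap j : 0 <= sqc * (2 `^ theta) ^+ 2 * (2 ^- j) `^ (2 * alpha - 1 - 2 * d).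
    by rewrite mulr_ge0 ?powR_ge0// mulr_ge0 ?sqr_ge0.
  (* The powers of [dyad N k] in the weight and in the level bound cancel, and the decay 2 alpha - 1
     - 2 d in j is left. *)
  have term (j k : nat) : ((wgt N j k)%:E * \int[leb]_x Q (j, k) x <=
      (sqc * (2 `^ theta) ^+ 2 * (2 ^- j) `^ (2 * alpha - 1 - 2 * d))%:E * m k)%E.
    have [_ _ _ Hi] := HQ (j, k); rewrite /= in Hi.
    have w0 : (0 <= (wgt N j k)%:E)%E by rewrite lee_fin.
    apply: le_trans (lee_wpmul2l w0 Hi) _.
    have Hl : (\int[leb]_x (level N k x ^+ 2)%:E <= (((2 * dyad N k) `^ theta) ^+ 2)%:E * m k)%E.
      rewrite /m -ge0_integralZl//; try (by move=> x _; rewrite lee_fin mulr_ge0// powR_ge0);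
        try (by rewrite lee_fin sqr_ge0).
      apply: ge0_le_integralT => x; rewrite -EFinM !lee_fin sqr_ge0/=; exact: level_sqr_le.
    have s0 : (0 <= (sqc * (2 ^- j) `^ (2 * alpha - 1))%:E)%E by rewrite lee_fin mulr_ge0// powR_ge0.
    apply: le_trans (lee_wpmul2l w0 (lee_wpmul2l s0 Hl)) _.
    rewrite !muleA -!EFinM; apply: lee_wpmul2r => //.
    rewrite lee_fin le_eqVlt; apply/orP; left; apply/eqP.
    rewrite /wgt; have d2 : 0 <= dyad N k :> R by exact/ltW/dyad_gt0.
    rewrite (powRM _ (ler0n R 2) d2) dyad_expR twoN_expR !powR_expR.
    set x1 := 2 `^ theta.
    rewrite (_ : expR (- (j%:R * ln 2) * - (2 * d)) * expR ((k%:R - N%:R) * ln 2 * - (2 * theta)) *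
       (sqc * expR (- (j%:R * ln 2) * (2 * alpha - 1))) * (x1 * expR ((k%:R - N%:R) * ln 2 * theta)) ^+ 2 =
      sqc * x1 ^+ 2 * (expR (- (j%:R * ln 2) * - (2 * d)) * expR ((k%:R - N%:R) * ln 2 * - (2 * theta)) *
       expR (- (j%:R * ln 2) * (2 * alpha - 1)) * (expR ((k%:R - N%:R) * ln 2 * theta)) ^+ 2)); last ring.
    by congr (_ * _); rewrite -!expRM_natl -!expRD; congr expR; ring.
  apply: (@le_trans _ _ (\sum_(j < N.+1) (sqc * (2 `^ theta) ^+ 2 * (2 ^- j) `^ (2 * alpha - 1 - 2 * d))%:E)%E).
    apply: lee_sum => j _.
    apply: (@le_trans _ _ (\sum_(k < N + N) (sqc * (2 `^ theta) ^+ 2 * (2 ^- j) `^ (2 * alpha - 1 - 2 * d))%:E * m k)%E).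
      by apply: lee_sum => k _; exact: term.
    rewrite -ge0_sume_distrr; last by move=> k _; exact: m0.
    rewrite -[leRHS]mule1; apply: lee_wpmul2l; first by rewrite lee_fin.
    (* The levels are disjoint, so their shares of the modular of [a] add up to at most 1. *)
    apply: le_trans app; rewrite /m -ge0_integral_sum//; last first.
      by move=> k x _; rewrite lee_fin mulr_ge0// powR_ge0.
    apply: ge0_le_integralT => x; rewrite sumEFin !lee_fin -mulr_sumr sum_inlevel.
    rewrite mulr_ge0 ?powR_ge0//=; case: (_ && _); rewrite ?mulr1// mulr0 powR_ge0//.
  rewrite sumEFin lee_fin -mulr_sumr /sqbound ler_wpM2l//; last exact: sum_twoN_le.
  by rewrite mulr_ge0// sqr_ge0.
move=> t x v V t1 t2 Uv v0 V0 HV.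
have tp : 0 < t by apply: lt_le_trans t1; rewrite invr_gt0 exprn_gt0.
have hlc0 : 0 <= hlc by exact: (piece_hlcst_ge0 K gB C0).
rewrite -sum_piece.
pose D (j k : nat) := `|piece sigma g K j (level N k) t x|.
apply: (@le_trans _ _ (\sum_(j < N.+1) \sum_(k < N + N) D j k)).
  apply: le_trans (ler_norm_sum _ _ _) _; apply: ler_sum => j _.
  rewrite cut_sum piece_sum//; last by move=> k; exact: integrable_level.
  exact: ler_norm_sum.
apply: (@interp_sum R theta d (n%:R - beta) theta01 dtheta N N.+1 (N + N) D).
- exact: sqrtr_ge0.
- exact: mulr_ge0.
- by move=> j k; exact: normr_ge0.
- move=> j k jN kN; have [_ _ HQ2 _] := HQ (j, k).
  have h1 := HQ2 t x t1 t2; rewrite /= in h1.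
  have h2 : ((wgt N j k)%:E * Q (j, k) x <= U x)%E.
    rewrite /U (bigD1 (Ordinal jN))//= (bigD1 (Ordinal kN))//= -addeA leeDl//.
    apply: adde_ge0; first by apply: sume_ge0 => i _; exact: t0'.
    by apply: sume_ge0 => i _; apply: sume_ge0 => i' _; exact: t0'.
  have w0 : (0 <= (wgt N j k)%:E)%E by rewrite lee_fin.
  have h3 := le_trans (lee_wpmul2l w0 h1) (le_trans h2 Uv).
  rewrite -EFinM lee_fin in h3.
  set y := (2 ^- j) `^ d * dyad N k `^ theta.
  have yp : 0 < y by rewrite mulr_gt0// powR_gt0 ?dyad_gt0// invr_gt0 exprn_gt0.
  have wy : wgt N j k = (y ^+ 2)^-1.
    rewrite /wgt /y twoN_expR dyad_expR !powR_expR -!expRD -expRM_natl -expRN; congr expR; ring.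
  rewrite wy mulrC ler_pdivrMr ?exprn_gt0// in h3.
  rewrite /D -(sqrtr_sqr (piece _ _ _ _ _ _ _)).
  apply: (@le_trans _ _ (Num.sqrt (v * y ^+ 2))); first by rewrite ler_wsqrtr.
  by rewrite sqrtrM// sqrtr_sqr ger0_norm ?(ltW yp)// mulrC.
- move=> j k jN kN.
  have h1 := norm_piece_hl mg K gB gsigma beta0n C0 dim j x tp (integrable_level N k).
  have Lp0 : 0 <= dyad N k `^ (- (1 - theta)) :> R by exact: powR_ge0.
  have h2 := hlmax_scale x measurable_fone Lp0 (norm_level_le N k).
  have Lp1 : (0 <= (dyad N k `^ (- (1 - theta)))%:E)%E by rewrite lee_fin.
  have h3 := le_trans h2 (lee_wpmul2l Lp1 HV).
  have p0 : (0 <= (hlc * (2 ^- j) `^ (beta - n%:R))%:E)%E by rewrite lee_fin mulr_ge0// powR_ge0.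
  have h4 := le_trans h1 (lee_wpmul2l p0 h3).
  move: h4; rewrite -!EFinM lee_fin -(opprB n%:R beta) => h4.
  by apply: (le_trans h4); rewrite le_eqVlt; apply/orP; left; apply/eqP; rewrite /D; ring.
Qed.


Hypothesis pp1 : forall x, 1 <= pp x.
Hypothesis pp2 : forall x, (1 - theta) * pp x <= 2.
Hypothesis A11 : 1 <= A1.

Let ln2 : 0 < ln 2 :> R. Proof. by rewrite ln_gt0// ltr1n. Qed.

Let nat_above (X : R) : exists N : nat, X < N%:R.
Proof. by exists (Num.truncn X).+1; exact: truncnS_gt. Qed.

(** The exponent in [ratio] lies in [-E, E] because pp is between 1 and 2 / (1-theta), and
    [a <= A1]. A ratio outside [2^-N, 2^N) therefore forces [a] itself to be small, uniformly in
    x. *)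
Lemma cut_rest (tau : R) : 0 < tau ->
  exists N0 : nat, forall N x, (N0 <= N)%N -> `|u x - cut N x| <= tau.
Proof.
move=> tau0; pose E : R := (2 * theta)^-1 + (1 - theta)^-1.
have i1 : 0 < (2 * theta)^-1 by rewrite invr_gt0 mulr_gt0.
have i2 : 0 < (1 - theta)^-1 by rewrite invr_gt0.
have E0 : 0 < E by exact: addr_gt0.
have L0 : 0 <= ln A1 by rewrite ln_ge0.
have [N0 hN0] := nat_above ((ln A1 * E + E * `|ln tau|) / ln 2).
exists N0 => N x NN; rewrite /cut; have [|nin] := boolP (_ && _).
  by move=> _; rewrite mulr1 subrr normr0 ltW.
rewrite mulr0 subr0; apply: (le_trans (ua x)).
have [->|an] := eqVneq (a x) 0; first exact: ltW.
have ap : 0 < a x by rewrite lt_neqAle eq_sym an a0.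
have [l lE] := aexp ap.
have lA : l <= ln A1.
  by rewrite -ler_expR lnK ?posrE ?(lt_le_trans ltr01)// -lE.
have NL : ln A1 * E + E * `|ln tau| < N%:R * ln 2.
  rewrite -ltr_pdivrMr//; apply: lt_le_trans hN0 _.
  by rewrite ler_nat.
set e := (2 - pp x) / (2 * theta).
have eU : e <= E.
  rewrite /E; have : e <= (2 * theta)^-1.
    by rewrite /e ler_piMl ?(ltW i1)//; have := pp1 x; lra.
  by lra.
have eL : - E <= e.
  have h : - (1 - theta)^-1 <= e.
    rewrite /e ler_pdivlMr ?mulr_gt0// -subr_ge0.
    rewrite (_ : _ - _ = (2 - (1 - theta) * pp x) / (1 - theta)); last by field; rewrite gt_eqF.
    by rewrite divr_ge0 ?(ltW th1)// subr_ge0.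
  by rewrite /E; lra.
have rE : ratio x = expR (l * e) by rewrite /ratio lE powR_expR.
have Et0 : 0 <= E * `|ln tau| by rewrite mulr_ge0// ltW.
have LE0 : 0 <= ln A1 * E by rewrite mulr_ge0// ltW.
have out : l * e < - (N%:R * ln 2) \/ N%:R * ln 2 <= l * e.
  move: nin; rewrite negb_and -ltNge -leNgt rE !dyad_expR ltr_expR ler_expR => /orP[h|h]; [left|right].
    by move: h; rewrite sub0r mulNr.
  by move: h; rewrite natrD addrK.
have [l0|l0] := leP 0 l.
  have h1 : l * e <= ln A1 * E.
    by apply: le_trans (ler_wpM2l l0 eU) _; rewrite ler_wpM2r// ltW.
  have h2 : - (ln A1 * E) <= l * e.
    by apply: le_trans (ler_wpM2l l0 eL); rewrite mulrN lerN2 ler_wpM2r// ltW.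
  by case: out; lra.
have k1 : l * e <= - l * E.
  have ln0 : 0 <= - l by rewrite oppr_ge0 ltW.
  have eE : - e <= E by lra.
  by have := ler_wpM2l ln0 eE; rewrite mulrNN.
have k2 : l * E <= l * e by rewrite ler_wnM2l// ltW.
have k3 : E * `|ln tau| < E * - l by rewrite (mulrC E (- l)); case: out; lra.
rewrite ltr_pM2l// in k3.
have k4 : l <= ln tau by have := ler_normr (- ln tau) (ln tau); have := ler_norm (- ln tau); rewrite normrN; lra.
by rewrite lE -[leRHS]lnK ?posrE// ler_expR.
Qed.

Variable Lp : R.
Hypothesis Lp0 : 0 <= Lp.
Hypothesis lip : forall y z, `|u y - u z| <= Lp * enorm (y - z).

Variable Lq : R.
Hypothesis Lq0 : 0 <= Lq.

(** The 2 absorbs the approximation error into the left side, and the + 1 makes the constant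
    positive. *)
Definition interp_final_cst : R := 2 * (icst * (hlc * Lq) `^ theta) + 1.

Let hlc0 : 0 <= hlc. Proof. exact: (piece_hlcst_ge0 K gB C0). Qed.
Let icst0 : 0 <= icst. Proof. exact: (interp_cst_ge0 theta01 dtheta). Qed.

Lemma interp_final_cst_gt0 : 0 < interp_final_cst.
Proof. by rewrite ltr_wpDl// mulr_ge0// mulr_ge0// powR_ge0. Qed.

(** Two errors: the discarded part of [u] is small in supremum norm and stays so after smoothing,
    and smoothing a Lipschitz function at scale 2^-N costs a multiple of 2^-N. *)
Lemma avgop_cut t x (m : R) : 0 < t -> 0 < m ->
  exists N0 : nat, forall N, (N0 <= N)%N -> [/\ (2 ^+ N)^-1 <= t, t < 2 ^+ N &
    `|smooth sigma g K (cut N) (2 ^- N) t x - avgop sigma g u t x| <= m].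
Proof.
move=> t0 m0; pose bW := @bincoef_sum R K * mass sigma.
have bW0 : 0 <= bW by rewrite mulr_ge0 ?bincoef_sum_ge0 ?mass_ge0.
(* The + 1 keeps the denominator positive when sigma has mass zero. *)
pose tau := m / 2 / (bW + 1).
have tau0 : 0 < tau by rewrite !divr_gt0// ltr_wpDl.
have [N1 hN1] := cut_rest tau0.
pose Kc := @bincoef_sum R K * (Lp * (t * S0 K * Num.sqrt 2 ^+ n) * mass sigma).
have Kc0 : 0 <= Kc.
  rewrite mulr_ge0 ?bincoef_sum_ge0// mulr_ge0 ?mass_ge0// mulr_ge0// mulr_ge0 ?exprn_ge0 ?sqrtr_ge0//.
  by rewrite mulr_ge0 ?sqrtr_ge0// ltW.
have q0 : 0 <= Kc / (m / 2) by rewrite !divr_ge0// ltW.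
have tV : 0 < t^-1 by rewrite invr_gt0.
have [N2 hN2] := nat_above (t + t^-1 + Kc / (m / 2)).
exists (maxn N1 N2) => N; rewrite geq_max => /andP[NN1 NN2].
have big : t + t^-1 + Kc / (m / 2) < 2 ^+ N.
  apply: (lt_trans hN2); rewrite -natrX ltr_nat; apply: leq_ltn_trans NN2 _.
  exact: ltn_expl.
have p0 : 0 < 2 ^+ N :> R by rewrite exprn_gt0.
have r0 : 0 < 2 ^- N :> R by rewrite invr_gt0.
split.
- by rewrite -[leRHS]invrK lef_pV2 ?posrE//; lra.
- by lra.
have e1' : @bincoef_sum R K * (tau * mass sigma) <= m / 2.
  rewrite (_ : _ * _ = m / 2 * (bW / (bW + 1))); last by rewrite /tau /bW; field; rewrite gt_eqF// ltr_wpDl.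
  by rewrite ler_piMr ?divr_ge0 ?(ltW m0)// ler_pdivrMr ?ltr_wpDl// mul1r lerDl.
have e2' : @bincoef_sum R K * (Lp * (t * (2 ^- N * S0 K) * Num.sqrt 2 ^+ n) * mass sigma) <= m / 2.
  rewrite (_ : _ * _ = Kc / 2 ^+ N); last by rewrite /Kc; ring.
  rewrite ler_pdivrMr// mulrC -ler_pdivrMr ?divr_gt0//; lra.
have ir : leb.-integrable setT (EFin \o (fun y => u y - cut N y)).
  by apply: integrableRB => //; exact: integrable_cut.
pose v (i : 'I_2) y := if val i == 0%N then cut N y else u y - cut N y.
have iv i : leb.-integrable setT (EFin \o v i).
  by rewrite /v; case: (val i == 0%N) => //; exact: integrable_cut.
have uE : u = (fun y => \sum_i v i y).
  by apply/funext => y; rewrite !big_ord_recl big_ord0 /v/= addr0 addrC subrK.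
have S2 : smooth sigma g K u (2 ^- N) t x = smooth sigma g K (cut N) (2 ^- N) t x +
    smooth sigma g K (fun y => u y - cut N y) (2 ^- N) t x.
  have S := smooth_sum sigma mg K x t0 r0 iv; rewrite -uE in S.
  by move: S; rewrite !big_ord_recl big_ord0 addr0 => S; exact: S.
have e1 := norm_smooth_sup sigma mg K x t0 r0 ir (fun y => hN1 N y NN1).
have uA y : `|u y| <= A1 by exact: le_trans (ua y) (aA1 y).
have e2 := smooth_approx sigma mg K x t0 r0 Lp0 iu uA lip.
have {}e1 := le_trans e1 e1'; have {}e2 := le_trans e2 e2'.
rewrite S2 in e2; exact: (norm_split_le e1 e2).
Qed.

(** In the application [V] is M f1 up to a constant. Where q is finite, [Y] is V^q and the condition
    linking them is an equality, since theta p / q = 1 - (1-theta) p / 2; where q is infinite the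
    condition reads V^(theta p) <= 1 and [Y = 0] is allowed. The sum on the right is Young's
    inequality with these two exponents. *)
Lemma interp_pointwise : exists U : 'rV[R]_n -> \bar R, [/\ measurable_fun setT U,
  forall x, (0 <= U x)%E, (\int[leb]_x U x <= sqbound%:E)%E &
  forall t x V Y, 0 < t -> 0 <= V -> 0 <= Y -> (hlmax fone x <= (Lq * V)%:E)%E ->
    V `^ (theta * pp x) <= Y `^ (1 - (1 - theta) * pp x / 2) ->
    (((`|avgop sigma g u t x| / interp_final_cst) `^ pp x)%:E <= U x + Y%:E)%E].
Proof.
have /choice[UN HUN] := interp_square.
have mU N : measurable_fun setT (UN N) by case: (HUN N).
have U0 N x : (0 <= UN N x)%E by case: (HUN N).
exists (fun x => limn_einf (fun N => UN N x)); split.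
- rewrite (_ : (fun x => _) = (fun x => - limn_esup (fun N => - UN N x))%E)//.
  apply: measurableT_comp => //; apply: measurable_fun_limn_esup => N.
  exact: measurableT_comp.
- by move=> x; apply: (@limn_einf_ge _ _ _ 0%N) => m _.
- by apply: fatou_bound => // N; case: (HUN N).
move=> t x V Y t0 V0 Y0 HV VY.
set m := `|avgop sigma g u t x|; set c3 := interp_final_cst.
have c30 : 0 < c3 := interp_final_cst_gt0.
have pp0 : 0 < pp x by apply: lt_le_trans (pp1 x).
set s := (1 - theta) * pp x / 2 in VY.
have s01 : 0 <= s <= 1.
  rewrite /s divr_ge0 ?mulr_ge0 ?(ltW th1) ?(ltW pp0)//= ler_pdivrMr// mul1r.
  exact: pp2.
have Uge0 : (0 <= limn_einf (fun N => UN N x))%E by apply: (@limn_einf_ge _ _ _ 0%N) => k _.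
have [m0|mp] := leP m 0.
  have -> : m = 0 by apply/eqP; rewrite eq_le m0 normr_ge0.
  by rewrite mul0r powR0 ?gt_eqF// adde_ge0// lee_fin.
have m20 : 0 < m / 2 by rewrite divr_gt0.
(* The error allowed is half of the value to be bounded, so it is absorbed on the left. *)
have [N0 hN0] := avgop_cut x t0 m20.
have key : (((m / c3) `^ pp x - Y)%:E <= limn_einf (fun N => UN N x))%E.
  apply: (@limn_einf_ge _ _ _ N0) => N /hN0[t1 t2 close].
  have [_ _ _ HU] := HUN N.
  case E : (UN N x) => [v||]; [|exact: leey|by have := U0 N x; rewrite E].
  have v0 : 0 <= v by have := U0 N x; rewrite E lee_fin.
  have Uv : (UN N x <= v%:E)%E by rewrite E.
  have h1 := HU t x v (Lq * V) t1 t2 Uv v0 (mulr_ge0 Lq0 V0) HV; rewrite (mulrA _ Lq) in h1.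
  have h2 : m <= m / 2 + icst * (Num.sqrt v `^ (1 - theta) * (hlc * Lq * V) `^ theta).
    exact: (norm_close_le close h1).
  set A := Num.sqrt v `^ (1 - theta) in h2.
  have A0 : 0 <= A by exact: powR_ge0.
  have h3 : m / c3 <= A * V `^ theta.
    rewrite ler_pdivrMr// mulrC.
    have hL : 0 <= hlc * Lq by exact: mulr_ge0.
    have e : icst * (A * (hlc * Lq * V) `^ theta) = icst * (hlc * Lq) `^ theta * (A * V `^ theta) by rewrite (powRM _ hL V0); ring.
    have AV : 0 <= A * V `^ theta by rewrite mulr_ge0// powR_ge0.
    by rewrite /c3 /interp_final_cst mulrDl mul1r -mulrA; move: h2; rewrite e; lra.
  have h4 : (m / c3) `^ pp x <= v + Y.
    have mc0 : 0 <= m / c3 by rewrite divr_ge0// ltW.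
    apply: (@le_trans _ _ ((A * V `^ theta) `^ pp x)).
      by apply: ge0_ler_powR; rewrite ?nnegrE ?(ltW pp0)// (le_trans mc0).
    rewrite powRM ?powR_ge0// -(powRrM V) /A -powRrM -powR12_sqrt// -powRrM.
    have -> : 2^-1 * ((1 - theta) * pp x) = s by rewrite /s; field.
    apply: le_trans (powR_mul_le_add v0 Y0 s01).
    by rewrite ler_wpM2l// powR_ge0.
  by rewrite lee_fin lerBlDr.
move: key Uge0; case: (limn_einf _) => [w||] //; rewrite ?addye ?leey//.
by rewrite -EFinD !lee_fin lerBlDr.
Qed.

End interpolation.

(** * Schwartz functions *)

Section schwartz_facts.
Context {R : realType} {n : nat}.
Notation leb := (lebesgue_rV n : {sigma_finite_measure set 'rV[R]_n -> \bar R}).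
Implicit Types (h : 'rV[R]_n -> R) (x y z v : 'rV[R]_n).

Lemma continuous_measurable_rV h : continuous h -> measurable_fun setT h.
Proof.
move=> ch; apply: (measurability _ (RGenOpens.measurableE R)) => //.
move=> _ [_ [a [b ->] <-]]; rewrite setTI.
apply: rV_open_measurable; apply: open_comp; last exact: interval_open.
by move=> v _; exact: ch.
Qed.

Lemma is_derive_along h z v (s : R) : differentiable h (z + s *: v) ->
  is_derive s (1:R) (fun s => h (z + s *: v)) ('D_v h (z + s *: v)).
Proof.
move=> dh; have dv : derivable h (z + s *: v) v by exact: diff_derivable.
have E : (fun t : R => t^-1 *: (((fun s => h (z + s *: v)) \o shift s) (t *: (1:R)) - h (z + s *: v))) =
    (fun t : R => t^-1 *: ((h \o shift (z + s *: v)) (t *: v) - h (z + s *: v))).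
  apply/funext => t /=; congr (_ *: (h _ - _)).
  have E1 : t *: (1:R) = t by rewrite /GRing.scale/= mulr1.
  by rewrite E1 scalerDl addrCA.
apply: DeriveDef; first by rewrite /derivable E.
by rewrite /derive E.
Qed.

Lemma derive_sum_partial h y v : differentiable h y ->
  'D_v h y = \sum_i v ord0 i * 'D_(delta_mx ord0 i) h y.
Proof.
move=> dh; rewrite deriveE// [in LHS](row_sum_delta v) linear_sum; apply: eq_bigr => i _.
by rewrite linearZ deriveE.
Qed.

Lemma partial_lipschitz h (C : R) : (forall x, differentiable h x) ->
  (forall i x, `|'D_(delta_mx ord0 i) h x| <= C) ->
  forall y z, `|h y - h z| <= n%:R * C * enorm (y - z).
Proof.
move=> dh hC y z; set v := y - z.
have D s := is_derive_along (dh (z + s *: v)).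
have cF := @is_derive_continuous R (fun s => h (z + s *: v)) (fun s => 'D_v h (z + s *: v)) D.
have [c _] := @MVT_segment R (fun s => h (z + s *: v)) (fun s => 'D_v h (z + s *: v)) 0 1 ler01
  (fun s _ => D s) (continuous_subspaceT cF).
have zv : z + v = y by rewrite /v addrC subrK.
rewrite scale1r scale0r addr0 subr0 mulr1 zv => ->.
rewrite derive_sum_partial//; apply: le_trans (ler_norm_sum _ _ _) _.
apply: (@le_trans _ _ (\sum_(i < n) C * enorm v)).
  apply: ler_sum => i _; rewrite normrM mulrC.
  by apply: ler_pM => //; exact: coord_le_enorm.
by rewrite sumr_const card_ord -[X in X <= _]mulr_natl mulrA.
Qed.

(** On dyadic shells the decay 2^(-i (n+1)) against the volume 2^(i n) leaves a geometric series. *)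
Lemma decay_integrable h (C0 C1 : R) : measurable_fun setT h ->
  (forall x, `|h x| <= C0) -> (forall x, enorm x ^+ n.+1 * `|h x| <= C1) ->
  leb.-integrable setT (EFin \o h).
Proof.
move=> mh h0 h1; have C00 : 0 <= C0 by exact: le_trans (h0 0).
have C10 : 0 <= C1 by apply: le_trans (h1 0); rewrite mulr_ge0// exprn_ge0 ?enorm_ge0.
pose A := C0 + C1 * 2 ^+ n.+1; have A0 : 0 <= A by rewrite addr_ge0// mulr_ge0// exprn_ge0.
pose c (i : nat) := A / (2 ^+ i) ^+ n.+1.
have c0 i : 0 <= c i by rewrite divr_ge0// !exprn_ge0.
have mE (i : nat) : measurable (eball (0 : 'rV[R]_n) (2 ^+ i)) by exact: measurable_eball.
apply/integrableP; split; first exact/measurable_EFinP.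
apply: (@le_lt_trans _ _ (\int[leb]_x \sum_(i <oo) (c i * \1_(eball 0 (2 ^+ i)) x)%:E)%E).
  apply: ge0_le_integralT => x; rewrite abse_ge0/=.
  have P : exists i, enorm x < 2 ^+ i.
    exists (Num.truncn (enorm x)).+1; apply: lt_le_trans (truncnS_gt _) _.
    by rewrite -natrX ler_nat ltnW// ltn_expl.
  case: (ex_minnP P) => i xi imin.
  have hc : `|h x| <= c i.
    rewrite /c; case: i xi imin => [|i] xi imin.
      by rewrite expr0 expr1n divr1; apply: le_trans (h0 x) _; rewrite lerDl mulr_ge0// exprn_ge0.
    have ex : 2 ^+ i <= enorm x by rewrite leNgt; apply/negP => /imin; rewrite ltnn.
    have e2 : (2 ^+ i) ^+ n.+1 <= enorm x ^+ n.+1.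
      by apply: lerXn2r; rewrite ?nnegrE ?exprn_ge0 ?enorm_ge0.
    rewrite ler_pdivlMr ?exprn_gt0// (exprS 2 i) exprMn mulrCA.
    have := ler_wpM2r (normr_ge0 (h x)) e2 => /le_trans/(_ (h1 x)) h3.
    have h4 := ler_wpM2l (exprn_ge0 n.+1 (ler0n R 2)) h3.
    by rewrite (mulrC `|_|); apply: (le_trans h4); rewrite mulrC lerDr.
  apply: (@le_trans _ _ (c i * \1_(eball 0 (2 ^+ i)) x)%:E).
    by rewrite indicE mem_set/= ?mulr1 ?lee_fin// /eball/= subr0.
  apply: le_trans (nneseries_lim_ge i.+1 _); last by move=> k _ _; rewrite lee_fin mulr_ge0.
  by rewrite big_nat_recr//= leeDr// sume_ge0// => k _; rewrite lee_fin mulr_ge0.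
rewrite integral_nneseries//; last 2 first.
- by move=> i; apply/measurable_EFinP; apply: measurable_funM => //; exact: measurable_indic.
- by move=> i z _; rewrite lee_fin mulr_ge0.
apply: (@le_lt_trans _ _ (A * 2 ^+ n * 2)%:E); last exact: ltry.
apply: lime_le.
  by apply: is_cvg_nneseries => i _ _; apply: integral_ge0 => x _; rewrite lee_fin mulr_ge0.
apply: nearW => N; apply: (@le_trans _ _ (\sum_(0 <= i < N) (A * 2 ^+ n * 2 ^- i)%:E)%E).
  apply: lee_sum => i _; under eq_integral do rewrite EFinM.
  rewrite ge0_integralZl//; try (by rewrite lee_fin); try (by apply/measurable_EFinP; exact: measurable_indic).
  rewrite integral_indic// setIT.
  have ci : (0 <= (c i)%:E)%E by rewrite lee_fin.
  have p2 : 0 <= 2 ^+ i :> R by rewrite exprn_ge0.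
  apply: le_trans (lee_wpmul2l ci (eball_volume_le 0 p2)) _.
  rewrite -EFinM lee_fin le_eqVlt; apply/orP; left; apply/eqP.
  have q2 : 2 ^+ i != 0 :> R by rewrite expf_neq0.
  rewrite /c exprMn exprS; move: (2 ^+ i) q2 => X q2; move: (expf_neq0 n q2).
  by move: (X ^+ n) => Y Y0; field; rewrite q2 Y0.
rewrite sumEFin lee_fin -mulr_sumr ler_wpM2l//; first by rewrite mulr_ge0// exprn_ge0.
have -> : \sum_(0 <= i < N) 2 ^- i = 2 * (1 - 2 ^- N) :> R.
  elim: (N) => [|k IH]; first by rewrite big_geq// expr0 invr1 subrr mulr0.
  by rewrite big_nat_recr//= IH exprS; field; rewrite expf_neq0.
have : 0 <= 2 ^- N :> R by rewrite invr_ge0 exprn_ge0.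
by lra.
Qed.

Lemma norm_Re_le (w : R[i]) : `|complex.Re w| <= normc w.
Proof.
case: w => p q /=; rewrite -sqrtr_sqr ler_sqrt ?addr_ge0 ?sqr_ge0//.
by rewrite lerDl sqr_ge0.
Qed.

Lemma norm_Im_le (w : R[i]) : `|complex.Im w| <= normc w.
Proof.
case: w => p q /=; rewrite -sqrtr_sqr ler_sqrt ?addr_ge0 ?sqr_ge0//.
by rewrite lerDr sqr_ge0.
Qed.

Lemma normc_le_ReIm (w : R[i]) : normc w <= `|complex.Re w| + `|complex.Im w|.
Proof.
have s0 : 0 <= `|complex.Re w| + `|complex.Im w| by rewrite addr_ge0.
rewrite -(ler_pXn2r (n := 2))// ?nnegrE//; last by case: w {s0} => p q; exact: sqrtr_ge0.
rewrite normc_sqr sqrrD !real_normK ?num_real// lerD2r lerDl mulrn_wge0// mulr_ge0//.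
Qed.

Variable f : 'rV[R]_n -> R[i].
Hypothesis sf : schwartz f.

Let fD s (x : 'rV[R]_n) : cdifferentiable (cpartials s f) x.
Proof. by case: (sf s). Qed.

Let fB s (k : nat) : exists C : R, forall x, enorm x ^+ k * normc (cpartials s f x) <= C.
Proof. by case: (sf s) => _; exact. Qed.

Let part_bound (w : R[i] -> R) : (forall c : R[i], `|w c| <= normc c) ->
  (forall x, differentiable (fun y => w (f y)) x) ->
  (forall i x, 'D_(delta_mx ord0 i) (fun y => w (f y)) x = w (cpartials [:: i] f x)) ->
  [/\ measurable_fun setT (fun y => w (f y)), leb.-integrable setT (EFin \o (fun y => w (f y))) &
    exists2 Lp, 0 <= Lp & forall y z, `|w (f y) - w (f z)| <= Lp * enorm (y - z)].
Proof.
move=> wn dw Dw.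
have mw : measurable_fun setT (fun y => w (f y)).
  by apply: continuous_measurable_rV => x; exact: differentiable_continuous.
have [C0 hC0] := fB [::] 0%N; have [C1 hC1] := fB [::] n.+1.
split => //.
  apply: (@decay_integrable _ C0 C1) => // x.
    by apply: le_trans (wn _) _; have := hC0 x; rewrite expr0 mul1r.
  apply: le_trans (hC1 x) => /=; rewrite ler_wpM2l ?exprn_ge0 ?enorm_ge0//.
have /choice[D hD] : forall i : 'I_n, exists C : R, forall x, normc (cpartials [:: i] f x) <= C.
  by move=> i; have [C hC] := fB [:: i] 0%N; exists C => x; have := hC x; rewrite expr0 mul1r.
pose C := \sum_i `|D i|; have C00 : 0 <= C by exact: sumr_ge0.
exists (n%:R * C); first by rewrite mulr_ge0.
apply: (@partial_lipschitz _ C) => // i x; rewrite Dw; apply: le_trans (wn _) _.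
apply: le_trans (hD i x) _; apply: le_trans (ler_norm _) _.
by rewrite /C (bigD1 i)//= lerDl sumr_ge0.
Qed.

Lemma schwartz_Re : [/\ measurable_fun setT (fun y => complex.Re (f y)),
  leb.-integrable setT (EFin \o (fun y => complex.Re (f y))) &
  exists2 Lp, 0 <= Lp & forall y z, `|complex.Re (f y) - complex.Re (f z)| <= Lp * enorm (y - z)].
Proof.
apply: (part_bound (w := fun c : R[i] => complex.Re c)) => //; first exact: norm_Re_le.
by move=> x; case: (fD [::] x).
Qed.

Lemma schwartz_Im : [/\ measurable_fun setT (fun y => complex.Im (f y)),
  leb.-integrable setT (EFin \o (fun y => complex.Im (f y))) &
  exists2 Lp, 0 <= Lp & forall y z, `|complex.Im (f y) - complex.Im (f z)| <= Lp * enorm (y - z)].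
Proof.
apply: (part_bound (w := fun c : R[i] => complex.Im c)) => //; first exact: norm_Im_le.
by move=> x; case: (fD [::] x).
Qed.

Lemma schwartz_bounded : exists2 A, 1 <= A & forall x, normc (f x) <= A.
Proof.
have [C hC] := fB [::] 0%N; exists (1 + `|C|); first by rewrite lerDl.
by move=> x; have := hC x; rewrite expr0 mul1r => /le_trans; apply; have := ler_norm C; lra.
Qed.

End schwartz_facts.

(** * Support and dimension of sigma *)

Section supports.
Context {R : realType} {n : nat}.
Variable sigma : {finite_measure set 'rV[R]_n.+1 -> \bar R}.

Lemma compact_truncation : compactly_supported sigma ->
  exists g : 'rV[R]_n.+1 -> 'rV[R]_n.+1, exists B : R,
    [/\ measurable_fun setT g, forall z, enorm (g z) <= B & {ae sigma, forall z, g z = z}].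
Proof.
move=> [K cK sK].
have clK : closed K by apply: compact_closed => //; exact: norm_hausdorff.
have mK : measurable K by rewrite -(setCK K); apply: measurableC; apply: rV_open_measurable; exact: closed_openC.
have [M [_ hM]] := compact_bounded cK.
have hb z : K z -> forall i, `|z ord0 i| <= M + 1.
  move=> Kz i; have h := hM (M + 1) (ltr_pwDr ltr01 (lexx M)) z Kz.
  apply: le_trans h; rewrite (_ : `|z| = mx_norm z)// mx_normrE.
  exact: (le_bigmax _ (fun ij : 'I_1 * 'I_n.+1 => `|z ij.1 ij.2|) (ord0, i)).
pose g z := if z \in K then z else 0.
exists g, (n.+1%:R * `|M + 1|); split.
- move=> _ A mA; rewrite setTI.
  have -> : g @^-1` A = (K `&` A) `|` (~` K `&` (fun=> 0) @^-1` A).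
    apply/seteqP; split => [z /=|z /= [[Kz Az]|[nKz A0]]]; rewrite /g.
    + by case: ifPn => [/set_mem Kz Az|/negP nK A0]; [left|right; split => // Kz; apply: nK; exact: mem_set].
    + by rewrite /= mem_set.
    + by rewrite /= memNset.
  apply: measurableU; apply: measurableI => //; first exact: measurableC.
  by rewrite preimage_cst; case: ifP.
- move=> z; rewrite /g; case: ifPn => [/set_mem Kz|_].
    apply: le_trans (enorm_le_sum _) _.
    apply: (@le_trans _ _ (\sum_(i < n.+1) `|M + 1|)).
      by apply: ler_sum => i _; apply: le_trans (hb z Kz i) (ler_norm _).
    by rewrite sumr_const card_ord mulr_natl.
  by rewrite enorm0 mulr_ge0.
exists (~` K); split => //; first exact: measurableC.
by move=> z /= + Kz; apply; rewrite /g mem_set.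
Qed.

(** For r > 1 the total mass suffices, as r^beta >= 1. Such radii occur in the outer Gaussian
    shells. *)
Lemma dimension_all_radii beta : 0 <= beta -> locally_uniformly_dimensional sigma beta ->
  exists2 C, 0 <= C & forall x r, 0 < r -> (sigma (eball x r) <= (C * r `^ beta)%:E)%E.
Proof.
move=> b0 [C hC]; have W0 := mass_ge0 sigma.
exists (`|C| + mass sigma); first by rewrite addr_ge0.
move=> x r r0; have [r1|r1] := leP r 1.
  apply: le_trans (hC x r r0 r1) _; rewrite lee_fin ler_wpM2r ?powR_ge0//.
  by have := ler_norm C; lra.
have s1 : (sigma (eball x r) <= (mass sigma)%:E)%E.
  rewrite /mass fineK ?fin_num_measure//; apply: le_measure; rewrite ?inE//.
  exact: measurable_eball.
apply: le_trans s1 _; rewrite lee_fin.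
have : 1 <= r `^ beta by rewrite -(powRr0 r) ler_powR// ltW.
have := normr_ge0 C; move: (r `^ beta) => y C0 y1.
have h1 : mass sigma <= mass sigma * y by rewrite ler_peMr.
have h2 : 0 <= `|C| * y by rewrite mulr_ge0// (le_trans ler01).
by rewrite mulrDl; lra.
Qed.

End supports.

Import HBNNSimple.

(** Homogeneity of the lower integral: a simple function below [c * f] is [c] times a simple
    function below [f]. *)
Lemma ge0_integralZl_le d (T : measurableType d) (R : realType) (mu : {measure set T -> \bar R})
    (c : R) (f : T -> \bar R) : 0 < c -> (forall x, 0 <= f x)%E ->
  (\int[mu]_x (c%:E * f x) <= c%:E * \int[mu]_x f x)%E.
Proof.
move=> c0 f0; have cE : (0 <= c%:E)%E by rewrite lee_fin ltW.
have cV : 0 < c^-1 by rewrite invr_gt0.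
apply: nonneg_integral_le => [x|h hf]; first by rewrite mule_ge0.
pose k : T -> R := h; have mk : measurable_fun setT k by exact: measurable_funPT.
have k0 x : 0 <= k x by exact: fun_ge0.
have mh : measurable_fun setT (fun x => (c^-1 * k x)%:E).
  by apply/measurable_EFinP; exact: measurable_funM.
have le : (\int[mu]_x (c^-1 * k x)%:E <= \int[mu]_x f x)%E.
  apply: le_nonneg_integral => // x; rewrite lee_fin mulr_ge0 ?(ltW cV)//=.
  have := hf x; rewrite -/(k x); have := f0 x; case: (f x) => [y||] //=; rewrite ?leey// lee_fin => y0.
  by rewrite -EFinM !lee_fin => ky; rewrite mulrC ler_pdivrMr// mulrC.
have E : (\int[mu]_x (k x)%:E = c%:E * \int[mu]_x (c^-1 * k x)%:E)%E.
  rewrite -ge0_integralZl//; try (by move=> x _; rewrite lee_fin mulr_ge0 ?(ltW cV)).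
  by apply: eq_integral => x _; rewrite -EFinM mulrA divff ?gt_eqF// mul1r.
by rewrite -/k E; exact: lee_wpmul2l.
Qed.

(** * Variable exponents *)

Section exponents.
Context {R : realType} {n : nat}.
Notation leb := (lebesgue_rV n : {sigma_finite_measure set 'rV[R]_n -> \bar R}).

Lemma borel_lebesgue_measurable (h : 'rV[R]_n -> R) : measurable_fun setT h ->
  lebesgue_measurable (h : 'rV[R]_n -> measurableTypeR R).
Proof.
move=> mh Y mY; exists (h @^-1` Y); first by rewrite -[X in measurable X]setTI; exact: mh.
by exists set0; [exact: negligible_set0|rewrite setU0].
Qed.

(** For each rational q the set where P < q is Borel up to a negligible set. These countably many
    negligible sets lie in one Borel null set, off which P is Borel. *)
Lemma borel_version (p : 'rV[R]_n -> \bar R) (P : 'rV[R]_n -> R) (c0 : R) :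
  lebesgue_measurable p -> (forall x, p x = (P x)%:E) ->
  exists N : set 'rV[R]_n, exists pp : 'rV[R]_n -> R,
    [/\ measurable N, leb N = 0%E, measurable_fun setT pp,
      forall x, ~ N x -> pp x = P x & forall x, N x -> pp x = c0].
Proof.
move=> mp pE.
have hA (q : rat) : exists AM : set 'rV[R]_n * set 'rV[R]_n,
    [/\ measurable AM.1, leb.-negligible AM.2 & [set x | P x < ratr q] = AM.1 `|` AM.2].
  have [A mA [M nM E]] := mp _ (emeasurable_itv `]-oo, (ratr q)%:E[%O).
  exists (A, M); split => //=; rewrite E; apply/seteqP; split => x /=.
    by rewrite in_itv/= pE lte_fin.
  by rewrite in_itv/= pE lte_fin.
have [AM hAM] := choice hA.
have [F [nF FE]] : exists F : nat -> set 'rV[R]_n, (forall k, leb.-negligible (F k)) /\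
    forall q, F (pickle q) = (AM q).2.
  exists (fun k => oapp (fun q => (AM q).2) set0 (unpickle k)); split.
    by move=> k; case: (unpickle k) => [q|]; [case: (hAM q)|exact: negligible_set0].
  by move=> q; rewrite pickleK.
have [N [mN N0 MN]] := negligible_bigcup nF.
have MqN q x : (AM q).2 x -> N x.
  by rewrite -FE => Fx; apply: MN; exact: (bigcup_sup (I : setT (pickle q)) Fx).
exists N, (fun x => if x \in N then c0 else P x); split => //.
- apply: (measurability _ (RGenInftyO.measurableE R)) => //.
  move=> _ [_ [r ->] <-]; rewrite setTI.
  have -> : (fun x => if x \in N then c0 else P x) @^-1` `]-oo, r[%classic =
      (\bigcup_(q : rat) (if ratr q < r then (AM q).1 `\` N else set0)) `|`
      (if c0 < r then N else set0).
    apply/seteqP; split => [x /=|x [[q _]|]] /=.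
    + rewrite in_itv/=; case: ifPn => [/set_mem Nx h|/negP nN h]; first by right; rewrite h.
      have [q] := rat_in_itvoo h; rewrite in_itv/= => /andP[q1 q2].
      left; exists q => //; rewrite q2; split; last by move=> Nx; apply: nN; exact: mem_set.
      have [_ _ E] := hAM q.
      have : ((AM q).1 `|` (AM q).2) x by rewrite -E.
      by case=> // /MqN Nx; case: nN; exact: mem_set.
    + case: ifP => // qr [Ax nN]; rewrite in_itv/= memNset//.
      have [_ _ E] := hAM q; have : [set x | P x < ratr q] x by rewrite E; left.
      by move=> /= /lt_trans; apply.
    + by case: ifP => // cr Nx; rewrite in_itv/= mem_set.
  apply: measurableU; last by case: ifP.
  apply: bigcupT_measurable_rat => q; case: ifP => // _.
  by apply: measurableD => //; case: (hAM q).
- by move=> x nN; rewrite memNset.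
- by move=> x Nx; rewrite mem_set.
Qed.

Variables (theta : R).
Hypothesis theta01 : 0 < theta < 1.

(** That q takes values at least 1 restricts p: an infinite p violates it, and (1-theta) p > 2 would
    make the quotient negative. Hence p is at most 2 / (1-theta), with q infinite in the equality
    case. *)
Lemma exponent_cases (p : \bar R) : (1 <= p)%E ->
  (1 <= (2 * theta)%:E * p / (2%:E - (1 - theta)%:E * p))%E ->
  exists P : R, [/\ p = P%:E, 1 <= P, (1 - theta) * P <= 2 &
    ((2 * theta)%:E * p / (2%:E - (1 - theta)%:E * p) =
      if ((1 - theta) * P == 2)%R then +oo else (2 * theta * P / (2 - (1 - theta) * P))%:E)%E].
Proof.
have /andP[t0 t1] := theta01; have t2 : 0 < 2 * theta by rewrite mulr_gt0.
have t3 : 0 < 1 - theta by rewrite subr_gt0.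
case: p => [P||] //; last first.
  move=> _ h; exfalso; move: h; rewrite (gt0_muley (_ : 0 < (2 * theta)%:E)%E) ?lte_fin//.
  rewrite (gt0_muley (_ : 0 < (1 - theta)%:E)%E) ?lte_fin//.
rewrite lee_fin => P1; have P0 : 0 < P by exact: lt_le_trans P1.
have N0 : 0 < 2 * theta * P by rewrite mulr_gt0.
rewrite -!EFinM -EFinB inver subr_eq0 eq_sym => h; exists P; split => //; last first.
  by case: eqP => _ //; rewrite gt0_muley// lte_fin.
have [//|h2] := leP ((1 - theta) * P) 2; exfalso; move: h.
rewrite gt_eqF// -EFinM lee_fin leNgt => /negP; apply; apply: lt_trans ltr01.
by rewrite pmulr_rlt0// invr_lt0 subr_lt0.
Qed.

End exponents.

(** The 2 merges the bounds for the real and imaginary parts through their maximum. Dividing further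
    by [kap >= 1] gains a full factor [kap^-1], because P >= 1; this brings the modular below 1. *)
Lemma combine_powers (R : realType) (c P m1 m2 y1 z kap : R) : 0 < c -> 1 <= P -> 1 <= kap ->
  0 <= m1 -> 0 <= m2 -> (m1 / c) `^ P <= z -> (m2 / c) `^ P <= z ->
  0 <= y1 -> y1 <= m1 + m2 -> (y1 / (2 * c * kap)) `^ P <= kap^-1 * z.
Proof.
move=> c0 P1 k1 m10 m20 h1 h2 y10 y1m.
have P0 : 0 < P by exact: lt_le_trans P1.
have k0 : 0 < kap by exact: lt_le_trans k1.
pose m := Num.max m1 m2.
have m0 : 0 <= m by rewrite le_max m10.
have hm : (m / c) `^ P <= z.
  by have [->|->] : m = m1 \/ m = m2 by rewrite /m /Order.max; case: ifP => _; [right|left].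

have cV : 0 <= c^-1 by rewrite invr_ge0 ltW.
have kV : 0 <= kap^-1 by rewrite invr_ge0 ltW.
have le : y1 / (2 * c * kap) <= kap^-1 * (m / c).
  rewrite ler_pdivrMr ?mulr_gt0//.
  rewrite (_ : kap^-1 * (m / c) * (2 * c * kap) = m + m); last by field; rewrite (gt_eqF c0) (gt_eqF k0).
  by apply: (le_trans y1m); apply: lerD; rewrite /m le_max lexx ?orbT.
have q0 : 0 <= 2 * c * kap by apply: ltW; rewrite !mulr_gt0.
apply: (@le_trans _ _ ((kap^-1 * (m / c)) `^ P)).
  by apply: ge0_ler_powR; rewrite ?nnegrE ?(ltW P0)// ?mulr_ge0// invr_ge0.
rewrite powRM ?mulr_ge0//; apply: ler_pM; rewrite ?powR_ge0//.
rewrite -[leRHS]powRr1//; have kk : 0 < kap^-1 <= 1 by rewrite invr_gt0 k0 invf_le1.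
exact: (ger_powR kk).
Qed.

(** * The modular of the maximal operator *)

Section modular_estimate.
Context {R : realType} {n : nat}.
Notation leb := (lebesgue_rV n : {sigma_finite_measure set 'rV[R]_n -> \bar R}).
Variable sigma : {finite_measure set 'rV[R]_n -> \bar R}.

Lemma hardy_littlewood_real (F : 'rV[R]_n -> R) :
  hardy_littlewood (fun x => F x +i* 0)%C = hlmax F.
Proof.
apply/funext => x; rewrite /hardy_littlewood /hlmax; congr ereal_sup.
apply: eq_imagel => r _; congr (_ * _)%E; apply: eq_integral => y _.
by rewrite /cmodulus /= expr0n/= addr0 sqrtr_sqr.
Qed.

Lemma vpower_ge0 (s e : \bar R) : (0 <= vpower s e)%E.
Proof.
rewrite /vpower; case: e => [r||] //; first exact: poweR_ge0.
by case: ifP.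
Qed.

Lemma maximal_op_ge0 f x : (0 <= maximal_op sigma f x)%E.
Proof.
apply: (@le_trans _ _ (normc (multiplier_op sigma 1 f x))%:E); last first.
  by apply: ereal_sup_ubound; exists 1 => //=.
by rewrite lee_fin; case: (multiplier_op _ _ _ _) => u v; exact: sqrtr_ge0.
Qed.

(** [z] does not depend on t, so taking roots first turns the bounds for single t into a bound on
    the supremum, which is then raised back to the power P. *)
Lemma vpower_maximal_le f x (D P z : R) : 0 < D -> 0 < P -> 0 <= z ->
  (forall t, 0 < t -> (normc (multiplier_op sigma t f x) / D) `^ P <= z) ->
  (vpower `|maximal_op sigma f x / D%:E| P%:E <= z%:E)%E.
Proof.
move=> D0 P0 z0 hz; have nc (w : R[i]) : 0 <= normc w by case: w => u v; exact: sqrtr_ge0.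
have DV : 0 <= D^-1 by rewrite invr_ge0 ltW.
have le : (maximal_op sigma f x <= (D * z `^ P^-1)%:E)%E.
  apply: ge_ereal_sup => _ [t /= t0 <-]; rewrite lee_fin -ler_pdivrMl// mulrC.
  have := hz t t0; set y := _ / D => hy.
  have y0 : 0 <= y by rewrite mulr_ge0.
  rewrite -[leLHS]powRr1// -(mulfV (lt0r_neq0 P0)) powRrM.
  by apply: ge0_ler_powR; rewrite ?nnegrE ?powR_ge0// invr_ge0 ltW.
have := maximal_op_ge0 f x; move: le; case: (maximal_op sigma f x) => [s||] //.
rewrite !lee_fin => sD s0; rewrite inver gt_eqF// -EFinM/= lee_fin ger0_norm; last by rewrite mulr_ge0.
have h : s / D <= z `^ P^-1 by rewrite ler_pdivrMr// mulrC.
rewrite (_ : z = (z `^ P^-1) `^ P); last by rewrite -powRrM mulVf ?gt_eqF// powRr1.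
by apply: ge0_ler_powR; rewrite ?nnegrE ?powR_ge0 ?mulr_ge0// ltW.
Qed.

End modular_estimate.

Section final.
Context {R : realType} {n : nat}.
Notation leb := (lebesgue_rV n : {sigma_finite_measure set 'rV[R]_n -> \bar R}).
Notation leb1 := (@lebesgue_measure R).
Variable sigma : {finite_measure set 'rV[R]_n -> \bar R}.
Variable g : 'rV[R]_n -> 'rV[R]_n.
Hypothesis mg : measurable_fun setT g.
Variable K : nat.
Variable B : R.
Hypothesis gB : forall z, enorm (g z) <= B.
Hypothesis gsigma : {ae sigma, forall z, g z = z}.
Variables (beta C : R).
Hypothesis beta0n : 0 <= beta <= n%:R.
Hypothesis C0 : 0 <= C.
Hypothesis dim : forall (x : 'rV[R]_n) r, 0 < r -> (sigma (eball x r) <= (C * r `^ beta)%:E)%E.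
Variables (alpha C1 C2 : R).
Hypothesis alpha_half : 1 / 2 < alpha.
Hypothesis alphaK : alpha <= K.+1%:R.
Hypothesis C10 : 0 <= C1.
Hypothesis C20 : 0 <= C2.
Hypothesis decay : forall eta : 'rV[R]_n,
  (\int[leb1]_(t in `[1%R, 2%R]) (mcos sigma g (t *: eta) ^+ 2 + msin sigma g (t *: eta) ^+ 2)%:E
     <= (C1 * ((1 + enorm eta) `^ (- alpha)) ^+ 2)%:E)%E.
Hypothesis ddecay : forall eta : 'rV[R]_n,
  (\int[leb1]_(t in `[1%R, 2%R]) (dmcos sigma g t eta ^+ 2 + dmsin sigma g t eta ^+ 2)%:E
     <= (C2 * enorm eta ^+ 2 * ((1 + enorm eta) `^ (- alpha)) ^+ 2)%:E)%E.
Variables (theta d : R).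
Hypothesis theta01 : 0 < theta < 1.
Hypothesis dtheta : 0 < d * (1 - theta) - (n%:R - beta) * theta.
Hypothesis dalpha : 0 < 2 * alpha - 1 - 2 * d.
Variable p : 'rV[R]_n -> \bar R.
Hypothesis hp : exponent p.
Let q x : \bar R := ((2 * theta)%:E * p x / (2%:E - (1 - theta)%:E * p x))%E.
Hypothesis hq : HL_bounded_exponent q.

(** The hypothesis on the modular normalises [f / l]; the constant [C'] depends neither on [f] nor
    on [l], so the statement passes to norms by taking infima over [l]. *)
Lemma maximal_op_modular : exists2 C' : R, 0 < C' & forall f l, schwartz f -> 0 < l ->
  (modular p (fun x => cmodulus f x / l%:E) <= 1)%E ->
  (modular p (fun x => maximal_op sigma f x / (C' * l)%:E) <= 1)%E.
Proof.
have /andP[th0 th1] := theta01; have t3 : 0 < 1 - theta by rewrite subr_gt0.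
have t2 : 0 < 2 * theta by rewrite mulr_gt0.
have [[_ q1] [Cq hCq]] := hq; have [mp p1] := hp.
have /choice[P HP] := fun x => exponent_cases theta01 (p1 x) (q1 x).
have pE x : p x = (P x)%:E by case: (HP x).
(* The value 2 on the null set respects both constraints, pp >= 1 and (1-theta) pp <= 2. *)
have [N [pp [mN N0 mpp ppP ppN]]] := borel_version 2 mp pE.
have pp1 x : 1 <= pp x.
  have [Nx|nN] := pselect (N x); first by rewrite ppN// ler1n.
  by rewrite ppP//; case: (HP x).
have pp2 x : (1 - theta) * pp x <= 2.
  have [Nx|nN] := pselect (N x); last by rewrite ppP//; case: (HP x).
  by rewrite ppN// ler_piMl//; lra.
have pp0 x : 0 < pp x by exact: lt_le_trans (pp1 x).
(* Strictly larger than the operator constant, so that some admissible [l'] for the maximal function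
   of f1 lies below it. *)
pose Lq := `|Cq| + 1; have Lq0 : 0 <= Lq by rewrite addr_ge0.
pose sqb := sqbound sigma K B alpha C1 C2 theta d.
pose c3 := @interp_final_cst R n K B beta C theta d Lq.
have c30 : 0 < c3 by exact: interp_final_cst_gt0.
have sqb0 : 0 <= sqb.
  rewrite /sqb /sqbound mulr_ge0// ?mulr_ge0 ?sqr_ge0 ?(piece_sqcst_ge0 sigma K B C10 C20)//.
  by rewrite invr_ge0 subr_ge0 ltW// expR_lt1 oppr_lt0 mulr_gt0// ln_gt0// ltr1n.
(* Bounds the integral of [Z] below: [sqb] for each of the two functions U, and 1 for the modular of
   M f1 / l'. *)
pose kap := sqb + sqb + 1; have kap1 : 1 <= kap by rewrite /kap lerDr addr_ge0.
have kap0 : 0 < kap by exact: lt_le_trans kap1.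
exists (2 * c3 * kap); first by rewrite !mulr_gt0.
move=> f l sf l0 hmod; have lV : 0 < l^-1 by rewrite invr_gt0.
have lV0 := ltW lV.
pose a x := normc (f x) / l.
have nc (w : R[i]) : 0 <= normc w by case: w => u v; exact: sqrtr_ge0.
have a0 x : 0 <= a x by rewrite mulr_ge0.
have [mR iR [LR LR0 lipR]] := schwartz_Re sf.
have [mI iI [LI LI0 lipI]] := schwartz_Im sf.
have [A A1 hA] := schwartz_bounded sf.
have ma : measurable_fun setT a.
  apply: measurable_funM => //.
  rewrite (_ : (fun x => _) = (fun x => Num.sqrt (complex.Re (f x) ^+ 2 + complex.Im (f x) ^+ 2))).
    apply: (@measurableT_comp _ _ _ _ _ _ (Num.sqrt : measurableTypeR R -> measurableTypeR R)).
      by apply: continuous_measurable_fun; exact: sqrt_continuous.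
    by apply: measurable_funD; exact: measurable_funX.
  by apply/funext => x; rewrite -normc_sqr sqrtr_sqr ger0_norm.
have cE x : (`|cmodulus f x / l%:E| = (a x)%:E)%E.
  by rewrite /cmodulus inver gt_eqF// -EFinM abse_EFin ger0_norm// a0.
have app : (\int[leb]_x (a x `^ pp x)%:E <= 1)%E.
  apply: le_trans hmod; apply: (ge0_le_integral_off mN N0).
  - by move=> x; rewrite lee_fin powR_ge0.
  - by move=> x; exact: vpower_ge0.
  - by move=> x nN; rewrite cE pE ppP.
pose A1' := A / l + 1.
have A11 : 1 <= A1' by rewrite lerDr divr_ge0// ?(ltW l0)// (le_trans ler01).
have aA1 x : a x <= A1'.
  by apply: (@le_trans _ _ (A / l)); [rewrite ler_wpM2r|rewrite lerDl].
pose uR x := l^-1 * complex.Re (f x); pose uI x := l^-1 * complex.Im (f x).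
have iuR : leb.-integrable setT (EFin \o uR) by exact: integrableRZ.
have iuI : leb.-integrable setT (EFin \o uI) by exact: integrableRZ.
have uaR x : `|uR x| <= a x.
  by rewrite /uR normrM ger0_norm// mulrC ler_wpM2r//; exact: norm_Re_le.
have uaI x : `|uI x| <= a x.
  by rewrite /uI normrM ger0_norm// mulrC ler_wpM2r//; exact: norm_Im_le.
have lR y z : `|uR y - uR z| <= l^-1 * LR * enorm (y - z).
  by rewrite -mulrBr normrM ger0_norm// -mulrA ler_wpM2l.
have lI y z : `|uI y - uI z| <= l^-1 * LI * enorm (y - z).
  by rewrite -mulrBr normrM ger0_norm// -mulrA ler_wpM2l.
have [UR [mUR UR0 iUR hUR]] := interp_pointwise mg gB gsigma beta0n C0 dim alpha_half alphaK C10 C20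
  decay ddecay theta01 dtheta dalpha iuR ma mpp a0 uaR app aA1 pp1 pp2 A11 (mulr_ge0 lV0 LR0) lR Lq0.
have [UI [mUI UI0 iUI hUI]] := interp_pointwise mg gB gsigma beta0n C0 dim alpha_half alphaK C10 C20
  decay ddecay theta01 dtheta dalpha iuI ma mpp a0 uaI app aA1 pp1 pp2 A11 (mulr_ge0 lV0 LI0) lI Lq0.
pose F := fone theta a pp.
have F0 x : 0 <= F x by exact: powR_ge0.
have mF : measurable_fun setT F by exact: measurable_fone.
pose h x : R[i] := (F x +i* 0)%C.
have hE x : (`|cmodulus h x / 1%:E| = (F x)%:E)%E.
  by rewrite /cmodulus /h /= inver oner_eq0 invr1 -EFinM mulr1/= expr0n/= addr0 sqrtr_sqr !ger0_norm.
(* Where q is finite, f1^q = a^p. Where q is infinite, f1 = a^0 = 1, and the convention s^oo = 0 for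
   s <= 1 makes the integrand vanish. *)
have hmodq : (modular q (fun x => cmodulus h x / 1%:E) <= 1)%E.
  apply: le_trans app; apply: (ge0_le_integral_off mN N0).
  - by move=> x; exact: vpower_ge0.
  - by move=> x; rewrite lee_fin powR_ge0.
  move=> x nN; rewrite hE; have [_ _ _ E] := HP x; rewrite [q x]E ppP//.
  case: eqP => [e|/eqP e].
    by rewrite /= /F /fone ppP// e subrr mul0r powRr0 lexx lee_fin powR_ge0.
  rewrite /= /F /fone ppP// lee_fin -powRrM le_eqVlt; apply/orP; left; apply/eqP; congr (_ `^ _).
  by field; rewrite subr_eq0 eq_sym e gt_eqF.
have vh : vLspace q h.
  split.
  - exact: (@borel_lebesgue_measurable R n F mF).
  - exact: (@borel_lebesgue_measurable R n (cst 0)).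
  - by exists 1 => //; apply: le_lt_trans hmodq _; exact: ltry.
have vq1 : (vnorm q (cmodulus h) <= 1%:E)%E by apply: ereal_inf_lbound; exists 1.
have vq0 : (0 <= vnorm q (cmodulus h))%E.
  by apply: le_ereal_inf_tmp => _ [y [/ltW y0 _] <-]; rewrite lee_fin.
have vHL : (vnorm q (hardy_littlewood h) < Lq%:E)%E.
  apply: le_lt_trans (hCq h vh) _; apply: (@le_lt_trans _ _ (`|Cq|%:E * 1%:E)%E); last first.
    by rewrite mule1 lte_fin ltrDl.
  apply: (@le_trans _ _ (`|Cq|%:E * vnorm q (cmodulus h))%E).
    by apply: lee_wpmul2r => //; rewrite lee_fin ler_norm.
  by apply: lee_wpmul2l => //; rewrite lee_fin.
have [_ [l' [l'0 hl'] <-]] := ereal_inf_lt vHL; rewrite lte_fin => l'L.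
rewrite /h hardy_littlewood_real in hl'.
pose W0 x := vpower `|hlmax F x / l'%:E|%E (q x).
have W00 x : (0 <= W0 x)%E by exact: vpower_ge0.
pose Z x := (UR x + UI x + W0 x)%E.
have Z0 x : (0 <= Z x)%E by rewrite !adde_ge0.
have kV : 0 < kap^-1 by rewrite invr_gt0.
have intZ : (\int[leb]_x (kap^-1%:E * Z x) <= 1)%E.
  apply: le_trans (ge0_integralZl_le _ kV Z0) _.
  apply: (@le_trans _ _ (kap^-1%:E * kap%:E)%E); last by rewrite -EFinM mulVf ?gt_eqF.
  apply: lee_wpmul2l; first by rewrite lee_fin ltW.
  (* Only [UR + UI] is known to be measurable, and that is enough to split the lower integral of the
     sum. *)
  apply: le_trans (ge0_le_integralD _ _ _ _) _ => //.
  - exact: emeasurable_funD.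
  - by move=> x; rewrite adde_ge0.
  rewrite ge0_integralD// /kap !EFinD; apply: leeD => //; exact: leeD.
apply: le_trans intZ; apply: (ge0_le_integral_off mN N0).
- by move=> x; exact: vpower_ge0.
- by move=> x; apply: mule_ge0 => //; rewrite lee_fin ltW.
move=> x nN; rewrite pE -(ppP x nN).
(* [V] is M f1 / l'. The witness [Y] is V^q where q is finite; where q is infinite, finiteness of
   [W0 x] forces V <= 1 and [Y] is 0. An infinite maximal function makes [W0 x] infinite, which
   leaves nothing to prove. *)
have : exists V Y, (W0 x < +oo)%E -> [/\ 0 <= V, 0 <= Y, (hlmax F x <= (Lq * V)%:E)%E,
    V `^ (theta * pp x) <= Y `^ (1 - (1 - theta) * pp x / 2) & (Y%:E <= W0 x)%E].
  rewrite /W0; have H0 := hlmax_ge0 F x; have [_ P1x _ E] := HP x; rewrite [q x]E ppP//.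
  have Px0 : 0 < P x by exact: lt_le_trans P1x.
  move: H0; case: (hlmax F x) => [v||] //; last first.
    move=> _; exists 0, 0 => hW; exfalso; move: hW.
    have -> : (+oo / l'%:E = +oo :> \bar R)%E by rewrite inver gt_eqF// gt0_mulye// lte_fin invr_gt0.
    case: eqP => [_|/eqP e]; first by rewrite /= ltxx.
    have en : 2 * theta * P x / (2 - (1 - theta) * P x) != 0.
      by apply: mulf_neq0; [rewrite gt_eqF// !mulr_gt0|rewrite invr_eq0 subr_eq0 eq_sym].
    by rewrite /vpower/= (negbTE en) ltxx.
  rewrite lee_fin => v0; pose V := v / l'.
  have V0 : 0 <= V by rewrite divr_ge0// ltW.
  have HV : (v%:E <= (Lq * V)%:E)%E.
    rewrite lee_fin /V mulrA ler_pdivlMr// mulrC ler_wpM2r// ltW//.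
  rewrite inver gt_eqF// -EFinM/= -/V (ger0_norm V0).
  case: eqP => [e|/eqP e].
    exists V, 0; rewrite /vpower lee_fin; case: ifP => [V1|_]; last by rewrite ltxx.
    move=> _; split => //; rewrite e divff// subrr powRr0.
    apply: (@le_trans _ _ (1 `^ (theta * P x))); last by rewrite powR1.
    by apply: ge0_ler_powR; rewrite ?nnegrE// mulr_ge0// ltW.
  exists V, (V `^ (2 * theta * P x / (2 - (1 - theta) * P x))) => _; split => //.
  - exact: powR_ge0.
  rewrite -powRrM le_eqVlt; apply/orP; left; apply/eqP; congr (_ `^ _).
  by field; rewrite subr_eq0 eq_sym.
move=> [V [Y hVY]].
have [Zoo|Zfin] := eqVneq (Z x) +oo%E.
  by rewrite Zoo gt0_muley ?leey// lte_fin.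
have : (Z x \is a fin_num)%E by rewrite ge0_fin_numE// ltey.
rewrite /Z !fin_numD => /andP[/andP[fR fI] fW].
have {hVY} [|V0 Y0 HV VY YW] := hVY; first by rewrite ltey_eq fW.
have zE : ((fine (UR x) + fine (UI x) + fine (W0 x))%:E = Z x)%E by rewrite !EFinD !fineK.
have r0 : 0 <= fine (UR x) by exact: fine_ge0.
have i0 : 0 <= fine (UI x) by exact: fine_ge0.
have w0 : 0 <= fine (W0 x) by exact: fine_ge0.
have Yw : Y <= fine (W0 x) by rewrite -lee_fin fineK.
rewrite -/(Z x) -zE -EFinM; apply: vpower_maximal_le.
- by rewrite !mulr_gt0.
- exact: pp0.
- by rewrite mulr_ge0 ?(ltW kV)// !addr_ge0.
move=> t t0.
have hr := hUR t x V Y t0 V0 Y0 HV VY; have hi := hUI t x V Y t0 V0 Y0 HV VY.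
rewrite -(fineK fR) -EFinD lee_fin -/c3 in hr; rewrite -(fineK fI) -EFinD lee_fin -/c3 in hi.
have msub : measurable_fun setT (fun z : 'rV[R]_n => x - t *: z) by apply: measurable_rVB => //; exact: measurable_rVZ.
have aR : complex.Re (multiplier_op sigma t f x) = l * avgop sigma g uR t x.
  rewrite /multiplier_op /cintegral /= (ae_eq_g mg gsigma (measurableT_comp mR msub)) /avgop -RintegralZl//.
    by apply: eq_Rintegral => z _; rewrite /uR mulrA mulfV ?gt_eqF// mul1r.
  apply: (@integrable_bounded_finite _ _ sigma _ A1').
    apply: (measurableT_comp (_ : measurable_fun setT uR)); first exact: measurable_funM.
    by apply: measurable_rVB => //; exact: measurable_rVZ.
  by move=> z; apply: le_trans (uaR _) _.
have aI : complex.Im (multiplier_op sigma t f x) = l * avgop sigma g uI t x.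
  rewrite /multiplier_op /cintegral /= (ae_eq_g mg gsigma (measurableT_comp mI msub)) /avgop -RintegralZl//.
    by apply: eq_Rintegral => z _; rewrite /uI mulrA mulfV ?gt_eqF// mul1r.
  apply: (@integrable_bounded_finite _ _ sigma _ A1').
    apply: (measurableT_comp (_ : measurable_fun setT uI)); first exact: measurable_funM.
    by apply: measurable_rVB => //; exact: measurable_rVZ.
  by move=> z; apply: le_trans (uaI _) _.
rewrite (_ : normc (multiplier_op sigma t f x) / (2 * c3 * kap * l) =
   (normc (multiplier_op sigma t f x) / l) / (2 * c3 * kap)); last first.
  by field; rewrite (gt_eqF l0) (gt_eqF c30) (gt_eqF kap0).
set z := _ + _ + fine (W0 x).
have hr' : (`|avgop sigma g uR t x| / c3) `^ pp x <= z by apply: (le_trans hr); rewrite /z; lra.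
have hi' : (`|avgop sigma g uI t x| / c3) `^ pp x <= z by apply: (le_trans hi); rewrite /z; lra.
have y0 : 0 <= normc (multiplier_op sigma t f x) / l by rewrite mulr_ge0.
have ym : normc (multiplier_op sigma t f x) / l <= `|avgop sigma g uR t x| + `|avgop sigma g uI t x|.
  rewrite ler_pdivrMr//; apply: le_trans (normc_le_ReIm _) _.
  by rewrite aR aI !normrM (gtr0_norm l0) -mulrDr mulrC.
have HC := combine_powers c30 (pp1 x) kap1 (normr_ge0 _) (normr_ge0 _) hr' hi' y0 ym.
exact: HC.
Qed.

End final.

Theorem theorem2p1 (R : realType) (n : nat) (hn : (1 <= n)%N)
    (p : 'rV[R]_n -> \bar R) (hp : exponent p)
    (sigma : {finite_measure set 'rV[R]_n -> \bar R})
    (hsigma : compactly_supported sigma)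
    (beta alpha : R) (hbeta : 0 <= beta <= n%:R) (halpha : 1 / 2 < alpha)
    (h1 : locally_uniformly_dimensional sigma beta)
    (h2 : exists C : R, forall xi : 'rV[R]_n,
      Num.sqrt (\int[lebesgue_measure]_(t in `[1, 2])
        normc (fourier sigma (t *: xi)) ^+ 2)
      <= C * (1 + enorm xi) `^ (- alpha))
    (h3 : exists C : R, forall xi : 'rV[R]_n,
      Num.sqrt (\int[lebesgue_measure]_(t in `[1, 2])
        cenorm (cgradient (fourier sigma) (t *: xi)) ^+ 2)
      <= C * (1 + enorm xi) `^ (- alpha))
    (theta : R)
    (htheta : 0 < theta <
      (2 * alpha - 1) / (2 * alpha - 1 + 2 * n%:R - 2 * beta))
    (hq : HL_bounded_exponent (fun x =>
      (2 * theta)%:E * p x / (2%:E - (1 - theta)%:E * p x))%E) :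
  exists C' : R, forall f : 'rV[R]_n -> R[i], schwartz f ->
    (vnorm p (maximal_op sigma f) <= C'%:E * vnorm p (cmodulus f))%E.
Proof.
case: n hn p hp sigma hsigma hbeta h1 h2 h3 htheta hq => // n _ p hp sigma hsigma hbeta h1 h2 h3 htheta hq.
have /andP[th0 tht] := htheta; have /andP[b0 bn] := hbeta.
have del0 : 0 < 2 * alpha - 1 by have := halpha; lra.
have nu0 : 0 <= n.+1%:R - beta by rewrite subr_ge0.
have den0 : 0 < 2 * alpha - 1 + 2 * n.+1%:R - 2 * beta by lra.
have key : theta * (2 * alpha - 1 + 2 * n.+1%:R - 2 * beta) < 2 * alpha - 1.
  by rewrite -ltr_pdivlMr.
have th1 : theta < 1.
  by apply: (lt_le_trans tht); rewrite ler_pdivrMr// mul1r; lra.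
have t3 : 0 < 1 - theta by rewrite subr_gt0.
(* The upper bound on [theta], rearranged: the decay of the pieces, weighted by 1 - theta, beats
   their growth, weighted by theta. *)
have key' : (n.+1%:R - beta) * theta < (alpha - 1 / 2) * (1 - theta).
  rewrite -subr_gt0 (_ : _ - _ = (2 * alpha - 1 - theta * (2 * alpha - 1 + 2 * n.+1%:R - 2 * beta)) / 2); last by field.
  by rewrite divr_gt0// subr_gt0.
(* The midpoint between (n - beta) theta / (1 - theta), the least decay that sums the interpolated
   pieces, and alpha - 1/2, the decay available in L^2. Both inequalities have to be strict. *)
pose d := ((alpha - 1 / 2) + (n.+1%:R - beta) * theta / (1 - theta)) / 2.
have dtheta : 0 < d * (1 - theta) - (n.+1%:R - beta) * theta.
  rewrite (_ : _ - _ = ((alpha - 1 / 2) * (1 - theta) - (n.+1%:R - beta) * theta) / 2).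
    by rewrite divr_gt0// subr_gt0.
  by rewrite /d; field; rewrite gt_eqF.
have dalpha : 0 < 2 * alpha - 1 - 2 * d.
  have : (n.+1%:R - beta) * theta / (1 - theta) < alpha - 1 / 2 by rewrite ltr_pdivrMr.
  by rewrite /d; move: (_ / (1 - theta)) => y; lra.
have [g [B [mg gB gs]]] := compact_truncation hsigma.
have [C C0 dim] := dimension_all_radii b0 h1.
have [C1 C10 dec] := fourier_decay mg gs h2.
have [C2 C20 ddec] := gradient_decay mg gB gs h3.
(* The least order of flatness of this form: alpha < K + 1. *)
pose K := Num.truncn alpha.
have aK : alpha <= K.+1%:R by exact/ltW/truncnS_gt.
have th01 : 0 < theta < 1 by rewrite th0.
have [C' C'0 H] := maximal_op_modular mg gB gs hbeta C0 dim halpha aK C10 C20 dec ddec th01 dtheta dalpha hp hq.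
(* Every admissible [l] for f gives the admissible [C' * l] for the maximal function; dividing by
   [C'] compares the two infima. *)
exists C' => f sf; rewrite muleC -lee_pdivrMr//; apply: le_ereal_inf_tmp => _ [l [l0 hl] <-].
rewrite lee_pdivrMr// -EFinM; apply: ereal_inf_lbound; exists (C' * l); last by rewrite mulrC.
by split; [exact: mulr_gt0|exact: H].
Qed.
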